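(* For $\gamma>0$, $\sigma,\tau>-1$, $\beta>0$ and $\lambda\ge0$ let $$R^\gamma_{\sigma,\tau}(\beta,\lambda)=\sum_{(k_1,k_2)\in\mathbb{N}^2}\left(\lambda-(k_1+\sigma)\sqrt{\beta}-(k_2+\tau)/\sqrt{\beta}\right)_+^\gamma .$$ For any $\gamma>0$, $M\in\mathbb{N}$, $\delta>0$, $\beta\in(0,\infty)$ and $\sigma,\tau>-1$, there are constants $\alpha_k=\alpha_k(\beta,\sigma,\tau,\gamma)$ and an oscillatory term $\mathrm{Osc}(\beta,\lambda)$ (depending also on $\sigma,\tau,\gamma$) such that $$R^\gamma_{\sigma,\tau}(\beta,\lambda)=\sum_{k=0}^{M+1}\alpha_k\lambda^{2-k+\gamma}+\mathrm{Osc}(\beta,\lambda)+o(\lambda^{-M+\gamma+\delta}),\qquad\text{as }\lambda\to\infty .$$ The coefficients $\alpha_k$ are continuous in $\beta$, and $|\mathrm{Osc}(\beta,\lambda)|\le C_\beta(\lambda+1)$. Moreover, $C_\beta$ and the implicit constant of the remainder term are uniformly bounded for $\beta$ in compact subsets of $(0,\infty)$. The oscillatory term has the following form. (i) If $\beta=\frac{\mu}{\nu}$ with $\mu,\nu\in\mathbb{N}$, $\gcd(\mu,\nu)=1$, then, with $x=\sqrt{\mu\nu}\,\lambda-\mu\sigma-\nu\tau$, $$\begin{aligned}\mathrm{Osc}(\beta,\lambda)={}&\frac{\zeta(-\gamma,\{x\})}{(\mu\nu)^{\frac{1+\gamma}{2}}}\lambda-\frac{\zeta(-1-\gamma,\{x\})}{(\mu\nu)^{1+\frac{\gamma}{2}}}-\frac{(1+2\sigma)\mu+(1+2\tau)\nu}{2(\mu\nu)^{1+\frac{\gamma}{2}}}\zeta(-\gamma,\{x\})\\&+\frac{\nu^{\gamma/2}\Gamma(1+\gamma)}{\mu^{\gamma/2}(2\pi)^{1+\gamma}}\sum_{\substack{k\in\mathbb{N}\\k/\nu\notin\mathbb{N}}}\frac{\sin\left(\pi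 k(2x-\mu)/\nu-\frac{\pi}{2}(1+\gamma)\right)}{k^{1+\gamma}\sin\left(\pi k\frac{\mu}{\nu}\right)}\\&+\frac{\mu^{\gamma/2}\Gamma(1+\gamma)}{\nu^{\gamma/2}(2\pi)^{1+\gamma}}\sum_{\substack{k\in\mathbb{N}\\k/\mu\notin\mathbb{N}}}\frac{\sin\left(\pi k(2x-\nu)/\mu-\frac{\pi}{2}(1+\gamma)\right)}{k^{1+\gamma}\sin\left(\pi k\frac{\nu}{\mu}\right)} .\end{aligned}$$ (ii) If $\beta\in(0,\infty)\setminus\mathbb{Q}$, then $$\begin{aligned}\mathrm{Osc}(\beta,\lambda)={}&\frac{\beta^{-\gamma/2}\Gamma(1+\gamma)}{(2\pi)^{1+\gamma}}\sum_{k=1}^{\Lambda(\lambda)/\sqrt{\beta}}\frac{\sin\left(\pi k(2\lambda\sqrt{\beta}-(1+2\sigma)\beta-2\tau)-\frac{\pi}{2}(1+\gamma)\right)}{k^{1+\gamma}\sin(\pi k\beta)}\\&+\frac{\beta^{\gamma/2}\Gamma(1+\gamma)}{(2\pi)^{1+\gamma}}\sum_{k=1}^{\Lambda(\lambda)\sqrt{\beta}}\frac{\sin\left(\pi k(2\lambda/\sqrt{\beta}-2\sigma-(1+2\tau)/\beta)-\frac{\pi}{2}(1+\gamma)\right)}{k^{1+\gamma}\sin(\pi k/\beta)}\\&+o(\lambda^{-M+\gamma+\delta}),\end{aligned}$$ for some $\Lambda(\lambda)$ with $\Lambda(\lambda)=O\left(\lambda^{\frac{M+2-\gamma}{\ga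mma}}\right)$.
   Context: $\mathbb{N}=\{1,2,\ldots\}$; $x_+=(|x|+x)/2$; $\{x\}=x-\lfloor x\rfloor$ is the fractional part; $\Gamma$ is the Gamma function; $\zeta(z,a)$ is the Hurwitz zeta function (so $\zeta(z,1)$ is the Riemann zeta function), and for $\gamma>0$ the values $\zeta(-\gamma,0)$ and $\zeta(-1-\gamma,0)$ are understood by continuity in $a$, i.e. $\zeta(-\gamma,0)=\zeta(-\gamma,1)$ and $\zeta(-1-\gamma,0)=\zeta(-1-\gamma,1)$. A sum $\sum_{k=1}^{X}$ with real upper limit $X$ runs over all integers $k$ with $1\le k\le X$. *)

(* Defs.v *)
From Stdlib Require Import Reals Qreals ClassicalEpsilon.
From Coquelicot Require Import Coquelicot.

Open Scope R_scope.

Definition pos_part (x : R) : R := (Rabs x + x) / 2.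

(* [Rpower 0 g] is 1 in the library; this is the power of a nonnegative base
   by a positive exponent. *)
Definition nneg_pow (x g : R) : R :=
  if Req_EM_T x 0 then 0 else Rpower x g.

(* Euler's integral, used for [s > 0] only. *)
Definition Gamma (s : R) : R :=
  RInt_gen (fun t => Rpower t (s - 1) * exp (- t))
           (at_right 0) (Rbar_locally p_infty).

Definition Cexp (z : C) : C :=
  (exp (Re z) * cos (Im z), exp (Re z) * sin (Im z)).

(* [x ^ z] for real [x > 0] and complex [z]. *)
Definition Rcpow (x : R) (z : C) : C := Cexp (z * RtoC (ln x))%C.

Definition analytic_at (f : C -> C) (z0 : C) : Prop :=
  exists (c : nat -> C) (r : posreal),
    forall z : C, Cmod (z - z0) < r ->
      is_pseries (K := C_AbsRing) (V := C_NormedModule) c (z - z0)%C (f z).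

(* For [a > 0]: [f] is the analytic continuation to C \ {1} of the series
   sum_{n >= 0} (n + a)^(-z), Re z > 1. *)
Definition is_hurwitz_zeta (a : R) (f : C -> C) : Prop :=
  (forall z : C, z <> RtoC 1 -> analytic_at f z) /\
  (forall z : C, 1 < Re z ->
     is_series (K := C_AbsRing) (V := C_NormedModule)
       (fun n => Rcpow (INR n + a) (- z)%C) (f z)).

(* The continuation is unique on C \ {1}; the value at the pole is arbitrary. *)
Definition hurwitz_zeta (z : C) (a : R) : C :=
  epsilon (inhabits (fun _ : C => RtoC 0)) (is_hurwitz_zeta a) z.

(* zeta(s, a) for real [s < 0] and [0 <= a], which is a real number;
   zeta(s, 0) stands for zeta(s, 1). *)
Definition hurwitz_zetaR (s a : R) : R :=
  Re (hurwitz_zeta (RtoC s) (if Req_EM_T a 0 then 1 else a)).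

Definition sum_upto (X : R) (f : nat -> R) : R :=
  sum_n_m f 1 (Z.to_nat (Int_part X)).

(* Indices are shifted by one, as [Series] starts at 0. *)
Definition riesz_mean (gamma sigma tau beta lam : R) : R :=
  Series (fun k1 => Series (fun k2 =>
    nneg_pow (pos_part (lam - (INR (S k1) + sigma) * sqrt beta
                            - (INR (S k2) + tau) / sqrt beta)) gamma)).

Definition osc_rational_series (gamma x : R) (m n : nat) : R :=
  Series (fun j => let k := S j in
    if Nat.eqb (Nat.modulo k n) 0 then 0
    else sin (PI * INR k * (2 * x - INR m) / INR n - PI / 2 * (1 + gamma))
         / (Rpower (INR k) (1 + gamma) * sin (PI * INR k * (INR m / INR n)))).

Definition osc_rational (gamma sigma tau : R) (mu nu : nat) (lam : R) : R :=
  let m := INR mu in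
  let n := INR nu in
  let x := sqrt (m * n) * lam - m * sigma - n * tau in
  hurwitz_zetaR (- gamma) (frac_part x) / Rpower (m * n) ((1 + gamma) / 2) * lam
  - hurwitz_zetaR (- 1 - gamma) (frac_part x) / Rpower (m * n) (1 + gamma / 2)
  - ((1 + 2 * sigma) * m + (1 + 2 * tau) * n)
      / (2 * Rpower (m * n) (1 + gamma / 2))
      * hurwitz_zetaR (- gamma) (frac_part x)
  + Rpower n (gamma / 2) * Gamma (1 + gamma)
      / (Rpower m (gamma / 2) * Rpower (2 * PI) (1 + gamma))
      * osc_rational_series gamma x mu nu
  + Rpower m (gamma / 2) * Gamma (1 + gamma)
      / (Rpower n (gamma / 2) * Rpower (2 * PI) (1 + gamma))
      * osc_rational_series gamma x nu mu.

(* For irrational [beta], so that no denominator vanishes. *)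
Definition osc_truncated (gamma sigma tau beta L lam : R) : R :=
  Rpower beta (- gamma / 2) * Gamma (1 + gamma) / Rpower (2 * PI) (1 + gamma)
    * sum_upto (L / sqrt beta) (fun k =>
        sin (PI * INR k * (2 * lam * sqrt beta - (1 + 2 * sigma) * beta - 2 * tau)
             - PI / 2 * (1 + gamma))
        / (Rpower (INR k) (1 + gamma) * sin (PI * INR k * beta)))
  + Rpower beta (gamma / 2) * Gamma (1 + gamma) / Rpower (2 * PI) (1 + gamma)
    * sum_upto (L * sqrt beta) (fun k =>
        sin (PI * INR k * (2 * lam / sqrt beta - 2 * sigma - (1 + 2 * tau) / beta)
             - PI / 2 * (1 + gamma))
        / (Rpower (INR k) (1 + gamma) * sin (PI * INR k / beta))).

Definition irrational (x : R) : Prop := ~ exists q : Q, x = Q2R q.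

(* [r lam = o (lam ^ p)] as [lam -> +oo]. *)
Definition little_o_pow (r : R -> R) (p : R) : Prop :=
  is_domin (U := R_NormedModule) (V := R_NormedModule)
    (Rbar_locally p_infty) (fun lam => Rpower lam p) r.

(* [r beta lam = o (lam ^ p)] as [lam -> +oo], uniformly in [beta] in [K]. *)
Definition little_o_pow_unif (K : R -> Prop) (r : R -> R -> R) (p : R) : Prop :=
  forall eps : posreal, Rbar_locally p_infty (fun lam =>
    forall beta, K beta -> Rabs (r beta lam) <= eps * Rpower lam p).

Definition big_O_pow (r : R -> R) (p : R) : Prop :=
  exists c : R, Rbar_locally p_infty (fun lam =>
    Rabs (r lam) <= c * Rpower lam p).

Definition compact_in_pos (K : R -> Prop) : Prop :=
  compact K /\ forall b, K b -> 0 < b.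

(* Main.v *)
Require Import Defs.
From Stdlib Require Import ZArith Reals Lra Lia ClassicalEpsilon Qreals.
From Coquelicot Require Import Coquelicot.
Open Scope R_scope.

(* Put [a = sqrt beta], [b = 1 / a] and [w = lam - sigma a - tau b].  The Riesz mean is a function
   [Rdbl] of [w] with [(1 - T_a) (1 - T_b) Rdbl = w_+^gamma], where [T_h] translates by
   [h]; the regularized double zeta function [Z2] solves the same equation for large [w] and has an
   asymptotic expansion in powers of [w], which gives the coefficients [alpha k].  So [Osc] is the
   difference [Rdbl - Z2]; it is annihilated by [(1 - T_a) (1 - T_b)], hence grows at most linearly.
   For [beta = mu / nu] both shifts are multiples of one step, [Z2] is a finite sum of Hurwitz zeta
   functions, and Hurwitz's formula with finite Fourier sums gives (i).  For (ii), the term [k] of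
   the first sum is paired with the terms [l] of the second one for which [l] is near [k beta]: the
   small divisors cancel, so that the tails of (i) are [O((lam + 1) K^(- gamma))] uniformly in [beta].
   An irrational [beta] is approached by rationals with large denominators, where the resonant terms
   of (i) vanish in the limit, while the Riesz mean, the [alpha k] and the truncated sums are
   continuous at [beta]. *)

(** A term of (ii) with [k beta] close to an integer has no bound that is uniform in [beta], and
    uniformity is indispensable: it is what lets an estimate pass from rational to irrational
    [beta]. In a pair, the poles of the two terms at [l = k beta] have opposite residues; what is
    left is a phase difference, which costs the factor [lam + 1]. Both sums must therefore be cut
    between resonances, whence a cutoff of the form [(K + 1/2) sqrt beta], with [K] terms in one sum
    and the integer part of [(K + 1/2) beta] in the other. The exponent in the bound for [Lambda] is
    the one for which [lam K^(- gamma)] becomes [lam^(gamma - M - 1)]. The difference equation alone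
    does not determine [Z2]; the expansion does, because a solution of the homogeneous equation that
    tends to 0 must vanish. Constants depend on [beta] only through some [B] with
    [1/B <= sqrt beta <= B], which serves compact sets and the rational approximation alike. *)

Fixpoint rsum (f : nat -> R) (n : nat) : R :=
  match n with O => 0 | S m => rsum f m + f m end.

Fixpoint csum (f : nat -> C) (n : nat) : C :=
  match n with O => RtoC 0 | S m => (csum f m + f m)%C end.

Lemma rsum_S f n : rsum f (S n) = rsum f n + f n.
Proof. reflexivity. Qed.

Lemma rsum_ext f g n : (forall k, (k < n)%nat -> f k = g k) -> rsum f n = rsum g n.
Proof.
  induction n as [|n IH]; intros H; simpl; [reflexivity|].
  rewrite IH by (intros; apply H; lia). now rewrite H by lia.
Qed.

Lemma rsum_plus f g n : rsum (fun k => f k + g k) n = rsum f n + rsum g n.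
Proof. induction n as [|n IH]; simpl; [ring|rewrite IH; ring]. Qed.

Lemma rsum_minus f g n : rsum (fun k => f k - g k) n = rsum f n - rsum g n.
Proof. induction n as [|n IH]; simpl; [ring|rewrite IH; ring]. Qed.

Lemma rsum_scal c f n : rsum (fun k => c * f k) n = c * rsum f n.
Proof. induction n as [|n IH]; simpl; [ring|rewrite IH; ring]. Qed.

Lemma rsum_zero n : rsum (fun _ => 0) n = 0.
Proof. induction n as [|n IH]; simpl; [ring|rewrite IH; ring]. Qed.

Lemma rsum_const c n : rsum (fun _ => c) n = INR n * c.
Proof. induction n as [|n IH]; [simpl; ring|]. rewrite S_INR. simpl rsum. rewrite IH; ring. Qed.

Lemma rsum_le f g n : (forall k, (k < n)%nat -> f k <= g k) -> rsum f n <= rsum g n.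
Proof.
  induction n as [|n IH]; intros H; simpl; [lra|].
  apply Rplus_le_compat; [apply IH; intros; apply H; lia | apply H; lia].
Qed.

Lemma rsum_nonneg f n : (forall k, (k < n)%nat -> 0 <= f k) -> 0 <= rsum f n.
Proof. intros H. rewrite <- (rsum_zero n). now apply rsum_le. Qed.

Lemma rsum_abs f n : Rabs (rsum f n) <= rsum (fun k => Rabs (f k)) n.
Proof.
  induction n as [|n IH]; simpl; [rewrite Rabs_R0; lra|].
  eapply Rle_trans; [apply Rabs_triang|lra].
Qed.

Lemma rsum_S_l f n : rsum f (S n) = f O + rsum (fun k => f (S k)) n.
Proof. induction n as [|n IH]; [simpl; ring|]. change (rsum f (S (S n))) with (rsum f (S n) + f (S n)). rewrite IH. simpl. ring. Qed.

Lemma rsum_add f m n : rsum f (m + n) = rsum f m + rsum (fun k => f (m + k)%nat) n.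
Proof.
  induction n as [|n IH]; [rewrite Nat.add_0_r; simpl; ring|].
  rewrite Nat.add_succ_r. simpl. rewrite IH. ring.
Qed.

Lemma rsum_exchange (f : nat -> nat -> R) m n :
  rsum (fun i => rsum (fun j => f i j) n) m = rsum (fun j => rsum (fun i => f i j) m) n.
Proof.
  induction m as [|m IH]; simpl; [now rewrite rsum_zero|].
  rewrite IH. now rewrite <- rsum_plus.
Qed.

(** Regroups the pairs with [k + j < n] by [i = k + j]. This is how terms of equal order are
    collected when every term of an expansion is itself expanded. *)
Lemma rsum_triangle (g : nat -> nat -> R) n :
  rsum (fun k => rsum (fun j => g k j) (n - k)) n
  = rsum (fun i => rsum (fun k => g k (i - k)%nat) (S i)) n.
Proof.
  induction n as [|n IH]; [reflexivity|].
  change (rsum (fun i => rsum (fun k => g k (i - k)%nat) (S i)) (S n))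
    with (rsum (fun i => rsum (fun k => g k (i - k)%nat) (S i)) n
          + rsum (fun k => g k (n - k)%nat) (S n)).
  rewrite <- IH.
  rewrite (rsum_ext _ (fun k => rsum (fun j => g k j) (n - k) + g k (n - k)%nat) (S n)).
  2:{ intros k Hk. replace (S n - k)%nat with (S (n - k)) by lia. reflexivity. }
  rewrite rsum_plus. f_equal. simpl. rewrite Nat.sub_diag. simpl. ring.
Qed.

Lemma sum_n_rsum (f : nat -> R) n : sum_n f n = rsum f (S n).
Proof.
  induction n as [|n IH]; [rewrite sum_O; simpl; ring|].
  rewrite sum_Sn, IH. reflexivity.
Qed.

Lemma rsum_bound f n M : (forall k, (k < n)%nat -> Rabs (f k) <= M) -> Rabs (rsum f n) <= INR n * M.
Proof.
  intros H. eapply Rle_trans; [apply rsum_abs|]. rewrite <- rsum_const. now apply rsum_le.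
Qed.

Lemma rsum_ge_term f n k : (forall j, (j < n)%nat -> 0 <= f j) -> (k < n)%nat -> f k <= rsum f n.
Proof.
  induction n as [|n IH]; intros Hf Hk; [lia|]. simpl.
  assert (P := rsum_nonneg f n (fun j Hj => Hf j ltac:(lia))). assert (Q := Hf n ltac:(lia)).
  destruct (Nat.eq_dec k n) as [E|E]; [rewrite E; lra|].
  assert (f k <= rsum f n) by (apply IH; [intros; apply Hf; lia|lia]). lra.
Qed.

Lemma csum_ext f g n : (forall k, (k < n)%nat -> f k = g k) -> csum f n = csum g n.
Proof.
  induction n as [|n IH]; intros H; simpl; [reflexivity|].
  rewrite IH by (intros; apply H; lia). now rewrite H by lia.
Qed.

Lemma csum_plus f g n : csum (fun k => f k + g k)%C n = (csum f n + csum g n)%C.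
Proof. induction n as [|n IH]; simpl; [ring|rewrite IH; ring]. Qed.

Lemma csum_minus f g n : csum (fun k => f k - g k)%C n = (csum f n - csum g n)%C.
Proof. induction n as [|n IH]; simpl; [ring|rewrite IH; ring]. Qed.

Lemma csum_scal c f n : csum (fun k => c * f k)%C n = (c * csum f n)%C.
Proof. induction n as [|n IH]; simpl; [ring|rewrite IH; ring]. Qed.

Lemma csum_zero n : csum (fun _ => RtoC 0) n = RtoC 0.
Proof. induction n as [|n IH]; simpl; [ring|rewrite IH; ring]. Qed.

Lemma csum_S_l f n : csum f (S n) = (f O + csum (fun k => f (S k)) n)%C.
Proof. induction n as [|n IH]; [simpl; ring|]. change (csum f (S (S n))) with (csum f (S n) + f (S n))%C. rewrite IH. simpl. ring. Qed.

Lemma csum_add f m n : csum f (m + n) = (csum f m + csum (fun k => f (m + k)%nat) n)%C.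
Proof.
  induction n as [|n IH]; [rewrite Nat.add_0_r; simpl; ring|].
  rewrite Nat.add_succ_r. simpl. rewrite IH. ring.
Qed.

Lemma csum_exchange (f : nat -> nat -> C) m n :
  csum (fun i => csum (fun j => f i j) n) m = csum (fun j => csum (fun i => f i j) m) n.
Proof.
  induction m as [|m IH]; simpl; [now rewrite csum_zero|].
  rewrite IH. now rewrite <- csum_plus.
Qed.

Lemma csum_triangle (g : nat -> nat -> C) n :
  csum (fun k => csum (fun j => g k j) (n - k)) n
  = csum (fun i => csum (fun k => g k (i - k)%nat) (S i)) n.
Proof.
  induction n as [|n IH]; [reflexivity|].
  change (csum (fun i => csum (fun k => g k (i - k)%nat) (S i)) (S n))
    with (csum (fun i => csum (fun k => g k (i - k)%nat) (S i)) n
          + csum (fun k => g k (n - k)%nat) (S n))%C.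
  rewrite <- IH.
  rewrite (csum_ext _ (fun k => csum (fun j => g k j) (n - k) + g k (n - k)%nat)%C (S n)).
  2:{ intros k Hk. replace (S n - k)%nat with (S (n - k)) by lia. reflexivity. }
  rewrite csum_plus. f_equal. simpl. rewrite Nat.sub_diag. simpl. ring.
Qed.

Lemma csum_abs f n : Cmod (csum f n) <= rsum (fun k => Cmod (f k)) n.
Proof.
  induction n as [|n IH]; simpl; [rewrite Cmod_0; lra|].
  eapply Rle_trans; [apply Cmod_triangle|lra].
Qed.

Lemma csum_RtoC f n : csum (fun k => RtoC (f k)) n = RtoC (rsum f n).
Proof. induction n as [|n IH]; simpl; [reflexivity|rewrite IH; now rewrite RtoC_plus]. Qed.

Lemma csum_Re f n : Re (csum f n) = rsum (fun k => Re (f k)) n.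
Proof. induction n as [|n IH]; simpl; [reflexivity|now rewrite <- IH]. Qed.

Lemma csum_Im f n : Im (csum f n) = rsum (fun k => Im (f k)) n.
Proof. induction n as [|n IH]; simpl; [reflexivity|now rewrite <- IH]. Qed.

Lemma sum_n_csum (f : nat -> C) n : sum_n (G := C_AbelianMonoid) f n = csum f (S n).
Proof.
  induction n as [|n IH]; [rewrite sum_O; simpl; ring|].
  rewrite sum_Sn, IH. reflexivity.
Qed.

(** Falling factorials [q (q - 1) ... (q - k + 1)], that is, the factors in the derivative of order
    [k] of [w^q]. *)
Fixpoint cff (q : C) (k : nat) : C :=
  match k with O => RtoC 1 | S j => (cff q j * (q - RtoC (INR j)))%C end.

Fixpoint ff (q : R) (k : nat) : R :=
  match k with O => 1 | S j => ff q j * (q - INR j) end.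

Lemma cff_RtoC q k : cff (RtoC q) k = RtoC (ff q k).
Proof. induction k as [|k IH]; simpl; [reflexivity|rewrite IH]. now rewrite RtoC_mult, RtoC_minus. Qed.

Lemma cff_add q i j : cff q (i + j) = (cff q i * cff (q - RtoC (INR i)) j)%C.
Proof.
  induction j as [|j IH]; [rewrite Nat.add_0_r; simpl; ring|].
  rewrite Nat.add_succ_r. simpl. rewrite IH, plus_INR, RtoC_plus. ring.
Qed.

Lemma ff_add q i j : ff q (i + j) = ff q i * ff (q - INR i) j.
Proof.
  induction j as [|j IH]; [rewrite Nat.add_0_r; simpl; ring|].
  rewrite Nat.add_succ_r. simpl. rewrite IH, plus_INR. ring.
Qed.

Lemma cff_S_l q j : cff q (S j) = (q * cff (q - RtoC 1) j)%C.
Proof. change (S j) with (1 + j)%nat. rewrite cff_add. simpl. change (INR 1) with 1. ring. Qed.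

Lemma ff_S_l q j : ff q (S j) = q * ff (q - 1) j.
Proof. change (S j) with (1 + j)%nat. rewrite ff_add. simpl. ring. Qed.

Lemma Cmod_le_Re_Im z : Cmod z <= Rabs (Re z) + Rabs (Im z).
Proof.
  destruct z as [x y]. simpl.
  replace (x, y) with (RtoC x + Ci * RtoC y)%C.
  2:{ unfold RtoC, Ci, Cplus, Cmult; simpl; f_equal; ring. }
  eapply Rle_trans; [apply Cmod_triangle|].
  rewrite Cmod_mult, !Cmod_R.
  replace (Cmod Ci) with 1; [lra|].
  unfold Cmod, Ci; simpl. replace (_ + _) with 1 by ring. now rewrite sqrt_1.
Qed.

Lemma Im_le_Cmod z : Rabs (Im z) <= Cmod z.
Proof.
  apply Rsqr_incr_0_var; [|apply Cmod_ge_0].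
  rewrite <- Rsqr_abs. unfold Rsqr.
  assert (H := Cmod2_alt z). simpl in H. nra.
Qed.

Lemma exp_le_mono x y : x <= y -> exp x <= exp y.
Proof. intros [H|H]; [left; now apply exp_increasing|right; now rewrite H]. Qed.

(** * Powers with a complex exponent *)

Lemma Cexp_plus z1 z2 : Cexp (z1 + z2) = (Cexp z1 * Cexp z2)%C.
Proof.
  destruct z1 as [x1 y1], z2 as [x2 y2]. unfold Cexp, Cmult, Cplus; simpl.
  rewrite exp_plus, cos_plus, sin_plus. f_equal; ring.
Qed.

Lemma Cexp_0 : Cexp 0 = RtoC 1.
Proof. unfold Cexp, RtoC; simpl. rewrite exp_0, cos_0, sin_0. f_equal; ring. Qed.

Lemma Cmod_Cexp z : Cmod (Cexp z) = exp (Re z).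
Proof.
  unfold Cexp, Cmod; simpl.
  replace (_ + _) with (Rsqr (exp (Re z))).
  - apply sqrt_Rsqr. left; apply exp_pos.
  - unfold Rsqr. assert (H := sin2_cos2 (Im z)). unfold Rsqr in H. nra.
Qed.

Lemma Cexp_RtoC x : Cexp (RtoC x) = RtoC (exp x).
Proof. unfold Cexp, RtoC; simpl. rewrite cos_0, sin_0. f_equal; ring. Qed.

Lemma Rcpow_plus x z1 z2 : Rcpow x (z1 + z2) = (Rcpow x z1 * Rcpow x z2)%C.
Proof. unfold Rcpow. rewrite <- Cexp_plus. f_equal. ring. Qed.

Lemma Cmod_Rcpow x z : Cmod (Rcpow x z) = Rpower x (Re z).
Proof.
  unfold Rcpow. rewrite Cmod_Cexp. unfold Rpower. f_equal. destruct z; simpl. ring.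
Qed.

Lemma Rcpow_RtoC x s : Rcpow x (RtoC s) = RtoC (Rpower x s).
Proof. unfold Rcpow, Rpower. rewrite <- RtoC_mult. apply Cexp_RtoC. Qed.

Lemma Rcpow_mult x y z : 0 < x -> 0 < y -> Rcpow (x * y) z = (Rcpow x z * Rcpow y z)%C.
Proof.
  intros Hx Hy. unfold Rcpow. rewrite <- Cexp_plus, ln_mult, RtoC_plus by assumption.
  f_equal. ring.
Qed.

Lemma Rcpow_INR x k : 0 < x -> Rcpow x (RtoC (INR k)) = RtoC (x ^ k).
Proof. intros Hx. rewrite Rcpow_RtoC, Rpower_pow by assumption. reflexivity. Qed.

Lemma Rcpow_1_l z : Rcpow 1 z = RtoC 1.
Proof. unfold Rcpow. rewrite ln_1. replace (z * RtoC 0)%C with (RtoC 0) by ring. apply Cexp_0. Qed.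

(* [u^j w^(q-j)], with [w^(q-j)] split off. *)
Lemma Rcpow_minus_INR x z k : 0 < x ->
  (Rcpow x (z - RtoC (INR k)) * RtoC (x ^ k) = Rcpow x z)%C.
Proof.
  intros Hx. rewrite <- Rcpow_INR, <- Rcpow_plus by assumption. f_equal. ring.
Qed.

Definition cderiv (g : R -> C) (t : R) (g' : C) : Prop :=
  is_derive (fun s => Re (g s)) t (Re g') /\ is_derive (fun s => Im (g s)) t (Im g').

Lemma cderiv_plus f g t f' g' : cderiv f t f' -> cderiv g t g' ->
  cderiv (fun s => f s + g s)%C t (f' + g')%C.
Proof.
  intros [H1 H2] [H3 H4]. split; simpl.
  - exact (is_derive_plus _ _ _ _ _ H1 H3).
  - exact (is_derive_plus _ _ _ _ _ H2 H4).
Qed.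

Lemma cderiv_scal c g t g' : cderiv g t g' -> cderiv (fun s => c * g s)%C t (c * g')%C.
Proof.
  intros [H1 H2]. destruct c as [a b]. split; simpl.
  - exact (is_derive_minus _ _ _ _ _ (is_derive_scal _ _ a _ H1) (is_derive_scal _ _ b _ H2)).
  - exact (is_derive_plus _ _ _ _ _ (is_derive_scal _ _ a _ H2) (is_derive_scal _ _ b _ H1)).
Qed.

Lemma cderiv_RtoC (f : R -> R) t f' : is_derive f t f' -> cderiv (fun s => RtoC (f s)) t (RtoC f').
Proof. intros H. split; simpl; [exact H|]. exact (is_derive_const (K := R_AbsRing) (V := R_NormedModule) 0 t). Qed.

Lemma cderiv_csum (f : nat -> R -> C) (f' : nat -> C) t n :
  (forall k, (k < n)%nat -> cderiv (f k) t (f' k)) ->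
  cderiv (fun s => csum (fun k => f k s) n) t (csum f' n).
Proof.
  induction n as [|n IH]; intros H; simpl.
  - apply (cderiv_RtoC (fun _ => 0)). exact (is_derive_const (K := R_AbsRing) (V := R_NormedModule) 0 t).
  - apply cderiv_plus; [apply IH; intros; apply H; lia|apply H; lia].
Qed.

Lemma cderiv_ext f g t l : (forall s, f s = g s) -> cderiv f t l -> cderiv g t l.
Proof.
  intros H [H1 H2]. split.
  - eapply is_derive_ext; [|exact H1]. intros s; simpl; now rewrite H.
  - eapply is_derive_ext; [|exact H2]. intros s; simpl; now rewrite H.
Qed.

Lemma cderiv_Cexp z t : cderiv (fun s => Cexp (z * RtoC s)) t (z * Cexp (z * RtoC t))%C.
Proof.
  destruct z as [x y]. split; simpl; auto_derive; try exact I; unfold Rminus; simpl; ring.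
Qed.

Lemma cderiv_comp g (h : R -> R) t g' h' :
  cderiv g (h t) g' -> is_derive h t h' -> cderiv (fun s => g (h s)) t (RtoC h' * g')%C.
Proof.
  intros [H1 H2] H. split.
  - replace (Re (RtoC h' * g')%C) with (scal h' (Re g')) by (change (h' * Re g' = h' * Re g' - 0 * Im g'); ring).
    exact (is_derive_comp _ _ _ _ _ H1 H).
  - replace (Im (RtoC h' * g')%C) with (scal h' (Im g')) by (change (h' * Im g' = h' * Im g' + 0 * Re g'); ring).
    exact (is_derive_comp _ _ _ _ _ H2 H).
Qed.

Lemma cderiv_Rcpow p u : -1 < u ->
  cderiv (fun s => Rcpow (1 + s) p) u (p * Rcpow (1 + u) (p - RtoC 1))%C.
Proof.
  intros Hu. unfold Rcpow.
  assert (H : is_derive (fun s => ln (1 + s)) u (/ (1 + u))).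
  { auto_derive; [lra|field; lra]. }
  assert (H2 := cderiv_comp (fun s => Cexp (p * RtoC s)) (fun s => ln (1 + s)) u _ _
    (cderiv_Cexp p (ln (1 + u))) H). cbv beta in H2.
  replace (p * Cexp ((p - RtoC 1) * RtoC (ln (1 + u))))%C with
    (RtoC (/ (1 + u)) * (p * Cexp (p * RtoC (ln (1 + u)))))%C; [exact H2|].
  replace ((p - RtoC 1) * RtoC (ln (1 + u)))%C with (p * RtoC (ln (1 + u)) + RtoC (- ln (1 + u)))%C.
  2:{ rewrite RtoC_opp. ring. }
  rewrite Cexp_plus, Cexp_RtoC, exp_Ropp, exp_ln by lra. ring.
Qed.

(** The real mean value inequality is applied to the real and to the imaginary part, whence the
    factor 2. *)
Lemma cderiv_bound g g' M u :
  (forall s, Rabs s <= Rabs u -> cderiv g s (g' s) /\ Cmod (g' s) <= M) ->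
  Cmod (g u - g 0)%C <= 2 * (M * Rabs u).
Proof.
  intros H. eapply Rle_trans; [apply Cmod_le_Re_Im|].
  assert (A : Rabs (Re (g u) - Re (g 0)) <= M * Rabs (u - 0)).
  { apply (bounded_variation (fun s => Re (g s)) (fun s => Re (g' s))). intros t Ht.
    rewrite !Rminus_0_r in Ht. destruct (H t Ht) as [[H1 H2] H3]. split; [exact H1|].
    eapply Rle_trans; [apply re_le_Cmod|exact H3]. }
  assert (B : Rabs (Im (g u) - Im (g 0)) <= M * Rabs (u - 0)).
  { apply (bounded_variation (fun s => Im (g s)) (fun s => Im (g' s))). intros t Ht.
    rewrite !Rminus_0_r in Ht. destruct (H t Ht) as [[H1 H2] H3]. split; [exact H2|].
    eapply Rle_trans; [apply Im_le_Cmod|exact H3]. }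
  rewrite Rminus_0_r in A, B.
  change (Re (g u - g 0)%C) with (Re (g u) - Re (g 0)).
  change (Im (g u - g 0)%C) with (Im (g u) - Im (g 0)). lra.
Qed.

(** Induction on [J]: the remainder vanishes at [u = 0], and its derivative is [p] times the
    remainder of order one less for the exponent [p - 1], so that the disc for [p] grows from [P] to
    [P + 1]. The uniformity in [p] is what the analytic continuation in [z] relies on. *)
Lemma Rcpow_taylor J : forall P, 0 <= P -> exists K, 0 <= K /\
  forall p u, Cmod p <= P -> Rabs u <= / 2 ->
  Cmod (Rcpow (1 + u) p - csum (fun j => cff p j * RtoC (/ INR (fact j) * u ^ j)) J)%C
    <= K * Rabs u ^ J.
Proof.
  induction J as [|J IH]; intros P HP.
  (* As [1 + u] lies in [[1/2, 3/2]], the modulus of [ln (1 + u)] is at most [ln 2]. *)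
  - exists (Rpower 2 P). split; [left; apply exp_pos|]. intros p u Hp Hu. simpl.
    replace (Rcpow (1 + u) p - RtoC 0)%C with (Rcpow (1 + u) p) by ring.
    rewrite Rmult_1_r, Cmod_Rcpow. unfold Rpower. apply Rabs_le_between in Hu.
    apply exp_le_mono. assert (Hr := re_le_Cmod p). apply Rle_trans with (Rabs (Re p) * ln 2).
    2:{ apply Rmult_le_compat_r; [|lra]. rewrite <- ln_1. apply Rcomplements.ln_le; lra. }
    eapply Rle_trans; [apply Rle_abs|]. rewrite Rabs_mult. apply Rmult_le_compat_l; [apply Rabs_pos|].
    apply Rabs_le. split.
    + rewrite <- ln_Rinv by lra. apply Rcomplements.ln_le; lra.
    + apply Rcomplements.ln_le; lra.
  - destruct (IH (P + 1)) as [K [HK0 HK]]; [lra|].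
    exists (2 * (P * K)). split; [nra|]. intros p u Hp Hu.
    set (g := fun s => (Rcpow (1 + s) p - csum (fun j => cff p j * RtoC (/ INR (fact j) * s ^ j)) (S J))%C).
    set (g' := fun s => (p * (Rcpow (1 + s) (p - RtoC 1)
       - csum (fun j => cff (p - RtoC 1) j * RtoC (/ INR (fact j) * s ^ j)) J))%C).
    assert (g0 : g 0 = RtoC 0).
    { unfold g. rewrite csum_S_l. rewrite Rplus_0_r, Rcpow_1_l. simpl cff. simpl fact. simpl pow.
      rewrite (csum_ext _ (fun _ => RtoC 0)).
      - rewrite csum_zero. simpl INR. rewrite Rinv_1, Rmult_1_r. ring.
      - intros k _. rewrite Rmult_0_l, Rmult_0_r. ring. }
    replace (Rcpow (1 + u) p - _)%C with (g u - g 0)%C by (rewrite g0; unfold g; ring).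
    replace (2 * (P * K) * Rabs u ^ S J) with (2 * ((P * K * Rabs u ^ J) * Rabs u)) by (simpl; ring).
    apply (cderiv_bound g g'). intros s Hs. split.
    + unfold g. apply (cderiv_ext (fun s => Rcpow (1 + s) p + (- RtoC 1) * csum (fun j => cff p j * RtoC (/ INR (fact j) * s ^ j)) (S J))%C).
      { intros x. ring. }
      unfold g'.
      replace (p * (Rcpow (1 + s) (p - RtoC 1) - csum (fun j => cff (p - RtoC 1) j * RtoC (/ INR (fact j) * s ^ j)) J))%C
        with (p * Rcpow (1 + s) (p - RtoC 1) + (- RtoC 1) *
          csum (fun j => cff p j * RtoC (/ INR (fact j) * (INR j * s ^ pred j))) (S J))%C.
      2:{ rewrite csum_S_l. change (INR 0) with 0. rewrite Rmult_0_l, Rmult_0_r.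
          rewrite (csum_ext _ (fun j => p * (cff (p - RtoC 1) j * RtoC (/ INR (fact j) * s ^ j)))%C J).
          - rewrite csum_scal. ring.
          - intros k _. rewrite cff_S_l. change (pred (S k)) with k. rewrite fact_simpl, mult_INR.
            replace (/ (INR (S k) * INR (fact k)) * (INR (S k) * s ^ k)) with (/ INR (fact k) * s ^ k).
            + ring.
            + field. split; [apply INR_fact_neq_0|apply not_0_INR; lia]. }
      apply cderiv_plus; [apply cderiv_Rcpow; assert (Hs2 := Rle_trans _ _ _ Hs Hu); apply Rabs_le_between in Hs2|].
      * lra.
      * apply cderiv_scal. apply cderiv_csum. intros k _. apply cderiv_scal. apply cderiv_RtoC.
        apply is_derive_scal. auto_derive; [exact I|]. rewrite Rmult_1_l. reflexivity.
    + unfold g'. rewrite Cmod_mult.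
      assert (Hs2 : Rabs s <= / 2) by lra.
      assert (Hp' : Cmod (p - RtoC 1) <= P + 1).
      { unfold Cminus. eapply Rle_trans; [apply Cmod_triangle|]. rewrite Cmod_opp, Cmod_1. lra. }
      specialize (HK _ _ Hp' Hs2).
      rewrite Rmult_assoc. apply Rmult_le_compat; [apply Cmod_ge_0|apply Cmod_ge_0|exact Hp|].
      eapply Rle_trans; [exact HK|]. apply Rmult_le_compat_l; [exact HK0|].
      apply pow_incr. split; [apply Rabs_pos|exact Hs].
Qed.

Lemma Rpower_pos x y : 0 < Rpower x y.
Proof. apply exp_pos. Qed.

(** By homogeneity: [(w + h)^p = w^p (1 + h / w)^p], and the condition on [h] says that [h / w] is
    at most 1/2 in modulus. *)
Lemma Rpower_taylor J P : 0 <= P -> exists K, 0 <= K /\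
  forall p w h, Rabs p <= P -> 0 < w -> Rabs h <= w / 2 ->
  Rabs (Rpower (w + h) p - rsum (fun j => ff p j * (/ INR (fact j) * h ^ j) * Rpower w (p - INR j)) J)
    <= K * Rabs h ^ J * Rpower w (p - INR J).
Proof.
  intros HP. destruct (Rcpow_taylor J P HP) as [K [HK0 HK]]. exists K. split; [exact HK0|].
  intros p w h Hp Hw Hh.
  assert (Hu : Rabs (h / w) <= / 2).
  { unfold Rdiv. rewrite Rabs_mult, Rabs_inv, (Rabs_pos_eq w) by lra.
    apply (Rmult_le_reg_r w); [lra|]. rewrite Rmult_assoc, Rinv_l by lra. lra. }
  specialize (HK (RtoC p) (h / w)). rewrite Cmod_R in HK. specialize (HK Hp Hu).
  rewrite Rcpow_RtoC in HK.
  rewrite (csum_ext _ (fun j => RtoC (ff p j * (/ INR (fact j) * (h / w) ^ j)))) in HK.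
  2:{ intros k _. rewrite cff_RtoC, <- RtoC_mult. reflexivity. }
  rewrite csum_RtoC, <- RtoC_minus, Cmod_R in HK.
  assert (Hpw : forall j, Rpower w (p - INR j) = Rpower w p * / w ^ j).
  { intros j. unfold Rminus. rewrite Rpower_plus, Rpower_Ropp, Rpower_pow by lra. reflexivity. }
  assert (Hu2 := proj1 (Rabs_le_between _ _) Hu).
  replace (w + h) with (w * (1 + h / w)) by (field; lra).
  rewrite <- Rpower_mult_distr by lra.
  rewrite (rsum_ext _ (fun j => Rpower w p * (ff p j * (/ INR (fact j) * (h / w) ^ j)))).
  2:{ intros k _. rewrite Hpw. unfold Rdiv. rewrite Rpow_mult_distr, <- pow_inv. ring. }
  rewrite rsum_scal, <- Rmult_minus_distr_l, Rabs_mult, (Rabs_pos_eq (Rpower w p)) by (left; apply Rpower_pos).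
  rewrite Hpw. eapply Rle_trans; [apply Rmult_le_compat_l; [left; apply Rpower_pos|exact HK]|].
  right. unfold Rdiv. rewrite Rabs_mult, Rpow_mult_distr, Rabs_inv, (Rabs_pos_eq w) by lra.
  rewrite pow_inv. ring.
Qed.

Lemma Rpower_le_exp w p q : 1 <= w -> p <= q -> Rpower w p <= Rpower w q.
Proof. intros. now apply Rle_Rpower. Qed.

(** * Asymptotic expansions in descending powers, and their translates *)

Definition shift_sym (s : nat -> R) (h : R) (k : nat) : R :=
  rsum (fun j => s j * (/ INR (fact (k - j)) * h ^ (k - j))) (S k).

(** The operator [sum s_k D^k], [D = d/dw], applied to [w^q] and cut at order [N]. Translation by
    [h] is [exp (h D)], and [shift_sym] multiplies the power series [sum s_k D^k] by [exp (h D)].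
    With [ff q k] split off, a difference equation becomes an identity of power series in which [q]
    does not occur. *)
Definition psum (q : R) (s : nat -> R) (N : nat) (w : R) : R :=
  rsum (fun k => s k * ff q k * Rpower w (q - INR k)) N.

(** The power of index [k] is expanded to order [N - k] and the double sum is regrouped by total
    order. The constant depends on [s] and [h] only through [S0] and [H]; all the later uniformity
    in [beta] starts here. *)
Lemma psum_shift q N H S0 : 0 <= H -> exists K, 0 <= K /\
  forall s h w, (forall k, (k < N)%nat -> Rabs (s k) <= S0) -> Rabs h <= H -> 2 * Rabs h <= w -> 1 <= w ->
  Rabs (psum q s N (w + h) - psum q (shift_sym s h) N w) <= K * Rpower w (q - INR N).
Proof.
  intros HH.
  (* One Taylor constant for all the exponents [q - k] with [k < N], obtained as a maximum. *)
  assert (HT : exists K, 0 <= K /\ forall k, (k < N)%nat -> forall w h, 0 < w -> Rabs h <= w / 2 ->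
    Rabs (Rpower (w + h) (q - INR k) - rsum (fun j => ff (q - INR k) j * (/ INR (fact j) * h ^ j) * Rpower w (q - INR k - INR j)) (N - k))
    <= K * Rabs h ^ (N - k) * Rpower w (q - INR k - INR (N - k))).
  { clear S0. assert (G : forall n, (n <= N)%nat -> exists K, 0 <= K /\ forall k, (k < n)%nat -> forall w h, 0 < w -> Rabs h <= w / 2 ->
    Rabs (Rpower (w + h) (q - INR k) - rsum (fun j => ff (q - INR k) j * (/ INR (fact j) * h ^ j) * Rpower w (q - INR k - INR j)) (N - k))
    <= K * Rabs h ^ (N - k) * Rpower w (q - INR k - INR (N - k))).
    { induction n as [|n IH]; intros Hn.
      - exists 0. split; [lra|]. intros k Hk; lia.
      - destruct IH as [K1 [HK1 IH]]; [lia|].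
        destruct (Rpower_taylor (N - n) (Rabs (q - INR n)) (Rabs_pos _)) as [K2 [HK2 H2]].
        exists (Rmax K1 K2). split; [eapply Rle_trans; [exact HK1|apply Rmax_l]|].
        intros k Hk w h Hw Hh.
        assert (Pos : 0 <= Rabs h ^ (N - k) * Rpower w (q - INR k - INR (N - k))).
        { apply Rmult_le_pos; [apply pow_le, Rabs_pos|left; apply Rpower_pos]. }
        destruct (Nat.eq_dec k n) as [->|Hkn].
        + eapply Rle_trans; [apply H2; [lra|exact Hw|exact Hh]|].
          rewrite !Rmult_assoc. apply Rmult_le_compat_r; [exact Pos|apply Rmax_r].
        + eapply Rle_trans; [apply IH; [lia|exact Hw|exact Hh]|].
          rewrite !Rmult_assoc. apply Rmult_le_compat_r; [exact Pos|apply Rmax_l]. }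
    apply G. lia. }
  destruct HT as [K [HK HT]].
  exists (INR N * (Rabs S0 * rsum (fun k => Rabs (ff q k)) N * (K * (1 + H) ^ N))).
  assert (Pos1 : 0 <= rsum (fun k => Rabs (ff q k)) N) by (apply rsum_nonneg; intros; apply Rabs_pos).
  split.
  { apply Rmult_le_pos; [apply pos_INR|]. apply Rmult_le_pos.
    - apply Rmult_le_pos; [apply Rabs_pos|exact Pos1].
    - apply Rmult_le_pos; [exact HK|apply pow_le; lra]. }
  intros s h w Hs Hh Hw1 Hw2. unfold psum.
  assert (E : rsum (fun k => shift_sym s h k * ff q k * Rpower w (q - INR k)) N =
    rsum (fun k => s k * ff q k * rsum (fun j => ff (q - INR k) j * (/ INR (fact j) * h ^ j) * Rpower w (q - INR k - INR j)) (N - k)) N).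
  { symmetry. rewrite (rsum_ext _ (fun k => rsum (fun j => s k * ff q k * (ff (q - INR k) j * (/ INR (fact j) * h ^ j) * Rpower w (q - INR k - INR j))) (N - k))).
    2:{ intros k _. now rewrite rsum_scal. }
    rewrite rsum_triangle. apply rsum_ext. intros i Hi. unfold shift_sym.
    rewrite (Rmult_comm (rsum _ _)), Rmult_assoc, (Rmult_comm _ (Rpower _ _)), <- Rmult_assoc, <- rsum_scal.
    apply rsum_ext. intros k Hk.
    replace (ff q i) with (ff q (k + (i - k))) by (f_equal; lia). rewrite ff_add.
    replace (q - INR k - INR (i - k)) with (q - INR i); [ring|].
    rewrite minus_INR by lia. ring. }
  rewrite E, <- rsum_minus. rewrite Rmult_assoc. apply rsum_bound. intros k Hk.
  rewrite <- Rmult_minus_distr_l, Rabs_mult.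
  assert (B1 := HT k Hk w h ltac:(lra) ltac:(lra)).
  replace (q - INR k - INR (N - k)) with (q - INR N) in B1 by (rewrite minus_INR by lia; ring).
  rewrite Rmult_assoc, (Rmult_comm _ (Rpower _ _)), (Rmult_comm (Rpower _ _)), <- Rmult_assoc, Rmult_assoc.
  rewrite !Rmult_assoc, <- (Rmult_assoc (Rabs S0)). apply Rmult_le_compat; [apply Rabs_pos|apply Rabs_pos| |].
  - rewrite Rabs_mult. apply Rmult_le_compat; [apply Rabs_pos|apply Rabs_pos| |].
    + eapply Rle_trans; [apply Hs; exact Hk|apply Rle_abs].
    + apply (rsum_ge_term (fun k => Rabs (ff q k))); [intros; apply Rabs_pos|exact Hk].
  - eapply Rle_trans; [exact B1|]. rewrite !Rmult_assoc. apply Rmult_le_compat_l; [exact HK|].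
    apply Rmult_le_compat_r; [left; apply Rpower_pos|].
    eapply Rle_trans; [apply pow_incr; split; [apply Rabs_pos|exact (Rle_trans _ _ (1 + H) Hh ltac:(lra))]|].
    apply Rle_pow; [lra|lia].
Qed.

(** Neither [c] nor [W] may depend on the parameter [i], which stands for [beta] or for the pair of
    steps. For a single function, [I] is taken to be [unit]. *)
Definition has_symbol {I : Type} (K : I -> Prop) (F : I -> R -> R) (q : R) (s : I -> nat -> R) : Prop :=
  forall N, exists c W, 0 <= c /\ 1 <= W /\ forall i w, K i -> W <= w ->
    Rabs (F i w - psum q (s i) N w) <= c * Rpower w (q - INR N).

Definition bounded_sym {I : Type} (K : I -> Prop) (s : I -> nat -> R) : Prop :=
  forall N, exists S0, forall i k, K i -> (k < N)%nat -> Rabs (s i k) <= S0.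

Lemma Rpower_shift_le q w h : 2 * Rabs h <= w -> 1 <= w ->
  Rpower (w + h) q <= Rpower 2 (Rabs q) * Rpower w q.
Proof.
  intros Hh Hw. unfold Rpower. rewrite <- exp_plus. apply exp_le_mono.
  assert (Hh2 := proj1 (Rabs_le_between h (w / 2)) ltac:(lra)).
  assert (L1 : ln (w + h) <= ln 2 + ln w).
  { rewrite <- ln_mult by lra. apply Rcomplements.ln_le; lra. }
  assert (L2 : ln w - ln 2 <= ln (w + h)).
  { assert (ln w <= ln 2 + ln (w + h)); [|lra]. rewrite <- ln_mult by lra. apply Rcomplements.ln_le; lra. }
  destruct (Rle_dec 0 q).
  - rewrite Rabs_pos_eq by lra. nra.
  - rewrite Rabs_left by lra. nra.
Qed.

Section SymbolCalculus.
Context {I : Type} (K : I -> Prop).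

Lemma sym_plus F G q s t : has_symbol K F q s -> has_symbol K G q t ->
  has_symbol K (fun i w => F i w + G i w) q (fun i k => s i k + t i k).
Proof.
  intros HF HG N. destruct (HF N) as [c1 [W1 [Hc1 [HW1 H1]]]]. destruct (HG N) as [c2 [W2 [Hc2 [HW2 H2]]]].
  exists (c1 + c2), (Rmax W1 W2). split; [lra|]. split; [eapply Rle_trans; [exact HW1|apply Rmax_l]|].
  intros i w Hi Hw.
  specialize (H1 i w Hi (Rle_trans _ _ _ (Rmax_l _ _) Hw)). specialize (H2 i w Hi (Rle_trans _ _ _ (Rmax_r _ _) Hw)).
  replace (psum q (fun k => s i k + t i k) N w) with (psum q (s i) N w + psum q (t i) N w).
  2:{ unfold psum. rewrite <- rsum_plus. apply rsum_ext; intros; ring. }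
  replace (_ - _) with ((F i w - psum q (s i) N w) + (G i w - psum q (t i) N w)) by ring.
  eapply Rle_trans; [apply Rabs_triang|lra].
Qed.

Lemma sym_ext F G q s t : (forall i w, K i -> F i w = G i w) -> (forall i k, K i -> s i k = t i k) ->
  has_symbol K F q s -> has_symbol K G q t.
Proof.
  intros E1 E2 HF N. destruct (HF N) as [c1 [W1 [Hc1 [HW1 H1]]]]. exists c1, W1.
  split; [exact Hc1|]. split; [exact HW1|]. intros i w Hi Hw. rewrite <- E1 by exact Hi.
  replace (psum q (t i) N w) with (psum q (s i) N w); [now apply H1|].
  unfold psum. apply rsum_ext. intros; now rewrite E2.
Qed.

Lemma sym_rsum (F : nat -> I -> R -> R) q (s : nat -> I -> nat -> R) n :
  (forall j, (j < n)%nat -> has_symbol K (F j) q (s j)) ->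
  has_symbol K (fun i w => rsum (fun j => F j i w) n) q (fun i k => rsum (fun j => s j i k) n).
Proof.
  induction n as [|n IH]; intros H; simpl.
  - intros N. exists 0, 1. split; [lra|]. split; [lra|]. intros i w _ _. unfold psum.
    rewrite (rsum_ext _ (fun _ => 0)) by (intros; ring). rewrite rsum_zero, Rminus_0_r, Rabs_R0. lra.
  - apply sym_plus; [apply IH; intros; apply H; lia|apply H; lia].
Qed.

Lemma sym_shift F q s (h : I -> R) H : 0 <= H -> (forall i, K i -> Rabs (h i) <= H) ->
  bounded_sym K s -> has_symbol K F q s ->
  has_symbol K (fun i w => F i (w + h i)) q (fun i => shift_sym (s i) (h i)).
Proof.
  intros HH Hh Hs HF N. destruct (HF N) as [c1 [W1 [Hc1 [HW1 H1]]]].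
  destruct (Hs N) as [S0 HS0]. destruct (psum_shift q N H S0 HH) as [c2 [Hc2 H2]].
  exists (c1 * Rpower 2 (Rabs (q - INR N)) + c2), (W1 + 2 * H).
  split. { apply Rplus_le_le_0_compat; [apply Rmult_le_pos; [exact Hc1|left; apply Rpower_pos]|exact Hc2]. }
  split; [lra|]. intros i w Hi Hw. specialize (Hh i Hi).
  assert (Hh' := proj1 (Rabs_le_between _ _) Hh).
  replace (_ - _) with ((F i (w + h i) - psum q (s i) N (w + h i)) + (psum q (s i) N (w + h i) - psum q (shift_sym (s i) (h i)) N w)) by ring.
  eapply Rle_trans; [apply Rabs_triang|]. rewrite Rmult_plus_distr_r. apply Rplus_le_compat.
  - eapply Rle_trans; [apply H1; [exact Hi|lra]|]. rewrite Rmult_assoc.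
    apply Rmult_le_compat_l; [exact Hc1|]. apply Rpower_shift_le; lra.
  - apply H2; try lra. intros k Hk. now apply HS0.
Qed.

(* A fixed loss of [d] orders in the remainder is harmless, since it can be made up by a longer expansion. *)
Lemma sym_loss F q s d : bounded_sym K s ->
  (forall N0, exists N c W, (N0 <= N)%nat /\ 0 <= c /\ 1 <= W /\ forall i w, K i -> W <= w ->
     Rabs (F i w - psum q (s i) N w) <= c * Rpower w (q - INR N + INR d)) ->
  has_symbol K F q s.
Proof.
  intros Hs H M. destruct (H (M + d)%nat) as [N [c [W [HN [Hc [HW H1]]]]]]. destruct (Hs N) as [S0 HS0].
  exists (c + INR (N - M) * (Rabs S0 * rsum (fun k => Rabs (ff q (M + k))) (N - M))), W.
  assert (Pos1 : 0 <= rsum (fun k => Rabs (ff q (M + k))) (N - M)) by (apply rsum_nonneg; intros; apply Rabs_pos).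
  split. { apply Rplus_le_le_0_compat; [exact Hc|]. apply Rmult_le_pos; [apply pos_INR|].
    apply Rmult_le_pos; [apply Rabs_pos|exact Pos1]. }
  split; [exact HW|]. intros i w Hi Hw. specialize (H1 i w Hi Hw).
  assert (E : psum q (s i) N w = psum q (s i) M w + rsum (fun k => s i (M + k)%nat * ff q (M + k) * Rpower w (q - INR (M + k))) (N - M)).
  { unfold psum. replace N with (M + (N - M))%nat at 1 by lia. now rewrite rsum_add. }
  replace (F i w - psum q (s i) M w) with ((F i w - psum q (s i) N w) +
    rsum (fun k => s i (M + k)%nat * ff q (M + k) * Rpower w (q - INR (M + k))) (N - M)) by (rewrite E; ring).
  eapply Rle_trans; [apply Rabs_triang|]. rewrite Rmult_plus_distr_r. apply Rplus_le_compat.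
  - eapply Rle_trans; [exact H1|]. apply Rmult_le_compat_l; [exact Hc|]. apply Rpower_le_exp; [lra|].
    apply le_INR in HN. rewrite plus_INR in HN. lra.
  - rewrite Rmult_assoc. apply rsum_bound. intros k Hk. rewrite !Rabs_mult.
    apply Rmult_le_compat; [apply Rmult_le_pos; apply Rabs_pos|apply Rabs_pos| |].
    + apply Rmult_le_compat; [apply Rabs_pos|apply Rabs_pos| |].
      * eapply Rle_trans; [apply HS0; [exact Hi|lia]|apply Rle_abs].
      * apply (rsum_ge_term (fun k => Rabs (ff q (M + k)))); [intros; apply Rabs_pos|exact Hk].
    + rewrite Rabs_pos_eq by (left; apply Rpower_pos). apply Rpower_le_exp; [lra|].
      rewrite plus_INR. assert (0 <= INR k) by apply pos_INR. lra.
Qed.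

End SymbolCalculus.

(** * Coefficients given by recursion, and inversion of difference operators *)

Fixpoint srec_tab (step : nat -> (nat -> R) -> R) (n : nat) : nat -> R :=
  match n with
  | O => fun _ => 0
  | S m => fun k => if Nat.eqb k m then step m (srec_tab step m) else srec_tab step m k
  end.

(** Course-of-values recursion: [step] needs all the earlier coefficients, which are passed to it as
    a table. *)
Definition srec (step : nat -> (nat -> R) -> R) (k : nat) : R := step k (srec_tab step k).

Lemma srec_tab_eq step n k : (k < n)%nat -> srec_tab step n k = srec step k.
Proof.
  induction n as [|n IH]; intros H; [lia|]. simpl.
  destruct (Nat.eqb_spec k n) as [->|Hn]; [reflexivity|]. apply IH. lia.
Qed.

Lemma series_dom (u v : nat -> R) M : (forall n, Rabs (v n) <= u n) -> (forall n, rsum u n <= M) ->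
  ex_series v /\ ex_series (fun n => Rabs (v n)) /\ Rabs (Series v) <= M.
Proof.
  intros H1 H2.
  assert (Hu : ex_series u).
  { apply (ex_finite_lim_seq_incr (sum_n u) M).
    - intros n. rewrite sum_Sn. unfold plus; simpl. specialize (H1 (S n)).
      assert (0 <= Rabs (v (S n))) by apply Rabs_pos. lra.
    - intros n. rewrite sum_n_rsum. apply H2. }
  assert (Hv : ex_series (fun n => Rabs (v n))).
  { apply (ex_series_le (K := R_AbsRing) (V := R_CompleteNormedModule) _ u); [|exact Hu].
    intros n. unfold norm; simpl. unfold abs; simpl. now rewrite Rabs_Rabsolu. }
  split; [now apply ex_series_Rabs|]. split; [exact Hv|].
  eapply Rle_trans; [apply Series_Rabs, Hv|].
  apply Rle_trans with (Series u).
  - apply Series_le; [|exact Hu]. intros n. split; [apply Rabs_pos|apply H1].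
  - assert (HL := is_lim_seq_le (sum_n u) (fun _ => M) (Series u) M).
    simpl in HL. apply HL; [|apply Series_correct, Hu|apply is_lim_seq_const].
    intros n. rewrite sum_n_rsum. apply H2.
Qed.

(** Comparison with a telescoping sum. The induction is carried by the stronger bound that contains
    the term [- / (m * (1 + INR n * m))]. *)
Lemma rsum_inv_sq m n : 0 < m -> rsum (fun n => / (1 + INR n * m) ^ 2) n <= 1 + / m.
Proof.
  intros Hm. destruct n as [|n]; [simpl; assert (0 < / m) by (now apply Rinv_0_lt_compat); lra|].
  apply Rle_trans with (1 + / m - / (m * (1 + INR n * m))).
  2:{ assert (0 <= INR n) by apply pos_INR. assert (0 < / (m * (1 + INR n * m))); [|lra].
      apply Rinv_0_lt_compat. nra. }
  induction n as [|n IH].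
  - simpl. replace (1 + 0 * m) with 1 by ring. right. field. lra.
  - change (rsum (fun n => / (1 + INR n * m) ^ 2) (S (S n))) with
      (rsum (fun n => / (1 + INR n * m) ^ 2) (S n) + / (1 + INR (S n) * m) ^ 2).
    rewrite S_INR in *. assert (0 <= INR n) by apply pos_INR.
    assert (E : / (m * (1 + INR n * m)) - / (m * (1 + (INR n + 1) * m)) = / ((1 + INR n * m) * (1 + (INR n + 1) * m))).
    { field. repeat split; nra. }
    assert (/ (1 + (INR n + 1) * m) ^ 2 <= / ((1 + INR n * m) * (1 + (INR n + 1) * m))); [|lra].
    apply Rinv_le_contravar; [apply Rmult_lt_0_compat; nra|]. simpl. rewrite Rmult_1_r.
    apply Rmult_le_compat_r; nra.
Qed.

(** The Neumann series [sum_n T_a^n], which inverts [1 - T_a] on functions that decay fast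
    enough. *)
Definition Sop (a : R) (e : R -> R) (w : R) : R := Series (fun n => e (w + INR n * a)).

(** Two orders of decay are spent on convergence: [(w + n a)^(-p)] is at most [w^(-(p - 2))] times
    [(1 + n m)^(-2)], and the second factor is summable. The lower bound [m] of the step makes the
    constant uniform. *)
Lemma Sop_spec a m e c W p : 0 < m -> m <= a -> 0 <= c -> 1 <= W -> 2 <= p ->
  (forall w, W <= w -> Rabs (e w) <= c * Rpower w (- p)) ->
  (forall w, W <= w -> Rabs (Sop a e w) <= c * (1 + / m) * Rpower w (- (p - 2))) /\
  (forall w, W <= w -> Sop a e w - Sop a e (w + a) = e w).
Proof.
  intros Hm Ha Hc HW Hp He.
  assert (D : forall w, W <= w -> ex_series (fun n => e (w + INR n * a)) /\
     Rabs (Sop a e w) <= c * (1 + / m) * Rpower w (- (p - 2))).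
  { intros w Hw.
    destruct (series_dom (fun n => c * Rpower w (- (p - 2)) * / (1 + INR n * m) ^ 2) (fun n => e (w + INR n * a))
      (c * (1 + / m) * Rpower w (- (p - 2)))) as [H1 [_ H2]]; [| |split; assumption].
    - intros n. assert (Hn : 0 <= INR n) by apply pos_INR.
      assert (Hna : INR n * m <= INR n * a) by (apply Rmult_le_compat_l; assumption).
      assert (Hna0 : 0 <= INR n * m) by (apply Rmult_le_pos; lra).
      eapply Rle_trans; [apply He; lra|]. rewrite Rmult_assoc. apply Rmult_le_compat_l; [exact Hc|].
      replace (- p) with (- (p - 2) + - INR 2) by (simpl; ring). rewrite Rpower_plus.
      apply Rmult_le_compat; [left; apply Rpower_pos|left; apply Rpower_pos| |].
      + rewrite !Rpower_Ropp. apply Rinv_le_contravar; [apply Rpower_pos|]. apply Rle_Rpower_l; lra.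
      + rewrite Rpower_Ropp, Rpower_pow by lra. apply Rinv_le_contravar; [apply pow_lt; lra|].
        apply pow_incr. lra.
    - intros n. rewrite rsum_scal. rewrite (Rmult_assoc c (1 + / m)), (Rmult_comm (1 + / m)), <- Rmult_assoc.
      apply Rmult_le_compat_l; [|now apply rsum_inv_sq].
      apply Rmult_le_pos; [exact Hc|left; apply Rpower_pos]. }
  split; [intros w Hw; now apply D|].
  intros w Hw. unfold Sop. rewrite (Series_incr_1 (fun n => e (w + INR n * a))) by now apply D.
  simpl INR at 1. rewrite Rmult_0_l, Rplus_0_r.
  rewrite (Series_ext (fun n => e (w + INR (S n) * a)) (fun n => e (w + a + INR n * a))); [ring|].
  intros n. f_equal. rewrite S_INR. ring.
Qed.

Definition DD (a b : R) (F : R -> R) (w : R) : R := F w - F (w + a) - F (w + b) + F (w + a + b).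

Definition tends0 (F : R -> R) : Prop := forall eps, 0 < eps -> exists W, forall w, W <= w -> Rabs (F w) <= eps.

Lemma periodic_tends0 a F W : 0 < a -> (forall w, W <= w -> F w = F (w + a)) -> tends0 F ->
  forall w, W <= w -> F w = 0.
Proof.
  intros Ha HF H0 w Hw.
  assert (P : forall n, F w = F (w + INR n * a)).
  { induction n as [|n IH]; [f_equal; simpl; ring|]. rewrite IH, S_INR, HF.
    - f_equal. ring.
    - assert (0 <= INR n * a) by (apply Rmult_le_pos; [apply pos_INR|lra]). lra. }
  destruct (Req_dec (F w) 0) as [H|H]; [exact H|]. exfalso.
  destruct (H0 (Rabs (F w) / 2)) as [W' HW']; [assert (0 < Rabs (F w)) by (now apply Rabs_pos_lt); lra|].
  destruct (INR_unbounded ((W' - w) / a)) as [n Hn].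
  assert (Hb : Rabs (F w) <= Rabs (F w) / 2).
  { rewrite (P n) at 1. apply HW'. assert (W' - w <= INR n * a); [|lra].
    apply (Rmult_le_reg_r (/ a)); [now apply Rinv_0_lt_compat|]. rewrite Rmult_assoc, Rinv_r by lra.
    unfold Rdiv in Hn. lra. }
  assert (0 < Rabs (F w)) by now apply Rabs_pos_lt. lra.
Qed.

Lemma tends0_shift F a : tends0 F -> tends0 (fun w => F (w + a)).
Proof. intros H eps He. destruct (H eps He) as [W HW]. exists (W - a). intros w Hw. apply HW. lra. Qed.

Lemma tends0_minus F G : tends0 F -> tends0 G -> tends0 (fun w => F w - G w).
Proof.
  intros H1 H2 eps He. destruct (H1 (eps / 2)) as [W1 HW1]; [lra|]. destruct (H2 (eps / 2)) as [W2 HW2]; [lra|].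
  exists (Rmax W1 W2). intros w Hw. specialize (HW1 w (Rle_trans _ _ _ (Rmax_l _ _) Hw)).
  specialize (HW2 w (Rle_trans _ _ _ (Rmax_r _ _) Hw)). unfold Rminus.
  eapply Rle_trans; [apply Rabs_triang|]. rewrite Rabs_Ropp. lra.
Qed.

(** The uniqueness principle of the whole proof. Beyond [W] the function [F - T_a F] is [b]-periodic
    and tends to 0, so it vanishes; then [F] itself is [a]-periodic and tends to 0. *)
Lemma DD_tends0 a b F W : 0 < a -> 0 < b -> (forall w, W <= w -> DD a b F w = 0) -> tends0 F ->
  forall w, W <= w -> F w = 0.
Proof.
  intros Ha Hb HF H0.
  assert (P : forall w, W <= w -> F w - F (w + a) = 0).
  { apply (periodic_tends0 b (fun w => F w - F (w + a)) W Hb).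
    - intros w Hw. assert (H := HF w Hw). unfold DD in H. replace (w + b + a) with (w + a + b) by ring. lra.
    - apply tends0_minus; [exact H0|now apply tends0_shift]. }
  apply (periodic_tends0 a F W Ha); [|exact H0]. intros w Hw. specialize (P w Hw). lra.
Qed.

Lemma tends0_Rpower F c W p : p < 0 -> (forall w, W <= w -> Rabs (F w) <= c * Rpower w p) -> tends0 F.
Proof.
  intros Hp HF eps He. set (c' := Rabs c + 1).
  assert (Hc' : 0 < c') by (unfold c'; assert (0 <= Rabs c) by apply Rabs_pos; lra).
  exists (Rmax W (Rpower (eps / c') (/ p))). intros w Hw.
  assert (Hw1 := Rle_trans _ _ _ (Rmax_l _ _) Hw). assert (Hw2 := Rle_trans _ _ _ (Rmax_r _ _) Hw).
  eapply Rle_trans; [apply HF, Hw1|].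
  assert (Hw0 : 0 < Rpower (eps / c') (/ p)) by apply Rpower_pos.
  apply Rle_trans with (c' * Rpower w p).
  { apply Rmult_le_compat_r; [left; apply Rpower_pos|]. unfold c'. assert (H := Rle_abs c). lra. }
  apply Rle_trans with (c' * (eps / c')); [|right; field; lra].
  apply Rmult_le_compat_l; [lra|].
  assert (E : eps / c' = Rpower (Rpower (eps / c') (/ p)) p).
  { rewrite Rpower_mult, Rinv_l, Rpower_1; [reflexivity| |lra]. now apply Rdiv_lt_0_compat. }
  rewrite E. replace p with (- - p) at 1 3 by ring. rewrite !(Rpower_Ropp _ (- p)).
  apply Rinv_le_contravar; [apply Rpower_pos|]. apply Rle_Rpower_l; lra.
Qed.

(** * The double zeta function [sum_{m,n} (w + m a + n b) ^ gamma], regularized *)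

(* Coefficients of [s^2 / ((1 - e^(a s)) (1 - e^(b s)))] when [a b = 1]. *)
Definition acoef (a b : R) : nat -> R :=
  srec (fun i t => (if Nat.eqb i 0 then 1 else 0)
    - rsum (fun k => t k * (/ INR (fact (i + 2 - k)) * ((a + b) ^ (i + 2 - k) - a ^ (i + 2 - k) - b ^ (i + 2 - k)))) i).

Lemma acoef_rec a b i : acoef a b i = (if Nat.eqb i 0 then 1 else 0)
    - rsum (fun k => acoef a b k * (/ INR (fact (i + 2 - k)) * ((a + b) ^ (i + 2 - k) - a ^ (i + 2 - k) - b ^ (i + 2 - k)))) i.
Proof.
  unfold acoef at 1, srec. f_equal. apply rsum_ext. intros k Hk. now rewrite srec_tab_eq.
Qed.

(** The steps [a = sqrt beta] and [b = 1 / a] for [beta] in a compact set. Constants below depend on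
    [a] and [b] through [B] only. *)
Definition Reg (B a b : R) : Prop := / B <= a <= B /\ / B <= b <= B /\ a * b = 1.

Lemma acoef_bound B n : 1 <= B -> exists S0, 0 <= S0 /\
  forall a b k, Reg B a b -> (k < n)%nat -> Rabs (acoef a b k) <= S0.
Proof.
  intros HB. induction n as [|n [S0 [HS0 IH]]].
  - exists 0. split; [lra|]. intros; lia.
  - set (T := 1 + INR n * (S0 * ((2 * B) ^ (n + 2) + B ^ (n + 2) + B ^ (n + 2)))).
    exists (Rmax S0 T). split; [eapply Rle_trans; [exact HS0|apply Rmax_l]|].
    intros a b k HR Hk. destruct (Nat.eq_dec k n) as [->|Hkn].
    2:{ eapply Rle_trans; [apply IH; [exact HR|lia]|apply Rmax_l]. }
    eapply Rle_trans; [|apply Rmax_r]. rewrite acoef_rec. unfold Rminus at 1.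
    eapply Rle_trans; [apply Rabs_triang|]. rewrite Rabs_Ropp. unfold T. apply Rplus_le_compat.
    + destruct (Nat.eqb n 0); [rewrite Rabs_R1; lra|rewrite Rabs_R0; lra].
    + apply rsum_bound. intros j Hj. rewrite Rabs_mult.
      apply Rmult_le_compat; [apply Rabs_pos|apply Rabs_pos|apply IH; [exact HR|exact Hj]|].
      destruct HR as [Ha [Hb _]]. assert (HiB : 0 < / B) by (apply Rinv_0_lt_compat; lra).
      set (m := (n + 2 - j)%nat). assert (Hm : (m <= n + 2)%nat) by (unfold m; lia).
      assert (P1 : forall x y, 0 <= x -> x <= y -> 1 <= y -> 0 <= x ^ m <= y ^ (n + 2)).
      { intros x y H0 H1 H2. split; [now apply pow_le|].
        eapply Rle_trans; [apply pow_incr; split; [exact H0|exact H1]|]. now apply Rle_pow. }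
      assert (Q1 := P1 (a + b) (2 * B) ltac:(lra) ltac:(lra) ltac:(lra)).
      assert (Q2 := P1 a B ltac:(lra) ltac:(lra) ltac:(lra)).
      assert (Q3 := P1 b B ltac:(lra) ltac:(lra) ltac:(lra)).
      rewrite Rabs_mult. rewrite <- (Rmult_1_l ((2 * B) ^ _ + _ + _)).
      apply Rmult_le_compat; [apply Rabs_pos|apply Rabs_pos| |].
      * rewrite Rabs_pos_eq by (left; apply Rinv_0_lt_compat, INR_fact_lt_0).
        rewrite <- Rinv_1. apply Rinv_le_contravar; [lra|]. change 1 with (INR 1). apply le_INR, lt_O_fact.
      * apply Rabs_le. lra.
Qed.

(** The left side is the coefficient of [s^i] in the product of the series of [acoef] with
    [(1 - e^(a s)) (1 - e^(b s))]. The second factor starts with [a b s^2 = s^2], which is why the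
    recursion can be solved, and the product is [s^2]. *)
Lemma acoef_identity a b i : a * b = 1 ->
  acoef a b i - shift_sym (acoef a b) a i - shift_sym (acoef a b) b i + shift_sym (acoef a b) (a + b) i
  = if Nat.eqb i 2 then 1 else 0.
Proof.
  intros Hab. unfold shift_sym.
  assert (E : acoef a b i - rsum (fun j => acoef a b j * (/ INR (fact (i - j)) * a ^ (i - j))) (S i)
    - rsum (fun j => acoef a b j * (/ INR (fact (i - j)) * b ^ (i - j))) (S i)
    + rsum (fun j => acoef a b j * (/ INR (fact (i - j)) * (a + b) ^ (i - j))) (S i)
    = rsum (fun j => acoef a b j * (/ INR (fact (i - j)) * ((a + b) ^ (i - j) - a ^ (i - j) - b ^ (i - j)))) i).
  { rewrite !rsum_S. rewrite Nat.sub_diag. simpl fact. simpl pow. simpl INR.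
    rewrite (rsum_ext (fun j => acoef a b j * (/ INR (fact (i - j)) * ((a + b) ^ (i - j) - a ^ (i - j) - b ^ (i - j))))
      (fun j => acoef a b j * (/ INR (fact (i - j)) * (a + b) ^ (i - j))
        - acoef a b j * (/ INR (fact (i - j)) * a ^ (i - j)) - acoef a b j * (/ INR (fact (i - j)) * b ^ (i - j))))
      by (intros; ring).
    rewrite !rsum_minus. field. }
  rewrite E. clear E.
  destruct i as [|[|i]]; [reflexivity| |].
  - simpl. ring.
  - rewrite !rsum_S. replace (S (S i) - i)%nat with 2%nat by lia. replace (S (S i) - S i)%nat with 1%nat by lia.
    rewrite (acoef_rec a b i) at 1. simpl Nat.eqb.
    rewrite (rsum_ext _ (fun k => acoef a b k * (/ INR (fact (i + 2 - k)) * ((a + b) ^ (i + 2 - k) - a ^ (i + 2 - k) - b ^ (i + 2 - k))))).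
    2:{ intros k Hk. replace (S (S i) - k)%nat with (i + 2 - k)%nat by lia. reflexivity. }
    set (X := rsum _ i). simpl. replace ((a + b) * ((a + b) * 1) - a * (a * 1) - b * (b * 1)) with (2 * (a * b)) by ring.
    rewrite Hab. destruct (Nat.eqb i 0); field.
Qed.

(** Normalized so that [kappa g] times the second derivative of [w^(g + 2)] is [w^g]. *)
Definition kappa (g : R) : R := / ((g + 1) * (g + 2)).

Definition acoefk (g a b : R) (k : nat) : R := kappa g * acoef a b k.

Definition AN (g a b : R) (N : nat) (w : R) : R := psum (g + 2) (acoefk g a b) N w.

Definition eN (g a b : R) (N : nat) (w : R) : R := Rpower w g - DD a b (AN g a b N) w.

Lemma shift_sym_scal c s h k : shift_sym (fun j => c * s j) h k = c * shift_sym s h k.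
Proof. unfold shift_sym. rewrite <- rsum_scal. apply rsum_ext. intros; ring. Qed.

Lemma acoefk_bound g B n : 0 < g -> 1 <= B -> exists S0, 0 <= S0 /\
  forall a b k, Reg B a b -> (k < n)%nat -> Rabs (acoefk g a b k) <= S0.
Proof.
  intros Hg HB. destruct (acoef_bound B n HB) as [S0 [HS0 HS]].
  exists (Rabs (kappa g) * S0). split; [apply Rmult_le_pos; [apply Rabs_pos|exact HS0]|].
  intros a b k HR Hk. unfold acoefk. rewrite Rabs_mult. apply Rmult_le_compat_l; [apply Rabs_pos|]. now apply HS.
Qed.

Lemma Reg_pos B a b : 1 <= B -> Reg B a b -> 0 < a /\ 0 < b.
Proof. intros HB [[H1 _] [[H2 _] _]]. assert (0 < / B) by (apply Rinv_0_lt_compat; lra). lra. Qed.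

Lemma eN_bound g B N : 0 < g -> 1 <= B -> (3 <= N)%nat -> exists c, 0 <= c /\
  forall a b w, Reg B a b -> 2 * (a + b) + 1 <= w ->
  Rabs (eN g a b N w) <= c * Rpower w (g + 2 - INR N).
Proof.
  intros Hg HB HN. destruct (acoefk_bound g B N Hg HB) as [S0 [HS0 HS]].
  destruct (psum_shift (g + 2) N (2 * B) S0 ltac:(lra)) as [K [HK0 HK]].
  exists (3 * K). split; [lra|]. intros a b w HR Hw.
  destruct (Reg_pos B a b HB HR) as [Ha Hb]. assert (HR' := HR). destruct HR' as [HRa [HRb Hab]].
  assert (Hs : forall k, (k < N)%nat -> Rabs (acoefk g a b k) <= S0) by (intros; now apply HS).
  assert (Q1 := HK (acoefk g a b) a w Hs). assert (Q2 := HK (acoefk g a b) b w Hs).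
  assert (Q3 := HK (acoefk g a b) (a + b) w Hs).
  rewrite Rabs_pos_eq in Q1, Q2, Q3 by lra.
  specialize (Q1 ltac:(lra) ltac:(lra) ltac:(lra)). specialize (Q2 ltac:(lra) ltac:(lra) ltac:(lra)).
  specialize (Q3 ltac:(lra) ltac:(lra) ltac:(lra)).
  assert (E : psum (g + 2) (acoefk g a b) N w - psum (g + 2) (shift_sym (acoefk g a b) a) N w
    - psum (g + 2) (shift_sym (acoefk g a b) b) N w + psum (g + 2) (shift_sym (acoefk g a b) (a + b)) N w = Rpower w g).
  { unfold psum. rewrite <- !rsum_minus, <- rsum_plus.
    rewrite (rsum_ext _ (fun k => if Nat.eqb k 2 then Rpower w g else 0)).
    - replace N with (3 + (N - 3))%nat by lia. rewrite rsum_add.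
      rewrite (rsum_ext (fun k => if Nat.eqb (3 + k) 2 then _ else _) (fun _ => 0)) by reflexivity.
      rewrite rsum_zero. simpl. ring.
    - intros k _. unfold acoefk at 1.
      change (acoefk g a b) with (fun k => kappa g * acoef a b k). rewrite !shift_sym_scal.
      replace (_ - _ - _ + _) with (kappa g * (acoef a b k - shift_sym (acoef a b) a k - shift_sym (acoef a b) b k + shift_sym (acoef a b) (a + b) k) * ff (g + 2) k * Rpower w (g + 2 - INR k)) by ring.
      rewrite acoef_identity by exact Hab.
      destruct (Nat.eqb_spec k 2) as [->|_]; [|ring]. unfold kappa. simpl.
      replace (g + 2 - (1 + 1)) with g by ring. field. lra. }
  unfold eN, DD, AN. rewrite <- E. rewrite Rplus_assoc.
  set (p0 := psum (g + 2) (acoefk g a b) N w) in *.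
  apply Rabs_le_between in Q1. apply Rabs_le_between in Q2. apply Rabs_le_between in Q3. apply Rabs_le. lra.
Qed.

(** The truncated expansion solves the equation up to the defect [eN]; the sum of
    [eN (w + m a + n b)] over all [m, n >= 0] removes this defect, and it converges once [N] is
    large. *)
Definition ZN (g a b : R) (N : nat) (w : R) : R :=
  AN g a b N w + Sop a (Sop b (eN g a b N)) w.

(** Chosen such that the defect is [O(w^(-5))]: the two summations cost four orders, and the
    correction still tends to 0. *)
Definition base_order (g : R) : nat := (Z.to_nat (up g) + 7)%nat.

Lemma base_order_spec g : 0 < g -> g + 2 - INR (base_order g) <= - 5.
Proof.
  intros Hg. unfold base_order. rewrite plus_INR. destruct (archimed g) as [H _].
  assert (0 <= up g)%Z by (apply le_IZR; lra).
  rewrite INR_IZR_INZ, Z2Nat.id by assumption. simpl. lra.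
Qed.

Definition Z2 (g a b : R) : R -> R := ZN g a b (base_order g).

Lemma base_order_ge3 g : (3 <= base_order g)%nat. Proof. unfold base_order; lia. Qed.

Lemma DD_plus a b F G w : DD a b (fun x => F x + G x) w = DD a b F w + DD a b G w.
Proof. unfold DD; ring. Qed.

Lemma DD_minus a b F G w : DD a b (fun x => F x - G x) w = DD a b F w - DD a b G w.
Proof. unfold DD; ring. Qed.

(** The two applications of [Sop] invert [1 - T_a] and [1 - T_b] in turn; each costs two orders,
    which is the [4] in the exponent. *)
Lemma ZN_spec g B N : 0 < g -> 1 <= B -> (base_order g <= N)%nat -> exists c, 0 <= c /\
  forall a b w, Reg B a b -> 2 * (a + b) + 1 <= w ->
  DD a b (ZN g a b N) w = Rpower w g /\
  Rabs (ZN g a b N w - AN g a b N w) <= c * Rpower w (g + 2 - INR N + 4).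
Proof.
  intros Hg HB HN. assert (N3 := base_order_ge3 g).
  destruct (eN_bound g B N Hg HB ltac:(lia)) as [c [Hc He]].
  assert (Hp : g + 2 - INR N <= -4).
  { assert (H := base_order_spec g Hg). apply le_INR in HN. lra. }
  exists (c * (1 + / / B) * (1 + / / B)).
  assert (HiB : 0 < / B) by (apply Rinv_0_lt_compat; lra).
  assert (HiiB : 0 < / / B) by (apply Rinv_0_lt_compat; lra).
  split; [apply Rmult_le_pos; [apply Rmult_le_pos|]; lra|].
  intros a b w HR Hw. destruct (Reg_pos B a b HB HR) as [Ha Hb]. assert (HR' := HR).
  destruct HR' as [[HRa _] [[HRb _] _]].
  set (p := - (g + 2 - INR N)).
  destruct (Sop_spec b (/ B) (eN g a b N) c (2 * (a + b) + 1) p HiB HRb Hc ltac:(lra) ltac:(unfold p; lra)) as [S1 S2].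
  { intros x Hx. unfold p. rewrite Ropp_involutive. now apply He. }
  destruct (Sop_spec a (/ B) (Sop b (eN g a b N)) (c * (1 + / / B)) (2 * (a + b) + 1) (p - 2) HiB HRa
    ltac:(apply Rmult_le_pos; lra) ltac:(lra) ltac:(unfold p; lra) S1) as [S3 S4].
  split.
  - unfold ZN. rewrite DD_plus. unfold DD at 2.
    assert (T1 := S4 w Hw). assert (T2 := S4 (w + b) ltac:(lra)). assert (T3 := S2 w Hw).
    replace (w + b + a) with (w + a + b) in T2 by ring.
    unfold eN in T3 at 3. lra.
  - unfold ZN. replace (_ + _ - _) with (Sop a (Sop b (eN g a b N)) w) by ring.
    replace (g + 2 - INR N + 4) with (- (p - 2 - 2)) by (unfold p; ring). now apply S3.
Qed.

Lemma Z2_DD g a b w B : 0 < g -> 1 <= B -> Reg B a b -> 2 * (a + b) + 1 <= w ->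
  DD a b (Z2 g a b) w = Rpower w g.
Proof.
  intros Hg HB HR Hw. destruct (ZN_spec g B (base_order g) Hg HB (le_n _)) as [c [_ H]]. now apply H.
Qed.

Lemma Z2_near g B : 0 < g -> 1 <= B -> exists c, 0 <= c /\
  forall a b w, Reg B a b -> 2 * (a + b) + 1 <= w -> Rabs (Z2 g a b w - AN g a b (base_order g) w) <= c.
Proof.
  intros Hg HB. destruct (ZN_spec g B (base_order g) Hg HB (le_n _)) as [c [Hc H]]. exists c. split; [exact Hc|].
  intros a b w HR Hw. destruct (Reg_pos B a b HB HR).
  eapply Rle_trans; [apply H; assumption|]. rewrite <- (Rmult_1_r c) at 2.
  apply Rmult_le_compat_l; [exact Hc|]. rewrite <- (Rpower_O w) by lra. apply Rpower_le_exp; [lra|].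
  assert (HN := base_order_spec g Hg). lra.
Qed.

Lemma AN_diff g B N M : 0 < g -> 1 <= B -> (M <= N)%nat -> exists c, 0 <= c /\
  forall a b w, Reg B a b -> 1 <= w -> Rabs (AN g a b N w - AN g a b M w) <= c * Rpower w (g + 2 - INR M).
Proof.
  intros Hg HB HM. destruct (acoefk_bound g B N Hg HB) as [S0 [HS0 HS]].
  set (T := rsum (fun k => Rabs (ff (g + 2) (M + k))) (N - M)).
  assert (HT : 0 <= T) by (apply rsum_nonneg; intros; apply Rabs_pos).
  exists (INR (N - M) * (S0 * T)). split; [apply Rmult_le_pos; [apply pos_INR|now apply Rmult_le_pos]|].
  intros a b w HR Hw. unfold AN, psum. replace N with (M + (N - M))%nat at 1 by lia. rewrite rsum_add.
  replace (_ + _ - _) with (rsum (fun k => acoefk g a b (M + k) * ff (g + 2) (M + k) * Rpower w (g + 2 - INR (M + k))) (N - M)) by ring.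
  rewrite Rmult_assoc. apply rsum_bound. intros k Hk. rewrite !Rabs_mult.
  apply Rmult_le_compat; [apply Rmult_le_pos; apply Rabs_pos|apply Rabs_pos| |].
  - apply Rmult_le_compat; [apply Rabs_pos|apply Rabs_pos|apply HS; [exact HR|lia]|].
    apply (rsum_ge_term (fun k => Rabs (ff (g + 2) (M + k)))); [intros; apply Rabs_pos|exact Hk].
  - rewrite Rabs_pos_eq by (left; apply Rpower_pos). apply Rpower_le_exp; [exact Hw|].
    rewrite plus_INR. assert (0 <= INR k) by apply pos_INR. lra.
Qed.

(** Both functions solve the same equation, and their difference tends to 0. As [N] is arbitrary,
    the fixed function [Z2] acquires an expansion to every order. *)
Lemma ZN_Z2 g B N a b w : 0 < g -> 1 <= B -> (base_order g <= N)%nat -> Reg B a b -> 2 * (a + b) + 1 <= w ->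
  ZN g a b N w = Z2 g a b w.
Proof.
  intros Hg HB HN HR Hw. destruct (Reg_pos B a b HB HR) as [Ha Hb].
  destruct (ZN_spec g B N Hg HB HN) as [c1 [Hc1 H1]].
  destruct (ZN_spec g B (base_order g) Hg HB (le_n _)) as [c2 [Hc2 H2]].
  destruct (AN_diff g B N (base_order g) Hg HB HN) as [c3 [Hc3 H3]].
  apply Rminus_diag_uniq.
  apply (DD_tends0 a b (fun w => ZN g a b N w - Z2 g a b w) (2 * (a + b) + 1) Ha Hb); [| |exact Hw].
  - intros x Hx. rewrite DD_minus. unfold Z2. rewrite (proj1 (H1 a b x HR Hx)), (proj1 (H2 a b x HR Hx)). ring.
  - assert (Hp := base_order_spec g Hg). assert (HN' := le_INR _ _ HN).
    apply (tends0_Rpower _ (c1 + c2 + c3) (2 * (a + b) + 1) (-1)); [lra|]. intros x Hx.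
    specialize (H1 a b x HR Hx). specialize (H2 a b x HR Hx). specialize (H3 a b x HR ltac:(lra)).
    fold (Z2 g a b x) in H2.
    replace (_ - _) with ((ZN g a b N x - AN g a b N x) + (AN g a b N x - AN g a b (base_order g) x) - (Z2 g a b x - AN g a b (base_order g) x)) by ring.
    assert (L : forall c p, 0 <= c -> p <= -1 -> c * Rpower x p <= c * Rpower x (-1)).
    { intros c p H0 Hp'. apply Rmult_le_compat_l; [exact H0|]. apply Rpower_le_exp; lra. }
    assert (L1 := L c1 (g + 2 - INR N + 4) Hc1 ltac:(lra)).
    assert (L2 := L c2 (g + 2 - INR (base_order g) + 4) Hc2 ltac:(lra)).
    assert (L3 := L c3 (g + 2 - INR (base_order g)) Hc3 ltac:(lra)).
    destruct H1 as [_ H1]. destruct H2 as [_ H2]. unfold Z2 in *.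
    apply Rabs_le_between in H1. apply Rabs_le_between in H2. apply Rabs_le_between in H3.
    apply Rabs_le. lra.
Qed.

(** For each length [N] the function is read as [ZN], whose distance to the truncated expansion
    falls short of the required order by four; [sym_loss] makes up for it. *)
Lemma Z2_symbol g B : 0 < g -> 1 <= B ->
  has_symbol (fun i => Reg B (fst i) (snd i)) (fun i => Z2 g (fst i) (snd i)) (g + 2)
    (fun i => acoefk g (fst i) (snd i)).
Proof.
  intros Hg HB. apply (sym_loss _ _ _ _ 4).
  - intros N. destruct (acoefk_bound g B N Hg HB) as [S0 [_ H]]. exists S0. intros i k Hi Hk. now apply H.
  - intros M. set (N := Nat.max M (base_order g)).
    destruct (ZN_spec g B N Hg HB ltac:(lia)) as [c [Hc H]].
    exists N, c, (4 * B + 1). split; [lia|]. split; [exact Hc|]. split; [lra|].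
    intros [a b] w HR Hw. simpl in HR. simpl fst. simpl snd.
    assert (HR' := HR). destruct HR' as [[_ HRa] [[_ HRb] _]].
    rewrite <- (ZN_Z2 g B N a b w) by (try assumption; try lia; lra).
    replace (INR 4) with 4 by (simpl; ring). now apply H; [|lra].
Qed.

(** * Uniqueness of expansions, and growth of solutions of the homogeneous equation *)

Definition sym1 (F : R -> R) (q : R) (s : nat -> R) : Prop :=
  has_symbol (fun _ : unit => True) (fun _ => F) q (fun _ => s).

Lemma sym_at {I : Type} (K : I -> Prop) F q s i : has_symbol K F q s -> K i -> sym1 (F i) q (s i).
Proof.
  intros H Hi N. destruct (H N) as [c [W [Hc [HW H1]]]]. exists c, W.
  split; [exact Hc|]. split; [exact HW|]. intros _ w _ Hw. now apply H1.
Qed.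

(** [F - T_a F] is invariant under [b], hence under [mu b = nu a], so that along the progression
    [W + j a] it takes at most [nu] values. Their absolute values add up to [M]. *)
Lemma DD_linear_bound_commensurable a b (mu nu : nat) F W : 0 < a -> 0 < b -> (1 <= nu)%nat ->
  INR nu * a = INR mu * b -> (forall w, W <= w -> DD a b F w = 0) ->
  exists M, forall j, Rabs (F (W + INR j * a)) <= Rabs (F W) + INR j * M.
Proof.
  intros Ha Hb Hnu Hab HF. set (phi := fun w => F w - F (w + a)).
  assert (Hphi : forall n w, W <= w -> phi (w + INR n * b) = phi w).
  { induction n as [|n IH]; intros w Hw; [f_equal; simpl; ring|].
    rewrite S_INR. rewrite <- (IH w Hw). assert (0 <= INR n * b) by (apply Rmult_le_pos; [apply pos_INR|lra]).
    assert (H1 := HF (w + INR n * b) ltac:(lra)). unfold DD in H1. unfold phi.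
    replace (w + (INR n + 1) * b) with (w + INR n * b + b) by ring.
    replace (w + INR n * b + b + a) with (w + INR n * b + a + b) by ring. lra. }
  set (M := rsum (fun i => Rabs (phi (W + INR i * a))) nu). exists M.
  assert (HM : forall j, Rabs (phi (W + INR j * a)) <= M).
  { intros j. induction j as [j IH] using lt_wf_ind. destruct (Nat.lt_ge_cases j nu) as [Hj|Hj].
    - apply (rsum_ge_term (fun i => Rabs (phi (W + INR i * a)))); [intros; apply Rabs_pos|exact Hj].
    - specialize (IH (j - nu)%nat ltac:(lia)).
      replace (W + INR j * a) with (W + INR (j - nu) * a + INR mu * b).
      + rewrite Hphi; [exact IH|]. assert (0 <= INR (j - nu) * a) by (apply Rmult_le_pos; [apply pos_INR|lra]). lra.
      + rewrite <- Hab, minus_INR by lia. ring. }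
  intros j. induction j as [|j IH].
  - simpl. rewrite !Rmult_0_l, !Rplus_0_r. lra.
  - rewrite S_INR. replace (W + (INR j + 1) * a) with (W + INR j * a + a) by ring.
    replace (F (W + INR j * a + a)) with (F (W + INR j * a) - phi (W + INR j * a)) by (unfold phi; ring).
    unfold Rminus. eapply Rle_trans; [apply Rabs_triang|]. rewrite Rabs_Ropp. specialize (HM j). lra.
Qed.

Lemma ff_pos k : forall q, INR k <= q -> 0 < ff q k.
Proof.
  induction k as [|k IH]; intros q H; simpl ff; [lra|].
  rewrite S_INR in H. apply Rmult_lt_0_compat; [apply IH; lra|lra].
Qed.

Lemma kappa_pos g : 0 < g -> 0 < kappa g.
Proof. intros. unfold kappa. apply Rinv_0_lt_compat. nra. Qed.

(* The symbols do not depend on the exponent, so that they can be compared for a large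
   exponent, where all the powers under consideration outgrow the kernel of [DD]. *)
Lemma symbol_unique a b (mu nu : nat) (F G : R -> R -> R) (s t : nat -> R) : 0 < a -> 0 < b -> (1 <= nu)%nat ->
  INR nu * a = INR mu * b ->
  (forall g, 0 < g -> exists W, forall w, W <= w -> DD a b (F g) w = DD a b (G g) w) ->
  (forall g, 0 < g -> sym1 (F g) (g + 2) (fun k => kappa g * s k)) ->
  (forall g, 0 < g -> sym1 (G g) (g + 2) (fun k => kappa g * t k)) ->
  forall k, s k = t k.
Proof.
  intros Ha Hb Hnu Hab HD HF HG k. induction k as [k IH] using lt_wf_ind.
  (* For this exponent the term of index [k] is a multiple of [w^3] and the remainders are [O(w^2)],
     whereas solutions of the homogeneous equation grow at most linearly along the progression. *)
  set (g := INR k + 1). assert (Hk0 := pos_INR k). assert (Hg : 0 < g) by (unfold g; lra).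
  destruct (HD g Hg) as [W0 H0]. destruct (HF g Hg (S k)) as [c1 [W1 [Hc1 [HW1 H1]]]].
  destruct (HG g Hg (S k)) as [c2 [W2 [Hc2 [HW2 H2]]]].
  set (W := Rmax W0 (Rmax W1 W2)).
  assert (LW0 : W0 <= W) by apply Rmax_l.
  assert (LW1 : W1 <= W) by (eapply Rle_trans; [apply Rmax_l|apply Rmax_r]).
  assert (LW2 : W2 <= W) by (eapply Rle_trans; [apply Rmax_r|apply Rmax_r]).
  set (D := fun w => F g w - G g w).
  destruct (DD_linear_bound_commensurable a b mu nu D W Ha Hb Hnu Hab) as [M HM].
  { intros w Hw. unfold D. rewrite DD_minus, H0 by lra. ring. }
  set (d := kappa g * (s k - t k) * ff (g + 2) k).
  assert (HDw : forall w, W <= w -> Rabs (D w - d * w ^ 3) <= (c1 + c2) * w ^ 2).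
  { intros w Hw. specialize (H1 tt w I ltac:(lra)). specialize (H2 tt w I ltac:(lra)).
    cbv beta in H1, H2.
    assert (E : psum (g + 2) (fun j => kappa g * s j) (S k) w - psum (g + 2) (fun j => kappa g * t j) (S k) w = d * w ^ 3).
    { unfold psum. rewrite !rsum_S. rewrite (rsum_ext (fun j => kappa g * s j * _ * _) (fun j => kappa g * t j * ff (g + 2) j * Rpower w (g + 2 - INR j)) k).
      - replace (g + 2 - INR k) with (INR 3) by (unfold g; simpl; ring). rewrite Rpower_pow by lra. unfold d. ring.
      - intros j Hj. now rewrite IH. }
    replace (g + 2 - INR (S k)) with (INR 2) in H1, H2 by (unfold g; rewrite (S_INR k); simpl; ring).
    rewrite Rpower_pow in H1, H2 by lra.
    unfold D. rewrite <- E.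
    replace (_ - _) with ((F g w - psum (g + 2) (fun k => kappa g * s k) (S k) w) - (G g w - psum (g + 2) (fun k => kappa g * t k) (S k) w)) by ring.
    unfold Rminus at 1. eapply Rle_trans; [apply Rabs_triang|]. rewrite Rabs_Ropp. lra. }
  assert (Hd : d = 0).
  { destruct (Req_dec d 0) as [E|E]; [exact E|exfalso].
    assert (Hd : 0 < Rabs d) by now apply Rabs_pos_lt.
    set (Q := c1 + c2 + Rabs (D W) + Rabs M / a).
    destruct (INR_unbounded (Q / Rabs d / a)) as [j Hj].
    set (w := W + INR j * a). assert (Hja : 0 <= INR j * a) by (apply Rmult_le_pos; [apply pos_INR|lra]).
    assert (Hw : W <= w) by (unfold w; lra).
    assert (Hjw : INR j * a <= w) by (unfold w; lra).
    assert (B1 := HDw w Hw). assert (B2 := HM j). fold w in B2.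
    assert (B3 : Rabs d * w ^ 3 <= (c1 + c2) * w ^ 2 + Rabs (D W) + INR j * M).
    { replace (Rabs d * w ^ 3) with (Rabs (d * w ^ 3)).
      - replace (d * w ^ 3) with (D w - (D w - d * w ^ 3)) at 1 by ring. unfold Rminus at 1.
        eapply Rle_trans; [apply Rabs_triang|]. rewrite Rabs_Ropp. lra.
      - rewrite Rabs_mult, (Rabs_pos_eq (w ^ 3)); [reflexivity|]. apply pow_le. lra. }
    assert (Hw1 : 1 <= w) by lra.
    assert (B4 : INR j * M <= Rabs M / a * w ^ 2).
    { apply Rle_trans with (INR j * Rabs M). { apply Rmult_le_compat_l; [apply pos_INR|apply Rle_abs]. }
      replace (INR j * Rabs M) with (Rabs M / a * (INR j * a)) by (field; lra).
      apply Rmult_le_compat_l. { apply Rdiv_le_0_compat; [apply Rabs_pos|lra]. } simpl. nra. }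
    assert (B5 : Rabs (D W) <= Rabs (D W) * w ^ 2).
    { rewrite <- (Rmult_1_r (Rabs (D W))) at 1. apply Rmult_le_compat_l; [apply Rabs_pos|]. simpl. nra. }
    assert (B6 : Rabs d * w ^ 3 <= Q * w ^ 2) by (unfold Q; lra).
    assert (B7 : Rabs d * w <= Q).
    { apply (Rmult_le_reg_r (w ^ 2)); [apply pow_lt; lra|]. replace (Rabs d * w * w ^ 2) with (Rabs d * w ^ 3) by (simpl; ring). exact B6. }
    assert (B8 : Q < Rabs d * (INR j * a)).
    { apply (Rmult_lt_reg_r (/ Rabs d / a)). { apply Rdiv_lt_0_compat; [now apply Rinv_0_lt_compat|lra]. }
      replace (Rabs d * (INR j * a) * (/ Rabs d / a)) with (INR j) by (field; lra).
      replace (Q * (/ Rabs d / a)) with (Q / Rabs d / a) by (field; lra). exact Hj. }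
    assert (Rabs d * (INR j * a) <= Rabs d * w) by (apply Rmult_le_compat_l; lra). lra. }
  unfold d in Hd. assert (P1 := kappa_pos g Hg).
  assert (P2 : 0 < ff (g + 2) k) by (apply ff_pos; unfold g; lra).
  apply Rmult_integral in Hd. destruct Hd as [Hd|Hd]; [|lra].
  apply Rmult_integral in Hd. destruct Hd as [Hd|Hd]; lra.
Qed.

Lemma symbol_eq_tends0 F G q s : sym1 F q s -> sym1 G q s -> tends0 (fun w => F w - G w).
Proof.
  intros HF HG. set (N := S (Z.to_nat (up q))).
  assert (HN : q - INR N < 0).
  { unfold N. rewrite S_INR. destruct (archimed q) as [H _]. destruct (Z_le_dec 0 (up q)) as [Hz|Hz].
    - rewrite INR_IZR_INZ, Z2Nat.id by exact Hz. lra.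
    - assert (IZR (up q) < 0) by (apply IZR_lt; lia). assert (0 <= INR (Z.to_nat (up q))) by apply pos_INR. lra. }
  destruct (HF N) as [c1 [W1 [Hc1 [HW1 H1]]]]. destruct (HG N) as [c2 [W2 [Hc2 [HW2 H2]]]].
  apply (tends0_Rpower _ (c1 + c2) (Rmax W1 W2) (q - INR N) HN). intros w Hw.
  specialize (H1 tt w I (Rle_trans _ _ _ (Rmax_l _ _) Hw)). specialize (H2 tt w I (Rle_trans _ _ _ (Rmax_r _ _) Hw)).
  cbv beta in H1, H2.
  replace (F w - G w) with ((F w - psum q s N w) - (G w - psum q s N w)) by ring.
  unfold Rminus at 1. eapply Rle_trans; [apply Rabs_triang|]. rewrite Rabs_Ropp. lra.
Qed.

(** Beyond [W] the function [F - T_a F] is [b]-periodic, hence at most [2 M] everywhere; the number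
    of steps of length [a] then gives linear growth. This is the source of the bound for [Osc]. *)
Lemma DD_linear_bound a b F W M : 0 < a -> 0 < b ->
  (forall w, W <= w -> DD a b F w = 0) ->
  (forall w, W <= w <= W + a + b -> Rabs (F w) <= M) ->
  forall w, W <= w -> Rabs (F w) <= M + 2 * M * ((w - W) / a).
Proof.
  intros Ha Hb HF HM. set (phi := fun w => F w - F (w + a)).
  assert (HM0 : 0 <= M) by (eapply Rle_trans; [apply Rabs_pos|apply (HM W); lra]).
  assert (Hphi : forall n w, W <= w <= W + (INR n + 1) * b -> Rabs (phi w) <= 2 * M).
  { induction n as [|n IH]; intros w Hw.
    - simpl in Hw. unfold phi, Rminus. eapply Rle_trans; [apply Rabs_triang|]. rewrite Rabs_Ropp.
      assert (H1 := HM w ltac:(lra)). assert (H2 := HM (w + a) ltac:(lra)). lra.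
    - destruct (Rle_dec (W + b) w) as [H|H].
      + replace (phi w) with (phi (w - b)).
        * apply IH. rewrite S_INR in Hw. lra.
        * assert (H1 := HF (w - b) ltac:(lra)). unfold DD in H1. unfold phi.
          replace (w - b + b) with w in H1 by ring. replace (w - b + a + b) with (w + a) in H1 by ring. lra.
      + apply IH. assert (0 <= INR n * b) by (apply Rmult_le_pos; [apply pos_INR|lra]). lra. }
  assert (Hphi2 : forall w, W <= w -> Rabs (phi w) <= 2 * M).
  { intros w Hw. destruct (INR_unbounded ((w - W) / b)) as [n Hn]. apply (Hphi n). split; [exact Hw|].
    assert (w - W <= INR n * b); [|lra]. apply (Rmult_le_reg_r (/ b)); [now apply Rinv_0_lt_compat|].
    rewrite Rmult_assoc, Rinv_r by lra. unfold Rdiv in Hn. lra. }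
  assert (HFn : forall n w, W <= w <= W + (INR n + 1) * a -> Rabs (F w) <= M + 2 * M * ((w - W) / a)).
  { induction n as [|n IH]; intros w Hw.
    - assert (H1 := HM w ltac:(simpl in Hw; lra)). assert (0 <= 2 * M * ((w - W) / a)); [|lra].
      apply Rmult_le_pos; [lra|]. apply Rdiv_le_0_compat; lra.
    - destruct (Rle_dec (W + a) w) as [H|H].
      + replace (F w) with (F (w - a) - phi (w - a)).
        2:{ unfold phi. replace (w - a + a) with w by ring. ring. }
        unfold Rminus at 1. eapply Rle_trans; [apply Rabs_triang|]. rewrite Rabs_Ropp.
        rewrite S_INR in Hw. assert (H1 := IH (w - a) ltac:(lra)). assert (H2 := Hphi2 (w - a) ltac:(lra)).
        replace ((w - a - W) / a) with ((w - W) / a - 1) in H1 by (field; lra). lra.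
      + assert (H1 := HM w ltac:(lra)). assert (0 <= 2 * M * ((w - W) / a)); [|lra].
        apply Rmult_le_pos; [lra|]. apply Rdiv_le_0_compat; lra. }
  intros w Hw. destruct (INR_unbounded ((w - W) / a)) as [n Hn]. apply (HFn n). split; [exact Hw|].
  assert (w - W <= INR n * a); [|lra]. apply (Rmult_le_reg_r (/ a)); [now apply Rinv_0_lt_compat|].
  rewrite Rmult_assoc, Rinv_r by lra. unfold Rdiv in Hn. lra.
Qed.

(** In the form [F w = F (w + a) + F (w + b) - F (w + a + b)] the equation moves a bound to the left
    by [m] at the price of a factor 3. It takes care of the small [lam], for which (i) still has to
    be bounded. *)
Lemma DD_backward_bound a b m F W M : 0 < m -> m <= a -> m <= b ->
  (forall w, DD a b F w = 0) -> (forall w, W <= w <= W + a + b -> Rabs (F w) <= M) ->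
  forall n w, W - INR n * m <= w <= W + a + b -> Rabs (F w) <= 3 ^ n * M.
Proof.
  intros Hm Ha Hb HF HM. assert (HM0 : 0 <= M) by (eapply Rle_trans; [apply Rabs_pos|apply (HM W); lra]).
  induction n as [|n IH]; intros w Hw.
  - simpl in *. assert (H := HM w). lra.
  - rewrite S_INR in Hw. assert (0 <= INR n * m) by (apply Rmult_le_pos; [apply pos_INR|lra]).
    assert (P : 0 <= 3 ^ n * M) by (apply Rmult_le_pos; [apply pow_le; lra|exact HM0]).
    destruct (Rle_dec (W - INR n * m) w) as [Hc|Hc].
    + assert (H1 := IH w ltac:(lra)). simpl. lra.
    + assert (E := HF w). unfold DD in E. replace (F w) with (F (w + a) + F (w + b) - F (w + a + b)) by lra.
      assert (H1 := IH (w + a) ltac:(lra)). assert (H2 := IH (w + b) ltac:(lra)). assert (H3 := IH (w + a + b) ltac:(lra)).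
      unfold Rminus. eapply Rle_trans; [apply Rabs_triang|]. rewrite Rabs_Ropp.
      assert (H4 := Rabs_triang (F (w + a)) (F (w + b))). simpl. lra.
Qed.

(** * The Riesz mean as a function of [w = lam - sigma a - tau b] *)

Definition pp (g y : R) : R := nneg_pow (pos_part y) g.

Lemma pp_neg g y : y <= 0 -> pp g y = 0.
Proof.
  intros H. unfold pp, nneg_pow, pos_part. rewrite Rabs_left1 by exact H.
  destruct (Req_EM_T _ 0) as [E|E]; [reflexivity|]. exfalso; apply E; lra.
Qed.

Lemma pp_pos g y : 0 < y -> pp g y = Rpower y g.
Proof.
  intros H. unfold pp, nneg_pow, pos_part. rewrite Rabs_pos_eq by lra.
  destruct (Req_EM_T _ 0) as [E|E]; [exfalso; lra|]. f_equal. lra.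
Qed.

Lemma pp_nonneg g y : 0 <= pp g y.
Proof. destruct (Rle_dec y 0) as [H|H]; [rewrite pp_neg by lra; lra|]. rewrite pp_pos by lra. left; apply Rpower_pos. Qed.

Lemma pp_le g y z : 0 < g -> y <= z -> pp g y <= pp g z.
Proof.
  intros Hg H. destruct (Rle_dec y 0) as [Hy|Hy]; [rewrite pp_neg by lra; apply pp_nonneg|].
  rewrite !pp_pos by lra. apply Rle_Rpower_l; lra.
Qed.

Lemma is_series_finite (u : nat -> R) n : (forall k, (n <= k)%nat -> u k = 0) -> is_series u (rsum u n).
Proof.
  intros H. change (is_lim_seq (sum_n u) (rsum u n)).
  apply (is_lim_seq_ext_loc (fun _ => rsum u n)); [|apply is_lim_seq_const].
  exists n. intros m Hm. rewrite sum_n_rsum. replace (S m) with (n + (S m - n))%nat by lia.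
  rewrite rsum_add, (rsum_ext (fun k => u (n + k)%nat) (fun _ => 0)).
  - rewrite rsum_zero. symmetry. apply Rplus_0_r.
  - intros k _. apply H. lia.
Qed.

Lemma Series_finite (u : nat -> R) n : (forall k, (n <= k)%nat -> u k = 0) -> Series u = rsum u n.
Proof. intros H. apply is_series_unique. now apply is_series_finite. Qed.

Definition Rrow (g b y : R) : R := Series (fun k => pp g (y - INR (S k) * b)).

Definition Rdbl (g a b w : R) : R := Series (fun k => Rrow g b (w - INR (S k) * a)).

Lemma steps_exist b y : 0 < b -> exists n, y <= INR n * b.
Proof.
  intros Hb. destruct (INR_unbounded (y / b)) as [n Hn]. exists n.
  apply (Rmult_le_reg_r (/ b)); [now apply Rinv_0_lt_compat|]. rewrite Rmult_assoc, Rinv_r by lra.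
  unfold Rdiv in Hn. lra.
Qed.

Lemma INR_mono_b n k b : 0 < b -> (n <= k)%nat -> INR n * b <= INR k * b.
Proof. intros Hb H. apply Rmult_le_compat_r; [lra|]. now apply le_INR. Qed.

Lemma Rrow_finite g b y n : 0 < b -> y <= INR n * b -> Rrow g b y = rsum (fun k => pp g (y - INR (S k) * b)) n.
Proof.
  intros Hb Hn. apply Series_finite. intros k Hk. apply pp_neg.
  assert (H := INR_mono_b n k b Hb Hk). rewrite S_INR. lra.
Qed.

Lemma Rrow_zero g b y : 0 < b -> y <= b -> Rrow g b y = 0.
Proof.
  intros Hb Hy. rewrite (Rrow_finite g b y 1) by (simpl; lra). simpl. rewrite pp_neg by lra. ring.
Qed.

Lemma Rrow_finite_ex g b y : 0 < b -> ex_series (fun k => pp g (y - INR (S k) * b)).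
Proof.
  intros Hb. destruct (steps_exist b y Hb) as [n Hn]. exists (rsum (fun k => pp g (y - INR (S k) * b)) n).
  apply is_series_finite. intros k Hk. apply pp_neg. assert (H := INR_mono_b n k b Hb Hk). rewrite S_INR. lra.
Qed.

Lemma Rrow_step g b y : 0 < b -> Rrow g b (y + b) - Rrow g b y = pp g y.
Proof.
  intros Hb. unfold Rrow. rewrite (Series_incr_1 (fun k => pp g (y + b - INR (S k) * b))) by now apply Rrow_finite_ex.
  rewrite (Series_ext (fun k => pp g (y + b - INR (S (S k)) * b)) (fun k => pp g (y - INR (S k) * b))).
  - simpl INR. replace (y + b - 1 * b) with y by ring. ring.
  - intros k. f_equal. rewrite !S_INR. ring.
Qed.

Lemma Rdbl_finite g a b w n : 0 < a -> 0 < b -> w <= INR n * a -> Rdbl g a b w = rsum (fun k => Rrow g b (w - INR (S k) * a)) n.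
Proof.
  intros Ha Hb Hn. apply Series_finite. intros k Hk. apply Rrow_zero; [exact Hb|].
  assert (H := INR_mono_b n k a Ha Hk). rewrite S_INR. lra.
Qed.

Lemma Rdbl_step g a b w : 0 < a -> 0 < b -> Rdbl g a b (w + a) - Rdbl g a b w = Rrow g b w.
Proof.
  intros Ha Hb. unfold Rdbl. rewrite (Series_incr_1 (fun k => Rrow g b (w + a - INR (S k) * a))).
  - rewrite (Series_ext (fun k => Rrow g b (w + a - INR (S (S k)) * a)) (fun k => Rrow g b (w - INR (S k) * a))).
    + simpl INR. replace (w + a - 1 * a) with w by ring. ring.
    + intros k. f_equal. rewrite !S_INR. ring.
  - destruct (steps_exist a (w + a) Ha) as [n Hn]. exists (rsum (fun k => Rrow g b (w + a - INR (S k) * a)) n).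
    apply is_series_finite. intros k Hk. apply Rrow_zero; [exact Hb|].
    assert (H := INR_mono_b n k a Ha Hk). rewrite S_INR. lra.
Qed.

(** Replacing [w] by [w + a] adds exactly one new row to the double sum, and replacing [w] by
    [w + b] adds exactly one new term to a row. *)
Lemma Rdbl_DD g a b w : 0 < a -> 0 < b -> DD a b (Rdbl g a b) w = pp g w.
Proof.
  intros Ha Hb. unfold DD. assert (H1 := Rdbl_step g a b w Ha Hb). assert (H2 := Rdbl_step g a b (w + b) Ha Hb).
  assert (H3 := Rrow_step g b w Hb). replace (w + b + a) with (w + a + b) in H2 by ring. lra.
Qed.

Lemma Rdbl_zero g a b w : 0 < a -> 0 < b -> w <= a + b -> Rdbl g a b w = 0.
Proof.
  intros Ha Hb Hw. unfold Rdbl. rewrite (Series_finite _ 0); [reflexivity|]. intros k _. apply Rrow_zero; [exact Hb|].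
  rewrite S_INR. assert (0 <= INR k * a) by (apply Rmult_le_pos; [apply pos_INR|lra]). lra.
Qed.

Lemma Rdbl_double g a b w n : 0 < a -> 0 < b -> w <= INR n * a -> w <= INR n * b ->
  Rdbl g a b w = rsum (fun k => rsum (fun l => pp g (w - INR (S k) * a - INR (S l) * b)) n) n.
Proof.
  intros Ha Hb H1 H2. rewrite (Rdbl_finite g a b w n) by assumption. apply rsum_ext. intros k Hk.
  apply Rrow_finite; [exact Hb|]. assert (0 <= INR (S k) * a) by (apply Rmult_le_pos; [apply pos_INR|lra]). lra.
Qed.

Lemma Rdbl_bound g a b w n : 0 < g -> 0 < a -> 0 < b -> w <= INR n * a -> w <= INR n * b ->
  Rabs (Rdbl g a b w) <= INR n * (INR n * pp g w).
Proof.
  intros Hg Ha Hb H1 H2. rewrite (Rdbl_double g a b w n) by assumption.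
  apply rsum_bound. intros k _. apply rsum_bound. intros l _. rewrite Rabs_pos_eq by apply pp_nonneg.
  apply pp_le; [exact Hg|]. assert (0 <= INR (S k) * a) by (apply Rmult_le_pos; [apply pos_INR|lra]).
  assert (0 <= INR (S l) * b) by (apply Rmult_le_pos; [apply pos_INR|lra]). lra.
Qed.

Lemma riesz_mean_Rdbl g sigma tau beta lam : 0 < beta ->
  riesz_mean g sigma tau beta lam = Rdbl g (sqrt beta) (/ sqrt beta) (lam - sigma * sqrt beta - tau / sqrt beta).
Proof.
  intros Hb. assert (Hs := sqrt_lt_R0 beta Hb). unfold riesz_mean, Rdbl, Rrow.
  apply Series_ext. intros k. apply Series_ext. intros l. unfold pp. f_equal. f_equal. field. lra.
Qed.

(** * Complex power series *)

Definition cconv (s : nat -> C) (l : C) : Prop :=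
  forall eps, 0 < eps -> exists N, forall n, (N <= n)%nat -> Cmod (s n - l)%C < eps.

Lemma cconv_const l : cconv (fun _ => l) l.
Proof. intros eps He. exists O. intros n _. replace (l - l)%C with (RtoC 0) by ring. now rewrite Cmod_0. Qed.

Lemma cconv_ext s t l : (forall n, s n = t n) -> cconv s l -> cconv t l.
Proof. intros E H eps He. destruct (H eps He) as [N HN]. exists N. intros n Hn. rewrite <- E. now apply HN. Qed.

Lemma cconv_plus s t l m : cconv s l -> cconv t m -> cconv (fun n => s n + t n)%C (l + m)%C.
Proof.
  intros H1 H2 eps He. destruct (H1 (eps / 2)) as [N1 HN1]; [lra|]. destruct (H2 (eps / 2)) as [N2 HN2]; [lra|].
  exists (Nat.max N1 N2). intros n Hn. specialize (HN1 n ltac:(lia)). specialize (HN2 n ltac:(lia)).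
  replace (s n + t n - (l + m))%C with ((s n - l) + (t n - m))%C by ring.
  eapply Rle_lt_trans; [apply Cmod_triangle|lra].
Qed.

Lemma cconv_scal c s l : cconv s l -> cconv (fun n => c * s n)%C (c * l)%C.
Proof.
  intros H eps He. assert (Hc := Cmod_ge_0 c).
  destruct (H (eps / (Cmod c + 1))) as [N HN]; [apply Rdiv_lt_0_compat; lra|].
  exists N. intros n Hn. replace (c * s n - c * l)%C with (c * (s n - l))%C by ring. rewrite Cmod_mult.
  specialize (HN n Hn). assert (H0 := Cmod_ge_0 (s n - l)%C).
  apply Rle_lt_trans with ((Cmod c + 1) * Cmod (s n - l)%C); [nra|].
  apply (Rmult_lt_reg_r (/ (Cmod c + 1))); [apply Rinv_0_lt_compat; lra|].
  replace ((Cmod c + 1) * Cmod (s n - l)%C * / (Cmod c + 1)) with (Cmod (s n - l)%C) by (field; lra). exact HN.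
Qed.

Lemma cconv_minus s t l m : cconv s l -> cconv t m -> cconv (fun n => s n - t n)%C (l - m)%C.
Proof.
  intros H1 H2. apply (cconv_ext (fun n => s n + (- RtoC 1) * t n)%C); [intros; ring|].
  replace (l - m)%C with (l + (- RtoC 1) * m)%C by ring. apply cconv_plus; [exact H1|now apply cconv_scal].
Qed.

Lemma cconv_unique s l m : cconv s l -> cconv s m -> l = m.
Proof.
  intros H1 H2. assert (E : (l - m)%C = RtoC 0).
  { apply Cmod_eq_0. assert (H0 := Cmod_ge_0 (l - m)%C). destruct H0 as [H0|H0]; [exfalso|now rewrite <- H0].
    destruct (H1 (Cmod (l - m)%C / 2)) as [N1 HN1]; [lra|]. destruct (H2 (Cmod (l - m)%C / 2)) as [N2 HN2]; [lra|].
    specialize (HN1 (Nat.max N1 N2) ltac:(lia)). specialize (HN2 (Nat.max N1 N2) ltac:(lia)).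
    set (n := Nat.max N1 N2) in *.
    assert (T : Cmod (l - m)%C <= Cmod (s n - l)%C + Cmod (s n - m)%C).
    { replace (l - m)%C with (- (s n - l) + (s n - m))%C by ring.
      eapply Rle_trans; [apply Cmod_triangle|]. rewrite Cmod_opp. lra. }
    lra. }
  replace l with (l - m + m)%C by ring. rewrite E. ring.
Qed.

Lemma cconv_bound s l M : (exists N0, forall n, (N0 <= n)%nat -> Cmod (s n) <= M) -> cconv s l -> Cmod l <= M.
Proof.
  intros [N0 H0] H. apply le_epsilon. intros eps He. destruct (H eps He) as [N HN].
  specialize (HN (Nat.max N N0) ltac:(lia)). specialize (H0 (Nat.max N N0) ltac:(lia)).
  replace l with (- (s (Nat.max N N0) - l) + s (Nat.max N N0))%C by ring.
  eapply Rle_trans; [apply Cmod_triangle|]. rewrite Cmod_opp. lra.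
Qed.

Lemma cconv_S s l : cconv s l <-> cconv (fun n => s (S n)) l.
Proof.
  split; intros H eps He; destruct (H eps He) as [N HN].
  - exists N. intros n Hn. apply HN. lia.
  - exists (S N). intros n Hn. destruct n as [|n]; [lia|]. apply HN. lia.
Qed.

Lemma cconv_csum (s : nat -> nat -> C) (l : nat -> C) n : (forall k, (k < n)%nat -> cconv (s k) (l k)) ->
  cconv (fun m => csum (fun k => s k m) n) (csum l n).
Proof.
  induction n as [|n IH]; intros H; simpl; [apply cconv_const|].
  apply cconv_plus; [apply IH; intros; apply H; lia|apply H; lia].
Qed.

Lemma cconv_Re s l : cconv s l -> is_lim_seq (fun n => Re (s n)) (Re l).
Proof.
  intros H. apply is_lim_seq_spec. intros eps. destruct (H eps (cond_pos eps)) as [N HN].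
  exists N. intros n Hn. eapply Rle_lt_trans; [|apply HN, Hn].
  change (Re (s n) - Re l) with (Re (s n - l)%C). apply re_le_Cmod.
Qed.

Lemma is_series_cconv (u : nat -> C) l :
  is_series (K := C_AbsRing) (V := C_NormedModule) u l <-> cconv (csum u) l.
Proof.
  rewrite (cconv_S (csum u)). unfold is_series. split.
  - intros H eps He. apply (proj1 (filterlim_locally_ball_norm (K := C_AbsRing) (U := C_NormedModule) _ _)) with (eps := mkposreal eps He) in H.
    destruct H as [N HN]. exists N. intros n Hn. specialize (HN n Hn). unfold ball_norm in HN. simpl in HN.
    rewrite <- sum_n_csum. exact HN.
  - intros H. apply (filterlim_locally_ball_norm (K := C_AbsRing) (U := C_NormedModule)). intros eps.
    destruct (H eps (cond_pos eps)) as [N HN]. exists N. intros n Hn. specialize (HN n Hn).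
    rewrite <- sum_n_csum in HN. exact HN.
Qed.

Definition cpser (c : nat -> C) (y l : C) : Prop := cconv (csum (fun k => c k * y ^ k)%C) l.

Lemma is_pseries_cpser c y l : is_pseries (K := C_AbsRing) (V := C_NormedModule) c y l <-> cpser c y l.
Proof.
  unfold is_pseries, cpser. rewrite is_series_cconv.
  assert (E : forall n, csum (fun k => scal (pow_n (K := C_Ring) y k) (c k)) n = csum (fun k => c k * y ^ k)%C n).
  { intros n. apply csum_ext. intros k _.
    replace (pow_n (K := C_Ring) y k) with (y ^ k)%C.
    - change (y ^ k * c k = c k * y ^ k)%C. ring.
    - induction k as [|k IH]; [reflexivity|]. simpl. rewrite IH. reflexivity. }
  split; apply cconv_ext; intros; [|symmetry]; apply E.
Qed.

Definition CSeries (u : nat -> C) : C := (Series (fun n => Re (u n)), Series (fun n => Im (u n))).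

Lemma is_series_eps (u : nat -> R) l eps : is_series u l -> 0 < eps -> exists N, forall n, (N <= n)%nat -> Rabs (rsum u n - l) < eps.
Proof.
  intros H He. assert (H' := proj2 (is_lim_seq_spec (sum_n u) l) H (mkposreal eps He)). destruct H' as [N HN]. exists (S N). intros n Hn.
  destruct n as [|n]; [lia|]. rewrite <- sum_n_rsum. apply HN. lia.
Qed.

Lemma CSeries_conv (u : nat -> C) (v : nat -> R) M : (forall n, Cmod (u n) <= v n) -> (forall n, rsum v n <= M) ->
  cconv (csum u) (CSeries u).
Proof.
  intros H1 H2 eps He.
  destruct (series_dom v (fun n => Re (u n)) M) as [A _]; [intros n; eapply Rle_trans; [apply re_le_Cmod|apply H1]|exact H2|].
  destruct (series_dom v (fun n => Im (u n)) M) as [B _]; [intros n; eapply Rle_trans; [apply Im_le_Cmod|apply H1]|exact H2|].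
  destruct (is_series_eps _ _ (eps / 2) (Series_correct _ A) ltac:(lra)) as [N1 HN1].
  destruct (is_series_eps _ _ (eps / 2) (Series_correct _ B) ltac:(lra)) as [N2 HN2].
  exists (Nat.max N1 N2). intros n Hn. specialize (HN1 n ltac:(lia)). specialize (HN2 n ltac:(lia)).
  eapply Rle_lt_trans; [apply Cmod_le_Re_Im|].
  change (Re (csum u n - CSeries u)%C) with (Re (csum u n) - Series (fun n => Re (u n))).
  change (Im (csum u n - CSeries u)%C) with (Im (csum u n) - Series (fun n => Im (u n))).
  rewrite csum_Re, csum_Im. lra.
Qed.

Lemma csum_minus_tail u n m : (n <= m)%nat -> (csum u m - csum u n = csum (fun k => u (n + k)%nat) (m - n))%C.
Proof. intros H. replace m with (n + (m - n))%nat at 1 by lia. rewrite csum_add. ring. Qed.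

Lemma tail_bound (v : nat -> R) M eps : (forall n, 0 <= v n) -> (forall n, rsum v n <= M) -> 0 < eps ->
  exists N, forall m, rsum (fun k => v (N + k)%nat) m <= eps.
Proof.
  intros H0 H1 He.
  destruct (series_dom v v M) as [A _]; [intros n; rewrite Rabs_pos_eq by apply H0; lra|exact H1|].
  destruct (is_series_eps _ _ (eps / 2) (Series_correct _ A) ltac:(lra)) as [N HN].
  exists N. intros m. assert (T1 := HN N (le_n _)). assert (T2 := HN (N + m)%nat ltac:(lia)).
  rewrite rsum_add in T2. apply Rabs_lt_between in T1. apply Rabs_lt_between in T2. lra.
Qed.

Lemma cpser_coef_bound c y l : cpser c y l -> exists A, 0 <= A /\ forall k, Cmod (c k) * Cmod y ^ k <= A.
Proof.
  intros H. destruct (H 1 ltac:(lra)) as [N HN].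
  assert (HB : forall k, (N <= k)%nat -> Cmod (c k) * Cmod y ^ k <= 2).
  { intros k Hk. rewrite <- Cmod_pow, <- Cmod_mult. assert (T1 := HN k Hk). assert (T2 := HN (S k) ltac:(lia)). simpl csum in T2.
    set (S0 := csum (fun k => c k * y ^ k)%C k) in *.
    replace (c k * y ^ k)%C with ((S0 + c k * y ^ k - l) + - (S0 - l))%C by ring.
    eapply Rle_trans; [apply Cmod_triangle|]. rewrite Cmod_opp. lra. }
  exists (2 + rsum (fun k => Cmod (c k) * Cmod y ^ k) N).
  assert (P : forall k, 0 <= Cmod (c k) * Cmod y ^ k) by (intros; apply Rmult_le_pos; [apply Cmod_ge_0|apply pow_le, Cmod_ge_0]).
  assert (P2 : 0 <= rsum (fun k => Cmod (c k) * Cmod y ^ k) N) by (apply rsum_nonneg; intros; apply P).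
  split; [lra|]. intros k. destruct (Nat.lt_ge_cases k N) as [Hk|Hk].
  - assert (T := rsum_ge_term (fun k => Cmod (c k) * Cmod y ^ k) N k ltac:(intros; apply P) Hk). cbv beta in T. lra.
  - specialize (HB k Hk). lra.
Qed.

Lemma rsum_geom x n : x <> 1 -> rsum (fun k => x ^ k) n = (1 - x ^ n) / (1 - x).
Proof. intros Hx. induction n as [|n IH]; simpl; [field; lra|]. rewrite IH. field. lra. Qed.

Lemma rsum_geom_le x n : 0 <= x < 1 -> rsum (fun k => x ^ k) n <= / (1 - x).
Proof.
  intros Hx. rewrite rsum_geom by lra. unfold Rdiv. rewrite <- (Rmult_1_l (/ (1 - x))) at 2.
  apply Rmult_le_compat_r; [left; apply Rinv_0_lt_compat; lra|]. assert (0 <= x ^ n) by (apply pow_le; lra). lra.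
Qed.

Definition Eit (t : R) : C := (cos t, sin t).

Lemma Eit_plus s t : Eit (s + t) = (Eit s * Eit t)%C.
Proof. unfold Eit, Cmult; simpl. rewrite cos_plus, sin_plus. f_equal; ring. Qed.

Lemma Eit_0 : Eit 0 = RtoC 1.
Proof. unfold Eit. now rewrite cos_0, sin_0. Qed.

Lemma Cmod_Eit t : Cmod (Eit t) = 1.
Proof.
  unfold Cmod, Eit; simpl. replace (_ + _) with 1; [apply sqrt_1|].
  assert (H := sin2_cos2 t). unfold Rsqr in H. lra.
Qed.

Lemma Eit_pow t n : (Eit t ^ n)%C = Eit (INR n * t).
Proof.
  induction n as [|n IH]; [simpl; now rewrite Rmult_0_l, Eit_0|].
  rewrite Cpow_S, IH, <- Eit_plus, S_INR. f_equal. ring.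
Qed.

Lemma cos_eq_1 t : cos t = 1 -> exists k : Z, t = 2 * PI * IZR k.
Proof.
  intros H. assert (Hs : sin (t / 2) = 0).
  { assert (E : cos t = 1 - 2 * sin (t / 2) * sin (t / 2)).
    { replace t with (2 * (t / 2)) at 1 by field. apply cos_2a_sin. }
    nra. }
  apply sin_eq_0_0 in Hs. destruct Hs as [k Hk]. exists k. lra.
Qed.

Lemma Eit_root_ne1 N d : (0 < d < Z.of_nat N)%Z -> Eit (2 * PI * IZR d / INR N) <> RtoC 1.
Proof.
  intros Hd H. apply (f_equal Re) in H. simpl in H.
  assert (HN : 0 < INR N) by (apply lt_0_INR; lia).
  apply cos_eq_1 in H. destruct H as [k Hk].
  assert (HPI := PI_RGT_0).
  assert (E : IZR d = IZR k * INR N).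
  { apply (Rmult_eq_reg_l (2 * PI / INR N)); [|apply Rgt_not_eq; apply Rdiv_lt_0_compat; lra].
    replace (2 * PI / INR N * IZR d) with (2 * PI * IZR d / INR N) by (field; lra). rewrite Hk. field. lra. }
  rewrite INR_IZR_INZ, <- mult_IZR in E. apply eq_IZR in E.
  destruct (Z_le_dec k 0) as [Hk0|Hk0].
  - assert (k * Z.of_nat N <= 0)%Z by (apply Z.mul_nonpos_nonneg; lia). lia.
  - assert (1 * Z.of_nat N <= k * Z.of_nat N)%Z by (apply Z.mul_le_mono_nonneg_r; lia). lia.
Qed.

Lemma csum_geom_root x N : (x ^ N)%C = RtoC 1 -> x <> RtoC 1 -> csum (fun j => x ^ j)%C N = RtoC 0.
Proof.
  intros H1 H2. assert (E : forall n, ((x - RtoC 1) * csum (fun j => x ^ j) n = x ^ n - RtoC 1)%C).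
  { induction n as [|n IH]; simpl; [ring|]. rewrite Cmult_plus_distr_l, IH. ring. }
  specialize (E N). rewrite H1 in E.
  destruct (Ceq_dec (csum (fun j => x ^ j)%C N) (RtoC 0)) as [E0|E0]; [exact E0|exfalso].
  assert (Hx : (x - RtoC 1)%C <> RtoC 0). { intros Hx. apply H2. replace x with (x - RtoC 1 + RtoC 1)%C by ring. rewrite Hx. ring. }
  apply (Cmult_neq_0 _ _ Hx E0). rewrite E. ring.
Qed.

(* Cauchy's estimate, by averaging over the [N]-th roots of unity for large [N]. *)
Lemma cauchy_estimate c f rho M : 0 < rho -> (forall y, Cmod y <= 2 * rho -> cpser c y (f y)) ->
  (forall y, Cmod y <= rho -> Cmod (f y) <= M) -> forall k, Cmod (c k) * rho ^ k <= M.
Proof.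
  intros Hr Hf HM k.
  destruct (cpser_coef_bound c (RtoC (2 * rho)) (f (RtoC (2 * rho)))) as [A [HA0 HA]].
  { apply Hf. rewrite Cmod_R, Rabs_pos_eq; lra. }
  rewrite Cmod_R, Rabs_pos_eq in HA by lra.
  (* For the polynomials [p N] the average over roots of unity is exact. They approximate [f] on the
     disc of radius [rho] at the rate [2^(-N)], because the series still converges at [2 rho]. *)
  set (p := fun N y => csum (fun i => c i * y ^ i)%C N).
  assert (Hp : forall N y, Cmod y <= rho -> Cmod (p N y) <= M + A * 2 * (/ 2) ^ N).
  { intros N y Hy.
    assert (T : Cmod (f y - p N y)%C <= A * 2 * (/ 2) ^ N).
    { apply (cconv_bound (fun m => csum (fun i => c i * y ^ i) m - p N y)%C).
      - exists N. intros m Hm. unfold p. rewrite csum_minus_tail by exact Hm.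
        eapply Rle_trans; [apply csum_abs|].
        apply Rle_trans with (rsum (fun j => A * (/ 2) ^ N * (/ 2) ^ j) (m - N)).
        + apply rsum_le. intros j _. rewrite Cmod_mult, Cmod_pow. specialize (HA (N + j)%nat).
          rewrite Rmult_assoc, <- pow_add.
          assert (E : Cmod y ^ (N + j) <= (2 * rho) ^ (N + j) * (/ 2) ^ (N + j)).
          { rewrite <- Rpow_mult_distr. replace (2 * rho * / 2) with rho by field. apply pow_incr. split; [apply Cmod_ge_0|exact Hy]. }
          assert (P2 : 0 <= (/ 2) ^ (N + j)) by (apply pow_le; lra).
          eapply Rle_trans; [apply Rmult_le_compat_l; [apply Cmod_ge_0|exact E]|].
          rewrite <- Rmult_assoc. now apply Rmult_le_compat_r.
        + rewrite rsum_scal. assert (P2 : 0 <= A * (/ 2) ^ N) by (apply Rmult_le_pos; [exact HA0|apply pow_le; lra]).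
          assert (G := rsum_geom_le (/ 2) (m - N) ltac:(lra)). replace (/ (1 - / 2)) with 2 in G by field.
          apply Rle_trans with (A * (/ 2) ^ N * 2); [now apply Rmult_le_compat_l|right; ring].
      - apply cconv_minus; [apply Hf; lra|apply cconv_const]. }
    replace (p N y) with (f y + - (f y - p N y))%C by ring.
    eapply Rle_trans; [apply Cmod_triangle|]. rewrite Cmod_opp. assert (H1 := HM y Hy). lra. }
  assert (Hk : forall N, (k < N)%nat -> Cmod (c k) * rho ^ k <= M + A * 2 * (/ 2) ^ N).
  { intros N HN. assert (HN0 : 0 < INR N) by (apply lt_0_INR; lia).
    set (x := fun j : nat => Eit (2 * PI * INR j / INR N)).
    (* Orthogonality of the characters of the cyclic group of order [N]: of all [i < N] only [i = k]
       survives. *)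
    assert (E : csum (fun j => p N (RtoC rho * x j) * Eit (- (2 * PI * INR j / INR N) * INR k))%C N = (RtoC (INR N) * (c k * RtoC rho ^ k))%C).
    { unfold p.
      rewrite (csum_ext _ (fun j => csum (fun i => (c i * RtoC rho ^ i) * Eit (2 * PI * IZR (Z.of_nat i - Z.of_nat k) / INR N) ^ j)%C N)).
      2:{ intros j _. rewrite Cmult_comm, <- csum_scal. apply csum_ext. intros i _.
          rewrite Cpow_mult_l. unfold x. rewrite !Eit_pow.
          replace (INR j * (2 * PI * IZR (Z.of_nat i - Z.of_nat k) / INR N)) with (INR i * (2 * PI * INR j / INR N) + - (2 * PI * INR j / INR N) * INR k).
          - rewrite Eit_plus. ring.
          - rewrite minus_IZR, <- !INR_IZR_INZ. field. lra. }
      rewrite csum_exchange.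
      rewrite (csum_ext _ (fun i => if Nat.eqb i k then RtoC (INR N) * (c k * RtoC rho ^ k) else RtoC 0)%C).
      - assert (G : forall m, (k < m)%nat -> csum (fun i => if Nat.eqb i k then RtoC (INR N) * (c k * RtoC rho ^ k) else RtoC 0)%C m = (RtoC (INR N) * (c k * RtoC rho ^ k))%C).
        { clear. intros m. induction m as [|m IH]; intros H; [lia|]. simpl. destruct (Nat.eqb_spec m k) as [->|Hmk].
          - rewrite (csum_ext _ (fun _ => RtoC 0)); [rewrite csum_zero; ring|]. intros i Hi.
            destruct (Nat.eqb_spec i k); [lia|reflexivity].
          - rewrite IH by lia. ring. }
        now apply G.
      - intros i Hi. rewrite csum_scal. destruct (Nat.eqb_spec i k) as [->|Hik].
        + rewrite Z.sub_diag. replace (2 * PI * 0 / INR N) with 0 by (field; lra). rewrite Eit_0.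
          rewrite (csum_ext _ (fun _ => RtoC 1)) by (intros; apply Cpow_1_l).
          replace (csum (fun _ => RtoC 1) N) with (RtoC (INR N)); [ring|].
          clear. induction N as [|N IH]; [reflexivity|]. rewrite S_INR. simpl csum. rewrite <- IH, RtoC_plus. reflexivity.
        + rewrite csum_geom_root; [ring| |].
          * rewrite Eit_pow. replace (INR N * (2 * PI * IZR (Z.of_nat i - Z.of_nat k) / INR N)) with (0 + 2 * IZR (Z.of_nat i - Z.of_nat k) * PI) by (field; lra).
            unfold Eit. destruct (Z_le_dec 0 (Z.of_nat i - Z.of_nat k)) as [Hz|Hz].
            -- rewrite <- (Z2Nat.id _ Hz), <- INR_IZR_INZ, cos_period, sin_period, cos_0, sin_0. reflexivity.
            -- set (q := Z.to_nat (Z.of_nat k - Z.of_nat i)).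
               replace (IZR (Z.of_nat i - Z.of_nat k)) with (- INR q).
               2:{ unfold q. rewrite INR_IZR_INZ, Z2Nat.id, <- opp_IZR by lia. f_equal. lia. }
               replace (0 + 2 * - INR q * PI) with (- (0 + 2 * INR q * PI)) by ring.
               rewrite cos_neg, sin_neg, cos_period, sin_period, cos_0, sin_0. unfold RtoC. f_equal. ring.
          * destruct (Z_lt_dec 0 (Z.of_nat i - Z.of_nat k)) as [Hz|Hz].
            -- apply Eit_root_ne1. lia.
            -- intros H. apply (Eit_root_ne1 N (Z.of_nat k - Z.of_nat i)); [lia|].
               replace (IZR (Z.of_nat i - Z.of_nat k)) with (- IZR (Z.of_nat k - Z.of_nat i)) in H by (rewrite <- opp_IZR; f_equal; lia).
               replace (2 * PI * - IZR (Z.of_nat k - Z.of_nat i) / INR N) with (- (2 * PI * IZR (Z.of_nat k - Z.of_nat i) / INR N)) in H by (field; lra).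
               unfold Eit in *. rewrite cos_neg, sin_neg in H. injection H as H1 H2. unfold RtoC. f_equal; lra. }
    assert (B : Cmod (RtoC (INR N) * (c k * RtoC rho ^ k))%C <= INR N * (M + A * 2 * (/ 2) ^ N)).
    { rewrite <- E. eapply Rle_trans; [apply csum_abs|]. rewrite <- rsum_const. apply rsum_le. intros j _.
      rewrite Cmod_mult, Cmod_Eit, Rmult_1_r. apply Hp. rewrite Cmod_mult, Cmod_R, Rabs_pos_eq by lra. unfold x.
      rewrite Cmod_Eit. lra. }
    rewrite !Cmod_mult, Cmod_pow, !Cmod_R, !Rabs_pos_eq in B by lra.
    now apply Rmult_le_reg_l in B. }
  apply le_epsilon. intros eps He.
  destruct (pow_lt_1_zero (/ 2) ltac:(rewrite Rabs_pos_eq; lra) (eps / (A * 2 + 1)) ltac:(apply Rdiv_lt_0_compat; lra)) as [N HN].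
  set (n := Nat.max N (S k)). specialize (HN n ltac:(lia)). specialize (Hk n ltac:(lia)).
  rewrite Rabs_pos_eq in HN by (apply pow_le; lra).
  assert (P : (A * 2 + 1) * (/ 2) ^ n <= eps).
  { apply (Rmult_le_reg_r (/ (A * 2 + 1))); [apply Rinv_0_lt_compat; lra|].
    replace ((A * 2 + 1) * (/ 2) ^ n * / (A * 2 + 1)) with ((/ 2) ^ n) by (field; lra). unfold Rdiv in HN. lra. }
  assert (0 <= (/ 2) ^ n) by (apply pow_le; lra). lra.
Qed.

(** Cauchy's estimate turns the bound [M n] on the disc into bounds for the coefficients, with the
    sum [T] preserved; hence the coefficients may be summed over [n], and tails are controlled by a
    geometric series in [Cmod y / rho]. The summands have expansions everywhere, so that Cauchy's
    estimate is available with radius [rho]. *)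
Lemma weierstrass (e : nat -> C -> C) (cf : nat -> nat -> C) (M : nat -> R) T rho (F : C -> C) : 0 < rho ->
  (forall n y, cpser (cf n) y (e n y)) -> (forall n y, Cmod y <= rho -> Cmod (e n y) <= M n) ->
  (forall n, rsum M n <= T) -> (forall y, Cmod y <= rho -> cconv (csum (fun n => e n y)) (F y)) ->
  exists c, forall y, Cmod y < rho -> cpser c y (F y).
Proof.
  intros Hr He HM HT HF.
  assert (HM0 : forall n, 0 <= M n) by (intros n; eapply Rle_trans; [apply Cmod_ge_0|apply (HM n (RtoC 0)); rewrite Cmod_0; lra]).
  assert (HC : forall n k, Cmod (cf n k) * rho ^ k <= M n).
  { intros n k. apply (cauchy_estimate (cf n) (e n) rho (M n) Hr); [intros; apply He|intros; now apply HM]. }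
  assert (Hrk : forall k, 0 < rho ^ k) by (intros; now apply pow_lt).
  assert (HC2 : forall n k, Cmod (cf n k) <= M n * / rho ^ k).
  { intros n k. apply (Rmult_le_reg_r (rho ^ k)); [apply Hrk|]. rewrite Rmult_assoc, Rinv_l, Rmult_1_r; [apply HC|]. apply Rgt_not_eq, Hrk. }
  set (c := fun k => CSeries (fun n => cf n k)).
  assert (Hc : forall k, cconv (csum (fun n => cf n k)) (c k)).
  { intros k. apply (CSeries_conv _ (fun n => M n * / rho ^ k) (T * / rho ^ k)); [intros; apply HC2|].
    intros n. rewrite (rsum_ext _ (fun n => / rho ^ k * M n)) by (intros; ring). rewrite rsum_scal, Rmult_comm.
    apply Rmult_le_compat_r; [left; apply Rinv_0_lt_compat, Hrk|apply HT]. }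
  exists c. intros y Hy eps Heps.
  set (th := Cmod y / rho). assert (Hth : 0 <= th < 1).
  { unfold th. split; [apply Rdiv_le_0_compat; [apply Cmod_ge_0|lra]|]. apply (Rmult_lt_reg_r rho); [lra|]. unfold Rdiv. rewrite Rmult_assoc, Rinv_l; lra. }
  assert (Hth2 : 0 < / (1 - th)) by (apply Rinv_0_lt_compat; lra).
  (* The tail beyond [N] enters twice, once through the coefficients with the factor [1 / (1 - th)]
     and once through the functions; together this makes [eps / 4]. *)
  set (e1 := eps / 4 / (1 + / (1 - th))). assert (He1 : 0 < e1) by (unfold e1; apply Rdiv_lt_0_compat; lra).
  assert (He1' : e1 * (1 + / (1 - th)) = eps / 4) by (unfold e1; field; lra).
  destruct (tail_bound M T e1 HM0 HT He1) as [N HN].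
  assert (A1 : forall k, Cmod (c k - csum (fun n => cf n k) N)%C <= e1 * / rho ^ k).
  { intros k. apply (cconv_bound (fun m => csum (fun n => cf n k) m - csum (fun n => cf n k) N)%C).
    - exists N. intros m Hm. rewrite csum_minus_tail by exact Hm. eapply Rle_trans; [apply csum_abs|].
      apply Rle_trans with (rsum (fun n => / rho ^ k * M (N + n)%nat) (m - N)).
      + apply rsum_le. intros n _. rewrite Rmult_comm. apply HC2.
      + rewrite rsum_scal, Rmult_comm. apply Rmult_le_compat_r; [left; apply Rinv_0_lt_compat, Hrk|apply HN].
    - apply cconv_minus; [apply Hc|apply cconv_const]. }
  assert (A2 : Cmod (csum (fun n => e n y) N - F y)%C <= e1).
  { replace (csum (fun n => e n y) N - F y)%C with (- (F y - csum (fun n => e n y) N))%C by ring. rewrite Cmod_opp.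
    apply (cconv_bound (fun m => csum (fun n => e n y) m - csum (fun n => e n y) N)%C).
    - exists N. intros m Hm. rewrite csum_minus_tail by exact Hm. eapply Rle_trans; [apply csum_abs|].
      eapply Rle_trans; [|apply (HN (m - N)%nat)]. apply rsum_le. intros n _. apply HM. lra.
    - apply cconv_minus; [apply HF; lra|apply cconv_const]. }
  assert (A3 := cconv_csum (fun n => csum (fun k => cf n k * y ^ k)%C) (fun n => e n y) N (fun n _ => He n y)).
  destruct (A3 (eps / 4) ltac:(lra)) as [K HK]. exists K. intros m Hm. specialize (HK m Hm).
  replace (csum (fun k => c k * y ^ k) m - F y)%C with
    (csum (fun k => (c k - csum (fun n => cf n k) N) * y ^ k) m
     + (csum (fun n => csum (fun k => cf n k * y ^ k) m) N - csum (fun n => e n y) N)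
     + (csum (fun n => e n y) N - F y))%C.
  2:{ rewrite csum_exchange.
      rewrite (csum_ext (fun k => (c k - csum (fun n => cf n k) N) * y ^ k)%C (fun k => c k * y ^ k - csum (fun n => cf n k * y ^ k) N)%C).
      - rewrite csum_minus. ring.
      - intros k _. rewrite (csum_ext (fun n => cf n k * y ^ k)%C (fun n => y ^ k * cf n k)%C) by (intros; ring). rewrite csum_scal. ring. }
  eapply Rle_lt_trans; [apply Cmod_triangle|].
  assert (B1 : Cmod (csum (fun k => (c k - csum (fun n => cf n k) N) * y ^ k)%C m) <= e1 * / (1 - th)).
  { eapply Rle_trans; [apply csum_abs|]. eapply Rle_trans; [|apply Rmult_le_compat_l; [lra|apply (rsum_geom_le th m Hth)]].
    rewrite <- rsum_scal. apply rsum_le. intros k _. rewrite Cmod_mult, Cmod_pow.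
    replace (e1 * th ^ k) with (e1 * / rho ^ k * Cmod y ^ k).
    - apply Rmult_le_compat_r; [apply pow_le, Cmod_ge_0|apply A1].
    - unfold th, Rdiv. rewrite Rpow_mult_distr, pow_inv. ring. }
  assert (B2 := Cmod_triangle (csum (fun k => (c k - csum (fun n => cf n k) N) * y ^ k)%C m)
     (csum (fun n => csum (fun k => cf n k * y ^ k)%C m) N - csum (fun n => e n y) N)%C).
  assert (0 < e1 * / (1 - th)) by (apply Rmult_lt_0_compat; lra). lra.
Qed.

(** Integration of the bound for [f'], as the mean value theorem for
    [M s^(n + 1) / (n + 1) - sg f s] with both signs [sg]. *)
Lemma monomial_comparison (f f' : R -> R) M n u : 0 <= u -> f 0 = 0 ->
  (forall s, 0 <= s <= u -> is_derive f s (f' s) /\ Rabs (f' s) <= M * s ^ n) ->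
  Rabs (f u) <= M * u ^ S n / INR (S n).
Proof.
  intros Hu H0 H. assert (HS : INR (S n) <> 0) by (apply not_0_INR; lia).
  assert (G : forall sg, Rabs sg = 1 -> sg * f u <= M * u ^ S n / INR (S n)).
  { intros sg Hsg.
    destruct (MVT_gen (fun s => M * s ^ S n / INR (S n) - sg * f s) 0 u (fun s => M * s ^ n - sg * f' s)) as [c [Hc E]].
    - intros s Hs. rewrite Rmin_left, Rmax_right in Hs by lra.
      apply (is_derive_minus (fun s => M * s ^ S n / INR (S n)) (fun s => sg * f s)).
      + auto_derive; [exact I|]. change (pred (S n)) with n. change (match n with O => 1 | S _ => INR n + 1 end) with (INR (S n)). simpl pred. field. exact HS.
      + apply is_derive_scal. apply H. lra.
    - intros s Hs. rewrite Rmin_left, Rmax_right in Hs by lra. apply continuity_pt_filterlim.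
      apply (ex_derive_continuous (fun s => M * s ^ S n / INR (S n) - sg * f s)).
      exists (M * s ^ n - sg * f' s). apply (is_derive_minus (fun s => M * s ^ S n / INR (S n)) (fun s => sg * f s)).
      + auto_derive; [exact I|]. change (match n with O => 1 | S _ => INR n + 1 end) with (INR (S n)). simpl pred. field. exact HS.
      + apply is_derive_scal. apply H. lra.
    - rewrite Rmin_left, Rmax_right in Hc by lra. cbv beta in E. rewrite H0 in E. rewrite pow_i in E by lia.
      destruct (H c Hc) as [_ B].
      assert (B2 : sg * f' c <= M * c ^ n).
      { eapply Rle_trans; [apply Rle_abs|]. rewrite Rabs_mult, Hsg. lra. }
      assert (0 <= (M * c ^ n - sg * f' c) * (u - 0)) by (apply Rmult_le_pos; lra).
      unfold Rdiv in E at 2. rewrite Rmult_0_r, Rmult_0_l in E. lra. }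
  assert (G1 := G 1 Rabs_R1). assert (G2 := G (-1) ltac:(rewrite Rabs_left; lra)). apply Rabs_le. lra.
Qed.

(** Induction through the derivative in [u], which is [x] times the remainder of order one less. The
    factor [2^n] comes from estimating real and imaginary parts separately and is harmless against
    [n!]. *)
Lemma Cexp_taylor x n : forall u, 0 <= u <= 1 ->
  Cmod (Cexp (x * RtoC u) - csum (fun k => x ^ k * RtoC (/ INR (fact k) * u ^ k)) n)%C
   <= (2 * Cmod x) ^ n * exp (Cmod x) * (u ^ n / INR (fact n)).
Proof.
  assert (Hx := Cmod_ge_0 x). induction n as [|n IH]; intros u Hu.
  - simpl. replace (Cexp (x * RtoC u) - RtoC 0)%C with (Cexp (x * RtoC u)) by ring.
    rewrite Cmod_Cexp. replace (1 * exp (Cmod x) * (1 / 1)) with (exp (Cmod x)) by field. apply exp_le_mono.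
    apply Rle_trans with (Cmod (x * RtoC u)%C); [eapply Rle_trans; [apply Rle_abs|apply re_le_Cmod]|].
    rewrite Cmod_mult, Cmod_R, Rabs_pos_eq by lra. nra.
  - set (h := fun u => (Cexp (x * RtoC u) - csum (fun k => x ^ k * RtoC (/ INR (fact k) * u ^ k)) (S n))%C).
    set (h' := fun u => (x * (Cexp (x * RtoC u) - csum (fun k => x ^ k * RtoC (/ INR (fact k) * u ^ k)) n))%C).
    assert (h0 : h 0 = RtoC 0).
    { unfold h. rewrite csum_S_l, (csum_ext _ (fun _ => RtoC 0)).
      - rewrite csum_zero. replace (x * RtoC 0)%C with (RtoC 0) by ring. rewrite Cexp_0. simpl. rewrite Rinv_1, Rmult_1_r. ring.
      - intros k _. rewrite pow_i by lia. rewrite Rmult_0_r. ring. }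
    assert (hd : forall s, cderiv h s (h' s)).
    { intros s. unfold h, h'.
      apply (cderiv_ext (fun u => Cexp (x * RtoC u) + (- RtoC 1) * csum (fun k => x ^ k * RtoC (/ INR (fact k) * u ^ k)) (S n))%C); [intros; ring|].
      replace (x * (Cexp (x * RtoC s) - csum (fun k => x ^ k * RtoC (/ INR (fact k) * s ^ k)) n))%C
       with (x * Cexp (x * RtoC s) + (- RtoC 1) * csum (fun k => x ^ k * RtoC (/ INR (fact k) * (INR k * s ^ pred k))) (S n))%C.
      2:{ rewrite csum_S_l. change (INR 0) with 0. rewrite Rmult_0_l, Rmult_0_r.
          rewrite (csum_ext _ (fun j => x * (x ^ j * RtoC (/ INR (fact j) * s ^ j)))%C n).
          - rewrite csum_scal. ring.
          - intros k _. change (pred (S k)) with k. rewrite fact_simpl, mult_INR, Cpow_S.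
            replace (/ (INR (S k) * INR (fact k)) * (INR (S k) * s ^ k)) with (/ INR (fact k) * s ^ k).
            + ring.
            + field. split; [apply INR_fact_neq_0|apply not_0_INR; lia]. }
      apply cderiv_plus; [apply cderiv_Cexp|]. apply cderiv_scal. apply cderiv_csum. intros k _. apply cderiv_scal. apply cderiv_RtoC.
      apply is_derive_scal. auto_derive; [exact I|]. rewrite Rmult_1_l. reflexivity. }
    set (M := Cmod x * ((2 * Cmod x) ^ n * exp (Cmod x) / INR (fact n))).
    assert (hb : forall s, 0 <= s <= u -> Cmod (h' s) <= M * s ^ n).
    { intros s Hs. unfold h', M. rewrite Cmod_mult, Rmult_assoc. apply Rmult_le_compat_l; [exact Hx|].
      eapply Rle_trans; [apply IH; lra|]. right. field. apply INR_fact_neq_0. }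
    assert (B1 : Rabs (Re (h u)) <= M * u ^ S n / INR (S n)).
    { apply (monomial_comparison (fun s => Re (h s)) (fun s => Re (h' s))); [lra|now rewrite h0|].
      intros s Hs. split; [apply hd|]. eapply Rle_trans; [apply re_le_Cmod|now apply hb]. }
    assert (B2 : Rabs (Im (h u)) <= M * u ^ S n / INR (S n)).
    { apply (monomial_comparison (fun s => Im (h s)) (fun s => Im (h' s))); [lra|now rewrite h0|].
      intros s Hs. split; [apply hd|]. eapply Rle_trans; [apply Im_le_Cmod|now apply hb]. }
    fold (h u). eapply Rle_trans; [apply Cmod_le_Re_Im|]. eapply Rle_trans; [apply Rplus_le_compat; [exact B1|exact B2]|].
    right. unfold M. rewrite fact_simpl, mult_INR. rewrite <- (tech_pow_Rmult (2 * Cmod x)). field. split; [apply INR_fact_neq_0|apply not_0_INR; lia].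
Qed.

Lemma Cexp_cpser x : cpser (fun k => RtoC (/ INR (fact k))) x (Cexp x).
Proof.
  intros eps He. set (Y := exp (Cmod x)). assert (HY : 0 < Y) by apply exp_pos.
  destruct (cv_speed_pow_fact (2 * Cmod x) (eps / Y)) as [N HN]; [apply Rdiv_lt_0_compat; lra|].
  exists N. intros n Hn. specialize (HN n Hn). unfold Rdist in HN. rewrite Rminus_0_r in HN.
  assert (T := Cexp_taylor x n 1 ltac:(lra)). replace (x * RtoC 1)%C with x in T by ring.
  rewrite (csum_ext _ (fun k => RtoC (/ INR (fact k)) * x ^ k)%C) in T.
  2:{ intros k _. rewrite pow1, Rmult_1_r. ring. }
  replace (csum (fun k => RtoC (/ INR (fact k)) * x ^ k) n - Cexp x)%C with (- (Cexp x - csum (fun k => RtoC (/ INR (fact k)) * x ^ k) n))%C by ring.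
  rewrite Cmod_opp. eapply Rle_lt_trans; [exact T|]. rewrite pow1. fold Y.
  apply Rle_lt_trans with (Y * Rabs ((2 * Cmod x) ^ n / INR (fact n))).
  - rewrite Rabs_pos_eq; [right; unfold Rdiv; ring|]. apply Rdiv_le_0_compat; [apply pow_le; assert (H := Cmod_ge_0 x); lra|apply INR_fact_lt_0].
  - apply (Rmult_lt_reg_l (/ Y)); [now apply Rinv_0_lt_compat|]. rewrite <- Rmult_assoc, Rinv_l, Rmult_1_l by lra.
    unfold Rdiv in HN at 2. lra.
Qed.

(** Entire functions, by way of their expansion about one centre [z0]. *)
Definition ent (z0 : C) (f : C -> C) : Prop := exists c, forall y, cpser c y (f (z0 + y)%C).

Lemma ent_ext z0 f g : (forall z, f z = g z) -> ent z0 f -> ent z0 g.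
Proof. intros E [c H]. exists c. intros y. rewrite <- E. apply H. Qed.

Lemma cpser_plus c d y l m : cpser c y l -> cpser d y m -> cpser (fun k => c k + d k)%C y (l + m)%C.
Proof.
  intros H1 H2. eapply cconv_ext; [|exact (cconv_plus _ _ _ _ H1 H2)]. intros n. cbv beta.
  rewrite <- csum_plus. apply csum_ext. intros; ring.
Qed.

Lemma cpser_scal a c y l : cpser c y l -> cpser (fun k => a * c k)%C y (a * l)%C.
Proof.
  intros H1. eapply cconv_ext; [|exact (cconv_scal a _ _ H1)]. intros n. cbv beta.
  rewrite <- csum_scal. apply csum_ext. intros; ring.
Qed.

Lemma ent_plus z0 f g : ent z0 f -> ent z0 g -> ent z0 (fun z => f z + g z)%C.
Proof. intros [c H1] [d H2]. exists (fun k => c k + d k)%C. intros y. now apply cpser_plus. Qed.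

Lemma ent_scal z0 a f : ent z0 f -> ent z0 (fun z => a * f z)%C.
Proof. intros [c H1]. exists (fun k => a * c k)%C. intros y. now apply cpser_scal. Qed.

Lemma ent_csum z0 (f : nat -> C -> C) n : (forall k, (k < n)%nat -> ent z0 (f k)) -> ent z0 (fun z => csum (fun k => f k z) n).
Proof.
  induction n as [|n IH]; intros H; simpl.
  - exists (fun _ => RtoC 0). intros y. apply (cconv_ext (fun _ => RtoC 0)); [|apply cconv_const].
    intros m. rewrite (csum_ext _ (fun _ => RtoC 0)) by (intros; ring). now rewrite csum_zero.
  - apply ent_plus; [apply IH; intros; apply H; lia|apply H; lia].
Qed.

(** The falling factorials in [Bz] are products of linear factors in [z], so that multiplication by
    [a - z], a shift of the coefficients, takes the place of the Cauchy product. *)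
Lemma ent_linmul z0 a f : ent z0 f -> ent z0 (fun z => (a - z) * f z)%C.
Proof.
  intros [c H]. exists (fun k => (a - z0) * c k + (- RtoC 1) * match k with O => RtoC 0 | S j => c j end)%C.
  intros y. replace ((a - (z0 + y)) * f (z0 + y))%C with ((a - z0) * f (z0 + y) + (- RtoC 1) * (y * f (z0 + y)))%C by ring.
  apply cpser_plus; [now apply cpser_scal|]. apply cpser_scal.
  unfold cpser. apply cconv_S. eapply cconv_ext; [|exact (cconv_scal y _ _ (H y))]. intros n. cbv beta.
  rewrite csum_S_l, <- csum_scal. rewrite (csum_ext (fun k => c k * y ^ S k)%C (fun k => y * (c k * y ^ k))%C).
  - ring.
  - intros k _. rewrite Cpow_S. ring.
Qed.

Lemma ent_Rcpow z0 w a : ent z0 (fun z => Rcpow w (a - z)%C).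
Proof.
  exists (fun k => Rcpow w (a - z0) * (RtoC (/ INR (fact k)) * RtoC (- ln w) ^ k))%C. intros y.
  replace (a - (z0 + y))%C with (a - z0 + - y)%C by ring. rewrite Rcpow_plus. apply cpser_scal.
  unfold Rcpow. replace (- y * RtoC (ln w))%C with (RtoC (- ln w) * y)%C by (rewrite RtoC_opp; ring).
  eapply cconv_ext; [|exact (Cexp_cpser (RtoC (- ln w) * y)%C)]. intros n. apply csum_ext. intros k _.
  rewrite Cpow_mult_l. ring.
Qed.

(** * Analytic continuation of the Hurwitz zeta function *)

(* Coefficients of [s / (1 - e^s)]. *)
Definition bcoef : nat -> R :=
  srec (fun i t => (if Nat.eqb i 0 then -1 else 0) - rsum (fun k => t k * / INR (fact (i + 1 - k))) i).

Lemma bcoef_rec i : bcoef i = (if Nat.eqb i 0 then -1 else 0) - rsum (fun k => bcoef k * / INR (fact (i + 1 - k))) i.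
Proof. unfold bcoef at 1, srec. f_equal. apply rsum_ext. intros k Hk. now rewrite srec_tab_eq. Qed.

(** The coefficient of [s^i] in the product of [s / (1 - e^s)] with [1 - e^s]. *)
Lemma bcoef_identity i : bcoef i - shift_sym bcoef 1 i = if Nat.eqb i 1 then 1 else 0.
Proof.
  unfold shift_sym. rewrite rsum_S, Nat.sub_diag. change (INR (fact 0)) with 1. change (1 ^ 0) with 1.
  rewrite (rsum_ext _ (fun j => bcoef j * / INR (fact (i - j)))) by (intros; rewrite pow1; ring).
  destruct i as [|i]; [simpl; field|].
  rewrite rsum_S. replace (S i - i)%nat with 1%nat by lia. change (INR (fact 1)) with 1.
  rewrite (rsum_ext _ (fun j => bcoef j * / INR (fact (i + 1 - j)))).
  2:{ intros k Hk. replace (S i - k)%nat with (i + 1 - k)%nat by lia. reflexivity. }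
  assert (E := bcoef_rec i). revert E. change (Nat.eqb (S i) 1) with (Nat.eqb i 0).
  destruct (Nat.eqb i 0); intros E; rewrite Rinv_1; lra.
Qed.

(** The Euler-Maclaurin expansion of [(1 - z) zeta (z, w)]; the factor [1 - z] removes the pole, so
    that every term is entire in [z]. *)
Definition Bz (z : C) (w : R) (N : nat) : C :=
  csum (fun k => RtoC (bcoef k) * (cff (RtoC 1 - z) k * Rcpow w (RtoC 1 - z - RtoC (INR k))))%C N.

Definition ez (z : C) (w : R) (N : nat) : C :=
  ((RtoC 1 - z) * Rcpow w (- z) - (Bz z w N - Bz z (w + 1) N))%C.

Lemma ent_Bz z0 w N : ent z0 (fun z => Bz z w N).
Proof.
  unfold Bz. apply (ent_csum z0 (fun k z => RtoC (bcoef k) * (cff (RtoC 1 - z) k * Rcpow w (RtoC 1 - z - RtoC (INR k))))%C).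
  intros k _. apply ent_scal.
  assert (G : forall g, ent z0 g -> ent z0 (fun z => cff (RtoC 1 - z) k * g z)%C).
  { intros g Hg. induction k as [|k IH].
    - simpl. apply (ent_ext _ g); [intros; ring|exact Hg].
    - apply (ent_ext _ (fun z => (RtoC 1 - RtoC (INR k) - z) * (cff (RtoC 1 - z) k * g z))%C); [intros; simpl; ring|].
      now apply ent_linmul. }
  apply (G (fun z => Rcpow w (RtoC 1 - z - RtoC (INR k)))).
  apply (ent_ext _ (fun z => Rcpow w (RtoC 1 - RtoC (INR k) - z))); [intros; f_equal; ring|apply ent_Rcpow].
Qed.

Lemma ent_term z0 w : ent z0 (fun z => (RtoC 1 - z) * Rcpow w (- z))%C.
Proof.
  apply ent_linmul. apply (ent_ext _ (fun z => Rcpow w (RtoC 0 - z))); [intros; f_equal; ring|apply ent_Rcpow].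
Qed.

Lemma ent_ez z0 w N : ent z0 (fun z => ez z w N).
Proof.
  apply (ent_ext _ (fun z => (RtoC 1 - z) * Rcpow w (- z) + (- RtoC 1) * (Bz z w N + (- RtoC 1) * Bz z (w + 1) N))%C).
  - intros z. unfold ez. ring.
  - apply ent_plus; [apply ent_term|]. apply ent_scal. apply ent_plus; [apply ent_Bz|apply ent_scal, ent_Bz].
Qed.

Lemma cff_bound q Q k : Cmod q <= Q -> Cmod (cff q k) <= (Q + INR k) ^ k.
Proof.
  intros Hq. assert (H0 := Cmod_ge_0 q). induction k as [|k IH]; [simpl; rewrite Cmod_1; lra|].
  change (cff q (S k)) with (cff q k * (q - RtoC (INR k)))%C. rewrite Cmod_mult. rewrite <- tech_pow_Rmult, Rmult_comm.
  assert (Hk := pos_INR k). rewrite S_INR. apply Rmult_le_compat; [apply Cmod_ge_0|apply Cmod_ge_0| |].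
  - unfold Cminus. eapply Rle_trans; [apply Cmod_triangle|]. rewrite Cmod_opp, Cmod_R, Rabs_pos_eq by exact Hk. lra.
  - eapply Rle_trans; [exact IH|]. apply pow_incr. lra.
Qed.

Lemma Rcpow_step_taylor J P : 0 <= P -> exists K, 0 <= K /\ forall p w, Cmod p <= P -> 2 <= w ->
  Cmod (Rcpow (w + 1) p - csum (fun j => cff p j * (RtoC (/ INR (fact j)) * Rcpow w (p - RtoC (INR j)))) J)%C
    <= K * Rpower w (Re p - INR J).
Proof.
  intros HP. destruct (Rcpow_taylor J P HP) as [K [HK0 HK]]. exists K. split; [exact HK0|]. intros p w Hp Hw.
  assert (Hw0 : 0 < / w) by (apply Rinv_0_lt_compat; lra).
  assert (Hu : Rabs (/ w) <= / 2) by (rewrite Rabs_pos_eq by lra; apply Rinv_le_contravar; lra).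
  specialize (HK p (/ w) Hp Hu). replace (w + 1) with (w * (1 + / w)) by (field; lra).
  rewrite Rcpow_mult by lra.
  rewrite (csum_ext _ (fun j => Rcpow w p * (cff p j * RtoC (/ INR (fact j) * (/ w) ^ j)))%C).
  2:{ intros j _. rewrite <- (Rcpow_minus_INR w p j) by lra. rewrite RtoC_mult.
      assert (H1 : (RtoC (w ^ j) * RtoC ((/ w) ^ j) = RtoC 1)%C).
      { rewrite <- RtoC_mult, pow_inv, Rinv_r; [reflexivity|]. apply pow_nonzero; lra. }
      transitivity (cff p j * (RtoC (/ INR (fact j)) * Rcpow w (p - RtoC (INR j))) * (RtoC (w ^ j) * RtoC ((/ w) ^ j)))%C;
        [rewrite H1; ring|ring]. }
  rewrite csum_scal. replace (Rcpow w p * Rcpow (1 + / w) p - Rcpow w p * csum (fun j => cff p j * RtoC (/ INR (fact j) * (/ w) ^ j)) J)%C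
    with (Rcpow w p * (Rcpow (1 + / w) p - csum (fun j => cff p j * RtoC (/ INR (fact j) * (/ w) ^ j)) J))%C by ring.
  rewrite Cmod_mult, Cmod_Rcpow. eapply Rle_trans; [apply Rmult_le_compat_l; [left; apply Rpower_pos|exact HK]|].
  right. rewrite Rabs_pos_eq by lra. unfold Rminus. rewrite Rpower_plus, Rpower_Ropp, Rpower_pow by lra. rewrite pow_inv. ring.
Qed.

(** The expansion at [w + 1] is re-expanded at [w]. After regrouping, [bcoef_identity] leaves only
    the term of order 1, which is [(1 - z) w^(-z)], and [ez] is the sum of the Taylor remainders.
    The constant holds on the whole disc of radius [P], as [weierstrass] demands. *)
Lemma ez_bound N P : (2 <= N)%nat -> 0 <= P -> exists K, 0 <= K /\ forall z w, Cmod z <= P -> 2 <= w ->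
  Cmod (ez z w N) <= K * Rpower w (1 - Re z - INR N).
Proof.
  intros HN HP.
  assert (G : forall n, (n <= N)%nat -> exists K, 0 <= K /\ forall k, (k < n)%nat -> forall z w, Cmod z <= P -> 2 <= w ->
    Cmod (RtoC (bcoef k) * (cff (RtoC 1 - z) k * Rcpow (w + 1) (RtoC 1 - z - RtoC (INR k)))
      - csum (fun j => RtoC (bcoef k) * (cff (RtoC 1 - z) k * (cff (RtoC 1 - z - RtoC (INR k)) j * (RtoC (/ INR (fact j)) * Rcpow w (RtoC 1 - z - RtoC (INR k) - RtoC (INR j)))))) (N - k))%C
    <= K * Rpower w (1 - Re z - INR N)).
  { induction n as [|n IH]; intros Hn.
    - exists 0. split; [lra|]. intros; lia.
    - destruct IH as [K1 [HK1 IH]]; [lia|].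
      destruct (Rcpow_step_taylor (N - n) (1 + P + INR n)) as [K2 [HK2 H2]]; [assert (H := pos_INR n); lra|].
      set (K3 := Rabs (bcoef n) * ((1 + P + INR n) ^ n * K2)).
      assert (HK3 : 0 <= K3).
      { unfold K3. apply Rmult_le_pos; [apply Rabs_pos|]. apply Rmult_le_pos; [|exact HK2]. apply pow_le. assert (H := pos_INR n). lra. }
      exists (K1 + K3). split; [lra|]. intros k Hk z w Hz Hw.
      assert (Pw : 0 < Rpower w (1 - Re z - INR N)) by apply Rpower_pos.
      destruct (Nat.eq_dec k n) as [->|Hkn].
      + assert (Hz1 : Cmod (RtoC 1 - z) <= 1 + P).
        { unfold Cminus. eapply Rle_trans; [apply Cmod_triangle|]. rewrite Cmod_opp, Cmod_1. lra. }
        assert (Hz2 : Cmod (RtoC 1 - z - RtoC (INR n)) <= 1 + P + INR n).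
        { unfold Cminus at 1. eapply Rle_trans; [apply Cmod_triangle|]. rewrite Cmod_opp, Cmod_R, Rabs_pos_eq by apply pos_INR. lra. }
        specialize (H2 _ w Hz2 Hw).
        rewrite csum_scal. rewrite csum_scal.
        replace (RtoC (bcoef n) * (cff (RtoC 1 - z) n * Rcpow (w + 1) (RtoC 1 - z - RtoC (INR n))) - RtoC (bcoef n) * (cff (RtoC 1 - z) n * csum (fun j => cff (RtoC 1 - z - RtoC (INR n)) j * (RtoC (/ INR (fact j)) * Rcpow w (RtoC 1 - z - RtoC (INR n) - RtoC (INR j)))) (N - n)))%C
          with (RtoC (bcoef n) * (cff (RtoC 1 - z) n * (Rcpow (w + 1) (RtoC 1 - z - RtoC (INR n)) - csum (fun j => cff (RtoC 1 - z - RtoC (INR n)) j * (RtoC (/ INR (fact j)) * Rcpow w (RtoC 1 - z - RtoC (INR n) - RtoC (INR j)))) (N - n))))%C by ring.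
        rewrite !Cmod_mult, Cmod_R.
        replace (Re (RtoC 1 - z - RtoC (INR n)) - INR (N - n)) with (1 - Re z - INR N) in H2.
        2:{ rewrite minus_INR by lia. change (1 - Re z - INR N = 1 + - Re z + - INR n - (INR N - INR n)); ring. }
        apply Rle_trans with (K3 * Rpower w (1 - Re z - INR N)); [|nra].
        unfold K3. rewrite !Rmult_assoc. apply Rmult_le_compat_l; [apply Rabs_pos|].
        apply Rmult_le_compat; [apply Cmod_ge_0|apply Cmod_ge_0|now apply cff_bound|exact H2].
      + eapply Rle_trans; [apply IH; [lia|exact Hz|exact Hw]|]. nra. }
  destruct (G N (le_n _)) as [K [HK0 HK]]. exists (INR N * K). split; [apply Rmult_le_pos; [apply pos_INR|exact HK0]|].
  intros z w Hz Hw.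
  assert (E : ez z w N = csum (fun k => RtoC (bcoef k) * (cff (RtoC 1 - z) k * Rcpow (w + 1) (RtoC 1 - z - RtoC (INR k)))
      - csum (fun j => RtoC (bcoef k) * (cff (RtoC 1 - z) k * (cff (RtoC 1 - z - RtoC (INR k)) j * (RtoC (/ INR (fact j)) * Rcpow w (RtoC 1 - z - RtoC (INR k) - RtoC (INR j)))))) (N - k))%C N).
  { assert (HE : forall X : C, csum (fun i => if Nat.eqb i 1 then X else RtoC 0) N = X).
    { intros X. replace N with (2 + (N - 2))%nat by lia. rewrite csum_add.
      rewrite (csum_ext (fun k => if Nat.eqb (2 + k) 1 then X else RtoC 0) (fun _ => RtoC 0)) by reflexivity.
      rewrite csum_zero. simpl. ring. }
    rewrite csum_minus, csum_triangle.
    rewrite (csum_ext (fun i => csum _ (S i)) (fun i => RtoC (bcoef i) * (cff (RtoC 1 - z) i * Rcpow w (RtoC 1 - z - RtoC (INR i)))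
       - (if Nat.eqb i 1 then (RtoC 1 - z) * Rcpow w (- z) else RtoC 0))%C).
    - rewrite csum_minus. fold (Bz z w N). fold (Bz z (w + 1) N).
      rewrite HE. unfold ez. ring.
    - intros i Hi.
      rewrite (csum_ext _ (fun k => (cff (RtoC 1 - z) i * Rcpow w (RtoC 1 - z - RtoC (INR i))) * RtoC (bcoef k * (/ INR (fact (i - k)) * 1 ^ (i - k))))%C).
      + rewrite csum_scal, csum_RtoC. change (rsum (fun k => bcoef k * (/ INR (fact (i - k)) * 1 ^ (i - k))) (S i)) with (shift_sym bcoef 1 i).
        assert (Hb := bcoef_identity i). destruct (Nat.eqb_spec i 1) as [->|Hi1].
        * replace (shift_sym bcoef 1 1) with (bcoef 1 - 1) by lra. rewrite RtoC_minus. simpl.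
          replace (RtoC 1 - z - RtoC 1)%C with (- z)%C by ring. ring.
        * replace (shift_sym bcoef 1 i) with (bcoef i) by lra. ring.
      + intros k Hk. rewrite pow1, Rmult_1_r, RtoC_mult.
        replace (cff (RtoC 1 - z) i) with (cff (RtoC 1 - z) (k + (i - k))) by (f_equal; lia). rewrite cff_add.
        replace (RtoC 1 - z - RtoC (INR k) - RtoC (INR (i - k)))%C with (RtoC 1 - z - RtoC (INR i))%C.
        * ring.
        * rewrite minus_INR by lia. rewrite RtoC_minus. ring. }
  rewrite E. eapply Rle_trans; [apply csum_abs|]. rewrite Rmult_assoc, <- rsum_const. apply rsum_le. intros k Hk. now apply HK.
Qed.

Lemma tends0_add F G : tends0 F -> tends0 G -> tends0 (fun w => F w + G w).
Proof.
  intros H1 H2 eps He. destruct (H1 (eps / 2)) as [W1 HW1]; [lra|]. destruct (H2 (eps / 2)) as [W2 HW2]; [lra|].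
  exists (Rmax W1 W2). intros w Hw. specialize (HW1 w (Rle_trans _ _ _ (Rmax_l _ _) Hw)).
  specialize (HW2 w (Rle_trans _ _ _ (Rmax_r _ _) Hw)).
  eapply Rle_trans; [apply Rabs_triang|]. lra.
Qed.

Lemma tends0_cconv F (s : nat -> C) a : tends0 F -> (forall m, Cmod (s m) <= Rabs (F (a + INR m))) -> cconv s (RtoC 0).
Proof.
  intros HF H eps He. destruct (HF (eps / 2)) as [W HW]; [lra|].
  destruct (INR_unbounded (W - a)) as [N HN]. exists N. intros n Hn.
  replace (s n - RtoC 0)%C with (s n) by ring. apply le_INR in Hn.
  specialize (HW (a + INR n) ltac:(lra)). specialize (H n). lra.
Qed.

Lemma tends0_power c p : p < 0 -> tends0 (fun w => c * Rpower w p).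
Proof.
  intros Hp. apply (tends0_Rpower _ (Rabs c) 0 p Hp). intros w _. rewrite Rabs_mult, (Rabs_pos_eq (Rpower w p)) by (left; apply Rpower_pos). lra.
Qed.

Lemma tends0_rsum (f : nat -> R -> R) n : (forall k, (k < n)%nat -> tends0 (f k)) -> tends0 (fun w => rsum (fun k => f k w) n).
Proof.
  induction n as [|n IH]; intros H; simpl.
  - intros eps He. exists 0. intros. rewrite Rabs_R0. lra.
  - apply tends0_add; [apply IH; intros; apply H; lia|apply H; lia].
Qed.

Lemma Bz_terms_tends0 z a n m : (n <= m)%nat -> 1 - Re z - INR n < 0 ->
  cconv (fun j => Bz z (a + INR j) m - Bz z (a + INR j) n)%C (RtoC 0).
Proof.
  intros Hnm Hz.
  apply (tends0_cconv (fun w => rsum (fun k => Cmod (RtoC (bcoef (n + k)) * cff (RtoC 1 - z) (n + k))%C * Rpower w (1 - Re z - INR (n + k))) (m - n)) _ a).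
  - apply (tends0_rsum (fun k w => Cmod (RtoC (bcoef (n + k)) * cff (RtoC 1 - z) (n + k))%C * Rpower w (1 - Re z - INR (n + k)))).
    intros k _. apply tends0_power. rewrite plus_INR. assert (H := pos_INR k). lra.
  - intros j. unfold Bz. rewrite csum_minus_tail by exact Hnm. eapply Rle_trans; [apply csum_abs|].
    eapply Rle_trans; [|apply Rle_abs]. apply rsum_le. intros k _. rewrite Cmult_assoc, Cmod_mult, Cmod_Rcpow.
    right. f_equal.
Qed.

(** This is [(1 - z) zeta (z, a)]. The first two terms are split off so that the expansion is used
    only at [a + 2], in the range [w >= 2] where [ez_bound] applies for every [a > 0]. *)
Definition EN (z : C) (a : R) (N : nat) : C :=
  ((RtoC 1 - z) * Rcpow a (- z) + (RtoC 1 - z) * Rcpow (a + 1) (- z) + Bz z (a + 2) N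
   + CSeries (fun n => ez z (a + 2 + INR n) N))%C.

Definition partial_zeta (z : C) (a : R) (N m : nat) : C :=
  ((RtoC 1 - z) * csum (fun n => Rcpow (a + INR n) (- z)) m + Bz z (a + INR m) N)%C.

Lemma ez_majorant N P a : 0 < a -> (2 <= N)%nat -> 0 <= P -> P + 3 <= INR N -> exists K, 0 <= K /\
  forall z n, Cmod z <= P -> Cmod (ez z (a + 2 + INR n) N) <= K * / (1 + INR n * 1) ^ 2.
Proof.
  intros Ha HN HP HNP. destruct (ez_bound N P HN HP) as [K [HK0 HK]]. exists K. split; [exact HK0|].
  intros z n Hz. assert (Hn := pos_INR n). eapply Rle_trans; [apply HK; [exact Hz|lra]|].
  apply Rmult_le_compat_l; [exact HK0|].
  apply Rle_trans with (Rpower (a + 2 + INR n) (- INR 2)).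
  - apply Rpower_le_exp; [lra|]. assert (H1 := re_le_Cmod z). assert (H2 := Rle_abs (- Re z)). rewrite Rabs_Ropp in H2.
    simpl. lra.
  - rewrite Rpower_Ropp, Rpower_pow by lra. apply Rinv_le_contravar; [apply pow_lt; lra|]. apply pow_incr. lra.
Qed.

Lemma ez_majorant_sum K n : 0 <= K -> rsum (fun n => K * / (1 + INR n * 1) ^ 2) n <= K * 2.
Proof.
  intros HK. rewrite rsum_scal. apply Rmult_le_compat_l; [exact HK|].
  assert (H := rsum_inv_sq 1 n ltac:(lra)). rewrite Rinv_1 in H. lra.
Qed.

Lemma ez_CSeries z a N : 0 < a -> (2 <= N)%nat -> Cmod z + 3 <= INR N ->
  cconv (csum (fun n => ez z (a + 2 + INR n) N)) (CSeries (fun n => ez z (a + 2 + INR n) N)).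
Proof.
  intros Ha HN HNP. destruct (ez_majorant N (Cmod z) a Ha HN (Cmod_ge_0 z) HNP) as [K [HK0 HK]].
  apply (CSeries_conv _ (fun n => K * / (1 + INR n * 1) ^ 2) (K * 2)); [intros n; apply HK; lra|].
  intros n. now apply ez_majorant_sum.
Qed.

(** After the first two terms, the defects [ez] telescope: their partial sums move the expansion
    from [a + 2] out to [a + m]. This limit links [EN] to the Dirichlet series and to other
    truncation orders. *)
Lemma partial_zeta_conv z a N : 0 < a -> (2 <= N)%nat -> Cmod z + 3 <= INR N -> cconv (partial_zeta z a N) (EN z a N).
Proof.
  intros Ha HN HNP. apply cconv_S, cconv_S.
  apply (cconv_ext (fun m => (RtoC 1 - z) * Rcpow a (- z) + (RtoC 1 - z) * Rcpow (a + 1) (- z) + Bz z (a + 2) N + csum (fun n => ez z (a + 2 + INR n) N) m)%C).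
  - intros m. unfold partial_zeta. induction m as [|m IH].
    + simpl. rewrite !Rplus_0_r. replace (a + (1 + 1)) with (a + 2) by ring. ring.
    + change (csum (fun n => ez z (a + 2 + INR n) N) (S m)) with (csum (fun n => ez z (a + 2 + INR n) N) m + ez z (a + 2 + INR m) N)%C.
      rewrite Cplus_assoc, IH. unfold ez.
      change (csum (fun n => Rcpow (a + INR n) (- z)) (S (S (S m)))) with (csum (fun n => Rcpow (a + INR n) (- z)) (S (S m)) + Rcpow (a + INR (S (S m))) (- z))%C.
      replace (a + INR (S (S m))) with (a + 2 + INR m) by (rewrite !S_INR; ring).
      replace (a + INR (S (S (S m)))) with (a + 2 + INR m + 1) by (rewrite !S_INR; ring). ring.
  - apply cconv_plus; [apply cconv_const|]. now apply ez_CSeries.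
Qed.

Lemma EN_indep z a N M : 0 < a -> (2 <= N)%nat -> Cmod z + 3 <= INR N -> (N <= M)%nat -> EN z a M = EN z a N.
Proof.
  intros Ha HN HNP HM. assert (HM' := le_INR _ _ HM).
  apply (cconv_unique (partial_zeta z a M)); [apply partial_zeta_conv; [exact Ha|lia|lra]|].
  apply (cconv_ext (fun m => partial_zeta z a N m + (Bz z (a + INR m) M - Bz z (a + INR m) N))%C).
  - intros m. unfold partial_zeta. ring.
  - replace (EN z a N) with (EN z a N + RtoC 0)%C by ring. apply cconv_plus; [now apply partial_zeta_conv|].
    apply Bz_terms_tends0; [exact HM|]. assert (H1 := re_le_Cmod z). assert (H2 := Rle_abs (- Re z)). rewrite Rabs_Ropp in H2. lra.
Qed.

Definition order_for (P : R) : nat := (Z.to_nat (up P) + 3)%nat.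

Lemma order_for_spec P : 0 <= P -> (2 <= order_for P)%nat /\ P + 3 <= INR (order_for P).
Proof.
  intros HP. split; [unfold order_for; lia|]. unfold order_for. rewrite plus_INR. destruct (archimed P) as [H _].
  assert (0 <= up P)%Z by (apply le_IZR; lra). rewrite INR_IZR_INZ, Z2Nat.id by assumption. simpl. lra.
Qed.

(** The truncation order varies with [z], but by [EN_indep] one large order serves on any bounded
    set, and analyticity is proved with that one. *)
Definition hz (a : R) (z : C) : C := (EN z a (order_for (Cmod z)) / (RtoC 1 - z))%C.

Lemma hz_eq a z N : 0 < a -> (2 <= N)%nat -> Cmod z + 3 <= INR N -> hz a z = (EN z a N / (RtoC 1 - z))%C.
Proof.
  intros Ha HN HNP. unfold hz. destruct (order_for_spec (Cmod z) (Cmod_ge_0 z)) as [H1 H2]. f_equal.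
  destruct (Nat.le_ge_cases N (order_for (Cmod z))) as [H|H].
  - now apply EN_indep.
  - symmetry. now apply EN_indep.
Qed.

(** The coefficients of the quotient satisfy [u d_k = c_k + d_(k-1)]. Since [2 rho <= Cmod u], the
    bound [A] for the terms of [c] is inherited by [d], so the boundary term in the telescoped
    partial sums tends to 0. *)
Lemma cpser_div u c r (h : C -> C) : u <> RtoC 0 -> 0 < r -> (forall y, Cmod y < r -> cpser c y (h y)) ->
  exists c' r', 0 < r' /\ r' <= r /\ r' < Cmod u /\ forall y, Cmod y < r' -> cpser c' y (h y / (u - y))%C.
Proof.
  intros Hu Hr Hh. assert (Hu0 : 0 < Cmod u) by now apply Cmod_gt_0.
  set (rho := Rmin (r / 2) (Cmod u / 2)). assert (Hrho : 0 < rho) by (apply Rmin_pos; lra).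
  assert (L1 : rho <= r / 2) by apply Rmin_l. assert (L2 : rho <= Cmod u / 2) by apply Rmin_r.
  destruct (cpser_coef_bound c (RtoC rho) (h (RtoC rho))) as [A [HA0 HA]].
  { apply Hh. rewrite Cmod_R, Rabs_pos_eq; lra. }
  rewrite Cmod_R, Rabs_pos_eq in HA by lra.
  set (d := fix d k := match k with O => (c O / u)%C | S j => ((c (S j) + d j) / u)%C end).
  assert (Hd : forall k, Cmod (d k) * rho ^ S k <= A).
  { assert (Hdiv : forall x, Cmod (x / u) * (2 * rho) <= Cmod x).
    { intros x. rewrite Cmod_div by exact Hu. unfold Rdiv. rewrite Rmult_assoc. rewrite <- (Rmult_1_r (Cmod x)) at 2.
      apply Rmult_le_compat_l; [apply Cmod_ge_0|]. apply (Rmult_le_reg_l (Cmod u)); [lra|]. rewrite <- Rmult_assoc, Rinv_r by lra. lra. }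
    induction k as [|k IH].
    - simpl. specialize (Hdiv (c O)). specialize (HA O). simpl in HA. assert (H := Cmod_ge_0 (c O / u)%C). nra.
    - change (d (S k)) with ((c (S k) + d k) / u)%C. specialize (Hdiv (c (S k) + d k)%C). specialize (HA (S k)).
      assert (P : 0 < rho ^ S k) by now apply pow_lt.
      assert (T := Cmod_triangle (c (S k)) (d k)). rewrite <- (tech_pow_Rmult rho (S k)).
      set (X := Cmod ((c (S k) + d k) / u)%C) in *.
      assert (X * (2 * rho) * rho ^ S k <= (Cmod (c (S k)) + Cmod (d k)) * rho ^ S k) by (apply Rmult_le_compat_r; lra).
      nra. }
  exists d, (rho / 2). split; [lra|]. split; [lra|]. split; [lra|]. intros y Hy.
  assert (Huy : (u - y)%C <> RtoC 0).
  { intros E. assert (E2 : u = y) by (replace u with (u - y + y)%C by ring; rewrite E; ring). rewrite E2 in L2. lra. }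
  assert (E : forall n, csum (fun k => d k * y ^ k)%C (S n) = (/ (u - y) * (csum (fun k => c k * y ^ k) (S n) - d n * y ^ S n))%C).
  { intros n. induction n as [|n IH].
    - simpl. field; split; assumption.
    - change (csum (fun k => d k * y ^ k)%C (S (S n))) with (csum (fun k => d k * y ^ k)%C (S n) + d (S n) * y ^ (S n))%C. rewrite IH.
      change (csum (fun k => c k * y ^ k)%C (S (S n))) with (csum (fun k => c k * y ^ k)%C (S n) + c (S n) * y ^ (S n))%C.
      change (d (S n)) with ((c (S n) + d n) / u)%C. rewrite (Cpow_S y (S n)). field; split; assumption. }
  apply cconv_S. eapply cconv_ext; [intros n; symmetry; apply E|].
  replace (h y / (u - y))%C with (/ (u - y) * (h y - RtoC 0))%C by (field; exact Huy).
  apply cconv_scal. apply cconv_minus; [apply -> cconv_S; apply Hh; lra|].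
  intros eps He. destruct (pow_lt_1_zero (/ 2) ltac:(rewrite Rabs_pos_eq; lra) (eps / (A + 1)) ltac:(apply Rdiv_lt_0_compat; lra)) as [N HN].
  exists N. intros n Hn. specialize (HN (S n) ltac:(lia)). rewrite Rabs_pos_eq in HN by (apply pow_le; lra).
  replace (d n * y ^ S n - RtoC 0)%C with (d n * y ^ S n)%C by ring. rewrite Cmod_mult, Cmod_pow.
  assert (Hyp : Cmod y ^ S n <= rho ^ S n * (/ 2) ^ S n).
  { rewrite <- Rpow_mult_distr. apply pow_incr. split; [apply Cmod_ge_0|lra]. }
  assert (P2 : 0 < (/ 2) ^ S n) by (apply pow_lt; lra).
  apply Rle_lt_trans with (A * (/ 2) ^ S n).
  - eapply Rle_trans; [apply Rmult_le_compat_l; [apply Cmod_ge_0|exact Hyp]|]. rewrite <- Rmult_assoc. apply Rmult_le_compat_r; [lra|apply Hd].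
  - apply Rlt_le_trans with ((A + 1) * (/ 2) ^ S n + 0); [nra|]. rewrite Rplus_0_r.
    apply (Rmult_le_reg_r (/ (A + 1))); [apply Rinv_0_lt_compat; lra|].
    replace ((A + 1) * (/ 2) ^ S n * / (A + 1)) with ((/ 2) ^ S n) by (field; lra). unfold Rdiv in HN. lra.
Qed.

(** One order [N] is valid on the unit disc about [z0]. There [EN] is an entire function plus a
    normally convergent series of entire functions, and division by [1 - z] is possible because [z0]
    is not the pole. *)
Lemma hz_analytic a z0 : 0 < a -> z0 <> RtoC 1 -> analytic_at (hz a) z0.
Proof.
  intros Ha Hz0. set (P := Cmod z0 + 1). assert (HP : 0 <= P) by (unfold P; assert (H := Cmod_ge_0 z0); lra).
  destruct (order_for_spec P HP) as [HN1 HN2]. set (N := order_for P) in *.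
  assert (Hzy : forall y, Cmod y <= 1 -> Cmod (z0 + y)%C <= P).
  { intros y Hy. unfold P. eapply Rle_trans; [apply Cmod_triangle|lra]. }
  destruct (ez_majorant N P a Ha HN1 HP HN2) as [K [HK0 HK]].
  (* A simultaneous choice of the expansions of all the summands. *)
  assert (Hc : exists cf : nat -> nat -> C, forall n y, cpser (cf n) y (ez (z0 + y) (a + 2 + INR n) N)).
  { exists (fun n => proj1_sig (constructive_indefinite_description _ (ent_ez z0 (a + 2 + INR n) N))).
    intros n. exact (proj2_sig (constructive_indefinite_description _ (ent_ez z0 (a + 2 + INR n) N))). }
  destruct Hc as [cf Hcf].
  destruct (weierstrass (fun n y => ez (z0 + y) (a + 2 + INR n) N) cf (fun n => K * / (1 + INR n * 1) ^ 2) (K * 2) 1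
    (fun y => CSeries (fun n => ez (z0 + y) (a + 2 + INR n) N))) as [c1 Hc1].
  - lra.
  - exact Hcf.
  - intros n y Hy. apply HK. now apply Hzy.
  - intros n. now apply ez_majorant_sum.
  - intros y Hy. apply ez_CSeries; [exact Ha|exact HN1|]. specialize (Hzy y Hy). lra.
  - assert (He : ent z0 (fun z => (RtoC 1 - z) * Rcpow a (- z) + (RtoC 1 - z) * Rcpow (a + 1) (- z) + Bz z (a + 2) N)%C).
    { apply (ent_plus z0 (fun z => (RtoC 1 - z) * Rcpow a (- z) + (RtoC 1 - z) * Rcpow (a + 1) (- z))%C); [|apply ent_Bz].
      apply ent_plus; apply ent_term. }
    destruct He as [c2 Hc2].
    assert (Hu : (RtoC 1 - z0)%C <> RtoC 0).
    { intros E. apply Hz0. replace z0 with (RtoC 1 - (RtoC 1 - z0))%C by ring. rewrite E. ring. }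
    destruct (cpser_div (RtoC 1 - z0)%C (fun k => c2 k + c1 k)%C 1 (fun y => EN (z0 + y) a N) Hu ltac:(lra)) as [c [r [Hr [Hr1 [_ Hcr]]]]].
    { intros y Hy. unfold EN. apply cpser_plus; [apply Hc2|now apply Hc1]. }
    exists c, (mkposreal r Hr). intros z Hz. simpl in Hz. apply is_pseries_cpser.
    rewrite (hz_eq a z N Ha HN1).
    + specialize (Hcr (z - z0)%C Hz). replace (z0 + (z - z0))%C with z in Hcr by ring.
      replace (RtoC 1 - z0 - (z - z0))%C with (RtoC 1 - z)%C in Hcr by ring. exact Hcr.
    + specialize (Hzy (z - z0)%C ltac:(lra)). replace (z0 + (z - z0))%C with z in Hzy by ring. lra.
Qed.

(** For [Re z > 1] every term of [Bz z (a + m)] tends to 0 with growing [m], so that [partial_zeta]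
    reduces to the partial sums of the Dirichlet series. *)
Lemma hz_series a z : 0 < a -> 1 < Re z -> cconv (csum (fun n => Rcpow (INR n + a) (- z))) (hz a z).
Proof.
  intros Ha Hz. destruct (order_for_spec (Cmod z) (Cmod_ge_0 z)) as [HN1 HN2]. unfold hz. set (N := order_for (Cmod z)) in *.
  assert (Hu : (RtoC 1 - z)%C <> RtoC 0).
  { intros E. apply (f_equal Re) in E. destruct z as [x y]. simpl in *. lra. }
  assert (H1 := partial_zeta_conv z a N Ha HN1 HN2).
  assert (H2 := Bz_terms_tends0 z a 0 N ltac:(lia) ltac:(simpl; lra)).
  replace (EN z a N / (RtoC 1 - z))%C with (/ (RtoC 1 - z) * (EN z a N - RtoC 0))%C by (field; exact Hu).
  apply (cconv_ext (fun m => / (RtoC 1 - z) * (partial_zeta z a N m - (Bz z (a + INR m) N - Bz z (a + INR m) 0)))%C).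
  - intros m. unfold partial_zeta. rewrite (csum_ext (fun n => Rcpow (INR n + a) (- z)) (fun n => Rcpow (a + INR n) (- z))) by (intros; f_equal; ring).
    unfold Bz at 3. simpl. field. exact Hu.
  - apply cconv_scal. now apply cconv_minus.
Qed.

Lemma hz_is_hurwitz a : 0 < a -> is_hurwitz_zeta a (hz a).
Proof.
  intros Ha. split.
  - intros z Hz. now apply hz_analytic.
  - intros z Hz. apply is_series_cconv. now apply hz_series.
Qed.

(** * Identity theorem along a segment *)

(** If [c k] is the first nonzero coefficient, then [c k y^k] dominates the sum of all higher terms
    for small [y], of size [B] times [Cmod y^(k + 1)], and [d] cannot vanish at small [y] other than
    0. *)
Lemma isolated_zeros c r (d : C -> C) : 0 < r -> (forall y, Cmod y < r -> cpser c y (d y)) ->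
  (forall eps, 0 < eps -> exists y, y <> RtoC 0 /\ Cmod y < eps /\ d y = RtoC 0) -> forall k, c k = RtoC 0.
Proof.
  intros Hr Hd Hz k. induction k as [k IH] using lt_wf_ind.
  destruct (Ceq_dec (c k) (RtoC 0)) as [E|E]; [exact E|exfalso].
  assert (Hck : 0 < Cmod (c k)) by now apply Cmod_gt_0.
  set (rho := r / 2). destruct (cpser_coef_bound c (RtoC rho) (d (RtoC rho))) as [A [HA0 HA]].
  { apply Hd. rewrite Cmod_R, Rabs_pos_eq; unfold rho; lra. }
  rewrite Cmod_R, Rabs_pos_eq in HA by (unfold rho; lra).
  assert (Hrk : 0 < rho ^ S k) by (apply pow_lt; unfold rho; lra).
  set (B := 2 * A / rho ^ S k). assert (HB : 0 <= B) by (unfold B; apply Rdiv_le_0_compat; lra).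
  destruct (Hz (Rmin (rho / 2) (Cmod (c k) / 2 / (B + 1)))) as [y [Hy0 [Hy Hdy]]].
  { apply Rmin_pos; [unfold rho; lra|]. apply Rdiv_lt_0_compat; lra. }
  assert (Hy1 : Cmod y < rho / 2) by (eapply Rlt_le_trans; [exact Hy|apply Rmin_l]).
  assert (Hy2 : Cmod y < Cmod (c k) / 2 / (B + 1)) by (eapply Rlt_le_trans; [exact Hy|apply Rmin_r]).
  assert (Hyp : 0 < Cmod y) by now apply Cmod_gt_0.
  assert (Hyk : 0 < Cmod y ^ k) by now apply pow_lt.
  assert (HBy : B * Cmod y <= Cmod (c k) / 2).
  { apply Rle_trans with ((B + 1) * Cmod y); [nra|]. apply (Rmult_le_reg_r (/ (B + 1))); [apply Rinv_0_lt_compat; lra|].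
    replace ((B + 1) * Cmod y * / (B + 1)) with (Cmod y) by (field; lra). unfold Rdiv in *. lra. }
  assert (L : forall n, (S k <= n)%nat -> Cmod (csum (fun i => c i * y ^ i)%C n - c k * y ^ k)%C <= B * Cmod y * Cmod y ^ k).
  { intros n Hn. replace (c k * y ^ k)%C with (csum (fun i => c i * y ^ i)%C (S k)).
    2:{ simpl. rewrite (csum_ext _ (fun _ => RtoC 0)); [rewrite csum_zero; ring|]. intros i Hi. rewrite IH by exact Hi. ring. }
    rewrite csum_minus_tail by exact Hn. eapply Rle_trans; [apply csum_abs|].
    apply Rle_trans with (rsum (fun j => A / rho ^ S k * Cmod y ^ S k * (/ 2) ^ j) (n - S k)).
    - apply rsum_le. intros j _. rewrite Cmod_mult, Cmod_pow. specialize (HA (S k + j)%nat).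
      rewrite !pow_add in *.
      assert (Hrj : 0 < rho ^ j) by (apply pow_lt; unfold rho; lra).
      assert (Hyj : Cmod y ^ j <= rho ^ j * (/ 2) ^ j).
      { rewrite <- Rpow_mult_distr. apply pow_incr. unfold Rdiv in Hy1. lra. }
      assert (HyS : 0 < Cmod y ^ S k) by now apply pow_lt.
      apply Rle_trans with (Cmod (c (S k + j)%nat) * (Cmod y ^ S k * (rho ^ j * (/ 2) ^ j))).
      + apply Rmult_le_compat_l; [apply Cmod_ge_0|]. apply Rmult_le_compat_l; lra.
      + replace (Cmod (c (S k + j)%nat) * (Cmod y ^ S k * (rho ^ j * (/ 2) ^ j))) with
          (Cmod (c (S k + j)%nat) * (rho ^ S k * rho ^ j) * (/ rho ^ S k * Cmod y ^ S k * (/ 2) ^ j)) by (field; lra).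
        replace (A / rho ^ S k * Cmod y ^ S k * (/ 2) ^ j) with (A * (/ rho ^ S k * Cmod y ^ S k * (/ 2) ^ j)) by (unfold Rdiv; ring).
        apply Rmult_le_compat_r; [|exact HA]. apply Rmult_le_pos; [|apply pow_le; lra]. apply Rmult_le_pos; [left; now apply Rinv_0_lt_compat|lra].
    - rewrite rsum_scal. assert (G := rsum_geom_le (/ 2) (n - S k) ltac:(lra)). replace (/ (1 - / 2)) with 2 in G by field.
      apply Rle_trans with (A / rho ^ S k * Cmod y ^ S k * 2).
      + apply Rmult_le_compat_l; [|exact G]. apply Rmult_le_pos; [apply Rdiv_le_0_compat; lra|apply pow_le; lra].
      + right. unfold B. simpl. field. split; [apply pow_nonzero|]; unfold rho; lra. }
  assert (L2 : Cmod (d y - c k * y ^ k)%C <= B * Cmod y * Cmod y ^ k).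
  { apply (cconv_bound (fun n => csum (fun i => c i * y ^ i) n - c k * y ^ k)%C); [exists (S k); exact L|].
    apply cconv_minus; [apply Hd; unfold rho in *; lra|apply cconv_const]. }
  rewrite Hdy in L2. replace (RtoC 0 - c k * y ^ k)%C with (- (c k * y ^ k))%C in L2 by ring.
  rewrite Cmod_opp, Cmod_mult, Cmod_pow in L2. nra.
Qed.

Definition vanishes_near (d : C -> C) (z : C) : Prop := exists r, 0 < r /\ forall y, Cmod y < r -> d (z + y)%C = RtoC 0.

(** Connectedness of the segment: [tau] is the supremum of the parameters up to which [d] vanishes
    locally. Zeros accumulate at [g tau], so [d] vanishes near that point too, and [tau < 1] would
    contradict the choice of [tau]. *)
Lemma identity_segment (d : C -> C) (p q : C) : p <> q ->
  (forall t, 0 <= t <= 1 -> exists c r, 0 < r /\ forall y, Cmod y < r -> cpser c y (d (p + RtoC t * (q - p) + y)%C)) ->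
  vanishes_near d p -> d q = RtoC 0.
Proof.
  intros Hpq Hd H0. set (g := fun t => (p + RtoC t * (q - p))%C).
  assert (Hqp : 0 < Cmod (q - p)%C).
  { apply Cmod_gt_0. intros E. apply Hpq. replace q with (p + (q - p))%C by ring. rewrite E. ring. }
  assert (Hgg : forall s t, (g s - g t)%C = (RtoC (s - t) * (q - p))%C) by (intros; unfold g; rewrite RtoC_minus; ring).
  set (E := fun t => 0 <= t <= 1 /\ forall s, 0 <= s <= t -> vanishes_near d (g s)).
  assert (E0 : E 0).
  { split; [lra|]. intros s Hs. replace s with 0 by lra. unfold g. replace (p + RtoC 0 * (q - p))%C with p by ring. exact H0. }
  destruct (completeness E) as [tau [Hub Hlub]]; [exists 1; intros t [Ht _]; lra|now exists 0|].
  assert (Ht0 : 0 <= tau) by (apply Hub; exact E0).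
  assert (Ht1 : tau <= 1) by (apply Hlub; intros t [Ht _]; lra).
  assert (Hbelow : forall s, 0 <= s < tau -> vanishes_near d (g s)).
  { intros s Hs. destruct (classic (exists t, E t /\ s < t)) as [[t [[Ht1' Ht] Hst]]|Hn].
    - apply Ht. lra.
    - exfalso. assert (tau <= s); [|lra]. apply Hlub. intros t Ht. destruct (Rle_dec t s) as [H|H]; [exact H|].
      exfalso. apply Hn. exists t. split; [exact Ht|lra]. }
  assert (Htau : exists r, 0 < r /\ forall y, Cmod y < r -> d (g tau + y)%C = RtoC 0).
  { destruct (Req_dec tau 0) as [->|Hne].
    - unfold g. replace (p + RtoC 0 * (q - p))%C with p by ring. exact H0.
    - destruct (Hd tau ltac:(lra)) as [c [r [Hr Hc]]]. fold (g tau) in Hc.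
      assert (Hc0 := isolated_zeros c r (fun y => d (g tau + y)%C) Hr Hc).
      exists r. split; [exact Hr|]. intros y Hy.
      apply (cconv_unique (csum (fun k => c k * y ^ k)%C)); [now apply Hc|].
      apply (cconv_ext (fun _ => RtoC 0)); [|apply cconv_const]. intros n.
      rewrite (csum_ext _ (fun _ => RtoC 0)); [now rewrite csum_zero|]. intros k _. rewrite Hc0; [ring|].
      intros eps He. set (s := Rmax 0 (tau - eps / 2 / Cmod (q - p)%C)).
      assert (Hs : 0 <= s < tau).
      { unfold s. split; [apply Rmax_l|]. assert (0 < eps / 2 / Cmod (q - p)%C) by (apply Rdiv_lt_0_compat; lra).
        apply Rmax_lub_lt; lra. }
      exists (g s - g tau)%C. rewrite Hgg.
      assert (Hm : Cmod (RtoC (s - tau) * (q - p))%C = (tau - s) * Cmod (q - p)%C).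
      { rewrite Cmod_mult, Cmod_R, Rabs_left by lra. ring. }
      split; [apply Cmod_gt_0; rewrite Hm; apply Rmult_lt_0_compat; lra|]. split.
      + rewrite Hm. apply Rle_lt_trans with (eps / 2 / Cmod (q - p)%C * Cmod (q - p)%C).
        * apply Rmult_le_compat_r; [lra|]. assert (tau - eps / 2 / Cmod (q - p)%C <= s) by apply Rmax_r. lra.
        * replace (eps / 2 / Cmod (q - p)%C * Cmod (q - p)%C) with (eps / 2) by (field; lra). lra.
      + rewrite <- Hgg. destruct (Hbelow s Hs) as [r1 [Hr1 H1]]. specialize (H1 (RtoC 0) ltac:(rewrite Cmod_0; exact Hr1)).
        replace (g tau + (g s - g tau))%C with (g s + RtoC 0)%C by ring. exact H1. }
  destruct Htau as [r [Hr Hz]].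
  destruct (Req_dec tau 1) as [Hone|Hne].
  - specialize (Hz (RtoC 0) ltac:(rewrite Cmod_0; exact Hr)). rewrite Hone in Hz. unfold g in Hz.
    replace (p + RtoC 1 * (q - p) + RtoC 0)%C with q in Hz by ring. exact Hz.
  - exfalso. set (t := Rmin 1 (tau + r / 2 / Cmod (q - p)%C)).
    assert (Hpos : 0 < r / 2 / Cmod (q - p)%C) by (apply Rdiv_lt_0_compat; lra).
    assert (Ht : tau < t) by (unfold t; apply Rmin_glb_lt; lra).
    assert (Et : E t).
    { split; [split; [lra|apply Rmin_l]|]. intros s Hs. destruct (Rlt_dec s tau) as [H|H]; [apply Hbelow; lra|].
      exists (r / 2). split; [lra|]. intros y Hy. replace (g s + y)%C with (g tau + ((g s - g tau) + y))%C by ring. apply Hz.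
      eapply Rle_lt_trans; [apply Cmod_triangle|]. rewrite Hgg, Cmod_mult, Cmod_R, Rabs_pos_eq by lra.
      assert (Q1 : t <= tau + r / 2 / Cmod (q - p)%C) by apply Rmin_r.
      assert (Q2 : (s - tau) * Cmod (q - p)%C <= r / 2 / Cmod (q - p)%C * Cmod (q - p)%C) by (apply Rmult_le_compat_r; lra).
      replace (r / 2 / Cmod (q - p)%C * Cmod (q - p)%C) with (r / 2) in Q2 by (field; lra). lra. }
    assert (t <= tau) by now apply Hub. lra.
Qed.

Lemma hurwitz_zeta_unique a f g s : 0 < s -> is_hurwitz_zeta a f -> is_hurwitz_zeta a g -> f (RtoC (- s)) = g (RtoC (- s)).
Proof.
  intros Hs [Hf1 Hf2] [Hg1 Hg2]. set (d := fun z => (f z - g z)%C).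
  assert (Hd : d (RtoC (- s)) = RtoC 0).
  (* The segment from [3 + i] to [- s] meets the real axis only at its end, hence avoids the pole 1,
     and the unit disc about [3 + i] lies in the half plane where the series decides. *)
  { apply (identity_segment d ((3, 1) : C) (RtoC (- s))).
    - intros E. apply (f_equal Im) in E. simpl in E. lra.
    - intros t Ht. set (z := (((3, 1) : C) + RtoC t * (RtoC (- s) - ((3, 1) : C)))%C).
      assert (Hz : z <> RtoC 1).
      { intros E. assert (E1 := f_equal Re E). assert (E2 := f_equal Im E). unfold z in E1, E2. simpl in E1, E2.
        assert (t = 1) by lra. subst t. lra. }
      destruct (Hf1 z Hz) as [c1 [r1 H1]]. destruct (Hg1 z Hz) as [c2 [r2 H2]].
      exists (fun k => c1 k + (- RtoC 1) * c2 k)%C, (Rmin r1 r2). split; [apply Rmin_pos; apply cond_pos|].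
      intros y Hy. unfold d. specialize (H1 (z + y)%C). specialize (H2 (z + y)%C). replace (z + y - z)%C with y in H1, H2 by ring.
      specialize (H1 (Rlt_le_trans _ _ _ Hy (Rmin_l _ _))). specialize (H2 (Rlt_le_trans _ _ _ Hy (Rmin_r _ _))).
      apply is_pseries_cpser in H1. apply is_pseries_cpser in H2.
      replace (f (z + y) - g (z + y))%C with (f (z + y) + (- RtoC 1) * g (z + y))%C by ring.
      apply cpser_plus; [exact H1|now apply cpser_scal].
    - exists 1. split; [lra|]. intros y Hy. unfold d.
      assert (Hre : 1 < Re (((3, 1) : C) + y)%C).
      { assert (H := re_le_Cmod y). assert (H2 := Rle_abs (- Re y)). rewrite Rabs_Ropp in H2.
        change (1 < 3 + Re y). lra. }
      specialize (Hf2 _ Hre). specialize (Hg2 _ Hre). apply is_series_cconv in Hf2. apply is_series_cconv in Hg2.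
      rewrite (cconv_unique _ _ _ Hf2 Hg2). ring. }
  unfold d in Hd. replace (f (RtoC (- s))) with (f (RtoC (- s)) - g (RtoC (- s)) + g (RtoC (- s)))%C by ring. rewrite Hd. ring.
Qed.

(** Since [hz a] meets the specification, so does the function picked by [epsilon], and uniqueness
    identifies their values at [- s]. *)
Lemma hurwitz_zeta_hz a s : 0 < a -> 0 < s -> hurwitz_zeta (RtoC (- s)) a = hz a (RtoC (- s)).
Proof.
  intros Ha Hs. apply (hurwitz_zeta_unique a); [exact Hs| |now apply hz_is_hurwitz].
  unfold hurwitz_zeta. apply epsilon_spec. exists (hz a). now apply hz_is_hurwitz.
Qed.

(** * Hurwitz zeta functions at negative arguments, and the case of rational [beta] *)

Definition Bser (g : R) (N : nat) (w : R) : R := psum (g + 1) (fun k => / (g + 1) * bcoef k) N w.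

(** The limit behind [EN] at [z = - g], divided by [1 - z = g + 1]; all the quantities are real
    there. From here on, what is known of the zeta function is drawn from this limit. *)
Lemma hurwitz_lim g a N : 0 < g -> 0 < a -> (2 <= N)%nat -> g + 3 <= INR N ->
  is_lim_seq (fun m => rsum (fun n => Rpower (a + INR n) g) m + Bser g N (a + INR m)) (Re (hurwitz_zeta (RtoC (- g)) a)).
Proof.
  intros Hg Ha HN HNg. rewrite hurwitz_zeta_hz by assumption.
  assert (Hm : Cmod (RtoC (- g)) + 3 <= INR N) by (rewrite Cmod_R, Rabs_Ropp, Rabs_pos_eq; lra).
  rewrite (hz_eq a (RtoC (- g)) N Ha HN Hm).
  assert (H1 := partial_zeta_conv (RtoC (- g)) a N Ha HN Hm).
  assert (Hg1 : g + 1 <> 0) by lra.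
  apply (cconv_scal (RtoC (/ (g + 1)))) in H1. apply cconv_Re in H1.
  assert (E : (RtoC (/ (g + 1)) * EN (RtoC (- g)) a N)%C = (EN (RtoC (- g)) a N / (RtoC 1 - RtoC (- g)))%C).
  { unfold Cdiv. rewrite <- RtoC_minus, <- RtoC_inv by lra. replace (1 - - g) with (g + 1) by ring. ring. }
  rewrite E in H1. eapply is_lim_seq_ext; [|exact H1]. intros m. cbv beta.
  unfold partial_zeta, Bz. rewrite <- RtoC_opp, Ropp_involutive, <- RtoC_minus. replace (1 - - g) with (g + 1) by ring.
  rewrite (csum_ext (fun n => Rcpow (a + INR n) (RtoC g)) (fun n => RtoC (Rpower (a + INR n) g))) by (intros; apply Rcpow_RtoC).
  rewrite (csum_ext (fun k => RtoC (bcoef k) * (cff (RtoC (g + 1)) k * Rcpow (a + INR m) (RtoC (g + 1) - RtoC (INR k))))%C (fun k => RtoC (bcoef k * (ff (g + 1) k * Rpower (a + INR m) (g + 1 - INR k))))).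
  2:{ intros k _. rewrite cff_RtoC, <- RtoC_minus, Rcpow_RtoC, !RtoC_mult. reflexivity. }
  rewrite !csum_RtoC, <- RtoC_mult, <- RtoC_plus, <- RtoC_mult. simpl Re. unfold Bser, psum.
  rewrite Rmult_plus_distr_l, <- Rmult_assoc, Rinv_l, Rmult_1_l, <- rsum_scal by lra. f_equal.
  apply rsum_ext. intros; ring.
Qed.

Definition Z1 (g w : R) : R := Re (hurwitz_zeta (RtoC (- g)) w).

Definition e1 (g : R) (N : nat) (w : R) : R := Rpower w g - (Bser g N w - Bser g N (w + 1)).

Lemma e1_bound g N : 0 < g -> (2 <= N)%nat -> exists c, 0 <= c /\
  forall w, 2 <= w -> Rabs (e1 g N w) <= c * Rpower w (g + 1 - INR N).
Proof.
  intros Hg HN. set (s := fun k => / (g + 1) * bcoef k). set (S0 := rsum (fun k => Rabs (s k)) N).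
  destruct (psum_shift (g + 1) N 1 S0 ltac:(lra)) as [K [HK0 HK]]. exists K. split; [exact HK0|]. intros w Hw.
  specialize (HK s 1 w). rewrite Rabs_R1 in HK.
  replace (e1 g N w) with (psum (g + 1) s N (w + 1) - psum (g + 1) (shift_sym s 1) N w).
  - apply HK; try lra. intros k Hk. apply (rsum_ge_term (fun k => Rabs (s k))); [intros; apply Rabs_pos|exact Hk].
  - unfold e1, Bser. fold s.
    assert (E : psum (g + 1) s N w - psum (g + 1) (shift_sym s 1) N w = Rpower w g); [|lra].
    unfold psum. rewrite <- rsum_minus. rewrite (rsum_ext _ (fun k => if Nat.eqb k 1 then Rpower w g else 0)).
    + replace N with (2 + (N - 2))%nat by lia. rewrite rsum_add.
      rewrite (rsum_ext (fun k => if Nat.eqb (2 + k) 1 then _ else _) (fun _ => 0)) by reflexivity. rewrite rsum_zero. simpl. ring.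
    + intros k _. unfold s at 1. unfold s. rewrite shift_sym_scal.
      replace (_ - _) with (/ (g + 1) * (bcoef k - shift_sym bcoef 1 k) * ff (g + 1) k * Rpower w (g + 1 - INR k)) by ring.
      rewrite bcoef_identity. destruct (Nat.eqb_spec k 1) as [->|_]; [|ring]. simpl. replace (g + 1 - 1) with g by ring. field. lra.
Qed.

Lemma Z1_lim g a N : 0 < g -> 0 < a -> (2 <= N)%nat -> g + 3 <= INR N ->
  is_lim_seq (fun m => rsum (fun n => Rpower (a + INR n) g) m + Bser g N (a + INR m)) (Z1 g a).
Proof. intros. now apply hurwitz_lim. Qed.

Lemma Z1_step g w : 0 < g -> 0 < w -> Z1 g w - Z1 g (w + 1) = Rpower w g.
Proof.
  intros Hg Hw. destruct (order_for_spec g ltac:(lra)) as [HN1 HN2]. set (N := order_for g) in *.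
  assert (H1 := Z1_lim g w N Hg Hw HN1 HN2). assert (H2 := Z1_lim g (w + 1) N Hg ltac:(lra) HN1 HN2).
  apply is_lim_seq_incr_1 in H1.
  assert (H3 := is_lim_seq_plus' _ _ _ _ (is_lim_seq_const (Rpower w g)) H2). cbv beta in H3.
  assert (E : Finite (Z1 g w) = Finite (Rpower w g + Z1 g (w + 1))).
  { apply is_lim_seq_unique in H1. apply is_lim_seq_unique in H3. rewrite <- H1, <- H3. apply Lim_seq_ext.
    intros m. rewrite rsum_S_l. simpl INR at 1. rewrite Rplus_0_r.
    rewrite (rsum_ext (fun k => Rpower (w + INR (S k)) g) (fun n => Rpower (w + 1 + INR n) g)).
    - replace (w + INR (S m)) with (w + 1 + INR m) by (rewrite S_INR; ring). ring.
    - intros k _. f_equal. rewrite S_INR. ring. }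
  injection E as E. lra.
Qed.

(** The difference is the sum of the defects [e1] at [w, w + 1, ...], and two orders of decay are
    spent on its convergence. *)
Lemma Z1_near g N : 0 < g -> (2 <= N)%nat -> g + 3 <= INR N -> exists c, 0 <= c /\
  forall w, 2 <= w -> Rabs (Z1 g w - Bser g N w) <= c * Rpower w (g + 1 - INR N + 2).
Proof.
  intros Hg HN HNg. destruct (e1_bound g N Hg HN) as [c [Hc He]]. exists (c * 2). split; [lra|]. intros w Hw.
  assert (H1 := Z1_lim g w N Hg ltac:(lra) HN HNg).
  assert (H2 : is_lim_seq (fun m => rsum (fun n => e1 g N (w + INR n)) m) (Z1 g w - Bser g N w)).
  { eapply is_lim_seq_ext; [|exact (is_lim_seq_minus' _ _ _ _ H1 (is_lim_seq_const (Bser g N w)))].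
    intros m. cbv beta. induction m as [|m IH]; [simpl; rewrite Rplus_0_r; ring|].
    rewrite !rsum_S. unfold e1 at 2. rewrite <- IH, S_INR. replace (w + (INR m + 1)) with (w + INR m + 1) by ring. ring. }
  apply (is_lim_seq_abs _ (Finite _)) in H2. simpl in H2.
  apply (is_lim_seq_le (fun m => Rabs (rsum (fun n => e1 g N (w + INR n)) m)) (fun _ => c * 2 * Rpower w (g + 1 - INR N + 2)) _ _) with (2 := H2) (3 := is_lim_seq_const _).
  intros m. eapply Rle_trans; [apply rsum_abs|].
  apply Rle_trans with (rsum (fun n => c * Rpower w (g + 1 - INR N + 2) * / (1 + INR n * 1) ^ 2) m).
  - apply rsum_le. intros n _. assert (Hn := pos_INR n). eapply Rle_trans; [apply He; lra|]. rewrite Rmult_assoc.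
    apply Rmult_le_compat_l; [exact Hc|].
    replace (g + 1 - INR N) with ((g + 1 - INR N + 2) + - INR 2) at 1 by (simpl; ring). rewrite Rpower_plus.
    apply Rmult_le_compat; [left; apply Rpower_pos|left; apply Rpower_pos| |].
    + replace (g + 1 - INR N + 2) with (- - (g + 1 - INR N + 2)) by ring. rewrite !(Rpower_Ropp _ (- _)).
      apply Rinv_le_contravar; [apply Rpower_pos|]. apply Rle_Rpower_l; lra.
    + rewrite Rpower_Ropp, Rpower_pow by lra. apply Rinv_le_contravar; [apply pow_lt; lra|]. apply pow_incr. lra.
  - rewrite rsum_scal. assert (H := rsum_inv_sq 1 m ltac:(lra)). rewrite Rinv_1 in H.
    replace (c * 2 * Rpower w (g + 1 - INR N + 2)) with (c * Rpower w (g + 1 - INR N + 2) * 2) by ring.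
    apply Rmult_le_compat_l; [apply Rmult_le_pos; [exact Hc|left; apply Rpower_pos]|lra].
Qed.

Lemma Z1_symbol g : 0 < g -> sym1 (Z1 g) (g + 1) (fun k => / (g + 1) * bcoef k).
Proof.
  intros Hg. apply (sym_loss _ _ _ _ 2).
  - intros N. exists (rsum (fun k => Rabs (/ (g + 1) * bcoef k)) N). intros _ k _ Hk.
    apply (rsum_ge_term (fun k => Rabs (/ (g + 1) * bcoef k))); [intros; apply Rabs_pos|exact Hk].
  - intros M. destruct (order_for_spec g ltac:(lra)) as [HN1 HN2]. set (N := Nat.max M (order_for g)).
    assert (HNN : (order_for g <= N)%nat) by lia. assert (HNN' := le_INR _ _ HNN).
    destruct (Z1_near g N Hg ltac:(lia) ltac:(lra)) as [c [Hc H]]. exists N, c, 2.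
    split; [lia|]. split; [exact Hc|]. split; [lra|]. intros _ w _ Hw. replace (INR 2) with 2 by (simpl; ring). now apply H.
Qed.

(** The regularized double sum with equal steps [L]. There are [j + 1] pairs with [m + n = j], and
    with [v = w / L] one has [j + 1 = (v + j) + (1 - v)], so that the sum of [(j + 1) (w + j L)^g]
    splits into Hurwitz zeta functions of the exponents [g + 1] and [g]. *)
Definition Yblk (g L w : R) : R := Rpower L g * (Z1 (g + 1) (w / L) + (1 - w / L) * Z1 g (w / L)).

(** Coefficients of [s^2 / (1 - e^s)^2], which is [s B' - B + s B] for [B = s / (1 - e^s)]. *)
Definition ycoef (k : nat) : R := (INR k - 1) * bcoef k + match k with O => 0 | S j => bcoef j end.

Lemma Rpower_div w L p : 0 < w -> 0 < L -> Rpower (w / L) p = Rpower w p * Rpower L (- p).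
Proof.
  intros Hw HL. unfold Rdiv. rewrite <- Rpower_mult_distr; [|exact Hw|now apply Rinv_0_lt_compat]. f_equal.
  unfold Rpower. rewrite ln_Rinv by exact HL. f_equal. ring.
Qed.

Lemma Yblk_symbol g L : 0 < g -> 0 < L -> sym1 (Yblk g L) (g + 2) (fun k => kappa g * (ycoef k * (L ^ k / L ^ 2))).
Proof.
  intros Hg HL. apply (sym_loss _ _ _ _ 0).
  - intros N. exists (rsum (fun k => Rabs (kappa g * (ycoef k * (L ^ k / L ^ 2)))) N). intros _ k _ Hk.
    apply (rsum_ge_term (fun k => Rabs (kappa g * (ycoef k * (L ^ k / L ^ 2))))); [intros; apply Rabs_pos|exact Hk].
  (* The isolated summand [Z1 g] is one order below the two others, so that its expansion is needed
     with one term less. *)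
  - intros M. set (N := S M).
    destruct (Z1_symbol (g + 1) ltac:(lra) N) as [c1 [W1 [Hc1 [HW1 H1]]]].
    destruct (Z1_symbol g Hg N) as [c2 [W2 [Hc2 [HW2 H2]]]].
    destruct (Z1_symbol g Hg M) as [c3 [W3 [Hc3 [HW3 H3]]]].
    set (W := Rmax W1 (Rmax W2 W3)).
    assert (LW1 : W1 <= W) by apply Rmax_l.
    assert (LW2 : W2 <= W) by (eapply Rle_trans; [apply Rmax_l|apply Rmax_r]).
    assert (LW3 : W3 <= W) by (eapply Rle_trans; [apply Rmax_r|apply Rmax_r]).
    exists N, (Rpower L g * Rpower L (- (g + 2 - INR N)) * (c1 + c2 + c3)), (1 + W * L).
    assert (PL := Rpower_pos L). split; [lia|]. split.
    { apply Rmult_le_pos; [|lra]. apply Rmult_le_pos; left; apply PL. }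
    split; [assert (0 <= W * L) by (apply Rmult_le_pos; lra); lra|].
    intros _ w _ Hw. set (v := w / L).
    assert (Hw0 : 0 < w) by (assert (0 <= W * L) by (apply Rmult_le_pos; lra); lra).
    assert (Hv : W <= v).
    { unfold v. apply (Rmult_le_reg_r L); [exact HL|]. unfold Rdiv. rewrite Rmult_assoc, Rinv_l by lra. lra. }
    assert (Hv0 : 0 < v) by lra.
    specialize (H1 tt v I ltac:(lra)). specialize (H2 tt v I ltac:(lra)). specialize (H3 tt v I ltac:(lra)). cbv beta in H1, H2, H3.
    replace (g + 1 + 1) with (g + 2) in H1 by ring.
    assert (E : psum (g + 2) (fun k => kappa g * (ycoef k * (L ^ k / L ^ 2))) N w
      = Rpower L g * (psum (g + 2) (fun k => / (g + 2) * bcoef k) N v - v * psum (g + 1) (fun k => / (g + 1) * bcoef k) N v + psum (g + 1) (fun k => / (g + 1) * bcoef k) M v)).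
    { assert (E1 : psum (g + 2) (fun k => kappa g * (ycoef k * (L ^ k / L ^ 2))) N w = Rpower L g * psum (g + 2) (fun k => kappa g * ycoef k) N v).
      { unfold psum. rewrite <- rsum_scal. apply rsum_ext. intros k _. unfold v. rewrite Rpower_div by assumption.
        replace (- (g + 2 - INR k)) with (- g + (INR k + - INR 2)) by (simpl; ring). rewrite !Rpower_plus, !Rpower_Ropp, !Rpower_pow by exact HL.
        field; repeat split; first [apply Rgt_not_eq, PL | lra]. }
      rewrite E1. f_equal. unfold psum.
      replace (rsum (fun k => / (g + 1) * bcoef k * ff (g + 1) k * Rpower v (g + 1 - INR k)) M)
        with (rsum (fun k => match k with O => 0 | S j => / (g + 1) * bcoef j * ff (g + 1) j * Rpower v (g + 1 - INR j) end) N).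
      2:{ unfold N. rewrite rsum_S_l. ring. }
      rewrite <- rsum_scal, <- rsum_minus, <- rsum_plus. apply rsum_ext. intros k _.
      assert (EF : ff (g + 1) k = ff (g + 2) k * (g + 2 - INR k) / (g + 2)).
      { assert (F1 := ff_S_l (g + 2) k). simpl ff at 1 in F1. replace (g + 2 - 1) with (g + 1) in F1 by ring. rewrite F1. field. lra. }
      assert (EV : v * (/ (g + 1) * bcoef k * ff (g + 1) k * Rpower v (g + 1 - INR k)) = / (g + 1) * bcoef k * ff (g + 1) k * Rpower v (g + 2 - INR k)).
      { replace (g + 2 - INR k) with (1 + (g + 1 - INR k)) by ring. rewrite Rpower_plus, Rpower_1 by exact Hv0. ring. }
      rewrite EV, EF. unfold kappa, ycoef. destruct k as [|j].
      - simpl. field. lra.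
      - replace (g + 1 - INR j) with (g + 2 - INR (S j)) by (rewrite S_INR; ring).
        rewrite (ff_S_l (g + 2) j). replace (g + 2 - 1) with (g + 1) by ring. field. lra. }
    rewrite E. unfold Yblk. fold v. rewrite <- Rmult_minus_distr_l, Rabs_mult, (Rabs_pos_eq (Rpower L g)) by (left; apply PL).
    rewrite !Rmult_assoc. apply Rmult_le_compat_l; [left; apply PL|].
    assert (EW : Rpower w (g + 2 - INR N + INR 0) = Rpower v (g + 2 - INR N) * Rpower L (g + 2 - INR N)).
    { unfold v. rewrite Rpower_div by assumption. change (INR 0) with 0. rewrite Rplus_0_r, Rmult_assoc, <- Rpower_plus.
      replace (- (g + 2 - INR N) + (g + 2 - INR N)) with 0 by ring. rewrite Rpower_O by exact HL. ring. }
    rewrite EW. replace (Rpower L (- (g + 2 - INR N)) * ((c1 + c2 + c3) * (Rpower v (g + 2 - INR N) * Rpower L (g + 2 - INR N)))) with ((c1 + c2 + c3) * Rpower v (g + 2 - INR N)).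
    2:{ rewrite Rpower_Ropp. field. apply Rgt_not_eq, PL. }
    replace (g + 1 - INR M) with (g + 2 - INR N) in H3 by (unfold N; rewrite S_INR; ring).
    assert (H2' : Rabs (v * (Z1 g v - psum (g + 1) (fun k => / (g + 1) * bcoef k) N v)) <= c2 * Rpower v (g + 2 - INR N)).
    { rewrite Rabs_mult, (Rabs_pos_eq v) by lra. replace (g + 2 - INR N) with (1 + (g + 1 - INR N)) by ring.
      rewrite Rpower_plus, Rpower_1 by exact Hv0. replace (c2 * (v * Rpower v (g + 1 - INR N))) with (v * (c2 * Rpower v (g + 1 - INR N))) by ring.
      apply Rmult_le_compat_l; lra. }
    apply Rabs_le_between in H1. apply Rabs_le_between in H2'. apply Rabs_le_between in H3. apply Rabs_le. lra.
Qed.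

(** Sorts the pairs of indices by their residues modulo [nu] and [mu]. Since [nu a = mu b = L], each
    class is a double sum with both steps equal to [L]. *)
Definition blocks (mu nu : nat) (a b : R) (Y : R -> R) (w : R) : R :=
  rsum (fun r => rsum (fun s => Y (w + (INR r * a + INR s * b))) mu) nu.

Lemma telescope_step F a w n : rsum (fun r => F (w + INR r * a) - F (w + INR r * a + a)) n = F w - F (w + INR n * a).
Proof.
  induction n as [|n IH]; [simpl; rewrite Rmult_0_l, Rplus_0_r; ring|].
  rewrite rsum_S, IH, S_INR. replace (w + (INR n + 1) * a) with (w + INR n * a + a) by ring. ring.
Qed.

(** The sum of [T_a^r (1 - T_a)] over [r < nu] telescopes to [1 - T_L], and likewise for [b]. *)
Lemma blocks_DD mu nu a b L Y w : INR nu * a = L -> INR mu * b = L ->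
  DD a b (blocks mu nu a b Y) w = DD L L Y w.
Proof.
  intros Ha Hb. unfold DD, blocks.
  assert (E : forall h, rsum (fun r => rsum (fun s => Y (w + h + (INR r * a + INR s * b))) mu) nu = rsum (fun s => rsum (fun r => Y (w + h + INR s * b + INR r * a)) nu) mu).
  { intros h. rewrite rsum_exchange. apply rsum_ext. intros s _. apply rsum_ext. intros r _. f_equal. ring. }
  assert (E0 := E 0). rewrite Rplus_0_r in E0. rewrite E0, (E a), (E b).
  replace (w + a + b) with (w + (a + b)) by ring. rewrite (E (a + b)).
  rewrite <- !rsum_minus, <- rsum_plus.
  rewrite (rsum_ext _ (fun s => (Y (w + INR s * b) - Y (w + INR s * b + L)) - (Y (w + INR s * b + b) - Y (w + INR s * b + b + L)))).
  - set (F := fun x => Y x - Y (x + L)). change (rsum (fun s => F (w + INR s * b) - F (w + INR s * b + b)) mu = Y w - Y (w + L) - Y (w + L) + Y (w + L + L)).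
    rewrite telescope_step, Hb. unfold F. ring.
  - intros s _. rewrite <- rsum_minus. rewrite <- Ha. rewrite <- !(telescope_step Y a _ nu).
    rewrite <- rsum_minus, <- rsum_minus, <- rsum_plus. apply rsum_ext. intros r _.
    replace (w + a + INR s * b + INR r * a) with (w + INR s * b + INR r * a + a) by ring.
    replace (w + b + INR s * b + INR r * a) with (w + INR s * b + b + INR r * a) by ring.
    replace (w + (a + b) + INR s * b + INR r * a) with (w + INR s * b + b + INR r * a + a) by ring.
    ring.
Qed.

Lemma Yblk_DD g L w : 0 < g -> 0 < L -> 0 < w -> DD L L (Yblk g L) w = Rpower w g.
Proof.
  intros Hg HL Hw. unfold DD, Yblk.
  replace ((w + L) / L) with (w / L + 1) by (field; lra). replace ((w + L + L) / L) with (w / L + 1 + 1) by (field; lra).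
  set (v := w / L). assert (Hv : 0 < v) by (unfold v; now apply Rdiv_lt_0_compat).
  assert (S1 := Z1_step g v Hg Hv). assert (S2 := Z1_step g (v + 1) Hg ltac:(lra)).
  assert (S3 := Z1_step (g + 1) v ltac:(lra) Hv). assert (S4 := Z1_step (g + 1) (v + 1) ltac:(lra) ltac:(lra)).
  rewrite Rpower_plus, Rpower_1 in S3, S4 by lra.
  replace w with (L * v) by (unfold v; field; lra). rewrite <- Rpower_mult_distr by assumption.
  replace (Z1 g v) with (Rpower v g + Rpower (v + 1) g + Z1 g (v + 1 + 1)) by lra.
  replace (Z1 g (v + 1)) with (Rpower (v + 1) g + Z1 g (v + 1 + 1)) by lra.
  replace (Z1 (g + 1) v) with (Rpower v g * v + Rpower (v + 1) g * (v + 1) + Z1 (g + 1) (v + 1 + 1)) by lra.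
  replace (Z1 (g + 1) (v + 1)) with (Rpower (v + 1) g * (v + 1) + Z1 (g + 1) (v + 1 + 1)) by lra.
  ring.
Qed.

Lemma Reg_exists a b : 0 < a -> 0 < b -> a * b = 1 -> 1 <= 1 + a + b /\ Reg (1 + a + b) a b.
Proof.
  intros Ha Hb Hab. split; [lra|]. assert (Hi : / (1 + a + b) <= a /\ / (1 + a + b) <= b).
  { split; apply (Rmult_le_reg_r (1 + a + b)); try lra; rewrite Rinv_l by lra; nra. }
  unfold Reg. lra.
Qed.

(** Both sides solve the same equation for every exponent, so [symbol_unique] equates their
    coefficients without computing them. Then the difference tends to 0 and vanishes by
    [DD_tends0]. *)
Lemma Z2_blocks g a b (mu nu : nat) L : 0 < g -> 0 < a -> 0 < b -> a * b = 1 -> (1 <= mu)%nat -> (1 <= nu)%nat ->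
  INR nu * a = L -> INR mu * b = L ->
  forall w, 2 * (a + b) + 1 <= w -> Z2 g a b w = blocks mu nu a b (Yblk g L) w.
Proof.
  intros Hg Ha Hb Hab Hmu Hnu HaL HbL.
  assert (HL : 0 < L) by (rewrite <- HaL; apply Rmult_lt_0_compat; [apply lt_0_INR; lia|exact Ha]).
  destruct (Reg_exists a b Ha Hb Hab) as [HB HR].
  set (t := fun k => rsum (fun r => rsum (fun s => shift_sym (fun k => ycoef k * (L ^ k / L ^ 2)) (INR r * a + INR s * b) k) mu) nu).
  assert (HG : forall g', 0 < g' -> sym1 (blocks mu nu a b (Yblk g' L)) (g' + 2) (fun k => kappa g' * t k)).
  { intros g' Hg'. unfold blocks, sym1.
    apply (sym_ext _ (fun _ w => rsum (fun r => rsum (fun s => Yblk g' L (w + (INR r * a + INR s * b))) mu) nu) _ _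
      (fun _ k => rsum (fun r => rsum (fun s => shift_sym (fun k => kappa g' * (ycoef k * (L ^ k / L ^ 2))) (INR r * a + INR s * b) k) mu) nu)).
    - reflexivity.
    - intros _ k _. unfold t. rewrite <- rsum_scal. apply rsum_ext. intros r _. rewrite <- rsum_scal. apply rsum_ext. intros s _.
      now rewrite shift_sym_scal.
    - apply (sym_rsum _ (fun r (_ : unit) w => rsum (fun s => Yblk g' L (w + (INR r * a + INR s * b))) mu) _ (fun r _ k => rsum (fun s => shift_sym (fun k => kappa g' * (ycoef k * (L ^ k / L ^ 2))) (INR r * a + INR s * b) k) mu)).
      intros r _.
      apply (sym_rsum _ (fun s (_ : unit) w => Yblk g' L (w + (INR r * a + INR s * b))) _ (fun s _ k => shift_sym (fun k => kappa g' * (ycoef k * (L ^ k / L ^ 2))) (INR r * a + INR s * b) k)).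
      intros s _.
      apply (sym_shift _ (fun _ => Yblk g' L) _ (fun _ k => kappa g' * (ycoef k * (L ^ k / L ^ 2))) (fun _ => INR r * a + INR s * b) (Rabs (INR r * a + INR s * b))).
      + apply Rabs_pos.
      + intros _ _. apply Rle_refl.
      + intros N. exists (rsum (fun k => Rabs (kappa g' * (ycoef k * (L ^ k / L ^ 2)))) N). intros _ k _ Hk.
        apply (rsum_ge_term (fun k => Rabs (kappa g' * (ycoef k * (L ^ k / L ^ 2))))); [intros; apply Rabs_pos|exact Hk].
      + now apply Yblk_symbol. }
  assert (HF : forall g', 0 < g' -> sym1 (Z2 g' a b) (g' + 2) (fun k => kappa g' * acoef a b k)).
  { intros g' Hg'. exact (sym_at _ _ _ _ (a, b) (Z2_symbol g' (1 + a + b) Hg' HB) HR). }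
  assert (HDD : forall g' w, 0 < g' -> 2 * (a + b) + 1 <= w -> DD a b (Z2 g' a b) w = DD a b (blocks mu nu a b (Yblk g' L)) w).
  { intros g' w Hg' Hw. rewrite (Z2_DD g' a b w (1 + a + b)) by assumption. rewrite (blocks_DD mu nu a b L) by assumption.
    rewrite Yblk_DD by lra. reflexivity. }
  assert (ES : forall k, acoef a b k = t k).
  { apply (symbol_unique a b mu nu (fun g' => Z2 g' a b) (fun g' => blocks mu nu a b (Yblk g' L))); try assumption.
    - lra.
    - intros g' Hg'. exists (2 * (a + b) + 1). intros w Hw. now apply HDD. }
  intros w Hw. apply Rminus_diag_uniq.
  apply (DD_tends0 a b (fun w => Z2 g a b w - blocks mu nu a b (Yblk g L) w) (2 * (a + b) + 1) Ha Hb); [| |exact Hw].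
  - intros x Hx. rewrite DD_minus, HDD by assumption. ring.
  - apply (symbol_eq_tends0 _ _ (g + 2) (fun k => kappa g * acoef a b k)); [now apply HF|].
    apply (sym_ext _ (fun _ => blocks mu nu a b (Yblk g L)) _ _ (fun _ k => kappa g * t k)); [reflexivity| |now apply HG].
    intros _ k _. now rewrite ES.
Qed.

Definition zp (g v : R) : R := hurwitz_zetaR (- g) (frac_part v).

Lemma Int_part_unique v z : IZR z <= v < IZR z + 1 -> Int_part v = z.
Proof.
  intros H. destruct (base_Int_part v) as [H1 H2].
  assert (H3 : (Int_part v < z + 1)%Z) by (apply lt_IZR; rewrite plus_IZR; lra).
  assert (H4 : (z < Int_part v + 1)%Z) by (apply lt_IZR; rewrite plus_IZR; lra). lia.
Qed.

Lemma frac_part_shift v z : frac_part (v + IZR z) = frac_part v.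
Proof.
  unfold frac_part. rewrite (Int_part_unique (v + IZR z) (Int_part v + z)).
  - rewrite plus_IZR. ring.
  - rewrite plus_IZR. destruct (base_Int_part v). lra.
Qed.

Lemma zp_periodic g v : zp g (v + 1) = zp g v.
Proof. unfold zp. now rewrite (frac_part_shift v 1). Qed.

Lemma zp_unit g v : 0 < v <= 1 -> zp g v = Z1 g v.
Proof.
  intros Hv. unfold zp, hurwitz_zetaR, Z1, frac_part. destruct (Req_dec v 1) as [->|Hv1].
  - rewrite (Int_part_unique 1 1) by lra. destruct (Req_EM_T (1 - 1) 0) as [_|E]; [reflexivity|exfalso; lra].
  - rewrite (Int_part_unique v 0) by lra. rewrite Rminus_0_r. destruct (Req_EM_T v 0) as [E|_]; [exfalso; lra|reflexivity].
Qed.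

(** Passing from [v] to its fractional part adds the powers [(v - j)^g] with [1 <= j < v], a Riesz
    mean in one dimension. This is how the fractional part enters the theorem. *)
Lemma zp_Z1 g v : 0 < g -> 0 < v -> zp g v = Z1 g v + Rrow g 1 v.
Proof.
  intros Hg Hv. assert (G : forall n v, 0 < v <= INR n + 1 -> zp g v = Z1 g v + Rrow g 1 v).
  { clear v Hv. induction n as [|n IH]; intros v Hv.
    - simpl in Hv. rewrite zp_unit, Rrow_zero by lra. ring.
    - destruct (Rle_dec v 1) as [H|H]; [rewrite zp_unit, Rrow_zero by lra; ring|].
      rewrite S_INR in Hv. specialize (IH (v - 1) ltac:(lra)).
      assert (S1 := Z1_step g (v - 1) Hg ltac:(lra)). assert (S2 := Rrow_step g 1 (v - 1) ltac:(lra)).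
      assert (S3 := zp_periodic g (v - 1)). rewrite pp_pos in S2 by lra.
      replace (v - 1 + 1) with v in * by ring. lra. }
  destruct (INR_unbounded v) as [n Hn]. apply (G n). lra.
Qed.

(* The oscillatory term for rational [beta] as a function of [w], before Fourier expansion. *)
Definition oblk (g L w : R) : R := - Rpower L g * (zp (g + 1) (w / L) + (1 - w / L) * zp g (w / L)).

Lemma oblk_DD g L w : 0 < L -> DD L L (oblk g L) w = 0.
Proof.
  intros HL. unfold DD, oblk.
  replace ((w + L) / L) with (w / L + 1) by (field; lra). replace ((w + L + L) / L) with (w / L + 1 + 1) by (field; lra).
  rewrite !zp_periodic. ring.
Qed.

(** The Riesz mean with equal steps [L]. There are [j - 1] pairs of positive integers with sum [j],
    and with [v = w / L] one has [j - 1 = (v - 1) - (v - j)]. *)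
Definition rblk (g L w : R) : R := Rpower L g * ((w / L - 1) * Rrow g 1 (w / L) - Rrow (g + 1) 1 (w / L)).

Lemma rblk_DD g L w : 0 < g -> 0 < L -> DD L L (rblk g L) w = pp g w.
Proof.
  intros Hg HL. unfold DD, rblk.
  replace ((w + L) / L) with (w / L + 1) by (field; lra). replace ((w + L + L) / L) with (w / L + 1 + 1) by (field; lra).
  set (v := w / L).
  assert (S1 := Rrow_step g 1 v ltac:(lra)). assert (S2 := Rrow_step g 1 (v + 1) ltac:(lra)).
  assert (S3 := Rrow_step (g + 1) 1 v ltac:(lra)). assert (S4 := Rrow_step (g + 1) 1 (v + 1) ltac:(lra)).
  assert (P : forall x, pp (g + 1) x = x * pp g x).
  { intros x. destruct (Rle_dec x 0) as [H|H]; [rewrite !pp_neg by lra; ring|].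
    rewrite !pp_pos by lra. rewrite Rpower_plus, Rpower_1 by lra. ring. }
  rewrite !P in *.
  assert (E : pp g w = Rpower L g * pp g v).
  { destruct (Rle_dec w 0) as [H|H].
    - rewrite !pp_neg; [ring| |lra]. unfold v, Rdiv. assert (0 < / L) by now apply Rinv_0_lt_compat. nra.
    - assert (Hv : 0 < v) by (unfold v; apply Rdiv_lt_0_compat; lra). rewrite !pp_pos by lra.
      rewrite Rpower_mult_distr by lra. f_equal. unfold v. field. lra. }
  rewrite E.
  replace (Rrow g 1 (v + 1 + 1)) with (Rrow g 1 v + pp g v + pp g (v + 1)) by lra.
  replace (Rrow g 1 (v + 1)) with (Rrow g 1 v + pp g v) by lra.
  replace (Rrow (g + 1) 1 (v + 1 + 1)) with (Rrow (g + 1) 1 v + v * pp g v + (v + 1) * pp g (v + 1)) by lra.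
  replace (Rrow (g + 1) 1 (v + 1)) with (Rrow (g + 1) 1 v + v * pp g v) by lra. ring.
Qed.

Lemma rblk_zero g L w : 0 < L -> w <= 2 * L -> rblk g L w = 0.
Proof.
  intros HL Hw. unfold rblk. set (v := w / L). assert (Hv : v <= 2).
  { unfold v. apply (Rmult_le_reg_r L); [exact HL|]. unfold Rdiv. rewrite Rmult_assoc, Rinv_l; lra. }
  rewrite !(Rrow_finite _ 1 v 2) by (simpl; lra). simpl. rewrite !Rplus_0_l. replace (v - (1 + 1) * 1) with (v - 2) by ring.
  rewrite !(pp_neg _ (v - 2)) by lra. rewrite Rmult_1_l.
  destruct (Rle_dec v 1) as [H|H]; [rewrite !pp_neg by lra; ring|].
  rewrite !pp_pos by lra. rewrite Rpower_plus, Rpower_1 by lra. ring.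
Qed.

(** Read at [w - a - b], the equation expresses [F w] by values at least [Rmin a b] further to the
    left, so that zeros propagate to the right. *)
Lemma DD_zero_forward a b F : 0 < a -> 0 < b -> (forall w, DD a b F w = 0) -> (forall w, w <= a + b -> F w = 0) ->
  forall w, F w = 0.
Proof.
  intros Ha Hb HF H0. set (m := Rmin a b). assert (Hm : 0 < m) by now apply Rmin_pos.
  assert (Ma : m <= a) by apply Rmin_l. assert (Mb : m <= b) by apply Rmin_r.
  assert (G : forall n w, w <= a + b + INR n * m -> F w = 0).
  { induction n as [|n IH]; intros w Hw; [apply H0; simpl in Hw; lra|].
    rewrite S_INR in Hw. assert (E := HF (w - a - b)). unfold DD in E.
    replace (w - a - b + a + b) with w in E by ring. replace (w - a - b + a) with (w - b) in E by ring.
    replace (w - a - b + b) with (w - a) in E by ring.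
    rewrite (IH (w - b)), (IH (w - a)), (IH (w - a - b)) in E by lra. lra. }
  intros w. destruct (steps_exist m w Hm) as [n Hn]. apply (G n). lra.
Qed.

Lemma Rdbl_blocks g a b mu nu L w : 0 < g -> 0 < a -> 0 < b -> (1 <= mu)%nat -> (1 <= nu)%nat ->
  INR nu * a = L -> INR mu * b = L -> Rdbl g a b w = blocks mu nu a b (rblk g L) w.
Proof.
  intros Hg Ha Hb Hmu Hnu HaL HbL.
  assert (HL : 0 < L) by (rewrite <- HaL; apply Rmult_lt_0_compat; [apply lt_0_INR; lia|exact Ha]).
  apply Rminus_diag_uniq. apply (DD_zero_forward a b (fun w => Rdbl g a b w - blocks mu nu a b (rblk g L) w) Ha Hb).
  - intros x. rewrite DD_minus, Rdbl_DD, (blocks_DD mu nu a b L), rblk_DD by assumption. ring.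
  - intros x Hx. rewrite Rdbl_zero by assumption. unfold blocks.
    rewrite (rsum_ext _ (fun _ => 0)); [rewrite rsum_zero; ring|]. intros r Hr.
    rewrite (rsum_ext _ (fun _ => 0)); [apply rsum_zero|]. intros s Hs. apply rblk_zero; [exact HL|].
    assert (R1 : INR (S r) * a <= INR nu * a) by (apply INR_mono_b; [exact Ha|lia]).
    assert (R2 : INR (S s) * b <= INR mu * b) by (apply INR_mono_b; [exact Hb|lia]). rewrite S_INR in R1, R2. lra.
Qed.

(** In the difference of the two block formulas each [Rrow] meets a [Z1], and [zp_Z1] merges them
    into a periodic zeta function. *)
Lemma osc_blocks g a b mu nu L w : 0 < g -> 0 < a -> 0 < b -> a * b = 1 -> (1 <= mu)%nat -> (1 <= nu)%nat ->
  INR nu * a = L -> INR mu * b = L -> 2 * (a + b) + 1 <= w ->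
  Rdbl g a b w - Z2 g a b w = blocks mu nu a b (oblk g L) w.
Proof.
  intros Hg Ha Hb Hab Hmu Hnu HaL HbL Hw.
  assert (HL : 0 < L) by (rewrite <- HaL; apply Rmult_lt_0_compat; [apply lt_0_INR; lia|exact Ha]).
  rewrite (Z2_blocks g a b mu nu L) by assumption. rewrite (Rdbl_blocks g a b mu nu L) by assumption.
  unfold blocks. rewrite <- rsum_minus. apply rsum_ext. intros r _. rewrite <- rsum_minus. apply rsum_ext. intros s _.
  assert (0 <= INR r * a) by (apply Rmult_le_pos; [apply pos_INR|lra]).
  assert (0 <= INR s * b) by (apply Rmult_le_pos; [apply pos_INR|lra]).
  set (x := w + (INR r * a + INR s * b)). assert (Hx : 0 < x) by (unfold x; lra).
  assert (Hv : 0 < x / L) by now apply Rdiv_lt_0_compat.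
  unfold rblk, Yblk, oblk. rewrite !zp_Z1 by lra. ring.
Qed.

(** * Integrals of continuous functions *)

Definition rint (f : R -> R) (a b : R) : R := RInt f a b.

Definition cont_on (f : R -> R) (a b : R) : Prop := forall x, a <= x <= b -> continuous f x.

Lemma rint_ex f a b : a <= b -> cont_on f a b -> ex_RInt f a b.
Proof. intros H Hf. apply (ex_RInt_continuous (V := R_CompleteNormedModule)). intros z Hz. rewrite Rmin_left, Rmax_right in Hz by exact H. now apply Hf. Qed.

Lemma cont_plus (f g : R -> R) x : continuous f x -> continuous g x -> continuous (fun u => f u + g u) x.
Proof. intros H1 H2. exact (continuous_plus f g x H1 H2). Qed.

Lemma cont_minus (f g : R -> R) x : continuous f x -> continuous g x -> continuous (fun u => f u - g u) x.
Proof. intros H1 H2. exact (continuous_minus f g x H1 H2). Qed.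

Lemma cont_mult (f g : R -> R) x : continuous f x -> continuous g x -> continuous (fun u => f u * g u) x.
Proof. intros H1 H2. exact (continuous_mult f g x H1 H2). Qed.

Lemma cont_const (c x : R) : continuous (fun _ : R => c) x.
Proof. apply continuous_const. Qed.

Lemma cont_rsum (f : nat -> R -> R) n x : (forall k, (k < n)%nat -> continuous (f k) x) -> continuous (fun u => rsum (fun k => f k u) n) x.
Proof.
  induction n as [|n IH]; intros H; simpl; [apply cont_const|].
  apply cont_plus; [apply IH; intros; apply H; lia|apply H; lia].
Qed.

Lemma cont_shift (f : R -> R) h x : continuous f (x + h) -> continuous (fun u => f (u + h)) x.
Proof.
  intros H. apply (continuous_comp (fun u : R => u + h) f x); [|exact H].
  apply cont_plus; [apply continuous_id|apply cont_const].
Qed.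

Lemma cont_derive (f : R -> R) x l : is_derive f x l -> continuous f x.
Proof. intros H. apply (ex_derive_continuous f). now exists l. Qed.

Lemma rint_plus f g a b : a <= b -> cont_on f a b -> cont_on g a b -> rint (fun x => f x + g x) a b = rint f a b + rint g a b.
Proof. intros H Hf Hg. exact (RInt_plus (V := R_CompleteNormedModule) f g a b (rint_ex f a b H Hf) (rint_ex g a b H Hg)). Qed.

Lemma rint_minus f g a b : a <= b -> cont_on f a b -> cont_on g a b -> rint (fun x => f x - g x) a b = rint f a b - rint g a b.
Proof. intros H Hf Hg. exact (RInt_minus (V := R_CompleteNormedModule) f g a b (rint_ex f a b H Hf) (rint_ex g a b H Hg)). Qed.

Lemma rint_scal f a b c : a <= b -> cont_on f a b -> rint (fun x => c * f x) a b = c * rint f a b.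
Proof. intros H Hf. exact (RInt_scal (V := R_CompleteNormedModule) f a b c (rint_ex f a b H Hf)). Qed.

Lemma rint_split f a b c : a <= b -> b <= c -> cont_on f a c -> rint f a c = rint f a b + rint f b c.
Proof.
  intros H1 H2 Hf. symmetry. apply (RInt_Chasles (V := R_CompleteNormedModule) f a b c); apply rint_ex; try assumption; intros x Hx; apply Hf; lra.
Qed.

Lemma rint_abs f a b M : a <= b -> cont_on f a b -> (forall x, a <= x <= b -> Rabs (f x) <= M) -> Rabs (rint f a b) <= (b - a) * M.
Proof. intros H Hf HM. apply abs_RInt_le_const; [exact H|now apply rint_ex|exact HM]. Qed.

Lemma rint_abs_le f g a b : a <= b -> cont_on f a b -> cont_on g a b -> (forall x, a <= x <= b -> Rabs (f x) <= g x) -> Rabs (rint f a b) <= rint g a b.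
Proof.
  intros H Hf Hg HM. apply Rabs_le. split.
  - replace (- rint g a b) with (rint (fun x => -1 * g x) a b) by (rewrite (rint_scal g a b (-1) H Hg); ring).
    unfold rint; apply RInt_le; [exact H|apply rint_ex; [exact H|]|now apply rint_ex|].
    + intros x Hx. apply cont_mult; [apply cont_const|now apply Hg].
    + intros x Hx. assert (B := proj1 (Rabs_le_between _ _) (HM x ltac:(lra))). lra.
  - unfold rint; apply RInt_le; [exact H|now apply rint_ex|now apply rint_ex|].
    intros x Hx. assert (B := proj1 (Rabs_le_between _ _) (HM x ltac:(lra))). lra.
Qed.

Lemma rint_le f g a b : a <= b -> cont_on f a b -> cont_on g a b -> (forall x, a <= x <= b -> f x <= g x) -> rint f a b <= rint g a b.
Proof. intros H Hf Hg HM. apply RInt_le; [exact H|now apply rint_ex|now apply rint_ex|]. intros x Hx. apply HM. lra. Qed.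

Lemma rint_ftc F f a b : a <= b -> cont_on f a b -> (forall x, a <= x <= b -> is_derive F x (f x)) -> rint f a b = F b - F a.
Proof.
  intros H Hf HF. apply is_RInt_unique. apply (is_RInt_derive (V := R_CompleteNormedModule) F f a b).
  - intros x Hx. rewrite Rmin_left, Rmax_right in Hx by exact H. now apply HF.
  - intros x Hx. rewrite Rmin_left, Rmax_right in Hx by exact H. now apply Hf.
Qed.

Lemma rint_ext f g a b : a <= b -> (forall x, a < x < b -> f x = g x) -> rint f a b = rint g a b.
Proof. intros H E. apply RInt_ext. intros x Hx. rewrite Rmin_left, Rmax_right in Hx by exact H. now apply E. Qed.

Lemma rint_shift f a b h : a <= b -> cont_on f (a + h) (b + h) -> rint (fun x => f (x + h)) a b = rint f (a + h) (b + h).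
Proof.
  intros H Hf. assert (E := RInt_comp_lin (V := R_CompleteNormedModule) f 1 h a b). rewrite !Rmult_1_l in E.
  unfold rint at 2. rewrite <- E; [|apply rint_ex; [lra|exact Hf]]. symmetry; apply rint_ext; [exact H|]. intros x _. unfold scal; simpl. unfold mult; simpl. rewrite !Rmult_1_l. reflexivity.
Qed.

Lemma rint_dilate f a b r : a <= b -> 0 < r -> cont_on f (r * a) (r * b) -> r * rint (fun x => f (r * x)) a b = rint f (r * a) (r * b).
Proof.
  intros H Hr Hf. assert (E := RInt_comp_lin (V := R_CompleteNormedModule) f r 0 a b). rewrite !Rplus_0_r in E.
  unfold rint at 2. rewrite <- E; [|apply rint_ex; [nra|exact Hf]]. rewrite <- rint_scal.
  - symmetry; apply rint_ext; [exact H|]. intros x _. unfold scal; simpl. unfold mult; simpl. rewrite Rplus_0_r. reflexivity.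
  - exact H.
  - intros x Hx. apply (continuous_comp (fun u : R => r * u) f x).
    + apply cont_mult; [apply cont_const|apply continuous_id].
    + apply Hf. nra.
Qed.

Lemma rint_const c a b : rint (fun _ => c) a b = (b - a) * c.
Proof. exact (RInt_const (V := R_CompleteNormedModule) a b c). Qed.

Lemma rint_rsum (f : nat -> R -> R) n a b : a <= b -> (forall k, (k < n)%nat -> cont_on (f k) a b) ->
  rint (fun x => rsum (fun k => f k x) n) a b = rsum (fun k => rint (f k) a b) n.
Proof.
  intros H. induction n as [|n IH]; intros Hf; simpl; [rewrite rint_const; ring|].
  rewrite rint_plus; [rewrite IH; [reflexivity|intros; apply Hf; lia]|exact H| |apply Hf; lia].
  intros x Hx. apply cont_rsum. intros k Hk. apply Hf; [lia|exact Hx].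
Qed.

Lemma cont_uniform (f : R -> R) x d : 0 < d ->
  (forall eps, 0 < eps -> exists g, continuous g x /\ forall y, Rabs (y - x) < d -> Rabs (f y - g y) <= eps) -> continuous f x.
Proof.
  intros Hd H. apply continuity_pt_filterlim. intros eps He.
  destruct (H (eps / 4) ltac:(lra)) as [g [Hg Hfg]]. apply continuity_pt_filterlim in Hg.
  destruct (Hg (eps / 4) ltac:(lra)) as [d1 [Hd1 H1]].
  exists (Rmin d d1). split; [now apply Rmin_pos|]. intros y [Hy1 Hy2]. simpl in *. unfold Rdist in *.
  assert (G1 := Hfg y (Rlt_le_trans _ _ _ Hy2 (Rmin_l _ _))). assert (G2 := Hfg x ltac:(rewrite Rminus_diag, Rabs_R0; exact Hd)).
  assert (G3 := H1 y (conj Hy1 (Rlt_le_trans _ _ _ Hy2 (Rmin_r _ _)))).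
  apply Rabs_le_between in G1. apply Rabs_le_between in G2. apply Rabs_lt_between in G3. apply Rabs_lt_between. lra.
Qed.

Lemma pp_continuous g y : 0 < g -> continuous (pp g) y.
Proof.
  intros Hg. destruct (Rtotal_order y 0) as [H|[H|H]].
  - apply (continuous_ext_loc (T := R_UniformSpace) (U := R_UniformSpace) (pp g) (fun _ => 0) y); [|apply cont_const].
    exists (mkposreal (- y) ltac:(lra)). intros z Hz. unfold ball in Hz; simpl in Hz. unfold AbsRing_ball, abs, minus, plus, opp in Hz; simpl in Hz.
    apply Rabs_lt_between in Hz. rewrite pp_neg; [reflexivity|lra].
  - subst y. apply continuity_pt_filterlim. intros eps He.
    exists (Rpower eps (/ g)). split; [apply Rpower_pos|]. intros z [_ Hz]. simpl in *. unfold Rdist in *.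
    rewrite (pp_neg g 0) by lra. rewrite Rminus_0_r in *. rewrite Rabs_pos_eq by apply pp_nonneg.
    destruct (Rle_dec z 0) as [Hz0|Hz0]; [rewrite pp_neg by exact Hz0; exact He|].
    rewrite pp_pos by lra. rewrite Rabs_pos_eq in Hz by lra.
    apply Rlt_le_trans with (Rpower (Rpower eps (/ g)) g).
    + unfold Rpower at 1 2. apply exp_increasing. apply Rmult_lt_compat_l; [exact Hg|]. apply ln_increasing; lra.
    + rewrite Rpower_mult, Rinv_l, Rpower_1 by lra. lra.
  - apply (continuous_ext_loc (T := R_UniformSpace) (U := R_UniformSpace) (pp g) (fun z => Rpower z g) y).
    + exists (mkposreal y H). intros z Hz. unfold ball in Hz; simpl in Hz. unfold AbsRing_ball, abs, minus, plus, opp in Hz; simpl in Hz.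
      apply Rabs_lt_between in Hz. rewrite pp_pos; [reflexivity|lra].
    + apply (cont_derive _ _ (g * Rpower y (g - 1))). apply is_derive_Reals. now apply derivable_pt_lim_power.
Qed.

Lemma Rpower_continuous p x : 0 < x -> continuous (fun u => Rpower u p) x.
Proof. intros Hx. apply (cont_derive _ _ (p * Rpower x (p - 1))). apply is_derive_Reals. now apply derivable_pt_lim_power. Qed.

Lemma psum_continuous q s N x : 0 < x -> continuous (psum q s N) x.
Proof.
  intros Hx. unfold psum. apply (cont_rsum (fun k w => s k * ff q k * Rpower w (q - INR k))). intros k _.
  apply cont_mult; [apply cont_const|now apply Rpower_continuous].
Qed.

Lemma Z1_shift g w m : 0 < g -> 0 < w -> Z1 g w = rsum (fun n => Rpower (w + INR n) g) m + Z1 g (w + INR m).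
Proof.
  intros Hg Hw. induction m as [|m IH]; [simpl; rewrite Rplus_0_r; ring|].
  rewrite rsum_S, S_INR. assert (Hm := pos_INR m). assert (H := Z1_step g (w + INR m) Hg ltac:(lra)).
  replace (w + (INR m + 1)) with (w + INR m + 1) by ring. lra.
Qed.

Lemma Z1_near2 g : 0 < g -> exists N c, 0 <= c /\ forall w, 2 <= w -> Rabs (Z1 g w - Bser g N w) <= c * Rpower w (-2).
Proof.
  intros Hg. destruct (order_for_spec (g + 2) ltac:(lra)) as [HN1 HN2].
  destruct (Z1_near g (order_for (g + 2)) Hg HN1 ltac:(lra)) as [c [Hc H]]. exists (order_for (g + 2)), c. split; [exact Hc|].
  intros w Hw. eapply Rle_trans; [apply H, Hw|]. apply Rmult_le_compat_l; [exact Hc|]. apply Rpower_le_exp; lra.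
Qed.

Lemma Rpower_m2 w : 0 < w -> Rpower w (-2) = / w ^ 2.
Proof. intros Hw. replace (-2) with (- INR 2) by (simpl; ring). now rewrite Rpower_Ropp, Rpower_pow. Qed.

(** After [m] unit steps the error of [Bser] is [O(m^(-2))] uniformly near [x], so that [Z1] is a
    locally uniform limit of finite sums of powers. *)
Lemma Z1_continuous g x : 0 < g -> 0 < x -> continuous (Z1 g) x.
Proof.
  intros Hg Hx. destruct (Z1_near2 g Hg) as [N [c [Hc H]]].
  apply (cont_uniform _ x x Hx). intros eps He.
  destruct (INR_unbounded (c / eps)) as [m0 Hm0]. set (m := (m0 + 2)%nat).
  exists (fun w => rsum (fun n => Rpower (w + INR n) g) m + Bser g N (w + INR m)). assert (Hm := pos_INR m). split.
  - apply cont_plus.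
    + apply (cont_rsum (fun n w => Rpower (w + INR n) g)). intros n _. assert (Hn := pos_INR n).
      apply (cont_shift (fun w => Rpower w g)). apply Rpower_continuous. lra.
    + apply (cont_shift (Bser g N)). apply psum_continuous. lra.
  - intros y Hy. apply Rabs_lt_between in Hy. rewrite (Z1_shift g y m) by lra.
    replace (_ - _) with (Z1 g (y + INR m) - Bser g N (y + INR m)) by ring.
    assert (Hm2 : INR m = INR m0 + 2) by (unfold m; rewrite plus_INR; reflexivity). assert (Hm0' := pos_INR m0).
    eapply Rle_trans; [apply H; lra|]. rewrite Rpower_m2 by lra.
    set (z := y + INR m). assert (Hz : INR m0 + 2 <= z) by (unfold z; lra).
    apply (Rmult_le_reg_r (z ^ 2)); [apply pow_lt; lra|]. rewrite Rmult_assoc, Rinv_l by (apply pow_nonzero; lra).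
    assert (Hce : c <= eps * INR m0).
    { apply (Rmult_le_reg_r (/ eps)); [now apply Rinv_0_lt_compat|]. unfold Rdiv in Hm0. replace (eps * INR m0 * / eps) with (INR m0) by (field; lra). lra. }
    rewrite Rmult_1_r. apply Rle_trans with (eps * INR m0); [exact Hce|]. apply Rmult_le_compat_l; [lra|]. simpl. nra.
Qed.

(* [zeta (- g, u)] for [u > 0], extended continuously to [u = 0]. *)
Definition F0 (g u : R) : R := pp g u + Z1 g (u + 1).

Lemma F0_Z1 g u : 0 < g -> 0 < u -> F0 g u = Z1 g u.
Proof. intros Hg Hu. unfold F0. rewrite pp_pos by exact Hu. assert (H := Z1_step g u Hg Hu). lra. Qed.

Lemma F0_step g u : 0 < g -> 0 <= u -> F0 g (u + 1) = F0 g u - pp g u.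
Proof. intros Hg Hu. rewrite F0_Z1 by lra. unfold F0. ring. Qed.

Lemma F0_continuous g u : 0 < g -> -1 < u -> continuous (F0 g) u.
Proof.
  intros Hg Hu. apply cont_plus; [now apply pp_continuous|]. apply (cont_shift (Z1 g)). apply Z1_continuous; lra.
Qed.

(** * Euler's integral *)

Lemma exp_pow_bound n x : 0 <= x -> x ^ n <= INR (fact n) * exp x.
Proof.
  intros Hx. assert (H := exp_ge_taylor x n Hx).
  assert (H2 : x ^ n / INR (fact n) <= sum_f_R0 (fun k => x ^ k / INR (fact k)) n).
  { assert (P : forall k, 0 <= x ^ k / INR (fact k)) by (intros; apply Rdiv_le_0_compat; [now apply pow_le|apply INR_fact_lt_0]).
    destruct n as [|n]; [simpl; lra|]. rewrite tech5. assert (0 <= sum_f_R0 (fun k => x ^ k / INR (fact k)) n) by (apply cond_pos_sum; exact P). lra. }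
  assert (H3 : x ^ n / INR (fact n) <= exp x) by lra. assert (Hf := INR_fact_lt_0 n).
  apply (Rmult_le_reg_r (/ INR (fact n))); [now apply Rinv_0_lt_compat|].
  replace (INR (fact n) * exp x * / INR (fact n)) with (exp x) by (field; lra). exact H3.
Qed.

Lemma exp_Rpower_bound p : exists c, 0 < c /\ forall x, 1 <= x -> Rpower x p <= c * exp x.
Proof.
  destruct (INR_unbounded p) as [n Hn]. exists (INR (fact n)). split; [apply INR_fact_lt_0|]. intros x Hx.
  eapply Rle_trans; [|apply exp_pow_bound; lra]. rewrite <- Rpower_pow by lra. apply Rpower_le_exp; lra.
Qed.

Lemma pp_exp_bound g : 0 < g -> exists c, 0 < c /\ forall x, 0 <= x -> pp g x * exp (- x) <= c * exp (- x / 2).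
Proof.
  intros Hg. destruct (exp_Rpower_bound g) as [c [Hc H]]. exists (Rpower 2 g * (c + 1)).
  assert (P2 := Rpower_pos 2 g). split; [apply Rmult_lt_0_compat; lra|]. intros x Hx.
  replace (- x) with (- x / 2 + - (x / 2)) at 1 by field. rewrite exp_plus, (Rmult_comm (exp (- x / 2))), <- Rmult_assoc.
  apply Rmult_le_compat_r; [left; apply exp_pos|].
  assert (HH : pp g x <= Rpower 2 g * (c + 1) * exp (x / 2)).
  { destruct (Rle_dec 2 x) as [H2|H2].
    - rewrite pp_pos by lra. specialize (H (x / 2) ltac:(lra)).
      replace x with (2 * (x / 2)) at 1 by field. rewrite <- Rpower_mult_distr by lra. rewrite Rmult_assoc.
      apply Rmult_le_compat_l; [lra|]. assert (E := exp_pos (x / 2)). nra.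
    - apply Rle_trans with (Rpower 2 g); [rewrite <- (pp_pos g 2) by lra; apply pp_le; lra|].
      assert (1 <= exp (x / 2)) by (rewrite <- exp_0; apply exp_le_mono; lra). rewrite Rmult_assoc. rewrite <- (Rmult_1_r (Rpower 2 g)) at 1. apply Rmult_le_compat_l; [lra|nra]. }
  rewrite exp_Ropp. apply (Rmult_le_reg_r (exp (x / 2))); [apply exp_pos|]. rewrite Rmult_assoc, Rinv_l by (apply Rgt_not_eq, exp_pos). lra.
Qed.

(** The incomplete Gamma function at [1 + g]. As [pp g] is continuous at 0, unlike the formula for
    [Rpower], this is an integral of a continuous function over a closed interval. *)
Definition Ginc (g X : R) : R := rint (fun u => pp g u * exp (- u)) 0 X.

Lemma Ginc_cont g a b : 0 < g -> cont_on (fun u => pp g u * exp (- u)) a b.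
Proof. intros Hg x _. apply cont_mult; [now apply pp_continuous|]. apply (cont_derive _ _ (- exp (- x))). auto_derive; [exact I|ring]. Qed.

Lemma Ginc_mono g X Y : 0 < g -> 0 <= X <= Y -> Ginc g X <= Ginc g Y.
Proof.
  intros Hg H. unfold Ginc. rewrite (rint_split _ 0 X Y) by (try apply Ginc_cont; lra).
  assert (0 <= rint (fun u => pp g u * exp (- u)) X Y); [|lra].
  replace 0 with (rint (fun _ => 0) X Y) at 1 by (rewrite rint_const; ring).
  apply rint_le; [lra|intros x _; apply cont_const|now apply Ginc_cont|].
  intros x _. apply Rmult_le_pos; [apply pp_nonneg|left; apply exp_pos].
Qed.

Lemma Ginc_lim g : 0 < g -> exists l, forall eps, 0 < eps -> exists X0, 0 <= X0 /\ forall X, X0 <= X -> Rabs (Ginc g X - l) < eps.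
Proof.
  intros Hg. destruct (pp_exp_bound g Hg) as [c [Hc H]].
  assert (HB : forall X, 0 <= X -> Ginc g X <= 2 * c).
  { intros X HX. unfold Ginc. apply Rle_trans with (rint (fun u => c * exp (- u / 2)) 0 X).
    - apply rint_le; [exact HX|now apply Ginc_cont| |intros x Hx; apply H; lra].
      intros x _. apply (cont_derive _ _ (c * (exp (- x / 2) * (- 1 / 2)))). auto_derive; [exact I|unfold Rdiv; field].
    - rewrite (rint_ftc (fun u => - 2 * c * exp (- u / 2)) (fun u => c * exp (- u / 2)) 0 X HX).
      + replace (- 0 / 2) with 0 by field. rewrite exp_0. assert (P := exp_pos (- X / 2)). nra.
      + intros x _. apply (cont_derive _ _ (c * (exp (- x / 2) * (- 1 / 2)))). auto_derive; [exact I|unfold Rdiv; field].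
      + intros x _. auto_derive; [exact I|unfold Rdiv; field]. }
  destruct (completeness (fun y => exists X, 0 <= X /\ y = Ginc g X)) as [l [Hub Hlub]].
  - exists (2 * c). intros y [X [HX ->]]. now apply HB.
  - exists (Ginc g 0), 0. split; [lra|reflexivity].
  - exists l. intros eps He. destruct (classic (exists X, 0 <= X /\ l - eps < Ginc g X)) as [[X [HX HXl]]|Hn].
    + exists X. split; [exact HX|]. intros Y HY. assert (M := Ginc_mono g X Y Hg ltac:(lra)).
      assert (U : Ginc g Y <= l) by (apply Hub; exists Y; split; [lra|reflexivity]). apply Rabs_lt_between. lra.
    + exfalso. assert (l <= l - eps); [|lra]. apply Hlub. intros y [X [HX ->]].
      destruct (Rle_dec (Ginc g X) (l - eps)) as [Hle|Hgt]; [exact Hle|exfalso; apply Hn; exists X; split; [exact HX|lra]].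
Qed.

Lemma Ginc_Gamma g : 0 < g -> forall eps, 0 < eps -> exists X0, 0 <= X0 /\ forall X, X0 <= X -> Rabs (Ginc g X - Gamma (1 + g)) < eps.
Proof.
  intros Hg. destruct (Ginc_lim g Hg) as [l Hl].
  assert (E : Gamma (1 + g) = l).
  { unfold Gamma. apply is_RInt_gen_unique. intros P [d Hd]. unfold filtermapi.
    destruct (Hl (d / 2) ltac:(destruct d; simpl; lra)) as [X0 [HX0 H1]].
    (* On [[0, 1]] the integrand is at most 1, so that the missing piece over [[0, a]] is at most
       [a < d / 4]. *)
    apply (Filter_prod _ _ _ (fun a => 0 < a < Rmin 1 (d / 4)) (fun b => Rmax 1 X0 < b)).
    - assert (Hm : 0 < Rmin 1 (d / 4)) by (apply Rmin_pos; destruct d; simpl; lra).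
      exists (mkposreal _ Hm). intros y Hy Hy0. unfold ball in Hy; simpl in Hy. unfold AbsRing_ball, abs, minus, plus, opp in Hy; simpl in Hy.
      rewrite Ropp_0, Rplus_0_r, Rabs_pos_eq in Hy by lra. lra.
    - exists (Rmax 1 X0). intros x Hx. exact Hx.
    - intros a b Ha Hb. simpl.
      assert (La : a < 1) by (eapply Rlt_le_trans; [apply Ha|apply Rmin_l]).
      assert (La2 : a < d / 4) by (eapply Rlt_le_trans; [apply Ha|apply Rmin_r]).
      assert (Lb : 1 < b) by (eapply Rle_lt_trans; [apply Rmax_l|apply Hb]).
      assert (Lb2 : X0 < b) by (eapply Rle_lt_trans; [apply Rmax_r|apply Hb]).
      exists (rint (fun u => pp g u * exp (- u)) a b). split.
      + apply (is_RInt_ext (V := R_NormedModule) (fun u => pp g u * exp (- u))).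
        * intros x Hx. rewrite Rmin_left, Rmax_right in Hx by lra. rewrite pp_pos by lra. replace (1 + g - 1) with g by ring. reflexivity.
        * apply (RInt_correct (V := R_CompleteNormedModule)). apply rint_ex; [lra|now apply Ginc_cont].
      + apply Hd. change (Rabs (rint (fun u => pp g u * exp (- u)) a b - l) < d).
        assert (Sp : Ginc g b = Ginc g a + rint (fun u => pp g u * exp (- u)) a b).
        { unfold Ginc. apply rint_split; [lra|lra|now apply Ginc_cont]. }
        assert (Ga : Rabs (Ginc g a) <= (a - 0) * 1).
        { unfold Ginc. apply rint_abs; [lra|now apply Ginc_cont|]. intros x Hx.
          rewrite Rabs_pos_eq by (apply Rmult_le_pos; [apply pp_nonneg|left; apply exp_pos]).
          rewrite <- (Rmult_1_l 1). apply Rmult_le_compat; [apply pp_nonneg|left; apply exp_pos| |].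
          - apply Rle_trans with (pp g 1); [apply pp_le; lra|]. rewrite pp_pos by lra. unfold Rpower. rewrite ln_1, Rmult_0_r, exp_0. lra.
          - rewrite <- exp_0. apply exp_le_mono. lra. }
        specialize (H1 b ltac:(lra)). replace (rint (fun u => pp g u * exp (- u)) a b - l) with ((Ginc g b - l) - Ginc g a) by lra.
        unfold Rminus at 1. eapply Rle_lt_trans; [apply Rabs_triang|]. rewrite Rabs_Ropp. lra. }
  rewrite E. exact Hl.
Qed.

(** * Rotation of Euler's integral *)

Lemma pp_mul_derive g u : 0 < g -> 0 <= u -> is_derive (fun x => pp g x * x) u ((g + 1) * pp g u).
Proof.
  intros Hg Hu. destruct (Req_dec u 0) as [->|Hu0].
  - rewrite (pp_neg g 0) by lra. rewrite Rmult_0_r. apply is_derive_Reals. intros eps He.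
    assert (Hc := pp_continuous g 0 Hg). apply continuity_pt_filterlim in Hc.
    destruct (Hc eps He) as [d [Hd H]]. exists (mkposreal d Hd). intros h Hh0 Hhd. simpl in Hhd.
    rewrite Rplus_0_l, Rmult_0_r, !Rminus_0_r. replace (pp g h * h / h) with (pp g h) by (field; exact Hh0).
    specialize (H h). simpl in H. unfold Rdist, D_x, no_cond in H. rewrite (pp_neg g 0), !Rminus_0_r in H by lra.
    apply H. split; [split; [exact I|now apply not_eq_sym]|exact Hhd].
  - apply (is_derive_ext_loc (K := R_AbsRing) (V := R_NormedModule) (fun x => Rpower x (g + 1))).
    + exists (mkposreal u ltac:(lra)). intros z Hz. unfold ball in Hz; simpl in Hz. unfold AbsRing_ball, abs, minus, plus, opp in Hz; simpl in Hz.
      apply Rabs_lt_between in Hz. rewrite pp_pos by lra. rewrite Rpower_plus, Rpower_1 by lra. reflexivity.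
    + rewrite pp_pos by lra. replace (Rpower u g) with (Rpower u (g + 1 - 1)) by (f_equal; ring). apply is_derive_Reals. apply derivable_pt_lim_power. lra.
Qed.

Lemma is_derive_mult_R (f h : R -> R) x f' h' : is_derive f x f' -> is_derive h x h' -> is_derive (fun u => f u * h u) x (f' * h x + f x * h').
Proof.
  intros H1 H2. apply (is_derive_mult f h x f' h' H1 H2). intros n m. apply Rmult_comm.
Qed.

(** The integral is the real part of [e^(i psi)] times the integral of [zeta^g e^(- r zeta)] along
    the ray [zeta = u e^(- i t)], [u <= X]. Its derivative in the angle is the integral of a total
    derivative in [u], of which the boundary term at [X] remains; this plays the role of Cauchy's
    theorem. *)
Lemma rotation_derive g r X psi t : 0 < g -> 0 <= X ->
  is_derive (fun t => rint (fun u => pp g u * (exp (- (u * r * cos t)) * cos (u * r * sin t - (1 + g) * t + psi))) 0 X) t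
    (pp g X * X * (exp (- (X * r * cos t)) * sin (X * r * sin t - (1 + g) * t + psi))).
Proof.
  intros Hg HX.
  set (D := fun t u => exp (- (u * r * cos t)) * (u * r * sin t * cos (u * r * sin t - (1 + g) * t + psi)
     - sin (u * r * sin t - (1 + g) * t + psi) * (u * r * cos t - (1 + g)))).
  assert (Hd : forall u t, is_derive (fun t => pp g u * (exp (- (u * r * cos t)) * cos (u * r * sin t - (1 + g) * t + psi))) t (pp g u * D t u)).
  { intros u s. apply is_derive_scal. unfold D. auto_derive; [exact I|]. unfold Rminus. ring. }
  assert (Hcont : forall t b, cont_on (fun u => pp g u * (exp (- (u * r * cos t)) * cos (u * r * sin t - (1 + g) * t + psi))) 0 b).
  { intros s b x _. apply cont_mult; [now apply pp_continuous|].
    apply (cont_derive _ _ (exp (- (x * r * cos s)) * (- (r * cos s)) * cos (x * r * sin s - (1 + g) * s + psi) - exp (- (x * r * cos s)) * (sin (x * r * sin s - (1 + g) * s + psi) * (r * sin s)))).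
    auto_derive; [exact I|]. unfold Rminus. ring. }
  assert (HcontD : cont_on (fun u => pp g u * D t u) 0 X).
  { intros x _. apply cont_mult; [now apply pp_continuous|]. unfold D.
    apply (ex_derive_continuous (K := R_AbsRing) (V := R_NormedModule)). auto_derive. exact I. }
  replace (pp g X * X * (exp (- (X * r * cos t)) * sin (X * r * sin t - (1 + g) * t + psi)))
    with (RInt (fun u => Derive (fun t => pp g u * (exp (- (u * r * cos t)) * cos (u * r * sin t - (1 + g) * t + psi))) t) 0 X).
  - unfold rint. apply (is_derive_RInt_param (fun t u => pp g u * (exp (- (u * r * cos t)) * cos (u * r * sin t - (1 + g) * t + psi))) 0 X t).
    + exists (mkposreal 1 Rlt_0_1). intros s _ u _. eexists. apply Hd.
    + intros u _. apply (continuity_2d_pt_ext (fun t u => pp g u * D t u)).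
      { intros s v. symmetry. apply is_derive_unique. apply Hd. }
      assert (C1 : continuity_2d_pt (fun x _ : R => x) t u) by apply continuity_2d_pt_id1.
      assert (C2 : continuity_2d_pt (fun _ y : R => y) t u) by apply continuity_2d_pt_id2.
      assert (CA : continuity_2d_pt (fun t u => u * r * sin t - (1 + g) * t + psi) t u).
      { apply continuity_2d_pt_plus; [|apply continuity_2d_pt_const]. apply continuity_2d_pt_minus.
        - apply continuity_2d_pt_mult; [apply continuity_2d_pt_mult; [exact C2|apply continuity_2d_pt_const]|].
          apply (continuity_1d_2d_pt_comp sin (fun x _ => x)); [apply continuity_sin|exact C1].
        - apply continuity_2d_pt_mult; [apply continuity_2d_pt_const|exact C1]. }
      assert (CC : continuity_2d_pt (fun t u => u * r * cos t) t u).
      { apply continuity_2d_pt_mult; [apply continuity_2d_pt_mult; [exact C2|apply continuity_2d_pt_const]|].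
        apply (continuity_1d_2d_pt_comp cos (fun x _ => x)); [apply continuity_cos|exact C1]. }
      apply continuity_2d_pt_mult.
      { apply (continuity_1d_2d_pt_comp (pp g) (fun _ y => y)); [|exact C2]. apply continuity_pt_filterlim. now apply pp_continuous. }
      unfold D. apply continuity_2d_pt_mult.
      { apply (continuity_1d_2d_pt_comp exp (fun t u => - (u * r * cos t))).
        - apply derivable_continuous_pt, derivable_pt_exp.
        - apply continuity_2d_pt_opp. exact CC. }
      apply continuity_2d_pt_minus.
      { apply continuity_2d_pt_mult.
        - apply continuity_2d_pt_mult; [apply continuity_2d_pt_mult; [exact C2|apply continuity_2d_pt_const]|].
          apply (continuity_1d_2d_pt_comp sin (fun x _ => x)); [apply continuity_sin|exact C1].
        - apply (continuity_1d_2d_pt_comp cos (fun t u => u * r * sin t - (1 + g) * t + psi)); [apply continuity_cos|exact CA]. }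
      { apply continuity_2d_pt_mult.
        - apply (continuity_1d_2d_pt_comp sin (fun t u => u * r * sin t - (1 + g) * t + psi)); [apply continuity_sin|exact CA].
        - apply continuity_2d_pt_minus; [exact CC|apply continuity_2d_pt_const]. }
    + exists (mkposreal 1 Rlt_0_1). intros s _. apply rint_ex; [exact HX|apply Hcont].
  - rewrite (RInt_ext _ (fun u => pp g u * D t u)) by (intros u _; apply is_derive_unique, Hd).
    change (rint (fun u => pp g u * D t u) 0 X = pp g X * X * (exp (- (X * r * cos t)) * sin (X * r * sin t - (1 + g) * t + psi))).
    rewrite (rint_ftc (fun u => pp g u * u * (exp (- (u * r * cos t)) * sin (u * r * sin t - (1 + g) * t + psi))) _ 0 X HX HcontD).
    + rewrite Rmult_0_r, !Rmult_0_l. ring.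
    + intros u Hu.
      assert (E := is_derive_mult_R (fun u => pp g u * u) (fun u => exp (- (u * r * cos t)) * sin (u * r * sin t - (1 + g) * t + psi)) u _
        (- (r * cos t) * exp (- (u * r * cos t)) * sin (u * r * sin t - (1 + g) * t + psi) + exp (- (u * r * cos t)) * ((r * sin t) * cos (u * r * sin t - (1 + g) * t + psi)))
        (pp_mul_derive g u Hg ltac:(lra))).
      replace (pp g u * D t u) with ((g + 1) * pp g u * (exp (- (u * r * cos t)) * sin (u * r * sin t - (1 + g) * t + psi)) +
        pp g u * u * (- (r * cos t) * exp (- (u * r * cos t)) * sin (u * r * sin t - (1 + g) * t + psi) + exp (- (u * r * cos t)) * ((r * sin t) * cos (u * r * sin t - (1 + g) * t + psi)))).
      * apply E. auto_derive; [exact I|]. unfold Rminus. ring.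
      * unfold D. ring.
Qed.

(** The boundary term of [rotation_derive] over the angles from 0 to [th]; its exponential factor is
    largest at [th], where the cosine is smallest. *)
Lemma rotation g r X psi th : 0 < g -> 0 < r -> 0 <= X -> 0 <= th <= PI / 2 ->
  Rabs (rint (fun u => pp g u * (exp (- (u * r * cos th)) * cos (u * r * sin th - (1 + g) * th + psi))) 0 X
    - cos psi * rint (fun u => pp g u * exp (- (u * r))) 0 X) <= th * (pp g X * X * exp (- (X * r * cos th))).
Proof.
  intros Hg Hr HX Hth. assert (HPI := PI_RGT_0).
  set (K := fun t => rint (fun u => pp g u * (exp (- (u * r * cos t)) * cos (u * r * sin t - (1 + g) * t + psi))) 0 X).
  destruct (MVT_gen K 0 th (fun t => pp g X * X * (exp (- (X * r * cos t)) * sin (X * r * sin t - (1 + g) * t + psi)))) as [c [Hc E]].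
  - intros t _. now apply rotation_derive.
  - intros t _. apply continuity_pt_filterlim. eapply cont_derive. now apply rotation_derive.
  - rewrite Rmin_left, Rmax_right in Hc by lra.
    assert (E0 : K 0 = cos psi * rint (fun u => pp g u * exp (- (u * r))) 0 X).
    { unfold K. rewrite <- rint_scal; [|exact HX|].
      - apply rint_ext; [exact HX|]. intros x _. rewrite cos_0, sin_0, !Rmult_0_r, !Rmult_1_r, Rminus_0_r, Rplus_0_l. ring.
      - intros x _. apply cont_mult; [now apply pp_continuous|]. apply (ex_derive_continuous (K := R_AbsRing) (V := R_NormedModule)). auto_derive. exact I. }
    change (Rabs (K th - cos psi * rint (fun u => pp g u * exp (- (u * r))) 0 X) <= th * (pp g X * X * exp (- (X * r * cos th)))).
    rewrite <- E0, E, Rminus_0_r, Rabs_mult, (Rabs_pos_eq th), Rmult_comm by lra. apply Rmult_le_compat_l; [lra|].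
    assert (PX : 0 <= pp g X * X) by (apply Rmult_le_pos; [apply pp_nonneg|exact HX]).
    rewrite Rabs_mult, (Rabs_pos_eq (pp g X * X)) by exact PX. apply Rmult_le_compat_l; [exact PX|].
    rewrite Rabs_mult, (Rabs_pos_eq (exp _)) by (left; apply exp_pos).
    apply Rle_trans with (exp (- (X * r * cos c)) * 1).
    { apply Rmult_le_compat_l; [left; apply exp_pos|]. apply Rabs_le. apply SIN_bound. }
    rewrite Rmult_1_r. apply exp_le_mono. apply Ropp_le_contravar. apply Rmult_le_compat_l; [apply Rmult_le_pos; lra|].
    apply cos_decr_1; lra.
Qed.

Lemma Ginc_scale g r X : 0 < g -> 0 < r -> 0 <= X ->
  rint (fun u => pp g u * exp (- (u * r))) 0 X = Rpower r (- (1 + g)) * Ginc g (r * X).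
Proof.
  intros Hg Hr HX. unfold Ginc. replace 0 with (r * 0) at 2 by ring.
  change (RInt (fun u => pp g u * exp (- u)) (r * 0) (r * X)) with (rint (fun u => pp g u * exp (- u)) (r * 0) (r * X)).
  rewrite <- rint_dilate; [|exact HX|exact Hr|now apply Ginc_cont].
  rewrite (rint_ext (fun x => pp g (r * x) * exp (- (r * x))) (fun x => Rpower r g * (pp g x * exp (- (x * r))))).
  - rewrite rint_scal.
    + rewrite <- Rmult_assoc, <- Rmult_assoc. replace (Rpower r (- (1 + g)) * r * Rpower r g) with 1; [ring|].
      rewrite <- (Rpower_1 r) at 2 by exact Hr. rewrite <- !Rpower_plus. replace (- (1 + g) + 1 + g) with 0 by ring. now rewrite Rpower_O.
    + exact HX.
    + intros x _. apply cont_mult; [now apply pp_continuous|]. apply (ex_derive_continuous (K := R_AbsRing) (V := R_NormedModule)). auto_derive. exact I.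
  - exact HX.
  - intros x Hx. rewrite !pp_pos by nra. rewrite <- Rpower_mult_distr by lra. replace (x * r) with (r * x) by ring. ring.
Qed.

Lemma euler_integral_oscillating g e y phi X : 0 < g -> 0 < e -> 0 < y -> 0 <= X ->
  let r := sqrt (e * e + y * y) in
  Rabs (rint (fun u => pp g u * (exp (- (e * u)) * cos (y * u + phi))) 0 X
    - cos (phi + (1 + g) * (PI / 2 - atan (e / y))) * (Rpower r (- (1 + g)) * Ginc g (r * X)))
  <= PI / 2 * (pp g X * X * exp (- (e * X))).
Proof.
  intros Hg He Hy HX r. assert (Hr : 0 < r) by (apply sqrt_lt_R0; nra). assert (HPI := PI_RGT_0).
  set (th := PI / 2 - atan (e / y)).
  assert (Hey : 0 < e / y) by now apply Rdiv_lt_0_compat.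
  assert (Ha := atan_bound (e / y)). assert (Ha0 : 0 < atan (e / y)) by (rewrite <- atan_0; now apply atan_increasing).
  assert (Hth : 0 <= th <= PI / 2) by (unfold th; lra).
  assert (Hsq : sqrt (1 + (e / y)²) = r / y).
  { apply sqrt_lem_1; [assert (H := Rle_0_sqr (e / y)); lra|left; now apply Rdiv_lt_0_compat|].
    unfold Rdiv, Rsqr. replace (r * / y * (r * / y)) with (r * r * (/ y * / y)) by ring. unfold r. rewrite sqrt_sqrt by nra. field. lra. }
  assert (Hc : cos th = e / r).
  { unfold th. rewrite cos_shift, sin_atan, Hsq. field. lra. }
  assert (Hs : sin th = y / r).
  { unfold th. rewrite sin_shift, cos_atan, Hsq. field. lra. }
  assert (R := rotation g r X (phi + (1 + g) * th) th Hg Hr HX Hth).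
  rewrite <- Ginc_scale by assumption.
  replace (X * r * cos th) with (e * X) in R by (rewrite Hc; field; lra).
  rewrite (rint_ext _ (fun u => pp g u * (exp (- (e * u)) * cos (y * u + phi)))) in R; [|exact HX|].
  - eapply Rle_trans; [exact R|]. apply Rmult_le_compat_r; [|lra].
    apply Rmult_le_pos; [apply Rmult_le_pos; [apply pp_nonneg|exact HX]|left; apply exp_pos].
  - intros x _. rewrite Hc, Hs. do 2 f_equal; [f_equal; field; lra|]. f_equal. field. lra.
Qed.

Lemma Rpower_exp_lim q : is_lim_seq (fun n => Rpower (INR n) q * exp (- INR n)) 0.
Proof.
  destruct (exp_Rpower_bound (q + 1)) as [c [Hc H]].
  apply (is_lim_seq_le_le_loc (fun _ => 0) _ (fun n => c * / INR n)).
  - exists 1%nat. intros n Hn. assert (Hn1 : 1 <= INR n) by (apply (le_INR 1); exact Hn). split.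
    + apply Rmult_le_pos; [left; apply Rpower_pos|left; apply exp_pos].
    + specialize (H (INR n) Hn1). rewrite Rpower_plus, Rpower_1 in H by lra. rewrite exp_Ropp. assert (P := exp_pos (INR n)).
      apply (Rmult_le_reg_r (INR n * exp (INR n))); [apply Rmult_lt_0_compat; lra|].
      replace (Rpower (INR n) q * / exp (INR n) * (INR n * exp (INR n))) with (Rpower (INR n) q * INR n) by (field; lra).
      replace (c * / INR n * (INR n * exp (INR n))) with (c * exp (INR n)) by (field; lra). exact H.
  - apply is_lim_seq_const.
  - replace (Finite 0) with (Rbar_mult c 0) by (simpl; f_equal; ring). apply is_lim_seq_scal_l.
    apply (is_lim_seq_inv INR p_infty); [apply is_lim_seq_INR|discriminate].
Qed.

Lemma inv_INR_lim : is_lim_seq (fun n => / INR n) 0.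
Proof. apply (is_lim_seq_inv INR p_infty); [apply is_lim_seq_INR|discriminate]. Qed.

(* With [e = 1/n] and [X = n^2], so that [e X = n]. *)
Lemma euler_integral_limit g y phi : 0 < g -> 0 < y ->
  is_lim_seq (fun n => rint (fun u => pp g u * (exp (- (/ INR n * u)) * cos (y * u + phi))) 0 (INR n * INR n))
    (Gamma (1 + g) * Rpower y (- (1 + g)) * cos (phi + (1 + g) * (PI / 2))).
Proof.
  intros Hg Hy.
  set (P := fun e => cos (phi + (1 + g) * (PI / 2 - atan (e / y))) * Rpower (sqrt (e * e + y * y)) (- (1 + g))).
  assert (HP : is_lim_seq (fun n => P (/ INR n)) (P 0)).
  { apply is_lim_seq_continuous; [|exact inv_INR_lim]. apply continuity_pt_filterlim. unfold P.
    apply (cont_mult (fun e => cos (phi + (1 + g) * (PI / 2 - atan (e / y)))) (fun e => Rpower (sqrt (e * e + y * y)) (- (1 + g)))).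
    - apply (ex_derive_continuous (K := R_AbsRing) (V := R_NormedModule)). auto_derive. lra.
    - unfold Rpower. apply (ex_derive_continuous (K := R_AbsRing) (V := R_NormedModule)). auto_derive.
      split; [nra|]. split; [apply sqrt_lt_R0; nra|exact I]. }
  assert (EP : P 0 = Rpower y (- (1 + g)) * cos (phi + (1 + g) * (PI / 2))).
  { unfold P. replace (0 / y) with 0 by (field; lra). rewrite atan_0, Rminus_0_r. replace (0 * 0 + y * y) with (y * y) by ring.
    rewrite sqrt_square by lra. ring. }
  assert (HG : is_lim_seq (fun n => Ginc g (sqrt (/ INR n * / INR n + y * y) * (INR n * INR n))) (Gamma (1 + g))).
  { apply is_lim_seq_spec. intros eps. destruct (Ginc_Gamma g Hg eps (cond_pos eps)) as [X0 [HX0 H]].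
    destruct (INR_unbounded (X0 / y)) as [n0 Hn0]. exists (S n0). intros n Hn. apply H.
    assert (Hn1 : 1 <= INR n) by (apply (le_INR 1); lia). apply le_INR in Hn. rewrite S_INR in Hn.
    assert (Hs : y <= sqrt (/ INR n * / INR n + y * y)).
    { rewrite <- (sqrt_square y) at 1 by lra. apply sqrt_le_1_alt. assert (0 <= / INR n) by (left; apply Rinv_0_lt_compat; lra). nra. }
    assert (Hy2 : X0 <= y * INR n0).
    { apply (Rmult_le_reg_r (/ y)); [now apply Rinv_0_lt_compat|]. replace (y * INR n0 * / y) with (INR n0) by (field; lra). unfold Rdiv in Hn0. lra. }
    apply Rle_trans with (y * INR n0); [exact Hy2|]. apply Rmult_le_compat; [lra|apply pos_INR|exact Hs|nra]. }
  assert (HE : is_lim_seq (fun n => PI / 2 * (Rpower (INR n) (2 * (g + 1)) * exp (- INR n))) 0).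
  { replace (Finite 0) with (Rbar_mult (PI / 2) 0) by (simpl; f_equal; ring). apply is_lim_seq_scal_l. apply Rpower_exp_lim. }
  replace (Gamma (1 + g) * Rpower y (- (1 + g)) * cos (phi + (1 + g) * (PI / 2))) with (P 0 * Gamma (1 + g)) by (rewrite EP; ring).
  assert (HM := is_lim_seq_mult' _ _ _ _ HP HG).
  assert (Hlo := is_lim_seq_minus' _ _ _ _ HM HE). assert (Hhi := is_lim_seq_plus' _ _ _ _ HM HE).
  rewrite Rminus_0_r in Hlo. rewrite Rplus_0_r in Hhi.
  eapply is_lim_seq_le_le_loc; [|exact Hlo|exact Hhi].
  exists 1%nat. intros n Hn. assert (Hn1 : 1 <= INR n) by (apply (le_INR 1); exact Hn).
  assert (He : 0 < / INR n) by (apply Rinv_0_lt_compat; lra).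
  assert (B := euler_integral_oscillating g (/ INR n) y phi (INR n * INR n) Hg He Hy ltac:(nra)). cbv zeta in B.
  assert (E1 : pp g (INR n * INR n) * (INR n * INR n) * exp (- (/ INR n * (INR n * INR n))) = Rpower (INR n) (2 * (g + 1)) * exp (- INR n)).
  { rewrite pp_pos by nra. rewrite <- Rpower_mult_distr by lra. replace (/ INR n * (INR n * INR n)) with (INR n) by (field; lra).
    replace (2 * (g + 1)) with (g + g + 1 + 1) by ring. rewrite !Rpower_plus, !Rpower_1 by lra. ring. }
  rewrite E1 in B. rewrite <- Rmult_assoc in B. fold (P (/ INR n)) in B.
  apply Rabs_le_between in B. lra.
Qed.

(** * Fourier coefficients of the Hurwitz zeta function *)

Lemma smooth_cont (f : R -> R) x : ex_derive f x -> continuous f x.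
Proof. intros H. exact (ex_derive_continuous (K := R_AbsRing) (V := R_NormedModule) f x H). Qed.

Lemma cont_bounded f a b : a <= b -> cont_on f a b -> exists M, 0 <= M /\ forall x, a <= x <= b -> Rabs (f x) <= M.
Proof.
  intros H Hf. assert (Hc : forall c, a <= c <= b -> continuity_pt f c) by (intros c Hc; apply continuity_pt_filterlim; now apply Hf).
  destruct (continuity_ab_maj f a b H Hc) as [p [Hp _]]. destruct (continuity_ab_min f a b H Hc) as [q [Hq _]].
  exists (Rabs (f p) + Rabs (f q)). assert (P1 := Rabs_pos (f p)). assert (P2 := Rabs_pos (f q)). split; [lra|].
  intros x Hx. specialize (Hp x Hx). specialize (Hq x Hx). assert (Q1 := Rle_abs (f p)). assert (Q2 := Rle_abs (- f q)). rewrite Rabs_Ropp in Q2.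
  apply Rabs_le. lra.
Qed.

Definition damped (e y phi u : R) : R := exp (- (e * u)) * cos (y * u + phi).

Lemma damped_abs e y phi u : Rabs (damped e y phi u) <= exp (- (e * u)).
Proof.
  unfold damped. rewrite Rabs_mult, Rabs_pos_eq by (left; apply exp_pos). rewrite <- (Rmult_1_r (exp _)) at 2.
  apply Rmult_le_compat_l; [left; apply exp_pos|]. apply Rabs_le. apply COS_bound.
Qed.

Lemma exp_neg_le1 x : 0 <= x -> exp (- x) <= 1.
Proof. intros H. rewrite <- exp_0. apply exp_le_mono. lra. Qed.

Lemma damped_abs1 e y phi u : 0 <= e -> 0 <= u -> Rabs (damped e y phi u) <= 1.
Proof. intros He Hu. eapply Rle_trans; [apply damped_abs|]. apply exp_neg_le1. now apply Rmult_le_pos. Qed.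

Lemma damped_cont e y phi u : continuous (damped e y phi) u.
Proof. apply smooth_cont. unfold damped. auto_derive. exact I. Qed.

Lemma sin_cos_shift x : sin x = cos (x - PI / 2).
Proof. rewrite <- cos_shift, <- cos_neg. f_equal. ring. Qed.

(** One integration by parts against the explicit primitive [Psi] of [damped]. The coefficients
    [y / D] and [e / D] of [Psi] stay bounded for small [e] because [y >= 1], which makes the bound
    uniform in the damping. *)
Lemma damped_power_by_parts e y phi p X : 0 < e <= 1 -> 1 <= y -> 2 <= X ->
  Rabs (rint (fun u => Rpower u p * damped e y phi u) 2 X) <=
  2 * (Rpower X p * exp (- (e * X))) + 2 * Rpower 2 p
   + Rabs p * (Rabs (rint (fun u => Rpower u (p - 1) * damped e y (phi - PI / 2) u) 2 X)
               + Rabs (rint (fun u => Rpower u (p - 1) * damped e y phi u) 2 X)).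
Proof.
  intros He Hy HX. set (D := e * e + y * y). assert (HD : 1 <= D) by (unfold D; nra).
  set (Psi := fun u => y / D * damped e y (phi - PI / 2) u - e / D * damped e y phi u).
  assert (HPsi : forall u, is_derive Psi u (damped e y phi u)).
  { intros u. unfold Psi, damped. auto_derive; [exact I|].
    replace (y * u + (phi - PI / 2)) with (y * u + phi - PI / 2) by ring.
    replace (cos (y * u + phi - PI / 2)) with (sin (y * u + phi)) by apply sin_cos_shift.
    replace (sin (y * u + phi - PI / 2)) with (- cos (y * u + phi)).
    2:{ rewrite sin_minus, sin_PI2, cos_PI2. ring. }
    unfold D. field. fold D. lra. }
  assert (HyD : 0 <= y / D <= 1).
  { split; [apply Rdiv_le_0_compat; lra|]. apply (Rmult_le_reg_r D); [lra|]. unfold Rdiv. rewrite Rmult_assoc, Rinv_l by lra. unfold D. nra. }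
  assert (HeD : 0 <= e / D <= 1).
  { split; [apply Rdiv_le_0_compat; lra|]. apply (Rmult_le_reg_r D); [lra|]. unfold Rdiv. rewrite Rmult_assoc, Rinv_l by lra. unfold D. nra. }
  assert (HPb : forall u, Rabs (Psi u) <= 2 * exp (- (e * u))).
  { intros u. unfold Psi, Rminus. eapply Rle_trans; [apply Rabs_triang|]. rewrite Rabs_Ropp, !Rabs_mult, !(Rabs_pos_eq (_ / D)) by lra.
    assert (B1 := damped_abs e y (phi - PI / 2) u). assert (B2 := damped_abs e y phi u).
    assert (P1 := Rabs_pos (damped e y (phi - PI / 2) u)). assert (P2 := Rabs_pos (damped e y phi u)). unfold Rminus in B1, P1. nra. }
  assert (Hc1 : forall p f, (forall u, continuous f u) -> cont_on (fun u => Rpower u p * f u) 2 X).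
  { intros p' f Hf x Hx. apply cont_mult; [apply Rpower_continuous; lra|apply Hf]. }
  assert (HPc : forall u, continuous Psi u) by (intros u; eapply cont_derive; apply HPsi).
  assert (FT : rint (fun u => p * Rpower u (p - 1) * Psi u + Rpower u p * damped e y phi u) 2 X = Rpower X p * Psi X - Rpower 2 p * Psi 2).
  { apply (rint_ftc (fun u => Rpower u p * Psi u)); [exact HX| |].
    - intros x Hx. apply cont_plus; [|apply (Hc1 p (damped e y phi)); [intros; apply damped_cont|exact Hx]].
      apply cont_mult; [apply cont_mult; [apply cont_const|apply Rpower_continuous; lra]|apply HPc].
    - intros x Hx. apply (is_derive_mult_R (fun u => Rpower u p) Psi); [|apply HPsi]. apply is_derive_Reals. apply derivable_pt_lim_power. lra. }
  rewrite rint_plus in FT; [|exact HX| |apply Hc1; intros; apply damped_cont].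
  2:{ intros x Hx. apply cont_mult; [apply cont_mult; [apply cont_const|apply Rpower_continuous; lra]|apply HPc]. }
  assert (E2 : rint (fun u => p * Rpower u (p - 1) * Psi u) 2 X = p * (y / D * rint (fun u => Rpower u (p - 1) * damped e y (phi - PI / 2) u) 2 X
     - e / D * rint (fun u => Rpower u (p - 1) * damped e y phi u) 2 X)).
  { rewrite <- !rint_scal by (try exact HX; apply Hc1; intros; apply damped_cont).
    rewrite <- rint_minus; [|exact HX| |].
    - rewrite <- rint_scal; [|exact HX|].
      + apply rint_ext; [exact HX|]. intros x _. unfold Psi. ring.
      + intros x Hx. apply cont_minus; apply cont_mult; try apply cont_const; apply (Hc1 (p - 1)); try exact Hx; intros; apply damped_cont.
    - intros x Hx. apply cont_mult; [apply cont_const|]. apply (Hc1 (p - 1)); [intros; apply damped_cont|exact Hx].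
    - intros x Hx. apply cont_mult; [apply cont_const|]. apply (Hc1 (p - 1)); [intros; apply damped_cont|exact Hx]. }
  rewrite E2 in FT.
  set (A := rint (fun u => Rpower u (p - 1) * damped e y (phi - PI / 2) u) 2 X) in *.
  set (Bq := rint (fun u => Rpower u (p - 1) * damped e y phi u) 2 X) in *.
  replace (rint (fun u => Rpower u p * damped e y phi u) 2 X) with (Rpower X p * Psi X - Rpower 2 p * Psi 2 - p * (y / D * A - e / D * Bq)) by lra.
  unfold Rminus at 1. eapply Rle_trans; [apply Rabs_triang|]. rewrite Rabs_Ropp. apply Rplus_le_compat.
  - unfold Rminus. eapply Rle_trans; [apply Rabs_triang|]. rewrite Rabs_Ropp. apply Rplus_le_compat.
    + rewrite Rabs_mult, Rabs_pos_eq by (left; apply Rpower_pos). assert (H := HPb X). assert (P := Rpower_pos X p). nra.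
    + rewrite Rabs_mult, Rabs_pos_eq by (left; apply Rpower_pos). assert (H := HPb 2). assert (P := Rpower_pos 2 p).
      assert (E := exp_neg_le1 (e * 2) ltac:(lra)). nra.
  - rewrite Rabs_mult. apply Rmult_le_compat_l; [apply Rabs_pos|]. unfold Rminus. eapply Rle_trans; [apply Rabs_triang|]. rewrite Rabs_Ropp, !Rabs_mult, !(Rabs_pos_eq (_ / D)) by lra.
    assert (P1 := Rabs_pos A). assert (P2 := Rabs_pos Bq). nra.
Qed.

(** Each integration by parts lowers [p] by one, until the integrand is dominated by [u^(-2)]. With
    damping [1 / m] and [X = m^2] the boundary terms are [m^(2 p) e^(- m)], which is bounded in
    [m]. *)
Lemma damped_power_bounded y n : 1 <= y -> forall p, p <= INR n - 2 -> exists C, 0 <= C /\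
  forall phi m, (2 <= m)%nat -> Rabs (rint (fun u => Rpower u p * damped (/ INR m) y phi u) 2 (INR m * INR m)) <= C.
Proof.
  intros Hy. induction n as [|n IH]; intros p Hp.
  - exists 1. split; [lra|]. intros phi m Hm. assert (Hm2 : 2 <= INR m) by (apply (le_INR 2); exact Hm).
    assert (HX : 2 <= INR m * INR m) by nra. simpl in Hp.
    assert (Hc : cont_on (fun u => Rpower u p * damped (/ INR m) y phi u) 2 (INR m * INR m)).
    { intros x Hx. apply cont_mult; [apply Rpower_continuous; lra|apply damped_cont]. }
    eapply Rle_trans; [apply (rint_abs_le _ (fun u => / u ^ 2)); [exact HX|exact Hc| |]|].
    + intros x Hx. apply smooth_cont. auto_derive. simpl. rewrite Rmult_1_r. nra.
    + intros x Hx. rewrite Rabs_mult, (Rabs_pos_eq (Rpower _ _)) by (left; apply Rpower_pos).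
      assert (B := damped_abs1 (/ INR m) y phi x ltac:(left; apply Rinv_0_lt_compat; lra) ltac:(lra)).
      assert (B2 : Rpower x p <= / x ^ 2) by (rewrite <- Rpower_m2 by lra; apply Rpower_le_exp; lra).
      assert (P := Rpower_pos x p). assert (P2 := Rabs_pos (damped (/ INR m) y phi x)). nra.
    + rewrite (rint_ftc (fun u => - / u)); [|exact HX| |].
      * assert (0 < / (INR m * INR m)) by (apply Rinv_0_lt_compat; lra). lra.
      * intros x Hx. apply smooth_cont. auto_derive. simpl. rewrite Rmult_1_r. nra.
      * intros x Hx. auto_derive; [lra|]. field. lra.
  - destruct (IH (p - 1)) as [C [HC H]]; [rewrite S_INR in Hp; lra|].
    destruct (exp_Rpower_bound (2 * p)) as [c [Hc Hcb]].
    exists (2 * c + 2 * Rpower 2 p + Rabs p * (C + C)).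
    assert (P2 := Rpower_pos 2 p). assert (Pp := Rabs_pos p). split; [nra|].
    intros phi m Hm. assert (Hm2 : 2 <= INR m) by (apply (le_INR 2); exact Hm).
    assert (He : 0 < / INR m <= 1).
    { split; [apply Rinv_0_lt_compat; lra|]. rewrite <- Rinv_1. apply Rinv_le_contravar; lra. }
    eapply Rle_trans; [apply damped_power_by_parts; [exact He|exact Hy|nra]|].
    assert (H1 := H (phi - PI / 2) m Hm). assert (H2 := H phi m Hm).
    assert (B : Rpower (INR m * INR m) p * exp (- (/ INR m * (INR m * INR m))) <= c).
    { rewrite <- Rpower_mult_distr by lra. rewrite <- Rpower_plus. replace (p + p) with (2 * p) by ring.
      replace (/ INR m * (INR m * INR m)) with (INR m) by (field; lra). specialize (Hcb (INR m) ltac:(lra)).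
      rewrite exp_Ropp. assert (P := exp_pos (INR m)). apply (Rmult_le_reg_r (exp (INR m))); [exact P|].
      rewrite Rmult_assoc, Rinv_l by lra. lra. }
    assert (Rabs p * (Rabs (rint (fun u => Rpower u (p - 1) * damped (/ INR m) y (phi - PI / 2) u) 2 (INR m * INR m)) + Rabs (rint (fun u => Rpower u (p - 1) * damped (/ INR m) y phi u) 2 (INR m * INR m))) <= Rabs p * (C + C)) by (apply Rmult_le_compat_l; lra).
    lra.
Qed.

Lemma damped_power_bounded_any y p : 1 <= y -> exists C, 0 <= C /\
  forall phi m, (2 <= m)%nat -> Rabs (rint (fun u => Rpower u p * damped (/ INR m) y phi u) 2 (INR m * INR m)) <= C.
Proof.
  intros Hy. destruct (INR_unbounded (p + 2)) as [n Hn]. apply (damped_power_bounded y n Hy). lra.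
Qed.

Lemma F0_damped_cont g e y phi a b : 0 < g -> 0 <= a -> cont_on (fun u => F0 g u * damped e y phi u) a b.
Proof. intros Hg Ha x Hx. apply cont_mult; [apply F0_continuous; lra|apply damped_cont]. Qed.

(** [F0] grows like a power, and only the oscillation keeps this integral bounded. Beyond 2 the
    function is replaced by [Bser] with an error [O(u^(-2))], and the powers in [Bser] are covered
    by [damped_power_bounded_any]. *)
Lemma F0_damped_bounded g y phi : 0 < g -> 1 <= y -> exists C, 0 <= C /\
  forall m, (2 <= m)%nat -> Rabs (rint (fun u => F0 g u * damped (/ INR m) y phi u) 0 (INR m * INR m)) <= C.
Proof.
  intros Hg Hy. destruct (Z1_near2 g Hg) as [N [c [Hc HN]]].
  destruct (cont_bounded (F0 g) 0 2 ltac:(lra)) as [M [HM0 HM]]; [intros x Hx; apply F0_continuous; lra|].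
  set (s := fun k => / (g + 1) * bcoef k * ff (g + 1) k).
  assert (HB : exists C, 0 <= C /\ forall m, (2 <= m)%nat -> Rabs (rint (fun u => Bser g N u * damped (/ INR m) y phi u) 2 (INR m * INR m)) <= C).
  { assert (G : forall n, exists C, 0 <= C /\ forall m, (2 <= m)%nat -> Rabs (rint (fun u => rsum (fun k => s k * (Rpower u (g + 1 - INR k) * damped (/ INR m) y phi u)) n) 2 (INR m * INR m)) <= C).
    { induction n as [|n [C [HC0 IH]]].
      - exists 0. split; [lra|]. intros m _. simpl. rewrite rint_const, Rmult_0_r, Rabs_R0. lra.
      - destruct (damped_power_bounded_any y (g + 1 - INR n) Hy) as [C1 [HC1 H1]]. exists (C + Rabs (s n) * C1).
        assert (Ps := Rabs_pos (s n)). split; [nra|]. intros m Hm. specialize (IH m Hm). specialize (H1 phi m Hm).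
        assert (Hm2 : 2 <= INR m) by (apply (le_INR 2); exact Hm). assert (HX : 2 <= INR m * INR m) by nra.
        assert (Hcc : forall p, cont_on (fun u => Rpower u p * damped (/ INR m) y phi u) 2 (INR m * INR m)).
        { intros p x Hx. apply cont_mult; [apply Rpower_continuous; lra|apply damped_cont]. }
        simpl. rewrite rint_plus; [|exact HX| |].
        + rewrite rint_scal by (try exact HX; apply Hcc). eapply Rle_trans; [apply Rabs_triang|]. rewrite Rabs_mult.
          apply Rplus_le_compat; [exact IH|]. now apply Rmult_le_compat_l.
        + intros x Hx. apply (cont_rsum (fun k u => s k * (Rpower u (g + 1 - INR k) * damped (/ INR m) y phi u))). intros k _.
          apply cont_mult; [apply cont_const|]. now apply Hcc.
        + intros x Hx. apply cont_mult; [apply cont_const|]. now apply Hcc. }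
    destruct (G N) as [C [HC0 H]]. exists C. split; [exact HC0|]. intros m Hm. specialize (H m Hm).
    rewrite (rint_ext _ (fun u => rsum (fun k => s k * (Rpower u (g + 1 - INR k) * damped (/ INR m) y phi u)) N)); [exact H| |].
    - assert (Hm2 : 2 <= INR m) by (apply (le_INR 2); exact Hm). nra.
    - intros x _. unfold Bser, psum. rewrite Rmult_comm, <- rsum_scal. apply rsum_ext. intros; unfold s; ring. }
  destruct HB as [C [HC0 HC]]. exists (2 * M + (C + c)). split; [lra|]. intros m Hm. specialize (HC m Hm).
  assert (Hm2 : 2 <= INR m) by (apply (le_INR 2); exact Hm). assert (HX : 2 <= INR m * INR m) by nra.
  assert (He : 0 < / INR m) by (apply Rinv_0_lt_compat; lra).
  rewrite (rint_split _ 0 2) by (try lra; apply F0_damped_cont; lra).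
  eapply Rle_trans; [apply Rabs_triang|]. apply Rplus_le_compat.
  - replace 2 with (2 - 0) at 2 by ring. apply rint_abs; [lra|apply F0_damped_cont; lra|]. intros x Hx. rewrite Rabs_mult.
    assert (B := damped_abs1 (/ INR m) y phi x ltac:(lra) ltac:(lra)). specialize (HM x Hx). assert (P := Rabs_pos (F0 g x)). assert (P2 := Rabs_pos (damped (/ INR m) y phi x)). nra.
  - assert (Hcb : cont_on (fun u => Bser g N u * damped (/ INR m) y phi u) 2 (INR m * INR m)).
    { intros x Hx. apply cont_mult; [apply psum_continuous; lra|apply damped_cont]. }
    replace (rint (fun u => F0 g u * damped (/ INR m) y phi u) 2 (INR m * INR m)) with
      (rint (fun u => Bser g N u * damped (/ INR m) y phi u) 2 (INR m * INR m) + (rint (fun u => F0 g u * damped (/ INR m) y phi u) 2 (INR m * INR m) - rint (fun u => Bser g N u * damped (/ INR m) y phi u) 2 (INR m * INR m))) by ring.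
    rewrite <- rint_minus by (try exact HX; try exact Hcb; apply F0_damped_cont; lra).
    eapply Rle_trans; [apply Rabs_triang|]. apply Rplus_le_compat; [exact HC|].
    eapply Rle_trans; [apply (rint_abs_le _ (fun u => c * / u ^ 2)); [exact HX| | |]|].
    + intros x Hx. apply cont_minus; [apply (F0_damped_cont g (/ INR m) y phi 2 (INR m * INR m)); lra|now apply Hcb].
    + intros x Hx. apply smooth_cont. auto_derive. simpl. rewrite Rmult_1_r. nra.
    + intros x Hx. rewrite <- Rmult_minus_distr_r, Rabs_mult, F0_Z1 by lra. specialize (HN x ltac:(lra)). rewrite Rpower_m2 in HN by lra.
      assert (B := damped_abs1 (/ INR m) y phi x ltac:(lra) ltac:(lra)). assert (P2 := Rabs_pos (damped (/ INR m) y phi x)).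
      assert (P := Rabs_pos (Z1 g x - Bser g N x)). nra.
    + rewrite (rint_ftc (fun u => - (c * / u))); [|exact HX| |].
      * assert (0 < / (INR m * INR m)) by (apply Rinv_0_lt_compat; lra). nra.
      * intros x Hx. apply smooth_cont. auto_derive. simpl. rewrite Rmult_1_r. nra.
      * intros x Hx. auto_derive; [lra|]. field. lra.
Qed.

Lemma F0_growth g : 0 < g -> exists C, 0 <= C /\ forall u, 2 <= u -> Rabs (F0 g u) <= C * Rpower u (g + 1).
Proof.
  intros Hg. destruct (Z1_near2 g Hg) as [N [c [Hc HN]]].
  set (S0 := rsum (fun k => Rabs (/ (g + 1) * bcoef k * ff (g + 1) k)) N).
  assert (HS0 : 0 <= S0) by (apply rsum_nonneg; intros; apply Rabs_pos).
  exists (c + S0). split; [lra|]. intros u Hu. rewrite F0_Z1 by lra.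
  replace (Z1 g u) with ((Z1 g u - Bser g N u) + Bser g N u) by ring. eapply Rle_trans; [apply Rabs_triang|].
  rewrite Rmult_plus_distr_r. apply Rplus_le_compat.
  - eapply Rle_trans; [apply HN, Hu|]. apply Rmult_le_compat_l; [exact Hc|]. apply Rpower_le_exp; lra.
  - unfold Bser, psum. eapply Rle_trans; [apply rsum_abs|]. unfold S0. rewrite Rmult_comm, <- rsum_scal. apply rsum_le. intros k _.
    rewrite Rabs_mult, (Rabs_pos_eq (Rpower _ _)), Rmult_comm by (left; apply Rpower_pos). apply Rmult_le_compat_r; [apply Rabs_pos|].
    apply Rpower_le_exp; [lra|]. assert (H := pos_INR k). lra.
Qed.

Lemma cos_period_nat x k : cos (x + 2 * PI * INR k) = cos x.
Proof. replace (x + 2 * PI * INR k) with (x + 2 * INR k * PI) by ring. apply cos_period. Qed.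

Lemma sin_period_nat x k : sin (x + 2 * PI * INR k) = sin x.
Proof. replace (x + 2 * PI * INR k) with (x + 2 * INR k * PI) by ring. apply sin_period. Qed.

Lemma damped_step e k phi u : damped e (2 * PI * INR k) phi (u + 1) = exp (- e) * damped e (2 * PI * INR k) phi u.
Proof.
  unfold damped. replace (- (e * (u + 1))) with (- e + - (e * u)) by ring. rewrite exp_plus.
  replace (2 * PI * INR k * (u + 1) + phi) with (2 * PI * INR k * u + phi + 2 * PI * INR k) by ring. rewrite cos_period_nat. ring.
Qed.

(* The relation [F0 (u + 1) = F0 u - u^g] under a damped Fourier integral over [0, X]. *)
Lemma damped_unfold g e k phi X : 0 < g -> 1 <= X ->
  let E := damped e (2 * PI * INR k) phi in
  rint (fun u => F0 g u * E u) 0 1 = (1 - exp (- e)) * rint (fun u => F0 g u * E u) 0 X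
    + exp (- e) * rint (fun u => pp g u * E u) 0 X + rint (fun u => F0 g u * E u) X (X + 1).
Proof.
  intros Hg HX E.
  assert (Hc : forall a b, 0 <= a -> cont_on (fun u => F0 g u * E u) a b) by (intros; now apply F0_damped_cont).
  assert (Hp : cont_on (fun u => pp g u * E u) 0 X) by (intros x _; apply cont_mult; [now apply pp_continuous|apply damped_cont]).
  assert (S1 := rint_split (fun u => F0 g u * E u) 0 1 (X + 1) ltac:(lra) ltac:(lra) (Hc 0 (X + 1) ltac:(lra))).
  assert (S2 := rint_split (fun u => F0 g u * E u) 0 X (X + 1) ltac:(lra) ltac:(lra) (Hc 0 (X + 1) ltac:(lra))).
  assert (S3 := rint_shift (fun u => F0 g u * E u) 0 X 1 ltac:(lra) (Hc (0 + 1) (X + 1) ltac:(lra))). rewrite Rplus_0_l in S3.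
  rewrite (rint_ext _ (fun u => exp (- e) * (F0 g u * E u - pp g u * E u))) in S3; [|lra|].
  - rewrite rint_scal, rint_minus in S3; try lra; try exact Hp; try (apply Hc; lra).
    intros x Hx. apply cont_minus; [now apply (Hc 0 X); [lra|]|now apply Hp].
  - intros x Hx. unfold E. rewrite damped_step, F0_step by lra. ring.
Qed.

(** In [damped_unfold] with damping [1 / m] and [X = m^2], the first term is [O(1 / m)] by
    [F0_damped_bounded], the last one is exponentially small, and the middle one is the oscillating
    Euler integral. *)
Lemma F0_fourier g k phi : 0 < g -> (1 <= k)%nat ->
  rint (fun u => F0 g u * cos (2 * PI * INR k * u + phi)) 0 1
  = Gamma (1 + g) * Rpower (2 * PI * INR k) (- (1 + g)) * cos (phi + (1 + g) * (PI / 2)).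
Proof.
  intros Hg Hk. assert (Hk1 : 1 <= INR k) by (apply (le_INR 1); exact Hk). assert (HPI := PI2_1).
  set (y := 2 * PI * INR k). assert (Hy : 1 <= y) by (unfold y; nra).
  set (c := rint (fun u => F0 g u * cos (y * u + phi)) 0 1).
  set (cm := fun m => rint (fun u => F0 g u * damped (/ INR m) y phi u) 0 1).
  destruct (cont_bounded (F0 g) 0 1 ltac:(lra)) as [M [HM0 HM]]; [intros x Hx; apply F0_continuous; lra|].
  assert (HF0c : cont_on (fun u => F0 g u * cos (y * u + phi)) 0 1).
  { intros x Hx. apply cont_mult; [apply F0_continuous; lra|]. apply smooth_cont. auto_derive. exact I. }
  assert (L1 : is_lim_seq cm c).
  { assert (HZ : is_lim_seq (fun m => M * / INR m) 0).
    { replace (Finite 0) with (Rbar_mult M 0) by (simpl; f_equal; ring). apply is_lim_seq_scal_l. exact inv_INR_lim. }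
    assert (Lo := is_lim_seq_minus' _ _ _ _ (is_lim_seq_const c) HZ). assert (Hi := is_lim_seq_plus' _ _ _ _ (is_lim_seq_const c) HZ).
    rewrite Rminus_0_r in Lo. rewrite Rplus_0_r in Hi. eapply is_lim_seq_le_le_loc; [|exact Lo|exact Hi].
    exists 1%nat. intros m Hm. assert (Hm1 : 1 <= INR m) by (apply (le_INR 1); exact Hm). assert (He : 0 < / INR m) by (apply Rinv_0_lt_compat; lra).
    assert (B : Rabs (cm m - c) <= (1 - 0) * (M * / INR m)).
    { unfold cm, c. rewrite <- rint_minus by (try lra; try exact HF0c; apply F0_damped_cont; lra).
      apply rint_abs; [lra| |].
      - intros x Hx. apply cont_minus; [apply (F0_damped_cont g (/ INR m) y phi 0 1); lra|now apply HF0c].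
      - intros x Hx. unfold damped. replace (_ - _) with (F0 g x * ((exp (- (/ INR m * x)) - 1) * cos (y * x + phi))) by ring.
        rewrite !Rabs_mult. apply Rmult_le_compat; [apply Rabs_pos|apply Rmult_le_pos; apply Rabs_pos|now apply HM|].
        assert (Hex : 0 <= / INR m * x <= / INR m) by nra.
        assert (E1 := exp_neg_le1 (/ INR m * x) ltac:(lra)).
        assert (E2 : 1 + - (/ INR m * x) <= exp (- (/ INR m * x))) by apply exp_ineq1_le.
        rewrite Rabs_left1 by lra. assert (Cb : Rabs (cos (y * x + phi)) <= 1) by (apply Rabs_le; apply COS_bound).
        assert (P := Rabs_pos (cos (y * x + phi))). nra. }
    apply Rabs_le_between in B. lra. }
  destruct (F0_damped_bounded g y phi Hg Hy) as [C [HC0 HC]].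
  destruct (F0_growth g Hg) as [C2 [HC2 HG]].
  assert (L2 : is_lim_seq cm (Gamma (1 + g) * Rpower y (- (1 + g)) * cos (phi + (1 + g) * (PI / 2)))).
  { assert (HJ := euler_integral_limit g y phi Hg ltac:(lra)).
    assert (He1 : is_lim_seq (fun m => exp (- / INR m)) 1).
    { rewrite <- exp_0. apply (is_lim_seq_continuous exp (fun m => - / INR m) 0); [apply derivable_continuous_pt, derivable_pt_exp|].
      replace (Finite 0) with (Rbar_opp 0) by (simpl; f_equal; ring). apply -> is_lim_seq_opp. exact inv_INR_lim. }
    assert (HA := is_lim_seq_mult' _ _ _ _ He1 HJ). rewrite Rmult_1_l in HA.
    assert (HB : is_lim_seq (fun m => C * / INR m + C2 * Rpower 2 (g + 1) * (Rpower (INR m) (2 * (g + 1)) * exp (- INR m))) 0).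
    { replace 0 with (C * 0 + C2 * Rpower 2 (g + 1) * 0) by ring. apply is_lim_seq_plus'.
      - apply (is_lim_seq_scal_l _ C 0). exact inv_INR_lim.
      - apply (is_lim_seq_scal_l _ (C2 * Rpower 2 (g + 1)) 0). apply Rpower_exp_lim. }
    assert (Lo := is_lim_seq_minus' _ _ _ _ HA HB). assert (Hi := is_lim_seq_plus' _ _ _ _ HA HB).
    rewrite Rminus_0_r in Lo. rewrite Rplus_0_r in Hi. eapply is_lim_seq_le_le_loc; [|exact Lo|exact Hi].
    exists 2%nat. intros m Hm. assert (Hm2 : 2 <= INR m) by (apply (le_INR 2); exact Hm). assert (He : 0 < / INR m) by (apply Rinv_0_lt_compat; lra).
    assert (U := damped_unfold g (/ INR m) k phi (INR m * INR m) Hg ltac:(nra)). cbv zeta in U. fold y in U. unfold cm. rewrite U.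
    fold (damped (/ INR m) y phi). specialize (HC m Hm).
    change (fun u => pp g u * (exp (- (/ INR m * u)) * cos (y * u + phi))) with (fun u => pp g u * damped (/ INR m) y phi u).
    set (T := rint (fun u => F0 g u * damped (/ INR m) y phi u) 0 (INR m * INR m)) in *.
    set (I1 := rint (fun u => F0 g u * damped (/ INR m) y phi u) (INR m * INR m) (INR m * INR m + 1)).
    assert (BT : Rabs ((1 - exp (- / INR m)) * T) <= C * / INR m).
    { rewrite Rabs_mult. assert (E1 := exp_neg_le1 (/ INR m) ltac:(lra)). assert (E2 : 1 + - / INR m <= exp (- / INR m)) by apply exp_ineq1_le.
      rewrite Rabs_pos_eq by lra. assert (P := Rabs_pos T). nra. }
    assert (BI : Rabs I1 <= C2 * Rpower 2 (g + 1) * (Rpower (INR m) (2 * (g + 1)) * exp (- INR m))).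
    { unfold I1. replace (C2 * Rpower 2 (g + 1) * (Rpower (INR m) (2 * (g + 1)) * exp (- INR m))) with ((INR m * INR m + 1 - INR m * INR m) * (C2 * Rpower 2 (g + 1) * (Rpower (INR m) (2 * (g + 1)) * exp (- INR m)))) by ring.
      apply rint_abs; [lra|apply F0_damped_cont; nra|]. intros x Hx. rewrite Rabs_mult. rewrite <- Rmult_assoc.
      apply Rmult_le_compat; [apply Rabs_pos|apply Rabs_pos| |].
      - eapply Rle_trans; [apply HG; nra|]. rewrite Rmult_assoc. apply Rmult_le_compat_l; [exact HC2|].
        replace (2 * (g + 1)) with ((g + 1) + (g + 1)) by ring. rewrite (Rpower_plus (g + 1) (g + 1) (INR m)), (Rpower_mult_distr (INR m) (INR m)) by lra. rewrite Rpower_mult_distr by nra.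
        apply Rle_Rpower_l; nra.
      - eapply Rle_trans; [apply damped_abs|]. apply exp_le_mono. apply Ropp_le_contravar.
        replace (INR m) with (/ INR m * (INR m * INR m)) at 1 by (field; lra). apply Rmult_le_compat_l; lra. }
    apply Rabs_le_between in BT. apply Rabs_le_between in BI. lra. }
  apply is_lim_seq_unique in L1. apply is_lim_seq_unique in L2. rewrite L1 in L2. now injection L2.
Qed.

(** For frequency 0 nothing oscillates. Undamped, the integral equals [X^(g + 1) / (g + 1)] plus the
    integral of [F0] over [[X, X + 1]]. As [Bser (g + 1) / (g + 1)] is a primitive of [Bser g], the
    two parts cancel up to the defect [e1] for the exponent [g + 1]. *)
Lemma F0_mean g : 0 < g -> rint (F0 g) 0 1 = 0.
Proof.
  intros Hg.
  destruct (order_for_spec (g + 2) ltac:(lra)) as [HN1 HN2]. set (N := order_for (g + 2)) in *.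
  destruct (Z1_near g N Hg HN1 ltac:(lra)) as [c1 [Hc1 H1]].
  destruct (e1_bound (g + 1) N ltac:(lra) HN1) as [c2 [Hc2 H2]].
  assert (Hc : forall a b, 0 <= a -> cont_on (F0 g) a b) by (intros a b Ha x Hx; apply F0_continuous; lra).
  assert (B : forall X, 2 <= X -> Rabs (rint (F0 g) 0 1) <= (c1 + c2) * Rpower X (-1)).
  { intros X HX.
    assert (U := damped_unfold g 0 0 0 X Hg ltac:(lra)). cbv zeta in U.
    assert (Ed : forall x, damped 0 (2 * PI * INR 0) 0 x = 1).
    { intros x. unfold damped. simpl. replace (- (0 * x)) with 0 by ring. replace (2 * PI * 0 * x + 0) with 0 by ring. rewrite exp_0, cos_0. ring. }
    rewrite !(rint_ext (fun u => F0 g u * damped 0 (2 * PI * INR 0) 0 u) (F0 g)) in U by (try lra; intros x _; rewrite Ed; ring).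
    rewrite (rint_ext (fun u => pp g u * damped 0 (2 * PI * INR 0) 0 u) (pp g)) in U by (try lra; intros x _; rewrite Ed; ring).
    rewrite Ropp_0, exp_0 in U.
    assert (Ep : rint (pp g) 0 X = / (g + 1) * Rpower X (g + 1)).
    { rewrite (rint_ftc (fun u => / (g + 1) * (pp g u * u)) (pp g) 0 X); [|lra|intros x _; now apply pp_continuous|].
      - rewrite Rmult_0_r, Rmult_0_r, Rminus_0_r, pp_pos, Rpower_plus, Rpower_1 by lra. reflexivity.
      - intros x Hx. replace (pp g x) with (/ (g + 1) * ((g + 1) * pp g x)) by (field; lra). apply is_derive_scal. apply pp_mul_derive; lra. }
    assert (Eb : rint (Bser g N) X (X + 1) = / (g + 1) * (Bser (g + 1) N (X + 1) - Bser (g + 1) N X)).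
    { rewrite (rint_ftc (fun u => / (g + 1) * Bser (g + 1) N u) (Bser g N) X (X + 1)); [ring|lra|intros x Hx; apply psum_continuous; lra|].
      intros x Hx. unfold Bser, psum.
      assert (D : forall n, is_derive (fun u => rsum (fun k => / (g + 1 + 1) * bcoef k * ff (g + 1 + 1) k * Rpower u (g + 1 + 1 - INR k)) n) x
         (rsum (fun k => (g + 1) * (/ (g + 1) * bcoef k * ff (g + 1) k * Rpower x (g + 1 - INR k))) n)).
      { induction n as [|n IH]; [apply (is_derive_const (K := R_AbsRing) (V := R_NormedModule) 0 x)|].
        simpl. apply (is_derive_plus (K := R_AbsRing) (V := R_NormedModule) _ _ x _ _ IH).
        replace ((g + 1) * (/ (g + 1) * bcoef n * ff (g + 1) n * Rpower x (g + 1 - INR n))) with (/ (g + 1 + 1) * bcoef n * ff (g + 1 + 1) n * ((g + 1 + 1 - INR n) * Rpower x (g + 1 + 1 - INR n - 1))).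
        - apply is_derive_scal. apply is_derive_Reals. apply derivable_pt_lim_power. lra.
        - assert (F1 := ff_S_l (g + 1 + 1) n). simpl ff at 1 in F1. replace (g + 1 + 1 - 1) with (g + 1) in F1 by ring.
          replace (g + 1 + 1 - INR n - 1) with (g + 1 - INR n) by ring.
          replace (/ (g + 1 + 1) * bcoef n * ff (g + 1 + 1) n * ((g + 1 + 1 - INR n) * Rpower x (g + 1 - INR n)))
            with (/ (g + 1 + 1) * bcoef n * (ff (g + 1 + 1) n * (g + 1 + 1 - INR n)) * Rpower x (g + 1 - INR n)) by ring.
          rewrite F1. field. lra. }
      assert (D' := is_derive_scal _ _ (/ (g + 1)) _ (D N)). rewrite rsum_scal in D'.
      replace (rsum (fun k => / (g + 1) * bcoef k * ff (g + 1) k * Rpower x (g + 1 - INR k)) N) with (/ (g + 1) * ((g + 1) * rsum (fun k => / (g + 1) * bcoef k * ff (g + 1) k * Rpower x (g + 1 - INR k)) N)) by (field; lra).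
      exact D'. }
    assert (Er : Rabs (rint (F0 g) X (X + 1) - rint (Bser g N) X (X + 1)) <= (X + 1 - X) * (c1 * Rpower X (-1))).
    { assert (Hcb : cont_on (Bser g N) X (X + 1)) by (intros x Hx; apply psum_continuous; lra).
      rewrite <- rint_minus by (try lra; try exact Hcb; apply Hc; lra). apply rint_abs; [lra| |].
      - intros x Hx. apply cont_minus; [apply (Hc X (X + 1)); lra|now apply Hcb].
      - intros x Hx. rewrite F0_Z1 by lra. eapply Rle_trans; [apply H1; lra|]. apply Rmult_le_compat_l; [exact Hc1|].
        apply Rle_trans with (Rpower x (-1)); [apply Rpower_le_exp; lra|].
        replace (-1) with (- (1)) by ring. rewrite !Rpower_Ropp, !Rpower_1 by lra. apply Rinv_le_contravar; lra. }
    assert (Ee : Rabs (e1 (g + 1) N X) <= c2 * Rpower X (-1)).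
    { eapply Rle_trans; [apply H2, HX|]. apply Rmult_le_compat_l; [exact Hc2|]. apply Rpower_le_exp; lra. }
    unfold e1 in Ee. assert (Hg1 : / (g + 1) <= 1) by (rewrite <- Rinv_1; apply Rinv_le_contravar; lra).
    assert (Hg0 : 0 < / (g + 1)) by (apply Rinv_0_lt_compat; lra).
    replace (rint (F0 g) 0 1) with ((rint (F0 g) X (X + 1) - rint (Bser g N) X (X + 1)) + / (g + 1) * (Rpower X (g + 1) - (Bser (g + 1) N X - Bser (g + 1) N (X + 1)))) by lra.
    eapply Rle_trans; [apply Rabs_triang|]. rewrite Rabs_mult, (Rabs_pos_eq (/ (g + 1))) by lra.
    assert (P := Rabs_pos (Rpower X (g + 1) - (Bser (g + 1) N X - Bser (g + 1) N (X + 1)))). nra. }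
  destruct (Req_dec (rint (F0 g) 0 1) 0) as [E|E]; [exact E|exfalso].
  assert (HE := Rabs_pos_lt _ E).
  destruct (tends0_power (c1 + c2) (-1) ltac:(lra) (Rabs (rint (F0 g) 0 1) / 2) ltac:(lra)) as [W HW].
  specialize (HW (Rmax 2 W) (Rmax_r _ _)). specialize (B (Rmax 2 W) (Rmax_l _ _)).
  assert (Q := Rle_abs ((c1 + c2) * Rpower (Rmax 2 W) (-1))). lra.
Qed.

(** * Uniqueness of Fourier coefficients *)

(** The powers of [(1 + cos) / 2] are trigonometric polynomials: by the product formula one more
    factor replaces the frequency [k] by a combination of [k - 1], [k] and [k + 1]. *)
Lemma fourier_kernel D u0 : cont_on D 0 1 ->
  (forall k phi, rint (fun u => D u * cos (2 * PI * INR k * u + phi)) 0 1 = 0) ->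
  forall n k, rint (fun u => D u * (((1 + cos (2 * PI * (u - u0))) / 2) ^ n * cos (2 * PI * INR k * (u - u0)))) 0 1 = 0.
Proof.
  intros HD H. induction n as [|n IH]; intros k.
  - eapply eq_trans; [|exact (H k (- (2 * PI * INR k * u0)))]. apply rint_ext; [lra|]. intros x _. simpl. rewrite Rmult_1_l. do 2 f_equal. ring.
  - set (f := fun k u => D u * (((1 + cos (2 * PI * (u - u0))) / 2) ^ n * cos (2 * PI * INR k * (u - u0)))).
    assert (Hf : forall k, cont_on (f k) 0 1).
    { intros j x Hx. apply cont_mult; [now apply HD|]. apply smooth_cont. auto_derive. exact I. }
    assert (Hs : forall j, cont_on (fun u => / 2 * f k u + / 4 * (f (S k) u + f j u)) 0 1).
    { intros j x Hx. apply cont_plus; [apply cont_mult; [apply cont_const|now apply Hf]|]. apply cont_mult; [apply cont_const|]. apply cont_plus; now apply Hf. }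
    assert (Hi : forall j, rint (fun u => / 2 * f k u + / 4 * (f (S k) u + f j u)) 0 1 = 0).
    { intros j. rewrite rint_plus, !rint_scal, rint_plus; try lra; try apply Hf.
      - unfold f. rewrite !IH. ring.
      - intros x Hx. apply cont_plus; now apply Hf.
      - intros x Hx. apply cont_mult; [apply cont_const|now apply Hf].
      - intros x Hx. apply cont_mult; [apply cont_const|]. apply cont_plus; now apply Hf. }
    assert (Hcos : forall x y, cos x * cos y = (cos (x + y) + cos (x - y)) / 2) by (intros x y; rewrite cos_plus, cos_minus; field).
    (* The lower frequency is the absolute value of [k - 1], which is 1 for [k = 0]. *)
    eapply eq_trans; [|exact (Hi (match k with O => 1%nat | S j => j end))]. apply rint_ext; [lra|]. intros x _. unfold f.
    set (T := ((1 + cos (2 * PI * (x - u0))) / 2) ^ n).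
    change (((1 + cos (2 * PI * (x - u0))) / 2) ^ S n) with ((1 + cos (2 * PI * (x - u0))) / 2 * T).
    assert (E : cos (2 * PI * (x - u0)) * cos (2 * PI * INR k * (x - u0)) = (cos (2 * PI * INR (S k) * (x - u0)) + cos (2 * PI * INR (match k with O => 1%nat | S j => j end) * (x - u0))) / 2).
    { rewrite Hcos. f_equal. f_equal.
      - f_equal. rewrite S_INR. ring.
      - destruct k as [|j].
        + simpl INR. f_equal. ring.
        + rewrite S_INR. rewrite <- cos_neg. f_equal. ring. }
    replace (D x * ((1 + cos (2 * PI * (x - u0))) / 2 * T * cos (2 * PI * INR k * (x - u0)))) with
      (D x * T * (cos (2 * PI * INR k * (x - u0)) + cos (2 * PI * (x - u0)) * cos (2 * PI * INR k * (x - u0))) / 2) by field.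
    rewrite E. field.
Qed.

Lemma half_one_plus_cos x : (1 + cos (2 * x)) / 2 = cos x * cos x.
Proof. rewrite cos_2a_cos. field. Qed.

Lemma pow_ratio_small a b c : 0 <= b -> b < a -> 0 < c -> exists n, b ^ n < c * a ^ n.
Proof.
  intros Hb Ha Hc. assert (Hr : Rabs (b / a) < 1).
  { rewrite Rabs_pos_eq by (apply Rdiv_le_0_compat; lra). apply (Rmult_lt_reg_r a); [lra|]. unfold Rdiv. rewrite Rmult_assoc, Rinv_l; lra. }
  destruct (pow_lt_1_zero (b / a) Hr c Hc) as [n Hn]. exists n. specialize (Hn n (le_n _)).
  rewrite Rabs_pos_eq in Hn by (apply pow_le; apply Rdiv_le_0_compat; lra).
  unfold Rdiv in Hn. rewrite Rpow_mult_distr, pow_inv in Hn. assert (P : 0 < a ^ n) by (apply pow_lt; lra).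
  apply (Rmult_lt_reg_r (/ a ^ n)); [now apply Rinv_0_lt_compat|]. rewrite Rmult_assoc, Rinv_r by lra. lra.
Qed.

(** The kernel is the power [n] of [cos^2 (PI (u - u0))]. It is at least [a^n] within distance
    [d / 2] of [u0] and at most [b^n] beyond distance [d], with [b < a]; between the two, [D] is
    positive anyway. So a positive value of [D] would give a positive integral for large [n]. *)
Lemma fourier_not_pos D u0 : 0 < u0 < 1 -> cont_on D 0 1 ->
  (forall k phi, rint (fun u => D u * cos (2 * PI * INR k * u + phi)) 0 1 = 0) -> ~ 0 < D u0.
Proof.
  intros Hu0 HD H Hpos. assert (HPI := PI_RGT_0).
  destruct (cont_bounded D 0 1 ltac:(lra) HD) as [M [HM0 HM]].
  assert (Hc := HD u0 ltac:(lra)). apply continuity_pt_filterlim in Hc.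
  destruct (Hc (D u0 / 2) ltac:(lra)) as [d1 [Hd1 H1]].
  set (d := Rmin (d1 / 2) (Rmin (u0 / 2) (Rmin ((1 - u0) / 2) (1 / 2)))).
  assert (Hd : 0 < d) by (unfold d; repeat apply Rmin_pos; lra).
  assert (L1 : d <= d1 / 2) by apply Rmin_l.
  assert (L2 : d <= u0 / 2) by (eapply Rle_trans; [apply Rmin_r|apply Rmin_l]).
  assert (L3 : d <= (1 - u0) / 2) by (eapply Rle_trans; [apply Rmin_r|]; eapply Rle_trans; [apply Rmin_r|apply Rmin_l]).
  assert (L4 : d <= 1 / 2) by (eapply Rle_trans; [apply Rmin_r|]; eapply Rle_trans; [apply Rmin_r|]; apply Rmin_r).
  assert (Hnear : forall u, Rabs (u - u0) <= d -> D u0 / 2 <= D u).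
  { intros u Hu. destruct (Req_dec u u0) as [->|Hne]; [lra|].
    specialize (H1 u). simpl in H1. unfold Rdist, D_x, no_cond in H1. assert (Hud : Rabs (u - u0) < d1) by lra. specialize (H1 (conj (conj I (not_eq_sym Hne)) Hud)).
    apply Rabs_lt_between in H1. lra. }
  set (a := cos (PI * (d / 2)) * cos (PI * (d / 2))). set (b := cos (PI * d) * cos (PI * d)).
  set (T := fun n u => ((1 + cos (2 * PI * (u - u0))) / 2) ^ n).
  assert (Ca : forall x y, 0 <= x -> x <= y -> y <= PI -> cos y <= cos x) by (intros x y Hx Hxy Hy; apply cos_decr_1; lra).
  assert (Cd0 : 0 <= cos (PI * d)) by (apply cos_ge_0; nra).
  assert (Cdd : cos (PI * d) < cos (PI * (d / 2))) by (apply cos_decreasing_1; nra).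
  assert (Hab : 0 <= b /\ b < a) by (unfold a, b; split; nra).
  assert (TE : forall n u, T n u = (cos (PI * Rabs (u - u0)) * cos (PI * Rabs (u - u0))) ^ n).
  { intros n u. unfold T. f_equal. replace (2 * PI * (u - u0)) with (2 * (PI * (u - u0))) by ring. rewrite half_one_plus_cos.
    destruct (Rle_dec 0 (u - u0)) as [Hs|Hs]; [now rewrite Rabs_pos_eq|].
    rewrite Rabs_left by lra. replace (PI * - (u - u0)) with (- (PI * (u - u0))) by ring. now rewrite cos_neg. }
  assert (T1 : forall n u, Rabs (u - u0) <= d / 2 -> a ^ n <= T n u).
  { intros n u Hu. rewrite TE. assert (Hp := Rabs_pos (u - u0)). apply pow_incr. assert (cos (PI * (d / 2)) <= cos (PI * Rabs (u - u0))) by (apply Ca; nra).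
    unfold a. nra. }
  assert (T2 : forall n u, 0 <= u <= 1 -> d <= Rabs (u - u0) -> 0 <= T n u <= b ^ n).
  { intros n u Hu Hdu. rewrite TE. assert (Hup : Rabs (u - u0) <= 1 - d) by (apply Rabs_le; lra).
    assert (B1 : cos (PI * Rabs (u - u0)) <= cos (PI * d)) by (apply Ca; nra).
    assert (B2 : - cos (PI * d) <= cos (PI * Rabs (u - u0))).
    { replace (- cos (PI * d)) with (cos (PI * (1 - d))); [apply Ca; nra|]. replace (PI * (1 - d)) with (- (PI * d - PI)) by ring.
      rewrite cos_neg, cos_minus, cos_PI, sin_PI. ring. }
    split; [apply pow_le; nra|]. apply pow_incr. split; [nra|]. unfold b. nra. }
  assert (T0 : forall n u, 0 <= T n u) by (intros; rewrite TE; apply pow_le; nra).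
  assert (HDT : forall n, cont_on (fun u => D u * T n u) 0 1).
  { intros n x Hx. apply cont_mult; [now apply HD|]. apply smooth_cont. unfold T. auto_derive. exact I. }
  assert (Hlow : forall n u, 0 <= u <= 1 -> - (M * b ^ n) <= D u * T n u).
  { intros n u Hu. assert (Pb : 0 <= b ^ n) by (apply pow_le; lra). destruct (Rle_dec (Rabs (u - u0)) d) as [Hle|Hgt].
    - assert (P1 := Hnear u Hle). assert (P2 := T0 n u). assert (0 <= D u * T n u) by (apply Rmult_le_pos; lra). nra.
    - assert (P1 := T2 n u Hu ltac:(lra)). assert (P2 := proj1 (Rabs_le_between _ _) (HM u Hu)). nra. }
  (* This [n] makes the contribution of the peak, at least [D u0 / 2] times [a^n] over a length [d],
     exceed [(M + 1) b^n]. *)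
  destruct (pow_ratio_small a b (D u0 / 2 * d / (M + 1)) ltac:(lra) ltac:(lra)) as [n Hn].
  { apply Rdiv_lt_0_compat; [nra|lra]. }
  assert (Z := fourier_kernel D u0 HD H n 0). fold (T n) in Z.
  rewrite (rint_ext _ (fun u => D u * T n u)) in Z; [|lra|].
  2:{ intros x _. simpl INR. replace (2 * PI * 0 * (x - u0)) with 0 by ring. rewrite cos_0. unfold T. ring. }
  rewrite (rint_split _ 0 (u0 - d / 2) 1) in Z by (try lra; apply HDT).
  rewrite (rint_split _ (u0 - d / 2) (u0 + d / 2) 1) in Z; try lra; [|intros x Hx; apply HDT; lra].
  assert (Sub : forall p q, 0 <= p -> q <= 1 -> cont_on (fun u => D u * T n u) p q) by (intros p q Hp Hq x Hx; apply HDT; lra).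
  assert (I1 : (u0 - d / 2 - 0) * - (M * b ^ n) <= rint (fun u => D u * T n u) 0 (u0 - d / 2)).
  { rewrite <- rint_const. apply rint_le; [lra|intros x _; apply cont_const|apply Sub; lra|intros x Hx; apply Hlow; lra]. }
  assert (I3 : (1 - (u0 + d / 2)) * - (M * b ^ n) <= rint (fun u => D u * T n u) (u0 + d / 2) 1).
  { rewrite <- rint_const. apply rint_le; [lra|intros x _; apply cont_const|apply Sub; lra|intros x Hx; apply Hlow; lra]. }
  assert (I2 : (u0 + d / 2 - (u0 - d / 2)) * (D u0 / 2 * a ^ n) <= rint (fun u => D u * T n u) (u0 - d / 2) (u0 + d / 2)).
  { rewrite <- rint_const. apply rint_le; [lra|intros x _; apply cont_const|apply Sub; lra|].
    intros x Hx. assert (Hax : Rabs (x - u0) <= d / 2) by (apply Rabs_le; lra).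
    apply Rmult_le_compat; [lra|apply pow_le; lra|apply Hnear; lra|now apply T1]. }
  assert (Pb : 0 <= b ^ n) by (apply pow_le; lra).
  assert (Hn2 : (M + 1) * b ^ n < D u0 / 2 * d * a ^ n).
  { apply (Rmult_lt_reg_r (/ (M + 1))); [apply Rinv_0_lt_compat; lra|].
    replace ((M + 1) * b ^ n * / (M + 1)) with (b ^ n) by (field; lra). unfold Rdiv in *. lra. }
  assert (PM : 0 <= M * b ^ n) by (apply Rmult_le_pos; assumption).
  assert ((u0 - d / 2 - 0) * - (M * b ^ n) + (1 - (u0 + d / 2)) * - (M * b ^ n) >= - (M * b ^ n)) by nra. nra.
Qed.

Lemma fourier_unique D : cont_on D 0 1 ->
  (forall k phi, rint (fun u => D u * cos (2 * PI * INR k * u + phi)) 0 1 = 0) -> forall u, 0 <= u <= 1 -> D u = 0.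
Proof.
  intros HD H.
  assert (Hin : forall u, 0 < u < 1 -> D u = 0).
  { intros u Hu. assert (N1 := fourier_not_pos D u Hu HD H).
    assert (N2 : ~ 0 < - 1 * D u).
    { apply (fourier_not_pos (fun u => -1 * D u) u Hu).
      - intros x Hx. apply cont_mult; [apply cont_const|now apply HD].
      - intros k phi. rewrite (rint_ext _ (fun u => -1 * (D u * cos (2 * PI * INR k * u + phi)))) by (try lra; intros; ring).
        rewrite rint_scal, H; [ring|lra|]. intros x Hx. apply cont_mult; [now apply HD|]. apply smooth_cont. auto_derive. exact I. }
    lra. }
  (* For the end points: a nonzero value there would persist at nearby inner points, where [D]
     vanishes. *)
  intros u Hu. destruct (Req_dec (D u) 0) as [E|E]; [exact E|exfalso].
  assert (HE := Rabs_pos_lt _ E). assert (Hc := HD u Hu). apply continuity_pt_filterlim in Hc.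
  destruct (Hc (Rabs (D u)) HE) as [d [Hd H1]].
  destruct (Rlt_dec u (1 / 2)) as [Hh|Hh].
  - set (v := u + Rmin (d / 2) (1 / 4)). assert (M1 := Rmin_l (d / 2) (1 / 4)). assert (M2 := Rmin_r (d / 2) (1 / 4)).
    assert (M3 : 0 < Rmin (d / 2) (1 / 4)) by (apply Rmin_pos; lra).
    specialize (H1 v). simpl in H1. unfold Rdist, D_x, no_cond in H1. rewrite (Hin v) in H1 by (unfold v; lra).
    replace (0 - D u) with (- D u) in H1 by ring. rewrite Rabs_Ropp in H1.
    assert (Rabs (D u) < Rabs (D u)); [|lra]. apply H1. split; [split; [exact I|unfold v; lra]|]. unfold v. rewrite Rabs_pos_eq; lra.
  - set (v := u - Rmin (d / 2) (1 / 4)). assert (M1 := Rmin_l (d / 2) (1 / 4)). assert (M2 := Rmin_r (d / 2) (1 / 4)).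
    assert (M3 : 0 < Rmin (d / 2) (1 / 4)) by (apply Rmin_pos; lra).
    specialize (H1 v). simpl in H1. unfold Rdist, D_x, no_cond in H1. rewrite (Hin v) in H1 by (unfold v; lra).
    replace (0 - D u) with (- D u) in H1 by ring. rewrite Rabs_Ropp in H1.
    assert (Rabs (D u) < Rabs (D u)); [|lra]. apply H1. split; [split; [exact I|unfold v; lra]|]. unfold v. rewrite Rabs_left; lra.
Qed.

(** * Hurwitz's formula *)

Definition zterm (g : R) (j : nat) : R := Rpower (INR (S j)) (- (1 + g)).

(** The mean value theorem for [t^(- g)] on [[x, x + 1]]; the right side telescopes and gives the
    tail bound [K^(- g) / g]. *)
Lemma zterm_step g x : 0 < g -> 0 < x -> Rpower (x + 1) (- (1 + g)) <= / g * (Rpower x (- g) - Rpower (x + 1) (- g)).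
Proof.
  intros Hg Hx. assert (HD : forall t, 0 < t -> is_derive (fun t => Rpower t (- g)) t (- g * Rpower t (- g - 1))).
  { intros t Ht. apply is_derive_Reals. now apply derivable_pt_lim_power. }
  destruct (MVT_gen (fun t => Rpower t (- g)) x (x + 1) (fun t => - g * Rpower t (- g - 1))) as [c [Hc E]].
  - intros t Ht. rewrite Rmin_left, Rmax_right in Ht by lra. apply HD. lra.
  - intros t Ht. rewrite Rmin_left, Rmax_right in Ht by lra. apply continuity_pt_filterlim. apply (cont_derive (fun t => Rpower t (- g)) t (- g * Rpower t (- g - 1))). apply HD. lra.
  - rewrite Rmin_left, Rmax_right in Hc by lra.
    replace (/ g * (Rpower x (- g) - Rpower (x + 1) (- g))) with (Rpower c (- g - 1)).
    + replace (- g - 1) with (- (1 + g)) by ring. rewrite !Rpower_Ropp. apply Rinv_le_contravar; [apply Rpower_pos|]. apply Rle_Rpower_l; lra.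
    + replace (Rpower x (- g) - Rpower (x + 1) (- g)) with (- (Rpower (x + 1) (- g) - Rpower x (- g))) by ring. rewrite E. field. lra.
Qed.

Lemma zterm_pos g j : 0 < zterm g j.
Proof. apply Rpower_pos. Qed.

Lemma zterm_tail g K n : 0 < g -> (1 <= K)%nat -> rsum (fun j => zterm g (K + j)) n <= / g * Rpower (INR K) (- g).
Proof.
  intros Hg HK. assert (HK1 : 1 <= INR K) by (apply (le_INR 1); exact HK).
  assert (Hig : 0 < / g) by now apply Rinv_0_lt_compat.
  assert (G : rsum (fun j => zterm g (K + j)) n <= / g * (Rpower (INR K) (- g) - Rpower (INR K + INR n) (- g))).
  { induction n as [|n IH]; [simpl; rewrite Rplus_0_r; lra|]. rewrite rsum_S. unfold zterm at 2. rewrite !S_INR, plus_INR.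
    assert (Hn := pos_INR n). assert (Q := zterm_step g (INR K + INR n) Hg ltac:(lra)).
    replace (INR K + (INR n + 1)) with (INR K + INR n + 1) by ring. lra. }
  assert (P := Rpower_pos (INR K + INR n) (- g)). nra.
Qed.

Lemma zterm_sum g n : 0 < g -> rsum (zterm g) n <= 1 + / g.
Proof.
  intros Hg. assert (Hig : 0 < / g) by now apply Rinv_0_lt_compat. destruct n as [|n]; [simpl; lra|].
  rewrite rsum_S_l. unfold zterm at 1. simpl INR. unfold Rpower at 1. rewrite ln_1, Rmult_0_r, exp_0.
  assert (T := zterm_tail g 1 n Hg (le_n _)). simpl INR in T. unfold Rpower in T at 1. rewrite ln_1, Rmult_0_r, exp_0 in T.
  change (fun k => zterm g (S k)) with (fun j => zterm g (1 + j)). lra.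
Qed.

Lemma series_tail (v u : nat -> R) K T : ex_series v -> (forall n, Rabs (v n) <= u n) ->
  (forall n, rsum (fun j => u (K + j)%nat) n <= T) -> Rabs (Series v - rsum v K) <= T.
Proof.
  intros Hv Hu HT. destruct (series_dom (fun j => u (K + j)%nat) (fun j => v (K + j)%nat) T) as [_ [_ H]]; [intros; apply Hu|exact HT|].
  destruct K as [|K]; [simpl in *; rewrite Rminus_0_r; exact H|].
  rewrite (Series_incr_n v (S K)) by (try lia; exact Hv). simpl pred.
  replace (sum_f_R0 v K) with (rsum v (S K)); [|rewrite <- sum_n_rsum; apply sum_n_Reals].
  replace (rsum v (S K) + Series (fun k => v (S K + k)%nat) - rsum v (S K)) with (Series (fun k => v (S K + k)%nat)) by ring. exact H.
Qed.

Definition hterm (g u : R) (j : nat) : R := sin (2 * PI * INR (S j) * u - PI / 2 * g) * zterm g j.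

Definition Hser (g u : R) : R := Series (hterm g u).

Lemma hterm_abs g u j : Rabs (hterm g u j) <= zterm g j.
Proof.
  unfold hterm. rewrite Rabs_mult, (Rabs_pos_eq (zterm g j)) by (left; apply zterm_pos). rewrite <- (Rmult_1_l (zterm g j)) at 2.
  apply Rmult_le_compat_r; [left; apply zterm_pos|]. apply Rabs_le. apply SIN_bound.
Qed.

Lemma hterm_ex g u : 0 < g -> ex_series (hterm g u).
Proof.
  intros Hg. destruct (series_dom (zterm g) (hterm g u) (1 + / g)) as [H _]; [apply hterm_abs|intros; now apply zterm_sum|exact H].
Qed.

Lemma Hser_bound g u : 0 < g -> Rabs (Hser g u) <= 1 + / g.
Proof.
  intros Hg. destruct (series_dom (zterm g) (hterm g u) (1 + / g)) as [_ [_ H]]; [apply hterm_abs|intros; now apply zterm_sum|exact H].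
Qed.

Lemma Hser_tail g u K : 0 < g -> (1 <= K)%nat -> Rabs (Hser g u - rsum (hterm g u) K) <= / g * Rpower (INR K) (- g).
Proof.
  intros Hg HK. apply (series_tail _ (zterm g)); [now apply hterm_ex|apply hterm_abs|]. intros n. now apply zterm_tail.
Qed.

Lemma power_small c g eps : 0 < g -> 0 < eps -> exists K, (1 <= K)%nat /\ forall n, (K <= n)%nat -> c * Rpower (INR n) (- g) <= eps.
Proof.
  intros Hg He. destruct (tends0_power c (- g) ltac:(lra) eps He) as [W HW]. destruct (INR_unbounded W) as [K HK].
  exists (S K). split; [lia|]. intros n Hn. assert (Hn' : INR K <= INR n) by (apply le_INR; lia).
  eapply Rle_trans; [apply Rle_abs|]. apply HW. lra.
Qed.

Lemma hterm_cont g j u : continuous (fun u => hterm g u j) u.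
Proof. apply smooth_cont. unfold hterm. auto_derive. exact I. Qed.

Lemma Hser_cont g u : 0 < g -> continuous (Hser g) u.
Proof.
  intros Hg. apply (cont_uniform _ u 1 Rlt_0_1). intros eps He. destruct (power_small (/ g) g eps Hg He) as [K [HK1 HK]].
  exists (fun u => rsum (hterm g u) K). split.
  - apply (cont_rsum (fun j u => hterm g u j)). intros j _. apply hterm_cont.
  - intros y _. eapply Rle_trans; [apply Hser_tail; assumption|]. now apply HK.
Qed.

Lemma cos_Zperiod x z : cos (x + 2 * PI * IZR z) = cos x.
Proof.
  destruct (Z_le_dec 0 z) as [Hz|Hz].
  - rewrite <- (Z2Nat.id z Hz), <- INR_IZR_INZ. apply cos_period_nat.
  - rewrite <- (cos_period_nat (x + 2 * PI * IZR z) (Z.to_nat (- z))). f_equal.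
    rewrite INR_IZR_INZ, Z2Nat.id, opp_IZR by lia. ring.
Qed.

Lemma sin_Zperiod x z : sin (x + 2 * PI * IZR z) = sin x.
Proof. rewrite !sin_cos_shift, <- (cos_Zperiod (x - PI / 2) z). f_equal. ring. Qed.

Lemma sin_integral z b : rint (fun u => sin (2 * PI * IZR z * u + b)) 0 1 = if Z.eqb z 0 then sin b else 0.
Proof.
  assert (HPI := PI_RGT_0). destruct (Z.eqb_spec z 0) as [->|Hz].
  - rewrite (rint_ext _ (fun _ => sin b)); [rewrite rint_const; ring|lra|]. intros x _. f_equal. ring.
  - assert (Hz' : IZR z <> 0) by now apply not_0_IZR.
    rewrite (rint_ftc (fun u => - cos (2 * PI * IZR z * u + b) / (2 * PI * IZR z))); [|lra| |].
    + replace (2 * PI * IZR z * 1 + b) with (b + 2 * PI * IZR z) by ring. rewrite cos_Zperiod. rewrite Rmult_0_r, Rplus_0_l. field. split; [exact Hz'|lra].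
    + intros x _. apply smooth_cont. auto_derive. exact I.
    + intros x _. auto_derive; [exact I|]. field. split; [exact Hz'|lra].
Qed.

Lemma hterm_fourier g j k phi : rint (fun u => hterm g u j * cos (2 * PI * INR k * u + phi)) 0 1 =
  if Nat.eqb (S j) k then / 2 * cos (phi + (1 + g) * (PI / 2)) * zterm g j else 0.
Proof.
  set (z1 := (Z.of_nat (S j) + Z.of_nat k)%Z). set (z2 := (Z.of_nat (S j) - Z.of_nat k)%Z).
  assert (C : forall z b, cont_on (fun u => sin (2 * PI * IZR z * u + b)) 0 1) by (intros z b x _; apply smooth_cont; auto_derive; exact I).
  rewrite (rint_ext _ (fun u => (zterm g j / 2) * (sin (2 * PI * IZR z1 * u + (phi - PI / 2 * g)) + sin (2 * PI * IZR z2 * u + (- phi - PI / 2 * g))))); [|lra|].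
  - rewrite rint_scal, rint_plus, !sin_integral; try lra; try apply C.
    + replace (Z.eqb z1 0) with false by (symmetry; apply Z.eqb_neq; unfold z1; lia).
      replace (Z.eqb z2 0) with (Nat.eqb (S j) k).
      2:{ destruct (Nat.eqb_spec (S j) k); symmetry; [apply Z.eqb_eq|apply Z.eqb_neq]; unfold z2; lia. }
      destruct (Nat.eqb (S j) k); [|lra].
      replace (cos (phi + (1 + g) * (PI / 2))) with (sin (- phi - PI / 2 * g)); [field|].
      replace (- phi - PI / 2 * g) with (PI / 2 - (phi + (1 + g) * (PI / 2))) by field. apply sin_shift.
    + intros x Hx. apply cont_plus; now apply C.
  - intros x _. unfold hterm, z1, z2. rewrite plus_IZR, minus_IZR, <- !INR_IZR_INZ.
    set (A := 2 * PI * INR (S j) * x - PI / 2 * g). set (Bq := 2 * PI * INR k * x + phi).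
    replace (2 * PI * (INR (S j) + INR k) * x + (phi - PI / 2 * g)) with (A + Bq) by (unfold A, Bq; ring).
    replace (2 * PI * (INR (S j) - INR k) * x + (- phi - PI / 2 * g)) with (A - Bq) by (unfold A, Bq; ring).
    rewrite sin_plus, sin_minus. field.
Qed.

Lemma Hser_fourier g k phi : 0 < g -> rint (fun u => Hser g u * cos (2 * PI * INR k * u + phi)) 0 1 =
  if Nat.eqb k 0 then 0 else / 2 * cos (phi + (1 + g) * (PI / 2)) * Rpower (INR k) (- (1 + g)).
Proof.
  intros Hg. set (v := if Nat.eqb k 0 then 0 else / 2 * cos (phi + (1 + g) * (PI / 2)) * Rpower (INR k) (- (1 + g))).
  assert (Cc : continuous (fun u : R => u) 0) by apply continuous_id. clear Cc.
  assert (Ccos : cont_on (fun u => cos (2 * PI * INR k * u + phi)) 0 1) by (intros x _; apply smooth_cont; auto_derive; exact I).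
  assert (HK : forall K, (k <= K)%nat -> rint (fun u => rsum (hterm g u) K * cos (2 * PI * INR k * u + phi)) 0 1 = v).
  { intros K HkK. rewrite (rint_ext _ (fun u => rsum (fun j => hterm g u j * cos (2 * PI * INR k * u + phi)) K)); [|lra|].
    2:{ intros x _. rewrite Rmult_comm, <- rsum_scal. apply rsum_ext. intros; ring. }
    rewrite (rint_rsum (fun j u => hterm g u j * cos (2 * PI * INR k * u + phi))); [|lra|].
    2:{ intros j _ x Hx. apply cont_mult; [apply hterm_cont|now apply Ccos]. }
    rewrite (rsum_ext _ (fun j => if Nat.eqb (S j) k then v else 0)).
    - unfold v. destruct k as [|k'].
      + simpl Nat.eqb. cbv iota. apply rsum_zero.
      + set (w := if Nat.eqb (S k') 0 then 0 else _). replace K with (k' + S (K - S k'))%nat by lia. rewrite rsum_add, rsum_S_l.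
        rewrite (rsum_ext _ (fun _ => 0) k').
        2:{ intros j Hj. destruct (Nat.eqb_spec (S j) (S k')); [lia|reflexivity]. }
        rewrite (rsum_ext (fun k0 => if Nat.eqb (S (k' + S k0)) (S k') then w else 0) (fun _ => 0)).
        2:{ intros j Hj. destruct (Nat.eqb_spec (S (k' + S j)) (S k')); [lia|reflexivity]. }
        rewrite !rsum_zero. rewrite Nat.add_0_r, Nat.eqb_refl. ring.
    - intros j _. rewrite hterm_fourier. unfold v. destruct (Nat.eqb_spec (S j) k) as [<-|_]; reflexivity. }
  assert (B : forall K, (k <= K)%nat -> (1 <= K)%nat -> Rabs (rint (fun u => Hser g u * cos (2 * PI * INR k * u + phi)) 0 1 - v) <= / g * Rpower (INR K) (- g)).
  { intros K HkK HK1. rewrite <- (HK K HkK). rewrite <- rint_minus; [|lra| |].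
    - replace (/ g * Rpower (INR K) (- g)) with ((1 - 0) * (/ g * Rpower (INR K) (- g))) by ring. apply rint_abs; [lra| |].
      + intros x Hx. apply cont_minus; apply cont_mult; try (now apply Ccos); [now apply Hser_cont|].
        apply (cont_rsum (fun j u => hterm g u j)). intros j _. apply hterm_cont.
      + intros x Hx. rewrite <- Rmult_minus_distr_r, Rabs_mult. assert (T := Hser_tail g x K Hg HK1).
        assert (Cb : Rabs (cos (2 * PI * INR k * x + phi)) <= 1) by (apply Rabs_le; apply COS_bound).
        assert (P1 := Rabs_pos (cos (2 * PI * INR k * x + phi))). assert (P2 := Rabs_pos (Hser g x - rsum (hterm g x) K)). nra.
    - intros x Hx. apply cont_mult; [now apply Hser_cont|now apply Ccos].
    - intros x Hx. apply cont_mult; [|now apply Ccos]. apply (cont_rsum (fun j u => hterm g u j)). intros j _. apply hterm_cont. }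
  destruct (Req_dec (rint (fun u => Hser g u * cos (2 * PI * INR k * u + phi)) 0 1 - v) 0) as [E|E]; [lra|exfalso].
  assert (HE := Rabs_pos_lt _ E). destruct (power_small (/ g) g (Rabs (rint (fun u => Hser g u * cos (2 * PI * INR k * u + phi)) 0 1 - v) / 2) Hg ltac:(lra)) as [K [HK1 HKs]].
  specialize (HKs (Nat.max K k) ltac:(lia)). specialize (B (Nat.max K k) ltac:(lia) ltac:(lia)). lra.
Qed.

(** The constant of Hurwitz's formula for [zeta (1 - s, u)] with [s = 1 + g]. *)
Definition hconst (g : R) : R := 2 * Gamma (1 + g) / Rpower (2 * PI) (1 + g).

(** Both sides are continuous on [[0, 1]] and have the same Fourier coefficients; the free phase
    [phi] handles sines and cosines at once. *)
Lemma F0_Hser g u : 0 < g -> 0 <= u <= 1 -> F0 g u = hconst g * Hser g u.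
Proof.
  intros Hg Hu. apply Rminus_diag_uniq. assert (HPI := PI_RGT_0).
  apply (fourier_unique (fun u => F0 g u - hconst g * Hser g u)); [| |exact Hu].
  - intros x Hx. apply cont_minus; [apply F0_continuous; lra|]. apply cont_mult; [apply cont_const|now apply Hser_cont].
  - intros k phi.
    assert (Ccos : cont_on (fun u => cos (2 * PI * INR k * u + phi)) 0 1) by (intros x _; apply smooth_cont; auto_derive; exact I).
    assert (C1 : cont_on (fun u => F0 g u * cos (2 * PI * INR k * u + phi)) 0 1) by (intros x Hx; apply cont_mult; [apply F0_continuous; lra|now apply Ccos]).
    assert (C2 : cont_on (fun u => Hser g u * cos (2 * PI * INR k * u + phi)) 0 1) by (intros x Hx; apply cont_mult; [now apply Hser_cont|now apply Ccos]).
    rewrite (rint_ext _ (fun u => F0 g u * cos (2 * PI * INR k * u + phi) - hconst g * (Hser g u * cos (2 * PI * INR k * u + phi)))) by (try lra; intros; ring).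
    rewrite rint_minus, rint_scal, Hser_fourier; try lra; try exact C1; try exact C2.
    + destruct (Nat.eqb_spec k 0) as [->|Hk].
      * rewrite (rint_ext _ (fun u => cos phi * F0 g u)).
        -- rewrite rint_scal, F0_mean; [ring|exact Hg|lra|]. intros x Hx. apply F0_continuous; lra.
        -- lra.
        -- intros x _. simpl INR. replace (2 * PI * 0 * x + phi) with phi by ring. ring.
      * rewrite F0_fourier by (try exact Hg; lia). unfold hconst.
        rewrite <- Rpower_mult_distr by (try lra; apply lt_0_INR; lia). rewrite (Rpower_Ropp (2 * PI)). field. apply Rgt_not_eq, Rpower_pos.
    + intros x Hx. apply cont_mult; [apply cont_const|now apply C2].
Qed.

Lemma Hser_Zperiod g u z : Hser g (u + IZR z) = Hser g u.
Proof.
  apply Series_ext. intros j. unfold hterm. f_equal.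
  rewrite <- (sin_Zperiod (2 * PI * INR (S j) * u - PI / 2 * g) (Z.of_nat (S j) * z)). f_equal.
  rewrite mult_IZR, <- INR_IZR_INZ. ring.
Qed.

Theorem hurwitz_formula g u : 0 < g -> zp g u = hconst g * Hser g u.
Proof.
  intros Hg. destruct (base_fp u) as [H1 H2].
  assert (Eu : u = frac_part u + IZR (Int_part u)) by (unfold frac_part; ring).
  assert (Ez : zp g u = zp g (frac_part u)). { unfold zp. rewrite Eu at 1. now rewrite frac_part_shift. }
  assert (Eh : Hser g u = Hser g (frac_part u)). { rewrite Eu at 1. now rewrite Hser_Zperiod. }
  rewrite Ez, Eh. set (v := frac_part u) in *. clearbody v.
  (* At integers the convention [zeta (- g, 0) = zeta (- g, 1)] agrees with the periodicity of the
     series. *)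
  destruct (Req_dec v 0) as [->|Hv].
  - rewrite <- (zp_periodic g 0), Rplus_0_l, zp_unit, <- F0_Z1, F0_Hser by lra.
    f_equal. rewrite <- (Hser_Zperiod g 0 1). f_equal. ring.
  - rewrite zp_unit, <- F0_Z1, F0_Hser by lra. reflexivity.
Qed.

(** * Finite Fourier sums *)

(** Multiplied by [2 sin (th / 2)] the sum telescopes to a difference of cosines, which is 0 because
    [n th] is a period. *)
Lemma sin_sum_zero A th n : sin (th / 2) <> 0 -> (forall x, cos (x + INR n * th) = cos x) ->
  rsum (fun r => sin (A + INR r * th)) n = 0.
Proof.
  intros Hs Hp.
  assert (E : forall n, 2 * sin (th / 2) * rsum (fun r => sin (A + INR r * th)) n = cos (A - th / 2) - cos (A - th / 2 + INR n * th)).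
  { clear n Hp. induction n as [|n IH]; [simpl; rewrite Rmult_0_l, Rplus_0_r; ring|].
    rewrite rsum_S, Rmult_plus_distr_l, IH, S_INR.
    replace (A - th / 2 + INR n * th) with ((A + INR n * th) - th / 2) by ring.
    replace (A - th / 2 + (INR n + 1) * th) with ((A + INR n * th) + th / 2) by field.
    rewrite (cos_minus (A + INR n * th)), (cos_plus (A + INR n * th)). ring. }
  specialize (E n). rewrite Hp in E. apply (Rmult_eq_reg_l (2 * sin (th / 2))); [|lra]. rewrite E. ring.
Qed.

(** The weight [r / n] is what creates the denominators [sin (PI k mu / nu)] of (i): without it the
    sum would be 0. *)
Lemma sin_weighted_sum A th n : sin (th / 2) <> 0 -> (1 <= n)%nat -> (forall x, cos (x + INR n * th) = cos x) ->
  rsum (fun r => INR r / INR n * sin (A + INR r * th)) n = - cos (A - th / 2) / (2 * sin (th / 2)).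
Proof.
  intros Hs Hn Hp. assert (Hn0 : INR n <> 0) by (apply not_0_INR; lia).
  (* Abel summation after multiplication by [2 sin (th / 2)] *)
  assert (E : forall m, 2 * sin (th / 2) * rsum (fun r => INR r * sin (A + INR r * th)) m
    = rsum (fun r => cos (A + th / 2 + INR r * th)) m - INR m * cos (A - th / 2 + INR m * th)).
  { induction m as [|m IH]; [simpl; ring|].
    rewrite !rsum_S, Rmult_plus_distr_l, IH, !S_INR.
    replace (A - th / 2 + INR m * th) with ((A + INR m * th) - th / 2) by ring.
    replace (A - th / 2 + (INR m + 1) * th) with ((A + INR m * th) + th / 2) by field.
    replace (A + th / 2 + INR m * th) with ((A + INR m * th) + th / 2) by field.
    rewrite (cos_minus (A + INR m * th)), (cos_plus (A + INR m * th)). ring. }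
  specialize (E n). rewrite Hp in E.
  rewrite (rsum_ext (fun r => cos (A + th / 2 + INR r * th)) (fun r => sin (A + th / 2 + PI / 2 + INR r * th))) in E.
  2:{ intros k _. rewrite (sin_cos_shift (A + th / 2 + PI / 2 + INR k * th)). f_equal. ring. }
  rewrite sin_sum_zero in E by assumption.
  rewrite (rsum_ext _ (fun r => / INR n * (INR r * sin (A + INR r * th)))) by (intros; field; exact Hn0). rewrite rsum_scal.
  apply (Rmult_eq_reg_l (2 * sin (th / 2) * INR n)); [|apply Rmult_integral_contrapositive_currified; [lra|exact Hn0]].
  transitivity (2 * sin (th / 2) * rsum (fun r => INR r * sin (A + INR r * th)) n); [field; exact Hn0|]. rewrite E. field. exact Hs.
Qed.

Definition divides_b (n k : nat) : bool := Nat.eqb (Nat.modulo k n) 0.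

Lemma divides_b_spec n k : (1 <= n)%nat -> divides_b n k = true <-> Nat.divide n k.
Proof.
  intros Hn. unfold divides_b. rewrite Nat.eqb_eq. split; intros H.
  - apply Nat.Lcm0.mod_divide in H. exact H.
  - apply Nat.Lcm0.mod_divide. exact H.
Qed.

Lemma sin_PI_rational_nz k m n : (1 <= n)%nat -> Nat.gcd m n = 1%nat -> ~ Nat.divide n k -> sin (PI * INR k * (INR m / INR n)) <> 0.
Proof.
  intros Hn Hg Hk H. assert (HPI := PI_RGT_0). assert (Hn0 : 0 < INR n) by (apply lt_0_INR; lia).
  apply sin_eq_0_0 in H. destruct H as [z Hz].
  assert (E : INR k * INR m = IZR z * INR n).
  { apply (Rmult_eq_reg_l (PI / INR n)); [|apply Rgt_not_eq; apply Rdiv_lt_0_compat; lra].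
    replace (PI / INR n * (INR k * INR m)) with (PI * INR k * (INR m / INR n)) by (field; lra). rewrite Hz. field. lra. }
  rewrite !INR_IZR_INZ, <- !mult_IZR in E. apply eq_IZR in E. apply Hk.
  apply (Nat.gauss n m k); [|rewrite Nat.gcd_comm; exact Hg].
  assert (Hz0 : (0 <= z)%Z) by nia. exists (Z.to_nat z). apply Nat2Z.inj. rewrite !Nat2Z.inj_mul, Z2Nat.id by exact Hz0. lia.
Qed.

Lemma full_turns m n k x : (1 <= n)%nat -> cos (x + INR n * (2 * PI * INR k * (INR m / INR n))) = cos x.
Proof.
  intros Hn. assert (Hn0 : INR n <> 0) by (apply not_0_INR; lia).
  replace (x + INR n * (2 * PI * INR k * (INR m / INR n))) with (x + 2 * PI * INR (k * m)) by (rewrite mult_INR; field; exact Hn0). apply cos_period_nat.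
Qed.

Lemma sin_divisible k m n r A : (1 <= n)%nat -> Nat.divide n k -> sin (A + INR r * (2 * PI * INR k * (INR m / INR n))) = sin A.
Proof.
  intros Hn [q ->]. assert (Hn0 : INR n <> 0) by (apply not_0_INR; lia).
  replace (A + INR r * (2 * PI * INR (q * n) * (INR m / INR n))) with (A + 2 * PI * INR (r * (q * m))) by (rewrite !mult_INR; field; exact Hn0). apply sin_period_nat.
Qed.

Lemma hterm_shift g v j m n r : (1 <= n)%nat -> hterm g (v + INR r * (INR m / INR n)) j =
  sin (2 * PI * INR (S j) * v - PI / 2 * g + INR r * (2 * PI * INR (S j) * (INR m / INR n))) * zterm g j.
Proof. intros Hn. unfold hterm. f_equal. f_equal. ring. Qed.

Lemma hterm_full_sum g v j m n : (1 <= n)%nat -> Nat.gcd m n = 1%nat ->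
  rsum (fun r => hterm g (v + INR r * (INR m / INR n)) j) n = if divides_b n (S j) then INR n * hterm g v j else 0.
Proof.
  intros Hn Hg. rewrite (rsum_ext _ (fun r => zterm g j * sin (2 * PI * INR (S j) * v - PI / 2 * g + INR r * (2 * PI * INR (S j) * (INR m / INR n))))).
  2:{ intros r _. rewrite hterm_shift by exact Hn. ring. }
  rewrite rsum_scal. destruct (divides_b n (S j)) eqn:E.
  - apply divides_b_spec in E; [|exact Hn]. rewrite (rsum_ext _ (fun _ => sin (2 * PI * INR (S j) * v - PI / 2 * g))).
    + rewrite rsum_const. unfold hterm. ring.
    + intros r _. now apply sin_divisible.
  - rewrite sin_sum_zero; [ring| |].
    + replace (2 * PI * INR (S j) * (INR m / INR n) / 2) with (PI * INR (S j) * (INR m / INR n)) by (field; apply not_0_INR; lia).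
      apply sin_PI_rational_nz; [exact Hn|exact Hg|]. intros D. apply divides_b_spec in D; [|exact Hn]. congruence.
    + intros x. now apply full_turns.
Qed.

Lemma hterm_weighted_sum g v j m n : (1 <= n)%nat -> Nat.gcd m n = 1%nat ->
  rsum (fun r => INR r / INR n * hterm g (v + INR r * (INR m / INR n)) j) n =
  if divides_b n (S j) then (INR n - 1) / 2 * hterm g v j
  else / 2 * (sin (2 * PI * INR (S j) * v - PI * INR (S j) * (INR m / INR n) - PI / 2 * (1 + g)) / sin (PI * INR (S j) * (INR m / INR n)) * zterm g j).
Proof.
  intros Hn Hg. assert (Hn0 : INR n <> 0) by (apply not_0_INR; lia).
  rewrite (rsum_ext _ (fun r => zterm g j * (INR r / INR n * sin (2 * PI * INR (S j) * v - PI / 2 * g + INR r * (2 * PI * INR (S j) * (INR m / INR n)))))).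
  2:{ intros r _. rewrite hterm_shift by exact Hn. ring. }
  rewrite rsum_scal. destruct (divides_b n (S j)) eqn:E.
  - apply divides_b_spec in E; [|exact Hn]. rewrite (rsum_ext _ (fun r => (sin (2 * PI * INR (S j) * v - PI / 2 * g) / INR n) * INR r)).
    + rewrite rsum_scal. assert (Es : forall n, rsum INR n = INR n * (INR n - 1) / 2).
      { clear. induction n as [|n IH]; [simpl; field|]. rewrite rsum_S, IH, S_INR. field. }
      change (rsum (fun r => INR r) n) with (rsum INR n). rewrite Es. unfold hterm. field. exact Hn0.
    + intros r _. rewrite sin_divisible by assumption. field. exact Hn0.
  - assert (Hsn : sin (PI * INR (S j) * (INR m / INR n)) <> 0).
    { apply sin_PI_rational_nz; [exact Hn|exact Hg|]. intros D. apply divides_b_spec in D; [|exact Hn]. congruence. }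
    assert (Eh : 2 * PI * INR (S j) * (INR m / INR n) / 2 = PI * INR (S j) * (INR m / INR n)) by (field; exact Hn0).
    rewrite sin_weighted_sum; [|rewrite Eh; exact Hsn|exact Hn|intros x; now apply full_turns]. rewrite Eh.
    replace (sin (2 * PI * INR (S j) * v - PI * INR (S j) * (INR m / INR n) - PI / 2 * (1 + g)))
      with (- cos (2 * PI * INR (S j) * v - PI / 2 * g - PI * INR (S j) * (INR m / INR n))).
    2:{ replace (2 * PI * INR (S j) * v - PI * INR (S j) * (INR m / INR n) - PI / 2 * (1 + g)) with
          (- (PI / 2 - (2 * PI * INR (S j) * v - PI / 2 * g - PI * INR (S j) * (INR m / INR n)))) by ring. rewrite sin_neg, sin_shift. reflexivity. }
    field. exact Hsn.
Qed.

Lemma rsum_lim u : ex_series u -> is_lim_seq (rsum u) (Series u).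
Proof.
  intros H. apply is_lim_seq_incr_1. apply (is_lim_seq_ext (sum_n u)); [intros n; apply sum_n_rsum|]. now apply Series_correct.
Qed.

Lemma Series_eq_subseq u v (f : nat -> nat) : ex_series u -> ex_series v -> (forall n, (n <= f n)%nat) -> (forall n, rsum u (f n) = rsum v n) -> Series u = Series v.
Proof.
  intros Hu Hv Hf E. assert (Lu := rsum_lim u Hu). assert (Lv := rsum_lim v Hv).
  assert (Ls : is_lim_seq (fun n => rsum u (f n)) (Series u)).
  { apply is_lim_seq_spec. intros eps. apply is_lim_seq_spec in Lu. destruct (Lu eps) as [N HN]. exists N. intros n Hn. apply HN. specialize (Hf n). lia. }
  apply (is_lim_seq_ext _ _ _ E) in Ls. apply is_lim_seq_unique in Ls. apply is_lim_seq_unique in Lv. rewrite Ls in Lv. now injection Lv.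
Qed.

Lemma zterm_scale g n i : (1 <= n)%nat -> Rpower (INR (n * S i)) (- (1 + g)) = Rpower (INR n) (- (1 + g)) * zterm g i.
Proof. intros Hn. unfold zterm. rewrite mult_INR, Rpower_mult_distr; [reflexivity|apply lt_0_INR; lia|apply lt_0_INR; lia]. Qed.

Lemma hterm_multiples_ex g v n : 0 < g -> ex_series (fun j => if divides_b n (S j) then hterm g v j else 0).
Proof.
  intros Hg. destruct (series_dom (zterm g) (fun j => if divides_b n (S j) then hterm g v j else 0) (1 + / g)) as [H _]; [|intros; now apply zterm_sum|exact H].
  intros j. destruct (divides_b n (S j)); [apply hterm_abs|]. rewrite Rabs_R0. left; apply zterm_pos.
Qed.

(** The partial sum of length [n K] on the left contains just the indices [n, 2 n, ..., K n], and it
    equals the partial sum of length [K] on the right. *)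
Lemma hterm_multiples g v n : 0 < g -> (1 <= n)%nat ->
  Series (fun j => if divides_b n (S j) then hterm g v j else 0) = Rpower (INR n) (- (1 + g)) * Hser g (INR n * v).
Proof.
  intros Hg Hn. unfold Hser. rewrite <- Series_scal_l.
  apply (Series_eq_subseq _ _ (fun K => (n * K)%nat)).
  - now apply hterm_multiples_ex.
  - apply (ex_series_scal_l (K := R_AbsRing) (V := R_NormedModule)). now apply hterm_ex.
  - intros K. nia.
  - induction n as [|n' _] using nat_ind; [lia|]. induction n as [|K IH]; [now rewrite Nat.mul_0_r|].
    rewrite Nat.mul_succ_r, rsum_add, IH, (rsum_S _ K). f_equal. rewrite (rsum_S _ n').
    rewrite (rsum_ext _ (fun _ => 0)).
    + rewrite rsum_zero, Rplus_0_l. replace (S (S n' * K + n')) with (S n' * S K)%nat by lia.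
      replace (divides_b (S n') (S n' * S K)) with true by (symmetry; apply divides_b_spec; [lia|exists (S K); lia]).
      assert (Ez : zterm g (S n' * K + n') = Rpower (INR (S n')) (- (1 + g)) * zterm g K).
      { rewrite <- zterm_scale by lia. unfold zterm. f_equal. f_equal. lia. }
      unfold hterm. rewrite Ez. replace (S (S n' * K + n')) with (S n' * S K)%nat by lia.
      rewrite mult_INR. replace (2 * PI * (INR (S n') * INR (S K)) * v) with (2 * PI * INR (S K) * (INR (S n') * v)) by ring. ring.
    + intros i Hi. destruct (divides_b (S n') (S (S n' * K + i))) eqn:E; [exfalso|reflexivity].
      apply divides_b_spec in E; [|lia]. destruct E as [q Hq]. assert (K < q < K + 1)%nat by nia. lia.
Qed.

Lemma rsum_Series (f : nat -> nat -> R) n : (forall r, (r < n)%nat -> ex_series (f r)) ->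
  rsum (fun r => Series (f r)) n = Series (fun j => rsum (fun r => f r j) n) /\ ex_series (fun j => rsum (fun r => f r j) n).
Proof.
  induction n as [|n IH]; intros H; simpl.
  - split; [symmetry; apply (Series_finite (fun _ => 0) 0); reflexivity|]. exists 0. apply (is_series_finite (fun _ => 0) 0). reflexivity.
  - destruct IH as [E Hex]; [intros; apply H; lia|]. specialize (H n ltac:(lia)). split.
    + rewrite E. symmetry. now apply Series_plus.
    + exact (ex_series_plus (K := R_AbsRing) (V := R_NormedModule) _ _ Hex H).
Qed.

(** The multiplication theorem for the Hurwitz zeta function: after Hurwitz's formula, the
    frequencies that [n] does not divide cancel, since [r m] runs through all residues modulo
    [n]. *)
Lemma zp_full_sum g v m n : 0 < g -> (1 <= n)%nat -> Nat.gcd m n = 1%nat ->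
  rsum (fun r => zp g (v + INR r * (INR m / INR n))) n = Rpower (INR n) (- g) * zp g (INR n * v).
Proof.
  intros Hg Hn Hmn. assert (Hn0 : 0 < INR n) by (apply lt_0_INR; lia).
  rewrite (rsum_ext _ (fun r => hconst g * Hser g (v + INR r * (INR m / INR n)))) by (intros; now apply hurwitz_formula).
  rewrite rsum_scal, hurwitz_formula by exact Hg.
  destruct (rsum_Series (fun r j => hterm g (v + INR r * (INR m / INR n)) j) n) as [E _]; [intros; now apply hterm_ex|].
  rewrite (rsum_ext (fun r => Hser g (v + INR r * (INR m / INR n))) (fun r => Series (fun j => hterm g (v + INR r * (INR m / INR n)) j))) by reflexivity.
  rewrite E.
  rewrite (Series_ext _ (fun j => INR n * (if divides_b n (S j) then hterm g v j else 0))).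
  - rewrite Series_scal_l, hterm_multiples by assumption.
    replace (Rpower (INR n) (- g)) with (INR n * Rpower (INR n) (- (1 + g))); [ring|].
    rewrite <- (Rpower_1 (INR n)) at 1 by exact Hn0. rewrite <- Rpower_plus. f_equal. ring.
  - intros j. rewrite hterm_full_sum by assumption. destruct (divides_b n (S j)); ring.
Qed.

(** The frequencies divisible by [n] reproduce [zp g x], the others give the series of (i). The
    convergence of that series comes out as well, because it is a combination of convergent
    series. *)
Lemma zp_weighted_sum g x m n : 0 < g -> (1 <= n)%nat -> Nat.gcd m n = 1%nat ->
  ex_series (fun j => let k := S j in
    if Nat.eqb (Nat.modulo k n) 0 then 0
    else sin (PI * INR k * (2 * x - INR m) / INR n - PI / 2 * (1 + g))
         / (Rpower (INR k) (1 + g) * sin (PI * INR k * (INR m / INR n)))) /\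
  rsum (fun r => INR r / INR n * zp g (x / INR n + INR r * (INR m / INR n))) n
  = (INR n - 1) / 2 * Rpower (INR n) (- (1 + g)) * zp g x + / 2 * hconst g * osc_rational_series g x m n.
Proof.
  intros Hg Hn Hmn. assert (Hn0 : 0 < INR n) by (apply lt_0_INR; lia). set (v := x / INR n).
  set (w := fun j => if Nat.eqb (Nat.modulo (S j) n) 0 then 0
    else sin (PI * INR (S j) * (2 * x - INR m) / INR n - PI / 2 * (1 + g)) / (Rpower (INR (S j)) (1 + g) * sin (PI * INR (S j) * (INR m / INR n)))).
  destruct (rsum_Series (fun r j => INR r / INR n * hterm g (v + INR r * (INR m / INR n)) j) n) as [E Hex].
  { intros r _. apply (ex_series_scal_l (K := R_AbsRing) (V := R_NormedModule)). now apply hterm_ex. }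
  set (q := fun j => if divides_b n (S j) then hterm g v j else 0).
  assert (EW : forall j, rsum (fun r => INR r / INR n * hterm g (v + INR r * (INR m / INR n)) j) n = (INR n - 1) / 2 * q j + / 2 * w j).
  { intros j. rewrite hterm_weighted_sum by assumption. unfold q, w. change (Nat.eqb (Nat.modulo (S j) n) 0) with (divides_b n (S j)).
    destruct (divides_b n (S j)) eqn:Ed; [ring|].
    assert (Hsn : sin (PI * INR (S j) * (INR m / INR n)) <> 0).
    { apply sin_PI_rational_nz; [exact Hn|exact Hmn|]. intros D. apply divides_b_spec in D; [|exact Hn]. congruence. }
    replace (2 * PI * INR (S j) * v - PI * INR (S j) * (INR m / INR n) - PI / 2 * (1 + g)) with (PI * INR (S j) * (2 * x - INR m) / INR n - PI / 2 * (1 + g)) by (unfold v; field; lra).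
    unfold zterm. rewrite Rpower_Ropp. field. split; first [exact Hsn | apply Rgt_not_eq, Rpower_pos]. }
  assert (Hq : ex_series q) by now apply hterm_multiples_ex.
  assert (Hw : ex_series w).
  { apply (ex_series_ext (fun j => 2 * (rsum (fun r => INR r / INR n * hterm g (v + INR r * (INR m / INR n)) j) n + - ((INR n - 1) / 2) * q j))).
    - intros j.
      assert (E0 : 2 * (rsum (fun r => INR r / INR n * hterm g (v + INR r * (INR m / INR n)) j) n + - ((INR n - 1) / 2) * q j) = w j) by (rewrite EW; field).
      exact E0.
    - apply (ex_series_scal_l (K := R_AbsRing) (V := R_NormedModule)). apply (ex_series_plus (K := R_AbsRing) (V := R_NormedModule)); [exact Hex|].
      apply (ex_series_scal_l (K := R_AbsRing) (V := R_NormedModule)). exact Hq. }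
  split; [exact Hw|].
  rewrite (rsum_ext _ (fun r => hconst g * (Series (fun j => INR r / INR n * hterm g (v + INR r * (INR m / INR n)) j)))).
  2:{ intros r _. rewrite hurwitz_formula by exact Hg. unfold Hser. fold v. rewrite Series_scal_l. ring. }
  rewrite rsum_scal, E, (Series_ext _ _ EW), Series_plus.
  - rewrite !Series_scal_l. unfold q. rewrite hterm_multiples by assumption. rewrite hurwitz_formula by exact Hg.
    replace (INR n * v) with x by (unfold v; field; lra). change (osc_rational_series g x m n) with (Series w). ring.
  - apply (ex_series_scal_l (K := R_AbsRing) (V := R_NormedModule)). exact Hq.
  - apply (ex_series_scal_l (K := R_AbsRing) (V := R_NormedModule)). exact Hw.
Qed.

Lemma sqrt_ratio (mu nu : nat) : (1 <= mu)%nat -> (1 <= nu)%nat ->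
  let a := sqrt (INR mu / INR nu) in let L := sqrt (INR mu * INR nu) in
  0 < a /\ 0 < L /\ INR nu * a = L /\ INR mu * / a = L /\ L * L = INR mu * INR nu.
Proof.
  intros Hmu Hnu a L. assert (Hm : 0 < INR mu) by (apply lt_0_INR; lia). assert (Hn : 0 < INR nu) by (apply lt_0_INR; lia).
  assert (Ha : 0 < a) by (apply sqrt_lt_R0; now apply Rdiv_lt_0_compat).
  assert (HL : 0 < L) by (apply sqrt_lt_R0; now apply Rmult_lt_0_compat).
  assert (Eaa : a * a = INR mu / INR nu) by (apply sqrt_sqrt; apply Rdiv_le_0_compat; lra).
  assert (E1 : INR nu * a = L).
  { unfold L. symmetry. apply sqrt_lem_1; [nra|nra|]. replace (INR nu * a * (INR nu * a)) with (INR nu * INR nu * (a * a)) by ring. rewrite Eaa. field. lra. }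
  repeat split; try assumption.
  - rewrite <- E1. apply (Rmult_eq_reg_r a); [|lra]. rewrite Rmult_assoc, Rinv_l by lra. rewrite Rmult_assoc, Eaa. field. lra.
  - apply sqrt_sqrt. nra.
Qed.

(** The block [(r, s)] has the argument [x / (mu nu) + r / nu + s / mu], so that the weight
    [1 - w / L] splits into [1 - x / (mu nu)], [- r / nu] and [- s / mu]. The first part collapses
    by the multiplication theorem in both indices; each of the others does so in one index and gives
    one of the two series in the other. *)
Lemma blocks_osc_rational g sigma tau mu nu lam : 0 < g -> (1 <= mu)%nat -> (1 <= nu)%nat -> Nat.gcd mu nu = 1%nat ->
  let a := sqrt (INR mu / INR nu) in
  blocks mu nu a (/ a) (oblk g (sqrt (INR mu * INR nu))) (lam - sigma * a - tau / a) = osc_rational g sigma tau mu nu lam.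
Proof.
  intros Hg Hmu Hnu Hgcd a. destruct (sqrt_ratio mu nu Hmu Hnu) as [Ha [HL [EaL [EbL HLL]]]]. fold a in Ha, EaL, EbL.
  set (L := sqrt (INR mu * INR nu)) in *. set (m := INR mu) in *. set (n := INR nu) in *.
  assert (Hm : 0 < m) by (apply lt_0_INR; lia). assert (Hn : 0 < n) by (apply lt_0_INR; lia).
  set (w := lam - sigma * a - tau / a). set (x := L * lam - m * sigma - n * tau).
  assert (Ex : x = L * w).
  { unfold x, w, Rdiv. assert (E1 : L * a = m) by (rewrite <- EbL; field; lra). assert (E2 : L * / a = n) by (rewrite <- EaL; field; lra).
    rewrite <- E1, <- E2. ring. }
  assert (Ev : forall r s : nat, (w + (INR r * a + INR s * / a)) / L = x / (m * n) + INR r / n + INR s / m).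
  { intros r s. rewrite <- HLL, Ex. replace (INR r / n) with (INR r * a / L) by (rewrite <- EaL; field; lra).
    replace (INR s / m) with (INR s * / a / L) by (rewrite <- EbL; field; lra). field. lra. }
  assert (Hg1m : Nat.gcd 1 mu = 1%nat) by reflexivity. assert (Hg1n : Nat.gcd 1 nu = 1%nat) by reflexivity.
  assert (Hgcd' : Nat.gcd nu mu = 1%nat) by (rewrite Nat.gcd_comm; exact Hgcd).
  assert (Is : forall q r, 0 < q -> rsum (fun s => zp q (x / (m * n) + INR r / n + INR s / m)) mu = Rpower m (- q) * zp q (x / n + INR r * (m / n))).
  { intros q r Hq. rewrite (rsum_ext _ (fun s => zp q (x / (m * n) + INR r / n + INR s * (INR 1 / INR mu)))).
    - rewrite zp_full_sum by assumption. fold m. f_equal. f_equal. field. lra.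
    - intros s _. f_equal. fold m. simpl INR. field. lra. }
  assert (Ir : forall q s, 0 < q -> rsum (fun r => zp q (x / (m * n) + INR r / n + INR s / m)) nu = Rpower n (- q) * zp q (x / m + INR s * (n / m))).
  { intros q s Hq. rewrite (rsum_ext _ (fun r => zp q (x / (m * n) + INR s / m + INR r * (INR 1 / INR nu)))).
    - rewrite zp_full_sum by assumption. fold n. f_equal. f_equal. field. lra.
    - intros r _. f_equal. fold n. simpl INR. field. lra. }
  assert (T1 : forall q, 0 < q -> rsum (fun r => rsum (fun s => zp q (x / (m * n) + INR r / n + INR s / m)) mu) nu = Rpower m (- q) * (Rpower n (- q) * zp q x)).
  { intros q Hq. rewrite (rsum_ext _ (fun r => Rpower m (- q) * zp q (x / n + INR r * (m / n)))) by (intros; now apply Is).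
    rewrite rsum_scal. f_equal. change (rsum (fun r => zp q (x / n + INR r * (INR mu / INR nu))) nu = Rpower n (- q) * zp q x). rewrite (zp_full_sum q (x / n) mu nu) by assumption. fold n. f_equal. f_equal. field. lra. }
  assert (T3 : rsum (fun r => rsum (fun s => INR r / n * zp g (x / (m * n) + INR r / n + INR s / m)) mu) nu
    = Rpower m (- g) * ((n - 1) / 2 * Rpower n (- (1 + g)) * zp g x + / 2 * hconst g * osc_rational_series g x mu nu)).
  { rewrite (rsum_ext _ (fun r => Rpower m (- g) * (INR r / INR nu * zp g (x / INR nu + INR r * (INR mu / INR nu))))).
    - rewrite rsum_scal. f_equal. now apply zp_weighted_sum.
    - intros r _. rewrite rsum_scal, Is by exact Hg. fold m n. ring. }
  assert (T4 : rsum (fun r => rsum (fun s => INR s / m * zp g (x / (m * n) + INR r / n + INR s / m)) mu) nu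
    = Rpower n (- g) * ((m - 1) / 2 * Rpower m (- (1 + g)) * zp g x + / 2 * hconst g * osc_rational_series g x nu mu)).
  { rewrite rsum_exchange. rewrite (rsum_ext _ (fun s => Rpower n (- g) * (INR s / INR mu * zp g (x / INR mu + INR s * (INR nu / INR mu))))).
    - rewrite rsum_scal. f_equal. now apply zp_weighted_sum.
    - intros s _. rewrite rsum_scal, Ir by exact Hg. fold m n. ring. }
  assert (EB : blocks mu nu a (/ a) (oblk g L) w = - Rpower L g * (Rpower m (- (g + 1)) * (Rpower n (- (g + 1)) * zp (g + 1) x)
     + (1 - x / (m * n)) * (Rpower m (- g) * (Rpower n (- g) * zp g x))
     - Rpower m (- g) * ((n - 1) / 2 * Rpower n (- (1 + g)) * zp g x + / 2 * hconst g * osc_rational_series g x mu nu)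
     - Rpower n (- g) * ((m - 1) / 2 * Rpower m (- (1 + g)) * zp g x + / 2 * hconst g * osc_rational_series g x nu mu))).
  { rewrite <- T3, <- T4, <- (T1 g Hg), <- (T1 (g + 1)) by lra. unfold blocks, oblk.
    rewrite <- rsum_scal, <- rsum_plus, <- !rsum_minus, <- rsum_scal. apply rsum_ext. intros r _.
    rewrite <- rsum_scal, <- rsum_plus, <- !rsum_minus, <- rsum_scal. apply rsum_ext. intros s _. rewrite Ev. ring. }
  rewrite EB. unfold osc_rational. fold m n. cbv zeta. fold L x.
  replace (hurwitz_zetaR (- g) (frac_part x)) with (zp g x) by reflexivity.
  replace (hurwitz_zetaR (- 1 - g) (frac_part x)) with (zp (g + 1) x) by (unfold zp; f_equal; ring).
  (* With all the powers written in [P], [Q], [L], [m] and [n], the comparison becomes an identity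
     of rational functions. *)
  set (P := Rpower m (g / 2)). set (Q := Rpower n (g / 2)).
  assert (HP : 0 < P) by apply Rpower_pos. assert (HQ : 0 < Q) by apply Rpower_pos.
  assert (Em : Rpower m (- g) = / (P * P)). { unfold P. rewrite <- Rpower_plus, Rpower_Ropp. f_equal. f_equal. field. }
  assert (En : Rpower n (- g) = / (Q * Q)). { unfold Q. rewrite <- Rpower_plus, Rpower_Ropp. f_equal. f_equal. field. }
  assert (Em1 : Rpower m (- (g + 1)) = / (P * P * m)).
  { replace (- (g + 1)) with (- g + - (1)) by ring. rewrite Rpower_plus, Em, Rpower_Ropp, Rpower_1 by exact Hm. field. lra. }
  assert (En1 : Rpower n (- (g + 1)) = / (Q * Q * n)).
  { replace (- (g + 1)) with (- g + - (1)) by ring. rewrite Rpower_plus, En, Rpower_Ropp, Rpower_1 by exact Hn. field. lra. }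
  replace (- (1 + g)) with (- (g + 1)) by ring. rewrite Em, En, Em1, En1.
  assert (EL : Rpower L g = P * Q).
  { unfold P, Q. rewrite Rpower_mult_distr by assumption. fold m n in HLL. rewrite <- HLL, <- Rpower_mult_distr, <- Rpower_plus by exact HL. f_equal. field. }
  assert (E1 : Rpower (m * n) ((1 + g) / 2) = P * Q * L).
  { rewrite <- HLL, <- Rpower_mult_distr, <- Rpower_plus by exact HL. replace ((1 + g) / 2 + (1 + g) / 2) with (g + 1) by field.
    rewrite Rpower_plus, Rpower_1, EL by exact HL. reflexivity. }
  assert (E2 : Rpower (m * n) (1 + g / 2) = P * Q * (m * n)).
  { rewrite Rpower_plus, Rpower_1 by nra. rewrite <- Rpower_mult_distr by assumption. unfold P, Q. ring. }
  rewrite EL, E1, E2. unfold hconst.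
  set (G := Gamma (1 + g)). set (TP := Rpower (2 * PI) (1 + g)). assert (HTP : 0 < TP) by apply Rpower_pos.
  set (S1 := osc_rational_series g x mu nu). set (S2 := osc_rational_series g x nu mu).
  assert (El : lam = (x + m * sigma + n * tau) / L) by (unfold x; field; lra).
  assert (El2 : zp g x / (P * Q * L) * lam = zp g x * (x + m * sigma + n * tau) / (P * Q * (m * n))).
  { rewrite El at 1. rewrite <- HLL. field. lra. }
  rewrite El2. clearbody x S1 S2 G TP P Q m n. field. repeat split; lra.
Qed.

(** * The oscillatory term and the coefficients *)

Definition shift_c (sigma tau beta : R) : R := sigma * sqrt beta + tau / sqrt beta.

Definition osc_core (g sigma tau beta lam : R) : R :=
  Rdbl g (sqrt beta) (/ sqrt beta) (lam - shift_c sigma tau beta) - Z2 g (sqrt beta) (/ sqrt beta) (lam - shift_c sigma tau beta).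

(** Beyond it, [w = lam - shift_c sigma tau beta] lies in the range where the difference equation
    for [Z2] has been established. *)
Definition threshold (sigma tau beta : R) : R := shift_c sigma tau beta + (2 * (sqrt beta + / sqrt beta) + 1).

Definition reduced (beta : R) (p : nat * nat) : Prop :=
  (1 <= fst p)%nat /\ (1 <= snd p)%nat /\ Nat.gcd (fst p) (snd p) = 1%nat /\ beta = INR (fst p) / INR (snd p).

(** At a rational [beta] formula (i) is required for every [lam >= 0], also below the threshold,
    where [osc_core] is not controlled; hence the distinction of cases. The value 0 is a filler
    which concerns a bounded range of [lam] only. *)
Definition Osc (g sigma tau beta lam : R) : R :=
  match excluded_middle_informative (exists p, reduced beta p) with
  | left H => let p := proj1_sig (constructive_indefinite_description _ H) in osc_rational g sigma tau (fst p) (snd p) lam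
  | right _ => if Rle_dec (threshold sigma tau beta) lam then osc_core g sigma tau beta lam else 0
  end.

(** The expansion of [Z2] in powers of [w] is translated by [- shift_c] in order to become one in
    powers of [lam]. *)
Definition alpha (g sigma tau : R) (k : nat) (beta : R) : R :=
  ff (g + 2) k * shift_sym (acoefk g (sqrt beta) (/ sqrt beta)) (- shift_c sigma tau beta) k.

Lemma reduced_unique beta p q : reduced beta p -> reduced beta q -> p = q.
Proof.
  destruct p as [m n], q as [m' n']. intros [H1 [H2 [H3 H4]]] [K1 [K2 [K3 K4]]]. simpl in *.
  assert (Hn : 0 < INR n) by (apply lt_0_INR; lia). assert (Hn' : 0 < INR n') by (apply lt_0_INR; lia).
  assert (E : (m * n' = m' * n)%nat).
  { apply INR_eq. rewrite !mult_INR. rewrite H4 in K4. apply (Rmult_eq_reg_r (/ (INR n * INR n'))).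
    - transitivity (INR m / INR n); [field; lra|]. rewrite K4. field. lra.
    - apply Rinv_neq_0_compat. apply Rgt_not_eq. nra. }
  assert (D1 : Nat.divide n n').
  { apply (Nat.gauss n m n'); [exists m'; lia|]. rewrite Nat.gcd_comm. exact H3. }
  assert (D2 : Nat.divide n' n).
  { apply (Nat.gauss n' m' n); [exists m; lia|]. rewrite Nat.gcd_comm. exact K3. }
  assert (En : n = n') by (apply Nat.divide_antisym; assumption). subst n'.
  assert (m = m') by nia. now subst.
Qed.

Lemma Osc_rational_eq g sigma tau mu nu lam : (1 <= mu)%nat -> (1 <= nu)%nat -> Nat.gcd mu nu = 1%nat ->
  Osc g sigma tau (INR mu / INR nu) lam = osc_rational g sigma tau mu nu lam.
Proof.
  intros Hmu Hnu Hg. assert (HR : reduced (INR mu / INR nu) (mu, nu)) by (repeat split; assumption).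
  unfold Osc. destruct (excluded_middle_informative _) as [H|H]; [|exfalso; apply H; now exists (mu, nu)].
  destruct (constructive_indefinite_description _ H) as [p Hp]. simpl.
  now rewrite (reduced_unique _ _ _ Hp HR).
Qed.

Lemma Reg_sqrt B beta : 1 <= B -> / B <= sqrt beta <= B -> Reg B (sqrt beta) (/ sqrt beta).
Proof.
  intros HB H. assert (HiB : 0 < / B) by (apply Rinv_0_lt_compat; lra). split; [exact H|]. split.
  - split; [apply Rinv_le_contravar; lra|]. rewrite <- (Rinv_inv B). apply Rinv_le_contravar; lra.
  - apply Rinv_r. lra.
Qed.

Lemma threshold_w sigma tau beta lam : threshold sigma tau beta <= lam <-> 2 * (sqrt beta + / sqrt beta) + 1 <= lam - shift_c sigma tau beta.
Proof. unfold threshold. split; intros; lra. Qed.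

Lemma sqrt_pos_B B beta : 1 <= B -> / B <= sqrt beta <= B -> 0 < sqrt beta /\ 0 < beta.
Proof.
  intros HB H. assert (HiB : 0 < / B) by (apply Rinv_0_lt_compat; lra). split; [lra|].
  destruct (Rlt_dec 0 beta) as [Hb|Hb]; [exact Hb|]. rewrite sqrt_neg_0 in H by lra. lra.
Qed.

Lemma osc_rational_blocks g sigma tau mu nu lam : 0 < g -> (1 <= mu)%nat -> (1 <= nu)%nat -> Nat.gcd mu nu = 1%nat ->
  osc_rational g sigma tau mu nu lam = blocks mu nu (sqrt (INR mu / INR nu)) (/ sqrt (INR mu / INR nu)) (oblk g (sqrt (INR mu * INR nu))) (lam - shift_c sigma tau (INR mu / INR nu)).
Proof.
  intros Hg Hmu Hnu Hgcd. rewrite <- (blocks_osc_rational g sigma tau mu nu lam) by assumption. f_equal. unfold shift_c. ring.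
Qed.

Lemma Osc_core_eq g sigma tau beta lam : 0 < g -> 0 < beta -> threshold sigma tau beta <= lam ->
  Osc g sigma tau beta lam = osc_core g sigma tau beta lam.
Proof.
  intros Hg Hb Hl. destruct (classic (exists p, reduced beta p)) as [[[mu nu] HR]|H].
  - destruct HR as [H1 [H2 [H3 H4]]]. simpl in *. subst beta. rewrite Osc_rational_eq by assumption.
    rewrite osc_rational_blocks by assumption. unfold osc_core.
    destruct (sqrt_ratio mu nu H1 H2) as [Ha [HL [EaL [EbL HLL]]]].
    symmetry. apply osc_blocks; try assumption.
    + now apply Rinv_0_lt_compat.
    + apply Rinv_r. lra.
    + now apply threshold_w.
  - unfold Osc. destruct (excluded_middle_informative _) as [K|K]; [contradiction|].
    destruct (Rle_dec (threshold sigma tau beta) lam) as [_|K2]; [reflexivity|contradiction].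
Qed.

Lemma shift_c_bound sigma tau B beta : 1 <= B -> / B <= sqrt beta <= B -> Rabs (shift_c sigma tau beta) <= (Rabs sigma + Rabs tau) * B.
Proof.
  intros HB H. destruct (Reg_sqrt B beta HB H) as [_ [H2 _]]. destruct (sqrt_pos_B B beta HB H) as [Hs _].
  assert (Hi : 0 < / sqrt beta) by now apply Rinv_0_lt_compat.
  unfold shift_c, Rdiv. eapply Rle_trans; [apply Rabs_triang|]. rewrite !Rabs_mult, (Rabs_pos_eq (sqrt beta)), (Rabs_pos_eq (/ sqrt beta)) by lra.
  assert (P1 := Rabs_pos sigma). assert (P2 := Rabs_pos tau). nra.
Qed.

(** Above the threshold the remainder is by construction [Z2] minus the first [M + 2] terms of its
    expansion, so it has the exponent [g + 2 - (M + 2)]. *)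
Lemma remainder_bound g sigma tau B M : 0 < g -> 1 <= B -> exists C W, 0 <= C /\ 1 <= W /\
  forall beta lam, / B <= sqrt beta <= B -> W <= lam ->
   Rabs (riesz_mean g sigma tau beta lam - sum_n (fun k => alpha g sigma tau k beta * Rpower lam (2 - INR k + g)) (M + 1) - Osc g sigma tau beta lam)
     <= C * Rpower lam (g - INR M).
Proof.
  intros Hg HB.
  set (K := fun beta => / B <= sqrt beta <= B).
  assert (HS : has_symbol K (fun beta w => Z2 g (sqrt beta) (/ sqrt beta) (w + - shift_c sigma tau beta)) (g + 2)
     (fun beta => shift_sym (acoefk g (sqrt beta) (/ sqrt beta)) (- shift_c sigma tau beta))).
  { apply (sym_shift K (fun beta => Z2 g (sqrt beta) (/ sqrt beta)) (g + 2) (fun beta => acoefk g (sqrt beta) (/ sqrt beta)) (fun beta => - shift_c sigma tau beta) ((Rabs sigma + Rabs tau) * B)).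
    - apply Rmult_le_pos; [|lra]. assert (P1 := Rabs_pos sigma). assert (P2 := Rabs_pos tau). lra.
    - intros beta Hb. rewrite Rabs_Ropp. now apply shift_c_bound.
    - intros N. destruct (acoefk_bound g B N Hg HB) as [S0 [_ H]]. exists S0. intros beta k Hb Hk. apply H; [now apply Reg_sqrt|exact Hk].
    - intros N. destruct (Z2_symbol g B Hg HB N) as [c [W [Hc [HW H]]]]. exists c, W. split; [exact Hc|]. split; [exact HW|].
      intros beta w Hb Hw. apply (H (sqrt beta, / sqrt beta)); [now apply Reg_sqrt|exact Hw]. }
  destruct (HS (M + 2)%nat) as [C [W [HC [HW H]]]].
  exists C, (W + (Rabs sigma + Rabs tau) * B + 4 * B + 1). split; [exact HC|].
  assert (Pst : 0 <= (Rabs sigma + Rabs tau) * B) by (apply Rmult_le_pos; [|lra]; assert (P1 := Rabs_pos sigma); assert (P2 := Rabs_pos tau); lra).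
  split; [lra|]. intros beta lam Hb Hlam. specialize (H beta lam Hb ltac:(lra)). cbv beta in H.
  destruct (sqrt_pos_B B beta HB Hb) as [Hs Hbeta]. destruct (Reg_sqrt B beta HB Hb) as [[_ R1] [[_ R2] _]].
  assert (Hsc := proj1 (Rabs_le_between _ _) (shift_c_bound sigma tau B beta HB Hb)).
  rewrite Osc_core_eq by (try assumption; unfold threshold; lra).
  rewrite riesz_mean_Rdbl by exact Hbeta. unfold osc_core.
  replace (lam - sigma * sqrt beta - tau / sqrt beta) with (lam - shift_c sigma tau beta) by (unfold shift_c; ring).
  replace (lam + - shift_c sigma tau beta) with (lam - shift_c sigma tau beta) in H by ring.
  replace (g + 2 - INR (M + 2)) with (g - INR M) in H by (rewrite plus_INR; simpl; ring).
  replace (sum_n _ (M + 1)) with (psum (g + 2) (shift_sym (acoefk g (sqrt beta) (/ sqrt beta)) (- shift_c sigma tau beta)) (M + 2) lam).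
  2:{ rewrite sum_n_rsum. replace (S (M + 1)) with (M + 2)%nat by lia. unfold psum. apply rsum_ext. intros k _. unfold alpha.
      replace (2 - INR k + g) with (g + 2 - INR k) by ring. ring. }
  replace (_ - _ - _) with (Z2 g (sqrt beta) (/ sqrt beta) (lam - shift_c sigma tau beta) - psum (g + 2) (shift_sym (acoefk g (sqrt beta) (/ sqrt beta)) (- shift_c sigma tau beta)) (M + 2) lam) by ring.
  exact H.
Qed.

Lemma sqrt_continuous beta : 0 < beta -> continuous sqrt beta.
Proof. intros H. apply smooth_cont. auto_derive. exact H. Qed.

Lemma inv_sqrt_continuous beta : 0 < beta -> continuous (fun b => / sqrt b) beta.
Proof. intros H. apply smooth_cont. auto_derive. split; [exact H|]. split; [apply Rgt_not_eq; now apply sqrt_lt_R0|exact I]. Qed.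

Lemma cont_pow (f : R -> R) n x : continuous f x -> continuous (fun u => f u ^ n) x.
Proof. intros H. induction n as [|n IH]; simpl; [apply cont_const|now apply cont_mult]. Qed.

Lemma acoef_continuous k beta : 0 < beta -> continuous (fun b => acoef (sqrt b) (/ sqrt b) k) beta.
Proof.
  intros H. induction k as [k IH] using lt_wf_ind.
  apply (continuous_ext (fun b => (if Nat.eqb k 0 then 1 else 0) - rsum (fun j => acoef (sqrt b) (/ sqrt b) j * (/ INR (fact (k + 2 - j)) * ((sqrt b + / sqrt b) ^ (k + 2 - j) - sqrt b ^ (k + 2 - j) - (/ sqrt b) ^ (k + 2 - j)))) k)).
  { intros b. symmetry. apply acoef_rec. }
  apply cont_minus; [apply cont_const|].
  apply (cont_rsum (fun j b => acoef (sqrt b) (/ sqrt b) j * (/ INR (fact (k + 2 - j)) * ((sqrt b + / sqrt b) ^ (k + 2 - j) - sqrt b ^ (k + 2 - j) - (/ sqrt b) ^ (k + 2 - j))))).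
  intros j Hj. apply cont_mult; [now apply IH|]. apply cont_mult; [apply cont_const|].
  assert (C1 := sqrt_continuous beta H). assert (C2 := inv_sqrt_continuous beta H).
  apply cont_minus; [apply cont_minus|]; [apply (cont_pow (fun b => sqrt b + / sqrt b)); now apply cont_plus|now apply (cont_pow sqrt)|now apply (cont_pow (fun b => / sqrt b))].
Qed.

Lemma shift_c_continuous sigma tau beta : 0 < beta -> continuous (shift_c sigma tau) beta.
Proof.
  intros H. unfold shift_c, Rdiv. apply cont_plus; (apply cont_mult; [apply cont_const|]); [now apply sqrt_continuous|now apply inv_sqrt_continuous].
Qed.

Lemma alpha_continuous g sigma tau k beta : 0 < beta -> continuous (alpha g sigma tau k) beta.
Proof.
  intros H. unfold alpha, shift_sym, acoefk. apply cont_mult; [apply cont_const|].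
  apply (cont_rsum (fun j b => kappa g * acoef (sqrt b) (/ sqrt b) j * (/ INR (fact (k - j)) * (- shift_c sigma tau b) ^ (k - j)))).
  intros j _. apply cont_mult; [apply cont_mult; [apply cont_const|now apply acoef_continuous]|]. apply cont_mult; [apply cont_const|].
  apply (cont_pow (fun b => - shift_c sigma tau b)). apply (continuous_opp (shift_c sigma tau)). now apply shift_c_continuous.
Qed.

(** * Linear growth of the oscillatory term *)

(** Initial data for the propagation of bounds: on one window of bounded length, crude estimates of
    [Rdbl] and [Z2] suffice, provided that they depend on [B] only. *)
Lemma core_window g B : 0 < g -> 1 <= B -> exists M, 0 <= M /\ forall a b w, Reg B a b -> 2 * (a + b) + 1 <= w <= 2 * (a + b) + 1 + a + b ->
  Rabs (Rdbl g a b w - Z2 g a b w) <= M.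
Proof.
  intros Hg HB. set (X := 6 * B + 1). destruct (steps_exist (/ B) X) as [n Hn]; [apply Rinv_0_lt_compat; lra|].
  destruct (Z2_near g B Hg HB) as [c [Hc Hz]]. destruct (acoefk_bound g B (base_order g) Hg HB) as [S0 [HS0 HS]].
  set (F := rsum (fun k => Rabs (ff (g + 2) k)) (base_order g)). assert (HF : 0 <= F) by (apply rsum_nonneg; intros; apply Rabs_pos).
  exists (INR n * (INR n * pp g X) + (c + INR (base_order g) * (S0 * F * Rpower X (g + 2)))).
  assert (P1 := pos_INR n). assert (P2 := pp_nonneg g X). assert (P3 := pos_INR (base_order g)). assert (P4 := Rpower_pos X (g + 2)).
  split. { repeat apply Rplus_le_le_0_compat; try exact Hc; repeat apply Rmult_le_pos; lra. }
  intros a b w HR Hw. destruct (Reg_pos B a b HB HR) as [Ha Hb]. assert (HR' := HR). destruct HR' as [[Ra1 Ra2] [[Rb1 Rb2] _]].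
  assert (HwX : w <= X) by (unfold X; lra).
  unfold Rminus at 1. eapply Rle_trans; [apply Rabs_triang|]. rewrite Rabs_Ropp. apply Rplus_le_compat.
  - eapply Rle_trans; [apply (Rdbl_bound g a b w n Hg Ha Hb)|].
    + apply Rle_trans with (INR n * / B); [lra|]. now apply Rmult_le_compat_l.
    + apply Rle_trans with (INR n * / B); [lra|]. now apply Rmult_le_compat_l.
    + apply Rmult_le_compat_l; [exact P1|]. apply Rmult_le_compat_l; [exact P1|]. now apply pp_le.
  - replace (Z2 g a b w) with ((Z2 g a b w - AN g a b (base_order g) w) + AN g a b (base_order g) w) by ring.
    eapply Rle_trans; [apply Rabs_triang|]. apply Rplus_le_compat; [apply Hz; [exact HR|lra]|].
    unfold AN, psum. apply rsum_bound. intros k Hk. rewrite !Rabs_mult, (Rabs_pos_eq (Rpower _ _)) by (left; apply Rpower_pos).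
    apply Rmult_le_compat; [apply Rmult_le_pos; apply Rabs_pos|left; apply Rpower_pos| |].
    + apply Rmult_le_compat; [apply Rabs_pos|apply Rabs_pos|now apply HS|].
      apply (rsum_ge_term (fun k => Rabs (ff (g + 2) k))); [intros; apply Rabs_pos|exact Hk].
    + apply Rle_trans with (Rpower w (g + 2)).
      * apply Rpower_le_exp; [lra|]. assert (Q := pos_INR k). lra.
      * apply Rle_Rpower_l; lra.
Qed.

Lemma core_DD g a b w B : 0 < g -> 1 <= B -> Reg B a b -> 2 * (a + b) + 1 <= w -> DD a b (fun w => Rdbl g a b w - Z2 g a b w) w = 0.
Proof.
  intros Hg HB HR Hw. destruct (Reg_pos B a b HB HR) as [Ha Hb].
  rewrite DD_minus, Rdbl_DD, (Z2_DD g a b w B), pp_pos by (try assumption; lra). ring.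
Qed.

(** Above the threshold the bound on one window propagates to the right by [DD_linear_bound]. Below
    it, [n] backward steps of length [/ B] lead from that window to [lam = 0], each with a factor
    3. *)
Lemma Osc_linear_bound g sigma tau B : 0 < g -> 1 <= B -> exists C, 0 <= C /\
  forall beta lam, / B <= sqrt beta <= B -> 0 <= lam -> Rabs (Osc g sigma tau beta lam) <= C * (lam + 1).
Proof.
  intros Hg HB. destruct (core_window g B Hg HB) as [M [HM0 HM]].
  assert (HiB : 0 < / B) by (apply Rinv_0_lt_compat; lra).
  set (cst := (Rabs sigma + Rabs tau) * B).
  assert (Hcst : 0 <= cst) by (unfold cst; apply Rmult_le_pos; [|lra]; assert (P1 := Rabs_pos sigma); assert (P2 := Rabs_pos tau); lra).
  destruct (steps_exist (/ B) (4 * B + 1 + cst) HiB) as [n Hn].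
  set (C1 := M + 2 * M * B * (cst + 1)). set (C2 := 3 ^ n * M).
  assert (HC1 : 0 <= C1) by (unfold C1; assert (0 <= 2 * M * B * (cst + 1)) by (repeat apply Rmult_le_pos; lra); lra).
  assert (HC2 : 0 <= C2) by (unfold C2; apply Rmult_le_pos; [apply pow_le; lra|exact HM0]).
  exists (C1 + C2). split; [lra|]. intros beta lam Hbeta Hlam.
  destruct (sqrt_pos_B B beta HB Hbeta) as [Hs Hb0]. assert (HR := Reg_sqrt B beta HB Hbeta).
  assert (Hsc := proj1 (Rabs_le_between _ _) (shift_c_bound sigma tau B beta HB Hbeta)). fold cst in Hsc.
  set (a := sqrt beta) in *. set (b := / sqrt beta) in *. fold a in b.
  destruct (Reg_pos B a b HB HR) as [Ha Hb]. assert (HR' := HR). destruct HR' as [[Ra1 Ra2] [[Rb1 Rb2] Hab]].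
  set (w := lam - shift_c sigma tau beta).
  destruct (Rle_dec (threshold sigma tau beta) lam) as [Ht|Ht].
  - rewrite Osc_core_eq by assumption. apply threshold_w in Ht. fold a b w in Ht.
    assert (Q := DD_linear_bound a b (fun w => Rdbl g a b w - Z2 g a b w) (2 * (a + b) + 1) M Ha Hb
      (fun x Hx => core_DD g a b x B Hg HB HR Hx) (fun x Hx => HM a b x HR Hx) w Ht). cbv beta in Q.
    unfold osc_core. fold a b w. eapply Rle_trans; [exact Q|].
    assert (Hd : (w - (2 * (a + b) + 1)) / a <= (lam + cst) * B).
    { unfold Rdiv. apply Rmult_le_compat; [lra|left; now apply Rinv_0_lt_compat|unfold w; lra|]. rewrite <- (Rinv_inv B). apply Rinv_le_contravar; lra. }
    apply Rle_trans with (M + 2 * M * ((lam + cst) * B)); [apply Rplus_le_compat_l; apply Rmult_le_compat_l; lra|].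
    assert (HMB : 0 <= 2 * M * B) by (repeat apply Rmult_le_pos; lra).
    assert (2 * M * B * (lam + cst) <= 2 * M * B * ((cst + 1) * (lam + 1))) by (apply Rmult_le_compat_l; [exact HMB|assert (Q1 := Rmult_le_pos cst lam Hcst Hlam); lra]).
    assert (Q2 := Rmult_le_pos M lam HM0 Hlam). assert (0 <= C2 * (lam + 1)) by (apply Rmult_le_pos; lra). unfold C1. lra.
  (* Below the threshold formula (i) is in force for rational [beta]; in its block form it solves
     the homogeneous equation on the whole line. *)
  - apply Rle_trans with C2; [|assert (0 <= C1 * (lam + 1)) by (apply Rmult_le_pos; lra); nra].
    destruct (classic (exists p, reduced beta p)) as [[[mu nu] HRd]|H].
    + destruct HRd as [H1 [H2 [H3 H4]]]. simpl in *. rewrite H4. rewrite Osc_rational_eq, osc_rational_blocks by assumption. rewrite <- H4.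
      fold a. change (/ a) with b. fold w.
      destruct (sqrt_ratio mu nu H1 H2) as [_ [HL [EaL [EbL _]]]]. rewrite <- H4 in EaL, EbL. fold a in EaL, EbL. change (/ a) with b in EbL.
      apply (DD_backward_bound a b (/ B) (blocks mu nu a b (oblk g (sqrt (INR mu * INR nu)))) (2 * (a + b) + 1) M HiB Ra1 Rb1).
      * intros x. rewrite (blocks_DD mu nu a b (sqrt (INR mu * INR nu))) by assumption. now apply oblk_DD.
      * intros x Hx. rewrite <- (osc_blocks g a b mu nu) by (try assumption; lra). now apply HM.
      * apply Rnot_le_lt in Ht. unfold threshold in Ht. fold a in Ht. change (/ a) with b in Ht. change (/ a) with b in Rb1, Rb2. unfold w. lra.
    + unfold Osc. destruct (excluded_middle_informative _) as [K|K]; [contradiction|].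
      destruct (Rle_dec (threshold sigma tau beta) lam) as [K2|_]; [contradiction|]. rewrite Rabs_R0. exact HC2.
Qed.

(** * Pairing the small divisors *)

Lemma sin_lipschitz u v : Rabs (sin u - sin v) <= Rabs (u - v).
Proof.
  destruct (MVT_abs sin cos v u) as [c [Hc _]]; [intros; apply derivable_pt_lim_sin|]. rewrite Hc.
  rewrite <- (Rmult_1_l (Rabs (u - v))) at 2. apply Rmult_le_compat_r; [apply Rabs_pos|].
  apply Rabs_le. assert (H := COS_bound c). lra.
Qed.

(** In the Taylor polynomial of degree 7 the last two terms combine to [y^5 (42 - y^2) / 5040],
    which is nonnegative here. *)
Lemma sin_cubic y : 0 <= y <= 2 -> y - y ^ 3 / 6 <= sin y <= y.
Proof.
  intros Hy. assert (HPI := PI2_3_2). split.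
  - destruct (SIN y ltac:(lra) ltac:(lra)) as [H _]. eapply Rle_trans; [|exact H].
    unfold sin_lb, sin_approx, sum_f_R0, sin_term.
    replace (INR (fact (2 * 0 + 1))) with 1 by reflexivity. replace (INR (fact (2 * 1 + 1))) with 6 by (simpl; ring).
    replace (INR (fact (2 * 2 + 1))) with 120 by (rewrite INR_IZR_INZ; reflexivity). replace (INR (fact (2 * 3 + 1))) with 5040 by (rewrite INR_IZR_INZ; reflexivity).
    replace ((-1) ^ 0 * (y ^ (2 * 0 + 1) / 1) + (-1) ^ 1 * (y ^ (2 * 1 + 1) / 6) + (-1) ^ 2 * (y ^ (2 * 2 + 1) / 120) + (-1) ^ 3 * (y ^ (2 * 3 + 1) / 5040))
      with (y - y ^ 3 / 6 + y ^ 5 * (42 - y ^ 2) / 5040) by (simpl; field).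
    assert (0 <= y ^ 5) by (apply pow_le; lra). assert (y ^ 2 <= 42) by nra.
    assert (0 <= y ^ 5 * (42 - y ^ 2)) by (apply Rmult_le_pos; lra). lra.
  - destruct (Req_dec y 0) as [->|H]; [rewrite sin_0; lra|]. left. apply sin_lt_x. lra.
Qed.

Lemma sin_small y : Rabs y <= 2 -> Rabs y / 3 <= Rabs (sin y) /\ Rabs (y - sin y) <= y ^ 2.
Proof.
  assert (G : forall y, 0 <= y <= 2 -> Rabs y / 3 <= Rabs (sin y) /\ Rabs (y - sin y) <= y ^ 2).
  { clear y. intros y Hy. destruct (sin_cubic y Hy) as [H1 H2].
    assert (E : y ^ 3 <= 4 * y) by nra. assert (E2 : y ^ 3 <= 2 * y ^ 2) by nra.
    rewrite (Rabs_pos_eq y), (Rabs_pos_eq (y - sin y)) by lra. split; [|lra].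
    eapply Rle_trans; [|apply Rle_abs]. lra. }
  intros Hy. destruct (Rle_dec 0 y) as [H|H].
  - rewrite Rabs_pos_eq in Hy by exact H. now apply G.
  - rewrite Rabs_left in Hy by lra. destruct (G (- y)) as [G1 G2]; [lra|].
    rewrite sin_neg, !Rabs_Ropp in G1. split; [exact G1|].
    replace (- y - sin (- y)) with (- (y - sin y)) in G2 by (rewrite sin_neg; ring). rewrite Rabs_Ropp in G2. nra.
Qed.

(** Isolates the pole: the quotient is [sin psi / y] up to an error that stays bounded when [d] is
    comparable to [y]. The two terms of a pair will share the same [psi]. *)
Lemma sin_ratio psi d y : y <> 0 -> Rabs y <= 2 ->
  Rabs (sin (psi + d) / sin y - sin psi / y) <= 3 * Rabs d / Rabs y + 3.
Proof.
  intros Hy0 Hy. destruct (sin_small y Hy) as [H1 H2]. assert (Hp := Rabs_pos_lt y Hy0).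
  assert (Hs : 0 < Rabs (sin y)) by lra.
  assert (Hs0 : sin y <> 0) by (intros E; rewrite E, Rabs_R0 in Hs; lra).
  replace (sin (psi + d) / sin y - sin psi / y) with ((sin (psi + d) - sin psi) * / sin y + sin psi * ((y - sin y) * / (sin y * y))) by (field; split; assumption).
  eapply Rle_trans; [apply Rabs_triang|].
  assert (Hinv : / Rabs (sin y) <= 3 / Rabs y).
  { replace (3 / Rabs y) with (/ (Rabs y / 3)) by (field; lra). apply Rinv_le_contravar; lra. }
  apply Rplus_le_compat.
  - rewrite Rabs_mult, Rabs_inv. replace (3 * Rabs d / Rabs y) with (Rabs d * (3 / Rabs y)) by (field; lra).
    apply Rmult_le_compat; [apply Rabs_pos|left; now apply Rinv_0_lt_compat| |exact Hinv].
    eapply Rle_trans; [apply sin_lipschitz|]. right. f_equal. ring.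
  - rewrite !Rabs_mult, Rabs_inv, Rabs_mult, Rinv_mult.
    replace 3 with (1 * (Rabs y ^ 2 * ((3 / Rabs y) * / Rabs y))) by (field; lra).
    apply Rmult_le_compat; [apply Rabs_pos| | |].
    + apply Rmult_le_pos; [apply Rabs_pos|]. apply Rmult_le_pos; left; now apply Rinv_0_lt_compat.
    + apply Rabs_le. assert (H := SIN_bound psi). lra.
    + apply Rmult_le_compat; [apply Rabs_pos|apply Rmult_le_pos; left; now apply Rinv_0_lt_compat| |].
      * rewrite RPow_abs, (Rabs_pos_eq (y ^ 2)) by (apply pow2_ge_0). exact H2.
      * apply Rmult_le_compat_r; [left; now apply Rinv_0_lt_compat|exact Hinv].
Qed.

Lemma sin_plus_nPI x n : sin (x + PI * INR n) = (-1) ^ n * sin x.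
Proof.
  induction n as [|n IH]; [simpl; rewrite Rmult_0_r, Rplus_0_r; ring|].
  rewrite S_INR. replace (x + PI * (INR n + 1)) with ((x + PI * INR n) + PI) by ring.
  rewrite neg_sin, IH. simpl. ring.
Qed.

Lemma sin_near_nPI x n : Rabs (x - INR n) <= / 2 -> Rabs (x - INR n) <= Rabs (sin (PI * x)).
Proof.
  intros H. assert (HPI := PI2_3_2). assert (HP4 := PI_4). replace (PI * x) with (PI * (x - INR n) + PI * INR n) by ring.
  rewrite sin_plus_nPI, Rabs_mult, <- RPow_abs, (Rabs_left (-1)) by lra. replace (- -1) with 1 by ring. rewrite pow1, Rmult_1_l.
  assert (E : Rabs (PI * (x - INR n)) = PI * Rabs (x - INR n)) by (rewrite Rabs_mult, Rabs_pos_eq by lra; reflexivity).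
  assert (P := Rabs_pos (x - INR n)).
  destruct (sin_small (PI * (x - INR n))) as [G _]; [rewrite E; nra|]. rewrite E in G. nra.
Qed.

(** The summands of (ii), taken at every [beta]. Where a denominator vanishes, the quotient is 0 by
    convention, in accordance with the omitted terms of (i). *)
Definition oscA (g sigma tau beta lam : R) (k : nat) : R :=
  sin (PI * INR k * (2 * lam * sqrt beta - (1 + 2 * sigma) * beta - 2 * tau) - PI / 2 * (1 + g))
  / (Rpower (INR k) (1 + g) * sin (PI * INR k * beta)).

Definition oscB (g sigma tau beta lam : R) (l : nat) : R :=
  sin (PI * INR l * (2 * lam / sqrt beta - 2 * sigma - (1 + 2 * tau) / beta) - PI / 2 * (1 + g))
  / (Rpower (INR l) (1 + g) * sin (PI * INR l / beta)).

Lemma Rpower_range beta D p : 1 <= D -> / D <= beta <= D -> Rpower beta p <= Rpower D (Rabs p).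
Proof.
  intros HD H. assert (HiD : 0 < / D) by (apply Rinv_0_lt_compat; lra). unfold Rpower. apply exp_le_mono.
  assert (L : Rabs (ln beta) <= ln D).
  { apply Rabs_le. split; [rewrite <- ln_Rinv by lra|]; apply ln_le; lra. }
  apply Rle_trans with (Rabs p * Rabs (ln beta)); [rewrite <- Rabs_mult; apply Rle_abs|].
  apply Rmult_le_compat_l; [apply Rabs_pos|exact L].
Qed.

Lemma Rpower_diff g x y : 0 < g -> 0 < x -> x / 2 <= y ->
  Rabs (Rpower y (- (1 + g)) - Rpower x (- (1 + g))) <= (1 + g) * Rpower (x / 2) (- (2 + g)) * Rabs (y - x).
Proof.
  intros Hg Hx Hy.
  destruct (MVT_gen (fun t => Rpower t (- (1 + g))) x y (fun t => - (1 + g) * Rpower t (- (1 + g) - 1))) as [c [Hc E]].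
  - intros t Ht. apply is_derive_Reals. apply derivable_pt_lim_power.
    destruct (Rle_dec x y); [rewrite Rmin_left in Ht by lra|rewrite Rmin_right in Ht by lra]; lra.
  - intros t Ht. apply derivable_continuous_pt. exists (- (1 + g) * Rpower t (- (1 + g) - 1)). apply derivable_pt_lim_power.
    destruct (Rle_dec x y); [rewrite Rmin_left in Ht by lra|rewrite Rmin_right in Ht by lra]; lra.
  - rewrite E, !Rabs_mult, Rabs_Ropp, (Rabs_pos_eq (1 + g)), (Rabs_pos_eq (Rpower c _)) by (try (left; apply Rpower_pos); lra).
    apply Rmult_le_compat_r; [apply Rabs_pos|]. apply Rmult_le_compat_l; [lra|].
    replace (- (1 + g) - 1) with (- (2 + g)) by ring. rewrite !Rpower_Ropp. apply Rinv_le_contravar; [apply Rpower_pos|].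
    apply Rle_Rpower_l; [lra|]. split; [lra|].
    destruct (Rle_dec x y); [rewrite Rmin_left in Hc by lra|rewrite Rmin_right in Hc by lra]; lra.
Qed.

(** With [e = l - k beta] one has [PI k beta = PI l - PI e], and the signs [(-1)^l] of numerator and
    denominator cancel. The phase that remains depends on [l] only through [e]. *)
Lemma oscA_near g sigma tau beta lam k l : (1 <= k)%nat -> INR l - INR k * beta <> 0 -> Rabs (PI * (INR l - INR k * beta)) <= 2 ->
  oscA g sigma tau beta lam k = - (Rpower (INR k) (- (1 + g)) *
    (sin (PI * INR k * (2 * lam * sqrt beta - 2 * sigma * beta - 2 * tau) - PI / 2 * (1 + g) + PI * (INR l - INR k * beta)) / sin (PI * (INR l - INR k * beta)))).
Proof.
  intros Hk He Hs. set (e := INR l - INR k * beta) in *. set (psi := PI * INR k * (2 * lam * sqrt beta - 2 * sigma * beta - 2 * tau) - PI / 2 * (1 + g)).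
  assert (HPI := PI_RGT_0). destruct (sin_small _ Hs) as [S1 _].
  assert (Hp : 0 < Rabs (PI * e)) by (apply Rabs_pos_lt; apply Rmult_integral_contrapositive_currified; lra).
  assert (Hs0 : sin (PI * e) <> 0) by (intros E; rewrite E, Rabs_R0 in S1; lra).
  unfold oscA. replace (sin (PI * INR k * beta)) with (- ((-1) ^ l * sin (PI * e))).
  2:{ replace (PI * INR k * beta) with (- (PI * e) + PI * INR l) by (unfold e; ring). rewrite sin_plus_nPI, sin_neg. ring. }
  assert (E2 : sin (psi + PI * e) = (-1) ^ l * sin (PI * INR k * (2 * lam * sqrt beta - (1 + 2 * sigma) * beta - 2 * tau) - PI / 2 * (1 + g))).
  { rewrite <- sin_plus_nPI. f_equal. unfold psi, e. ring. }
  rewrite E2, Rpower_Ropp.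
  assert (Hm : (-1) ^ l * (-1) ^ l = 1) by (rewrite <- Rpow_mult_distr; replace (-1 * -1) with 1 by ring; apply pow1).
  assert (Hm0 : (-1) ^ l <> 0) by (apply pow_nonzero; lra). assert (Hk0 := Rpower_pos (INR k) (1 + g)).
  set (sn := sin (_ - _)). replace sn with (((-1) ^ l * (-1) ^ l) * sn) at 1 by (rewrite Hm; ring).
  field. repeat split; try assumption. lra.
Qed.

(** Here [PI l / beta = PI k + PI e / beta]. The phase differs from the one of [oscA_near] by [e]
    times a frequency of size [O(lam + 1)], the origin of the factor [lam + 1] in the bound for a
    pair. *)
Lemma oscB_near g sigma tau beta lam k l : 0 < beta -> (1 <= l)%nat -> INR l - INR k * beta <> 0 -> Rabs (PI * (INR l - INR k * beta) / beta) <= 2 ->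
  oscB g sigma tau beta lam l = Rpower (INR l) (- (1 + g)) *
    (sin (PI * INR k * (2 * lam * sqrt beta - 2 * sigma * beta - 2 * tau) - PI / 2 * (1 + g)
       + (INR l - INR k * beta) * (PI * (2 * lam / sqrt beta - 2 * sigma - (1 + 2 * tau) / beta))) / sin (PI * (INR l - INR k * beta) / beta)).
Proof.
  intros Hb Hl He Hs. set (e := INR l - INR k * beta) in *. set (psi := PI * INR k * (2 * lam * sqrt beta - 2 * sigma * beta - 2 * tau) - PI / 2 * (1 + g)).
  assert (HPI := PI_RGT_0). destruct (sin_small _ Hs) as [S1 _]. assert (Hsb := sqrt_lt_R0 beta Hb). assert (Hsq := sqrt_sqrt beta (Rlt_le _ _ Hb)).
  assert (Hp : 0 < Rabs (PI * e / beta)).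
  { apply Rabs_pos_lt. apply Rmult_integral_contrapositive_currified; [apply Rmult_integral_contrapositive_currified; lra|]. apply Rinv_neq_0_compat; lra. }
  assert (Hs0 : sin (PI * e / beta) <> 0) by (intros E; rewrite E, Rabs_R0 in S1; lra).
  unfold oscB. replace (sin (PI * INR l / beta)) with ((-1) ^ k * sin (PI * e / beta)).
  2:{ replace (PI * INR l / beta) with (PI * e / beta + PI * INR k) by (unfold e; field; lra). now rewrite sin_plus_nPI. }
  set (d := e * _).
  assert (E2 : sin (psi + d) = (-1) ^ k * sin (PI * INR l * (2 * lam / sqrt beta - 2 * sigma - (1 + 2 * tau) / beta) - PI / 2 * (1 + g))).
  { rewrite <- sin_plus_nPI. f_equal. unfold psi, d, e. clear - Hsb Hsq. revert Hsb Hsq. generalize (sqrt beta). intros r Hr Hq. rewrite <- Hq. field. lra. }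
  rewrite E2, Rpower_Ropp.
  assert (Hm : (-1) ^ k * (-1) ^ k = 1) by (rewrite <- Rpow_mult_distr; replace (-1 * -1) with 1 by ring; apply pow1).
  assert (Hm0 : (-1) ^ k <> 0) by (apply pow_nonzero; lra). assert (Hk0 := Rpower_pos (INR l) (1 + g)).
  set (sn := sin (_ - _)). replace sn with (((-1) ^ k * (-1) ^ k) * sn) at 1 by (rewrite Hm; ring).
  field. repeat split; try assumption. lra.
Qed.

Lemma Rpower_half x p : 0 < x -> Rpower (x / 2) (- p) = Rpower 2 p * Rpower x (- p).
Proof.
  intros Hx. unfold Rdiv. rewrite <- Rpower_mult_distr by lra. rewrite (Rmult_comm (Rpower 2 p)). f_equal.
  unfold Rpower. f_equal. rewrite ln_Rinv by lra. ring.
Qed.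

(** Brings the weight of the second sum to the scale of the first one: for [x = l] near [k beta] the
    quotient [x / beta] is near [k], and the factor [/ beta] compensates the residue of
    [1 / sin (PI l / beta)]. *)
Lemma dual_weight g beta x : 0 < beta -> 0 < x ->
  Rpower beta (g / 2) * Rpower x (- (1 + g)) = Rpower beta (- g / 2) * / beta * Rpower (x / beta) (- (1 + g)).
Proof.
  intros Hb Hx. replace x with (x / beta * beta) at 1 by (field; lra).
  rewrite <- Rpower_mult_distr by (try apply Rdiv_lt_0_compat; lra).
  replace (/ beta) with (Rpower beta (- (1))) by (rewrite Rpower_Ropp, Rpower_1 by lra; reflexivity).
  rewrite <- Rpower_plus. replace (Rpower beta (g / 2) * (Rpower (x / beta) (- (1 + g)) * Rpower beta (- (1 + g)))) with
   ((Rpower beta (g / 2) * Rpower beta (- (1 + g))) * Rpower (x / beta) (- (1 + g))) by ring.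
  rewrite <- Rpower_plus. f_equal. f_equal. field.
Qed.

Lemma dual_weight_bound g beta k l D : 0 < g -> 1 <= D -> / D <= beta <= D -> 0 < k -> k / 2 <= l / beta -> 0 < l ->
  Rpower beta (g / 2) * Rpower l (- (1 + g)) <= Rpower D (Rabs (- g / 2)) * D * (Rpower 2 (1 + g) * Rpower k (- (1 + g))).
Proof.
  intros Hg HD Hb Hk Hl Hl0. assert (HiD : 0 < / D) by (apply Rinv_0_lt_compat; lra).
  assert (Hu := Rpower_pos beta (- g / 2)). assert (Hib0 : 0 < / beta) by (apply Rinv_0_lt_compat; lra).
  rewrite dual_weight by lra. apply Rmult_le_compat.
  - apply Rmult_le_pos; lra.
  - left; apply Rpower_pos.
  - apply Rmult_le_compat; [lra|lra|now apply Rpower_range|]. rewrite <- (Rinv_inv D). apply Rinv_le_contravar; lra.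
  - rewrite <- Rpower_half by lra. rewrite !Rpower_Ropp. apply Rinv_le_contravar; [apply Rpower_pos|]. apply Rle_Rpower_l; lra.
Qed.

(** Up to admissible errors the two terms are [- u P s] and [u Y s], where [s = sin psi / (PI e)]
    carries the pole, [P = k^(-(1 + g))] and [Y = (l / beta)^(-(1 + g))]. As [Y - P] is [O(e)] times
    [P], the pole cancels. *)
Lemma pair_bound g sigma tau D : 0 < g -> 1 <= D -> exists C, 0 <= C /\ forall beta lam k l, / D <= beta <= D -> 0 <= lam ->
  (1 <= k)%nat -> (1 <= l)%nat -> Rabs (INR l - INR k * beta) <= / (4 * D) ->
  Rabs (Rpower beta (- g / 2) * oscA g sigma tau beta lam k + Rpower beta (g / 2) * oscB g sigma tau beta lam l) <= C * (lam + 1) * Rpower (INR k) (- (1 + g)).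
Proof.
  intros Hg HD. set (U := Rpower D (Rabs (- g / 2))). set (T1 := Rpower 2 (1 + g)). set (T2 := Rpower 2 (2 + g)).
  set (K0 := 2 * D + 2 * Rabs sigma * D + 1 + 2 * Rabs tau).
  assert (HU : 0 < U) by apply Rpower_pos. assert (HT1 : 0 < T1) by apply Rpower_pos. assert (HT2 : 0 < T2) by apply Rpower_pos.
  assert (Ps := Rabs_pos sigma). assert (Pt := Rabs_pos tau).
  assert (HK0 : 0 <= K0) by (unfold K0; assert (0 <= Rabs sigma * D) by (apply Rmult_le_pos; lra); lra).
  exists (U * (6 + D * T1 * (3 * K0 + 3) + (1 + g) * T2 * D)).
  split. { apply Rmult_le_pos; [lra|]. repeat apply Rplus_le_le_0_compat; repeat apply Rmult_le_pos; lra. }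
  intros beta lam k l Hb Hlam Hk Hl He.
  assert (HiD : 0 < / D) by (apply Rinv_0_lt_compat; lra). assert (Hb0 : 0 < beta) by lra.
  assert (HPI := PI2_3_2). assert (HP4 := PI_4).
  assert (Hk0 : 1 <= INR k) by (apply (le_INR 1); exact Hk). assert (Hl0 : 1 <= INR l) by (apply (le_INR 1); exact Hl).
  set (P := Rpower (INR k) (- (1 + g))). assert (HP : 0 < P) by apply Rpower_pos.
  set (e := INR l - INR k * beta) in *.
  (* Exact resonance, which occurs only for rational [beta]: both terms are 0 because their
     denominators vanish. *)
  destruct (Req_dec e 0) as [E0|E0].
  { unfold oscA, oscB. replace (PI * INR k * beta) with (PI * INR l) by (unfold e in E0; replace (INR l) with (INR k * beta) by lra; ring).
    replace (PI * INR l / beta) with (PI * INR k) by (unfold e in E0; replace (INR l) with (INR k * beta) by lra; field; lra).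
    assert (Z : forall n, sin (PI * INR n) = 0) by (intros n; replace (PI * INR n) with (0 + PI * INR n) by ring; rewrite sin_plus_nPI, sin_0; ring).
    rewrite !Z, !Rmult_0_r. unfold Rdiv. rewrite Rinv_0, !Rmult_0_r, Rplus_0_r, Rabs_R0.
    apply Rmult_le_pos; [|lra]. apply Rmult_le_pos; [|lra]. apply Rmult_le_pos; [lra|]. repeat apply Rplus_le_le_0_compat; repeat apply Rmult_le_pos; lra. }
  assert (Hpe := Rabs_pos_lt e E0).
  assert (Hq : / (4 * D) = / 4 * / D) by (field; lra).
  assert (HiD1 : / D <= 1) by (rewrite <- Rinv_1; apply Rinv_le_contravar; lra).
  assert (He4 : Rabs e <= / 4) by lra.
  assert (Heb : Rabs e / beta <= / 4) by (apply (Rmult_le_reg_r beta); [lra|]; unfold Rdiv; rewrite Rmult_assoc, Rinv_l by lra; lra).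
  assert (Y1 : Rabs (PI * e) = PI * Rabs e) by (rewrite Rabs_mult, Rabs_pos_eq by lra; reflexivity).
  assert (Y2 : Rabs (PI * e / beta) = PI * (Rabs e / beta)).
  { unfold Rdiv. rewrite !Rabs_mult, (Rabs_pos_eq PI), Rabs_inv, (Rabs_pos_eq beta) by lra. ring. }
  assert (Y1' : Rabs (PI * e) <= 2) by (rewrite Y1; nra).
  assert (HebP : 0 < Rabs e / beta) by (apply Rdiv_lt_0_compat; lra).
  assert (Y2' : Rabs (PI * e / beta) <= 2) by (rewrite Y2; nra).
  rewrite (oscA_near g sigma tau beta lam k l Hk E0 Y1'), (oscB_near g sigma tau beta lam k l Hb0 Hl E0 Y2'). fold e P.
  set (psi := PI * INR k * (2 * lam * sqrt beta - 2 * sigma * beta - 2 * tau) - PI / 2 * (1 + g)).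
  set (kap := PI * (2 * lam / sqrt beta - 2 * sigma - (1 + 2 * tau) / beta)).
  assert (N1 : PI * e <> 0) by (intros E; rewrite E, Rabs_R0 in Y1; nra).
  assert (N2 : PI * e / beta <> 0) by (intros E; rewrite E, Rabs_R0 in Y2; nra).
  assert (R1 := sin_ratio psi (PI * e) (PI * e) N1 Y1'). assert (R2 := sin_ratio psi (e * kap) (PI * e / beta) N2 Y2').
  set (X1 := sin (psi + PI * e) / sin (PI * e)) in *. set (X2 := sin (psi + e * kap) / sin (PI * e / beta)) in *.
  set (s := sin psi / (PI * e)) in *.
  replace (sin psi / (PI * e / beta)) with (beta * s) in R2 by (unfold s; field; repeat split; lra).
  replace (3 * Rabs (PI * e) / Rabs (PI * e) + 3) with 6 in R1 by (field; rewrite Y1; nra).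
  replace (3 * Rabs (e * kap) / Rabs (PI * e / beta) + 3) with (3 * (Rabs kap * beta / PI) + 3) in R2
    by (rewrite Y2, Rabs_mult; field; repeat split; lra).
  set (Y := Rpower (INR l / beta) (- (1 + g))).
  set (u := Rpower beta (- g / 2)). assert (Hu : 0 < u) by apply Rpower_pos. assert (HuU : u <= U) by now apply Rpower_range.
  assert (EY : Rpower beta (g / 2) * Rpower (INR l) (- (1 + g)) = u * / beta * Y).
  { unfold u, Y. apply dual_weight; lra. }
  rewrite <- Rmult_assoc, EY.
  (* The first two products contain the deviations from the poles, the last one what remains after
     the poles have cancelled. *)
  replace (u * - (P * X1) + u * / beta * Y * X2) with (u * (- P * (X1 - s) + (/ beta * Y) * (X2 - beta * s) + (Y - P) * s)) by (field; lra).
  assert (Hlk : INR l / beta - INR k = e / beta) by (unfold e; field; lra).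
  assert (Hk2 : INR k / 2 <= INR l / beta).
  { assert (Q : - (/ 4) <= e / beta). { replace (e / beta) with (- (- e / beta)) by (field; lra). apply Ropp_le_contravar. eapply Rle_trans; [|exact Heb].
      unfold Rdiv. apply Rmult_le_compat_r; [left; now apply Rinv_0_lt_compat|]. rewrite <- Rabs_Ropp. apply Rle_abs. } lra. }
  assert (HY : Y <= T1 * P).
  { unfold Y, T1, P. rewrite <- Rpower_half by lra. rewrite !Rpower_Ropp. apply Rinv_le_contravar; [apply Rpower_pos|]. apply Rle_Rpower_l; lra. }
  assert (HY0 : 0 < Y) by apply Rpower_pos.
  assert (HYP : Rabs (Y - P) <= (1 + g) * (T2 * P) * (Rabs e / beta)).
  { eapply Rle_trans; [apply Rpower_diff; lra|]. rewrite Hlk. unfold Rdiv at 2. rewrite Rabs_mult, Rabs_inv, (Rabs_pos_eq beta) by lra.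
    apply Rmult_le_compat_r; [unfold Rdiv in HebP; lra|]. apply Rmult_le_compat_l; [lra|]. rewrite Rpower_half by lra. apply Rmult_le_compat_l; [lra|].
    apply Rpower_le_exp; lra. }
  assert (HKap : Rabs kap * beta / PI <= K0 * (lam + 1)).
  { replace (Rabs kap * beta / PI) with (Rabs (2 * lam * sqrt beta + (- (2 * sigma * beta) - (1 + 2 * tau)))).
    2:{ transitivity (Rabs (kap * beta / PI)); [|unfold Rdiv; rewrite !Rabs_mult, Rabs_inv, (Rabs_pos_eq beta), (Rabs_pos_eq PI) by lra; reflexivity]. f_equal.
        unfold kap. assert (Hsb := sqrt_lt_R0 beta Hb0). assert (Hsq := sqrt_sqrt beta (Rlt_le _ _ Hb0)). assert (HPI0 := PI_RGT_0).
        clear - Hsb Hsq HPI0. revert Hsb Hsq. generalize (sqrt beta). intros r Hr Hq. rewrite <- Hq. field. lra. }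
    assert (Hsq : sqrt beta <= D).
    { rewrite <- (sqrt_square D) by lra. apply sqrt_le_1; nra. }
    assert (Hs0 := sqrt_pos beta).
    eapply Rle_trans; [apply Rabs_triang|]. rewrite Rabs_pos_eq by (apply Rmult_le_pos; lra).
    apply Rle_trans with (2 * lam * D + (2 * Rabs sigma * D + (1 + 2 * Rabs tau))).
    - apply Rplus_le_compat; [apply Rmult_le_compat_l; lra|]. eapply Rle_trans; [apply Rabs_triang|]. rewrite !Rabs_Ropp. apply Rplus_le_compat.
      + rewrite !Rabs_mult, (Rabs_pos_eq 2), (Rabs_pos_eq beta) by lra. apply Rmult_le_compat_l; lra.
      + eapply Rle_trans; [apply Rabs_triang|]. rewrite Rabs_R1, Rabs_mult, (Rabs_pos_eq 2) by lra. lra.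
    - unfold K0. assert (0 <= Rabs sigma * D * lam) by (repeat apply Rmult_le_pos; lra). assert (0 <= Rabs tau * lam) by (apply Rmult_le_pos; lra). assert (0 <= D * lam) by (apply Rmult_le_pos; lra). lra. }
  assert (Hs : Rabs s <= / Rabs e).
  { unfold s, Rdiv. rewrite Rabs_mult, Rabs_inv, Y1. rewrite <- (Rmult_1_l (/ Rabs e)). apply Rmult_le_compat; [apply Rabs_pos|left; apply Rinv_0_lt_compat; nra| |].
    - apply Rabs_le. assert (H := SIN_bound psi). lra.
    - apply Rinv_le_contravar; nra. }
  assert (Hib : / beta <= D) by (rewrite <- (Rinv_inv D); apply Rinv_le_contravar; lra). assert (Hib0 : 0 < / beta) by now apply Rinv_0_lt_compat.
  rewrite Rabs_mult, (Rabs_pos_eq u) by lra.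
  apply Rle_trans with (U * ((6 + D * T1 * (3 * K0 + 3) + (1 + g) * T2 * D) * (lam + 1) * P)); [|right; ring].
  apply Rmult_le_compat; [lra|apply Rabs_pos|exact HuU|].
  apply Rle_trans with (6 * P + D * (T1 * P) * (3 * (K0 * (lam + 1)) + 3) + (1 + g) * (T2 * P) * D).
  - eapply Rle_trans; [apply Rabs_triang|]. apply Rplus_le_compat; [eapply Rle_trans; [apply Rabs_triang|]; apply Rplus_le_compat|].
    + rewrite Rabs_mult, Rabs_Ropp, Rabs_pos_eq by lra. rewrite Rmult_comm. apply Rmult_le_compat_r; lra.
    + rewrite Rabs_mult, Rabs_pos_eq by (apply Rmult_le_pos; lra). apply Rmult_le_compat; [apply Rmult_le_pos; lra|apply Rabs_pos| |lra].
      apply Rmult_le_compat; lra.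
    + rewrite Rabs_mult. apply Rle_trans with ((1 + g) * (T2 * P) * (Rabs e / beta) * / Rabs e).
      * apply Rmult_le_compat; [apply Rabs_pos|apply Rabs_pos|exact HYP|exact Hs].
      * replace ((1 + g) * (T2 * P) * (Rabs e / beta) * / Rabs e) with ((1 + g) * (T2 * P) * / beta) by (field; lra).
        apply Rmult_le_compat_l; [|exact Hib]. repeat apply Rmult_le_pos; lra.
  - assert (0 <= P * lam) by (apply Rmult_le_pos; lra). assert (0 <= D * T1 * (P * lam)) by (repeat apply Rmult_le_pos; lra).
    assert (0 <= (1 + g) * T2 * D * (P * lam)) by (repeat apply Rmult_le_pos; lra). lra.
Qed.

(** * Tails of the paired sums *)

Definition nat_floor (x : R) : nat := Z.to_nat (Int_part x).

Lemma nat_floor_spec x : 0 <= x -> INR (nat_floor x) <= x < INR (nat_floor x) + 1.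
Proof.
  intros Hx. destruct (base_Int_part x) as [H1 H2].
  assert (H : (0 <= Int_part x)%Z). { assert (-1 < Int_part x)%Z; [|lia]. apply lt_IZR. lra. }
  unfold nat_floor. rewrite INR_IZR_INZ, Z2Nat.id by exact H. lra.
Qed.

Lemma nat_floor_unique x n : INR n <= x < INR n + 1 -> nat_floor x = n.
Proof. intros H. unfold nat_floor. rewrite (Int_part_unique x (Z.of_nat n)); [apply Nat2Z.id|]. now rewrite <- INR_IZR_INZ. Qed.

Lemma nat_floor_mono x y : 0 <= x <= y -> (nat_floor x <= nat_floor y)%nat.
Proof.
  intros H. assert (H1 := nat_floor_spec x ltac:(lra)). assert (H2 := nat_floor_spec y ltac:(lra)).
  apply Nat.lt_succ_r, INR_lt. rewrite S_INR. lra.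
Qed.

Lemma rsum_pick f n i : (i < n)%nat -> rsum f n = f i + rsum (fun j => if Nat.eqb j i then 0 else f j) n.
Proof.
  intros Hi. induction n as [|n IH]; [lia|]. rewrite !rsum_S. destruct (Nat.eq_dec i n) as [->|Hn].
  - rewrite Nat.eqb_refl. rewrite (rsum_ext (fun j => if Nat.eqb j n then 0 else f j) f n); [ring|].
    intros k Hk. rewrite (proj2 (Nat.eqb_neq k n)); [reflexivity|lia].
  - rewrite IH by lia. rewrite (proj2 (Nat.eqb_neq n i)) by lia. ring.
Qed.

(** With this cutoff, the index [k] brings along the block of all [l] in the interval from
    [(k - 1/2) beta] to [(k + 1/2) beta], so that a resonant [l] enters together with its
    partner. *)
Definition osc_sum (g sigma tau : R) (K : nat) (beta lam : R) : R :=
  rsum (fun j => Rpower beta (- g / 2) * oscA g sigma tau beta lam (S j)) K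
  + rsum (fun i => Rpower beta (g / 2) * oscB g sigma tau beta lam (S i)) (nat_floor ((INR K + / 2) * beta)).

Lemma nat_separated l l' x : Rabs (INR l' - x) <= / 2 -> l <> l' -> / 2 <= Rabs (INR l - x).
Proof.
  intros H1 H2. apply Rabs_le_between in H1. destruct (Nat.lt_total l l') as [H|[H|H]]; [|contradiction|].
  - apply le_INR in H. rewrite S_INR in H. rewrite Rabs_left1; lra.
  - apply le_INR in H. rewrite S_INR in H. rewrite Rabs_pos_eq; lra.
Qed.

(** Within the block [k] is an integer nearest to [l / beta], and here the distance is at least
    [/ (4 D D)]; so there is no small divisor. *)
Lemma oscB_far g sigma tau beta lam k l D : 0 < g -> 1 <= D -> / D <= beta <= D -> (1 <= k)%nat ->
  (INR k - / 2) * beta <= INR l <= (INR k + / 2) * beta -> / (4 * D) <= Rabs (INR l - INR k * beta) ->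
  Rabs (Rpower beta (g / 2) * oscB g sigma tau beta lam l) <= Rpower D (Rabs (- g / 2)) * D * (Rpower 2 (1 + g) * Rpower (INR k) (- (1 + g))) * (4 * D * D).
Proof.
  intros Hg HD Hb Hk Hl Hf. assert (HiD : 0 < / D) by (apply Rinv_0_lt_compat; lra).
  assert (Hk0 : 1 <= INR k) by (apply (le_INR 1); exact Hk). assert (HPI := PI_RGT_0).
  assert (Hib : 0 < / beta) by (apply Rinv_0_lt_compat; lra).
  assert (Q1 : INR k - / 2 <= INR l / beta).
  { apply (Rmult_le_reg_r beta); [lra|]. unfold Rdiv. rewrite Rmult_assoc, Rinv_l by lra. lra. }
  assert (Q2 : INR l / beta <= INR k + / 2).
  { apply (Rmult_le_reg_r beta); [lra|]. unfold Rdiv. rewrite Rmult_assoc, Rinv_l by lra. lra. }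
  assert (Hl0 : 0 < INR l) by (assert (0 < (INR k - / 2) * beta) by (apply Rmult_lt_0_compat; lra); lra).
  assert (S1 : Rabs (INR l / beta - INR k) <= Rabs (sin (PI * (INR l / beta)))).
  { apply sin_near_nPI. apply Rabs_le. lra. }
  assert (S2 : / (4 * D * D) <= Rabs (INR l / beta - INR k)).
  { replace (INR l / beta - INR k) with ((INR l - INR k * beta) / beta) by (field; lra).
    unfold Rdiv. rewrite Rabs_mult, (Rabs_pos_eq (/ beta)) by lra. replace (/ (4 * D * D)) with (/ (4 * D) * / D) by (field; lra).
    apply Rmult_le_compat; [left; apply Rinv_0_lt_compat; lra|lra|exact Hf|]. apply Rinv_le_contravar; lra. }
  assert (H4 : 0 < / (4 * D * D)) by (apply Rinv_0_lt_compat; nra).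
  unfold oscB. replace (PI * INR l / beta) with (PI * (INR l / beta)) by (unfold Rdiv; ring).
  set (sn := sin (_ - _)). set (sd := sin (PI * (INR l / beta))) in *.
  replace (Rpower beta (g / 2) * (sn / (Rpower (INR l) (1 + g) * sd))) with ((Rpower beta (g / 2) * Rpower (INR l) (- (1 + g))) * (sn * / sd))
    by (rewrite Rpower_Ropp; unfold Rdiv; rewrite Rinv_mult; ring).
  assert (W := dual_weight_bound g beta (INR k) (INR l) D Hg HD Hb ltac:(lra) ltac:(lra) Hl0).
  assert (W0 : 0 < Rpower beta (g / 2) * Rpower (INR l) (- (1 + g))) by (apply Rmult_lt_0_compat; apply Rpower_pos).
  rewrite Rabs_mult, Rabs_pos_eq by lra. apply Rmult_le_compat; [lra|apply Rabs_pos|exact W|].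
  rewrite Rabs_mult, Rabs_inv. rewrite <- (Rmult_1_l (4 * D * D)). apply Rmult_le_compat; [apply Rabs_pos|left; apply Rinv_0_lt_compat; lra| |].
  - apply Rabs_le. apply SIN_bound.
  - rewrite <- (Rinv_inv (4 * D * D)). apply Rinv_le_contravar; lra.
Qed.

(** A block has at most [D + 1] indices [l], and only [l1], an integer nearest to [k beta], can be
    within [/ (4 D)] of it. If it is, it is paired with [k]; if not, the term of index [k] has no
    small divisor either. *)
Lemma block_bound g sigma tau D : 0 < g -> 1 <= D -> exists C, 0 <= C /\ forall beta lam K, / D <= beta <= D -> 0 <= lam ->
  Rabs (osc_sum g sigma tau (S K) beta lam - osc_sum g sigma tau K beta lam) <= C * (lam + 1) * zterm g K.
Proof.
  intros Hg HD. destruct (pair_bound g sigma tau D Hg HD) as [C0 [HC0 HP]].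
  set (U := Rpower D (Rabs (- g / 2))). set (Cb := U * D * Rpower 2 (1 + g) * (4 * D * D)).
  assert (HU : 0 < U) by apply Rpower_pos. assert (HT := Rpower_pos 2 (1 + g)).
  assert (HCb : 0 <= Cb) by (unfold Cb; repeat apply Rmult_le_pos; lra).
  exists (C0 + U * (4 * D) + (D + 1) * Cb). split.
  { repeat apply Rplus_le_le_0_compat; try exact HC0; repeat apply Rmult_le_pos; lra. }
  intros beta lam K Hb Hlam. assert (HiD : 0 < / D) by (apply Rinv_0_lt_compat; lra).
  assert (HK := pos_INR K). unfold zterm. set (k := S K). set (P := Rpower (INR k) (- (1 + g))). assert (HP0 : 0 < P) by apply Rpower_pos.
  assert (Ek : INR k = INR K + 1) by apply S_INR.
  set (n1 := nat_floor ((INR K + / 2) * beta)). set (n2 := nat_floor ((INR k + / 2) * beta)).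
  assert (F1 : INR n1 <= (INR K + / 2) * beta < INR n1 + 1) by (apply nat_floor_spec; apply Rmult_le_pos; lra).
  assert (F2 : INR n2 <= (INR k + / 2) * beta < INR n2 + 1) by (apply nat_floor_spec; apply Rmult_le_pos; lra).
  assert (F12 : (n1 <= n2)%nat). { apply nat_floor_mono. split; [apply Rmult_le_pos; lra|]. apply Rmult_le_compat_r; lra. }
  set (f := fun i => Rpower beta (g / 2) * oscB g sigma tau beta lam (S (n1 + i))).
  assert (E : osc_sum g sigma tau k beta lam - osc_sum g sigma tau K beta lam = Rpower beta (- g / 2) * oscA g sigma tau beta lam k + rsum f (n2 - n1)).
  { unfold osc_sum. fold n1 n2. unfold k. rewrite rsum_S. replace n2 with (n1 + (n2 - n1))%nat at 1 by lia. rewrite rsum_add. fold f. unfold f. ring. }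
  rewrite E.
  assert (Hnum : INR (n2 - n1) <= D + 1).
  { rewrite minus_INR by exact F12. replace ((INR K + / 2) * beta) with ((INR k + / 2) * beta - beta) in F1 by (rewrite Ek; ring). lra. }
  assert (Hblk : forall i, (i < n2 - n1)%nat -> (INR k - / 2) * beta <= INR (S (n1 + i)) <= (INR k + / 2) * beta).
  { intros i Hi. split.
    - replace ((INR k - / 2) * beta) with ((INR K + / 2) * beta) by (rewrite Ek; field).
      apply Rle_trans with (INR (S n1)); [rewrite S_INR; lra|apply le_INR; lia].
    - apply Rle_trans with (INR n2); [apply le_INR; lia|lra]. }
  assert (Hfar : forall i, (i < n2 - n1)%nat -> / (4 * D) <= Rabs (INR (S (n1 + i)) - INR k * beta) -> Rabs (f i) <= Cb * P).
  { intros i Hi Hi2. unfold f. eapply Rle_trans; [apply (oscB_far g sigma tau beta lam k _ D Hg HD Hb); [unfold k; lia|now apply Hblk|exact Hi2]|].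
    fold U P. unfold Cb. right. ring. }
  assert (Hq : / (4 * D) = / 4 * / D) by (field; lra).
  assert (HiD1 : / D <= 1) by (rewrite <- Rinv_1; apply Rinv_le_contravar; lra).
  set (l1 := nat_floor (INR k * beta + / 2)).
  assert (Hkb : 0 <= INR k * beta) by (apply Rmult_le_pos; lra).
  assert (Hl1 : Rabs (INR l1 - INR k * beta) <= / 2).
  { assert (F3 := nat_floor_spec (INR k * beta + / 2) ltac:(lra)). fold l1 in F3. apply Rabs_le. lra. }
  assert (Hsum : forall h : nat -> R, (forall i, (i < n2 - n1)%nat -> Rabs (h i) <= Cb * P) -> Rabs (rsum h (n2 - n1)) <= (D + 1) * Cb * P).
  { intros h Hh. eapply Rle_trans; [exact (rsum_bound h (n2 - n1) (Cb * P) Hh)|]. rewrite Rmult_assoc. apply Rmult_le_compat_r; [apply Rmult_le_pos; lra|exact Hnum]. }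
  assert (HlP : 0 <= lam * P) by (apply Rmult_le_pos; lra).
  assert (HDC : 0 <= (D + 1) * Cb) by (apply Rmult_le_pos; lra). assert (HU4 : 0 <= U * (4 * D)) by (apply Rmult_le_pos; lra).
  assert (G1 := Rmult_le_pos _ _ HDC HlP). assert (G2 := Rmult_le_pos _ _ HU4 HlP). assert (G3 := Rmult_le_pos _ _ HC0 HlP).
  assert (G4 := Rmult_le_pos _ _ HU4 (Rlt_le _ _ HP0)). assert (G5 := Rmult_le_pos _ _ HC0 (Rlt_le _ _ HP0)).
  destruct (Rle_dec (Rabs (INR l1 - INR k * beta)) (/ (4 * D))) as [Hn|Hn].
  (* As [/ (4 D)] is less than [beta / 2], the resonant [l1] belongs to the block of [k]. *)
  - assert (Hn' := proj1 (Rabs_le_between _ _) Hn).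
    assert (H4b : / (4 * D) < / 2 * beta) by lra.
    assert (B1 : (n1 < l1)%nat). { apply INR_lt. replace ((INR K + / 2) * beta) with (INR k * beta - / 2 * beta) in F1 by (rewrite Ek; field). lra. }
    assert (B2 : (l1 <= n2)%nat). { apply Nat.lt_succ_r, INR_lt. rewrite S_INR. replace ((INR k + / 2) * beta) with (INR k * beta + / 2 * beta) in F2 by ring. lra. }
    rewrite (rsum_pick f (n2 - n1) (l1 - n1 - 1)) by lia.
    replace (f (l1 - n1 - 1)%nat) with (Rpower beta (g / 2) * oscB g sigma tau beta lam l1).
    2:{ unfold f. do 2 f_equal. lia. }
    rewrite <- Rplus_assoc. eapply Rle_trans; [apply Rabs_triang|].
    apply Rle_trans with (C0 * (lam + 1) * P + (D + 1) * Cb * P); [|lra].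
    apply Rplus_le_compat.
    + apply HP; try assumption; [unfold k|]; lia.
    + apply Hsum. intros i Hi. destruct (Nat.eqb_spec i (l1 - n1 - 1)) as [->|Hne]; [rewrite Rabs_R0; apply Rmult_le_pos; lra|].
      apply Hfar; [exact Hi|]. apply Rle_trans with (/ 2); [lra|]. apply (nat_separated _ l1); [exact Hl1|lia].
  - apply Rnot_le_lt in Hn. eapply Rle_trans; [apply Rabs_triang|].
    apply Rle_trans with (U * (4 * D) * P + (D + 1) * Cb * P); [|lra]. apply Rplus_le_compat.
    + assert (Hs : / (4 * D) <= Rabs (sin (PI * (INR k * beta)))).
      { apply Rle_trans with (Rabs (INR k * beta - INR l1)); [rewrite Rabs_minus_sym; lra|]. apply sin_near_nPI. rewrite Rabs_minus_sym. exact Hl1. }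
      unfold oscA. rewrite (Rmult_assoc PI (INR k) beta). set (sn := sin (_ - _)). set (sd := sin (PI * (INR k * beta))) in *.
      replace (Rpower beta (- g / 2) * (sn / (Rpower (INR k) (1 + g) * sd))) with (Rpower beta (- g / 2) * P * (sn * / sd))
        by (unfold P; rewrite Rpower_Ropp; unfold Rdiv; rewrite Rinv_mult; ring).
      assert (Hu := Rpower_pos beta (- g / 2)). assert (HuU : Rpower beta (- g / 2) <= U) by now apply Rpower_range.
      assert (H4 : 0 < / (4 * D)) by lra.
      rewrite !Rabs_mult, Rabs_inv, (Rabs_pos_eq (Rpower beta _)), (Rabs_pos_eq P) by lra.
      apply Rle_trans with (U * P * (1 * (4 * D))); [|lra]. apply Rmult_le_compat.
      * apply Rmult_le_pos; lra.
      * apply Rmult_le_pos; [apply Rabs_pos|left; apply Rinv_0_lt_compat; lra].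
      * apply Rmult_le_compat_r; lra.
      * apply Rmult_le_compat; [apply Rabs_pos|left; apply Rinv_0_lt_compat; lra|apply Rabs_le; apply SIN_bound|].
        rewrite <- (Rinv_inv (4 * D)). apply Rinv_le_contravar; lra.
    + apply Hsum. intros i Hi. apply Hfar; [exact Hi|]. destruct (Nat.eq_dec (S (n1 + i)) l1) as [->|Hne]; [lra|].
      apply Rle_trans with (/ 2); [lra|]. now apply (nat_separated _ l1).
Qed.

Lemma osc_sum_tail g sigma tau D : 0 < g -> 1 <= D -> exists C, 0 <= C /\ forall beta lam K n, / D <= beta <= D -> 0 <= lam -> (1 <= K)%nat ->
  Rabs (osc_sum g sigma tau (K + n) beta lam - osc_sum g sigma tau K beta lam) <= C * (lam + 1) * Rpower (INR K) (- g).
Proof.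
  intros Hg HD. destruct (block_bound g sigma tau D Hg HD) as [C [HC H]]. assert (Hig : 0 < / g) by now apply Rinv_0_lt_compat.
  exists (C * / g). split; [apply Rmult_le_pos; lra|]. intros beta lam K n Hb Hlam HK.
  assert (T : Rabs (osc_sum g sigma tau (K + n) beta lam - osc_sum g sigma tau K beta lam) <= C * (lam + 1) * rsum (fun j => zterm g (K + j)) n).
  { induction n as [|n IH].
    - rewrite Nat.add_0_r, Rminus_diag, Rabs_R0. simpl. lra.
    - rewrite rsum_S, Nat.add_succ_r. specialize (H beta lam (K + n)%nat Hb Hlam).
      replace (_ - _) with ((osc_sum g sigma tau (K + n) beta lam - osc_sum g sigma tau K beta lam) + (osc_sum g sigma tau (S (K + n)) beta lam - osc_sum g sigma tau (K + n) beta lam)) by ring.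
      eapply Rle_trans; [apply Rabs_triang|]. lra. }
  eapply Rle_trans; [exact T|]. apply Rle_trans with (C * (lam + 1) * (/ g * Rpower (INR K) (- g))); [|right; ring].
  apply Rmult_le_compat_l; [apply Rmult_le_pos; lra|]. now apply zterm_tail.
Qed.

(** * Truncation of the oscillatory term at rational numbers *)

Lemma sin_PI_divisible k m n : (1 <= n)%nat -> Nat.divide n k -> sin (PI * INR k * (INR m / INR n)) = 0.
Proof.
  intros Hn [q ->]. assert (Hn0 : 0 < INR n) by (apply lt_0_INR; lia).
  replace (PI * INR (q * n) * (INR m / INR n)) with (0 + PI * INR (q * m)) by (rewrite !mult_INR; field; lra).
  rewrite sin_plus_nPI, sin_0. ring.
Qed.

(* As [x / 0 = 0], the terms which the series omits are zero anyway. *)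
Lemma rational_term g x k m n : (1 <= n)%nat ->
  (if Nat.eqb (Nat.modulo k n) 0 then 0
   else sin (PI * INR k * (2 * x - INR m) / INR n - PI / 2 * (1 + g)) / (Rpower (INR k) (1 + g) * sin (PI * INR k * (INR m / INR n))))
  = sin (PI * INR k * (2 * x - INR m) / INR n - PI / 2 * (1 + g)) / (Rpower (INR k) (1 + g) * sin (PI * INR k * (INR m / INR n))).
Proof.
  intros Hn. change (Nat.eqb (Nat.modulo k n) 0) with (divides_b n k). destruct (divides_b n k) eqn:E; [|reflexivity].
  apply divides_b_spec in E; [|exact Hn]. rewrite sin_PI_divisible by assumption. unfold Rdiv. rewrite Rmult_0_r, Rinv_0. ring.
Qed.

Lemma oscA_rational g sigma tau mu nu lam j : (1 <= mu)%nat -> (1 <= nu)%nat ->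
  let x := sqrt (INR mu * INR nu) * lam - INR mu * sigma - INR nu * tau in
  (let k := S j in if Nat.eqb (Nat.modulo k nu) 0 then 0
   else sin (PI * INR k * (2 * x - INR mu) / INR nu - PI / 2 * (1 + g)) / (Rpower (INR k) (1 + g) * sin (PI * INR k * (INR mu / INR nu))))
  = oscA g sigma tau (INR mu / INR nu) lam (S j).
Proof.
  intros Hmu Hnu x. cbv zeta. rewrite rational_term by exact Hnu. unfold oscA.
  destruct (sqrt_ratio mu nu Hmu Hnu) as [Ha [HL [EaL _]]]. assert (Hn : 0 < INR nu) by (apply lt_0_INR; lia).
  f_equal. f_equal. unfold x. rewrite <- EaL. field. lra.
Qed.

Lemma oscB_rational g sigma tau mu nu lam j : (1 <= mu)%nat -> (1 <= nu)%nat ->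
  let x := sqrt (INR mu * INR nu) * lam - INR mu * sigma - INR nu * tau in
  (let k := S j in if Nat.eqb (Nat.modulo k mu) 0 then 0
   else sin (PI * INR k * (2 * x - INR nu) / INR mu - PI / 2 * (1 + g)) / (Rpower (INR k) (1 + g) * sin (PI * INR k * (INR nu / INR mu))))
  = oscB g sigma tau (INR mu / INR nu) lam (S j).
Proof.
  intros Hmu Hnu x. cbv zeta. rewrite rational_term by exact Hmu. unfold oscB.
  destruct (sqrt_ratio mu nu Hmu Hnu) as [Ha [HL [_ [EbL _]]]]. assert (Hn : 0 < INR nu) by (apply lt_0_INR; lia). assert (Hm : 0 < INR mu) by (apply lt_0_INR; lia).
  set (a := sqrt (INR mu / INR nu)) in *.
  f_equal; [f_equal; unfold x; rewrite <- EbL; field; repeat split; lra|]. f_equal. f_equal. field. split; lra.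
Qed.

Lemma nat_floor_unbounded beta : 0 < beta -> filterlim (fun K => nat_floor ((INR K + / 2) * beta)) eventually eventually.
Proof.
  intros Hb P [N HN]. destruct (steps_exist beta (INR N) Hb) as [n Hn]. exists n. intros K HK. apply HN.
  assert (HK' : INR n <= INR K) by now apply le_INR. assert (H0 := pos_INR K).
  assert (F := nat_floor_spec ((INR K + / 2) * beta) ltac:(apply Rmult_le_pos; lra)).
  apply Nat.lt_succ_r, INR_lt. rewrite S_INR. apply Rle_lt_trans with ((INR K + / 2) * beta); [|lra].
  apply Rle_trans with (INR n * beta); [exact Hn|]. apply Rmult_le_compat_r; lra.
Qed.

(** At a fixed rational number both series of (i) converge separately, so the joint cutoff leads to
    the same sum. Nothing here is uniform in [beta]; uniformity comes from [osc_sum_tail]. *)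
Lemma osc_sum_lim g sigma tau mu nu lam : 0 < g -> (1 <= mu)%nat -> (1 <= nu)%nat -> Nat.gcd mu nu = 1%nat ->
  let x := sqrt (INR mu * INR nu) * lam - INR mu * sigma - INR nu * tau in let beta := INR mu / INR nu in
  is_lim_seq (fun K => osc_sum g sigma tau K beta lam)
    (Rpower beta (- g / 2) * osc_rational_series g x mu nu + Rpower beta (g / 2) * osc_rational_series g x nu mu).
Proof.
  intros Hg Hmu Hnu Hgcd x beta.
  assert (Hm : 0 < INR mu) by (apply lt_0_INR; lia). assert (Hn : 0 < INR nu) by (apply lt_0_INR; lia).
  assert (Hb : 0 < beta) by now apply Rdiv_lt_0_compat.
  assert (Hgcd' : Nat.gcd nu mu = 1%nat) by (rewrite Nat.gcd_comm; exact Hgcd).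
  destruct (zp_weighted_sum g x mu nu Hg Hnu Hgcd) as [XA _]. destruct (zp_weighted_sum g x nu mu Hg Hmu Hgcd') as [XB _].
  assert (LA := rsum_lim _ XA). assert (LB := rsum_lim _ XB).
  change (Series _) with (osc_rational_series g x mu nu) in LA. change (Series _) with (osc_rational_series g x nu mu) in LB.
  apply (is_lim_seq_plus' (fun K => rsum (fun j => Rpower beta (- g / 2) * oscA g sigma tau beta lam (S j)) K)
    (fun K => rsum (fun i => Rpower beta (g / 2) * oscB g sigma tau beta lam (S i)) (nat_floor ((INR K + / 2) * beta)))).
  - eapply is_lim_seq_ext; [intros K; symmetry; rewrite rsum_scal; reflexivity|].
    apply (is_lim_seq_scal_l _ (Rpower beta (- g / 2)) (osc_rational_series g x mu nu)).
    eapply is_lim_seq_ext; [|exact LA]. intros K. apply rsum_ext. intros j _. now apply oscA_rational.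
  - eapply is_lim_seq_ext; [intros K; symmetry; rewrite rsum_scal; reflexivity|].
    apply (is_lim_seq_scal_l _ (Rpower beta (g / 2)) (osc_rational_series g x nu mu)).
    apply (is_lim_seq_subseq (fun n => rsum (fun i => oscB g sigma tau beta lam (S i)) n)); [now apply nat_floor_unbounded|].
    eapply is_lim_seq_ext; [|exact LB]. intros K. apply rsum_ext. intros j _. now apply oscB_rational.
Qed.

Lemma zp_bound g u : 0 < g -> Rabs (zp g u) <= Rabs (hconst g) * (1 + / g).
Proof. intros Hg. rewrite hurwitz_formula, Rabs_mult by exact Hg. apply Rmult_le_compat_l; [apply Rabs_pos|now apply Hser_bound]. Qed.

Definition gamma_const (g : R) : R := Gamma (1 + g) / Rpower (2 * PI) (1 + g).

(** [zp] is bounded by Hurwitz's formula, and [mu] and [nu] are at most [B L] with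
    [L = sqrt (mu nu)]. The powers of [mu nu] in the denominators thus leave at least one factor
    [1 / L], which makes these terms disappear for large denominators. *)
Lemma resonant_bound g sigma tau B : 0 < g -> 1 <= B -> exists H, 0 <= H /\ forall mu nu lam, (1 <= mu)%nat -> (1 <= nu)%nat ->
  / B <= sqrt (INR mu / INR nu) <= B -> 0 <= lam ->
  let L := sqrt (INR mu * INR nu) in let x := L * lam - INR mu * sigma - INR nu * tau in
  Rabs (zp g x / Rpower (INR mu * INR nu) ((1 + g) / 2) * lam - zp (1 + g) x / Rpower (INR mu * INR nu) (1 + g / 2)
    - ((1 + 2 * sigma) * INR mu + (1 + 2 * tau) * INR nu) / (2 * Rpower (INR mu * INR nu) (1 + g / 2)) * zp g x) <= H * (lam + 1) / L.
Proof.
  intros Hg HB. set (H0 := Rabs (hconst g) * (1 + / g)). set (H1 := Rabs (hconst (1 + g)) * (1 + / (1 + g))).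
  assert (Hig : 0 < / g) by now apply Rinv_0_lt_compat. assert (Hig1 : 0 < / (1 + g)) by (apply Rinv_0_lt_compat; lra).
  assert (P0 : 0 <= H0) by (apply Rmult_le_pos; [apply Rabs_pos|lra]). assert (P1 : 0 <= H1) by (apply Rmult_le_pos; [apply Rabs_pos|lra]).
  set (S0 := (1 + 2 * Rabs sigma) * B + (1 + 2 * Rabs tau) * B).
  assert (Ps := Rabs_pos sigma). assert (Pt := Rabs_pos tau).
  assert (HS0 : 0 <= S0) by (unfold S0; apply Rplus_le_le_0_compat; apply Rmult_le_pos; lra).
  exists (H0 + H1 + S0 * H0). assert (PSH := Rmult_le_pos _ _ HS0 P0). split; [lra|].
  intros mu nu lam Hmu Hnu Hb Hlam L x. destruct (sqrt_ratio mu nu Hmu Hnu) as [Ha [HL [EaL [EbL HLL]]]]. fold L in HL, EaL, EbL, HLL.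
  assert (Hm : 1 <= INR mu) by (apply (le_INR 1); exact Hmu). assert (Hn : 1 <= INR nu) by (apply (le_INR 1); exact Hnu).
  destruct (Reg_sqrt B (INR mu / INR nu) HB Hb) as [[A1 A2] [[B1 B2] _]]. set (a := sqrt (INR mu / INR nu)) in *.
  assert (HL1 : 1 <= L) by nra.
  assert (HnL : INR nu <= B * L).
  { replace (INR nu) with (/ a * L) by (rewrite <- EaL; field; lra). apply Rmult_le_compat_r; lra. }
  assert (HmL : INR mu <= B * L).
  { replace (INR mu) with (a * L) by (rewrite <- EbL; field; lra). apply Rmult_le_compat_r; lra. }
  assert (EP : forall p, Rpower (INR mu * INR nu) (p / 2) = Rpower L p).
  { intros p. rewrite <- HLL, <- Rpower_mult_distr by exact HL. rewrite <- Rpower_plus. f_equal. field. }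
  rewrite EP. replace (1 + g / 2) with ((2 + g) / 2) by field. rewrite EP.
  assert (Q1 : / Rpower L (1 + g) <= / L). { apply Rinv_le_contravar; [exact HL|]. rewrite <- (Rpower_1 L) at 1 by exact HL. apply Rpower_le_exp; lra. }
  assert (Q2 : / Rpower L (2 + g) <= / L * / L).
  { rewrite <- Rinv_mult. apply Rinv_le_contravar; [nra|]. replace (L * L) with (Rpower L 2).
    - apply Rpower_le_exp; lra.
    - replace 2 with (1 + 1) by ring. rewrite Rpower_plus, Rpower_1 by exact HL. reflexivity. }
  assert (R1 : 0 < / Rpower L (1 + g)) by (apply Rinv_0_lt_compat, Rpower_pos). assert (R2 : 0 < / Rpower L (2 + g)) by (apply Rinv_0_lt_compat, Rpower_pos).
  assert (HiL : 0 < / L) by now apply Rinv_0_lt_compat. assert (HiL1 : / L <= 1) by (rewrite <- Rinv_1; apply Rinv_le_contravar; lra).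
  assert (Z0 := zp_bound g x Hg). fold H0 in Z0. assert (Z1' := zp_bound (1 + g) x ltac:(lra)). fold H1 in Z1'.
  assert (T1 : Rabs (zp g x / Rpower L (1 + g) * lam) <= H0 * / L * lam).
  { unfold Rdiv. rewrite !Rabs_mult, (Rabs_pos_eq lam), (Rabs_pos_eq (/ _)) by lra. apply Rmult_le_compat_r; [exact Hlam|]. apply Rmult_le_compat; [apply Rabs_pos|lra|exact Z0|exact Q1]. }
  assert (T2 : Rabs (zp (1 + g) x / Rpower L (2 + g)) <= H1 * / L).
  { unfold Rdiv. rewrite !Rabs_mult, (Rabs_pos_eq (/ _)) by lra. apply Rmult_le_compat; [apply Rabs_pos|lra|exact Z1'|]. nra. }
  assert (T3 : Rabs (((1 + 2 * sigma) * INR mu + (1 + 2 * tau) * INR nu) / (2 * Rpower L (2 + g)) * zp g x) <= (S0 * / L) * H0).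
  { rewrite Rabs_mult. apply Rmult_le_compat; [apply Rabs_pos|apply Rabs_pos| |exact Z0].
    replace (((1 + 2 * sigma) * INR mu + (1 + 2 * tau) * INR nu) / (2 * Rpower L (2 + g))) with (((1 + 2 * sigma) * INR mu + (1 + 2 * tau) * INR nu) * (/ 2 * / Rpower L (2 + g)))
      by (unfold Rdiv; rewrite <- Rinv_mult; reflexivity).
    rewrite Rabs_mult, (Rabs_pos_eq (/ 2 * _)) by lra.
    replace (S0 * / L) with ((S0 * L) * (/ L * / L)) by (field; lra). apply Rmult_le_compat; [apply Rabs_pos|lra| |lra].
    eapply Rle_trans; [apply Rabs_triang|]. replace (S0 * L) with ((1 + 2 * Rabs sigma) * (B * L) + (1 + 2 * Rabs tau) * (B * L)) by (unfold S0; ring).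
    assert (Hs2 : forall y, Rabs (1 + 2 * y) <= 1 + 2 * Rabs y). { intros y. eapply Rle_trans; [apply Rabs_triang|]. rewrite Rabs_R1, Rabs_mult, (Rabs_pos_eq 2) by lra. lra. }
    rewrite !Rabs_mult, (Rabs_pos_eq (INR mu)), (Rabs_pos_eq (INR nu)) by lra.
    apply Rplus_le_compat; (apply Rmult_le_compat; [apply Rabs_pos|lra|apply Hs2|assumption]). }
  unfold Rminus. eapply Rle_trans; [apply Rabs_triang|]. rewrite Rabs_Ropp.
  eapply Rle_trans; [apply Rplus_le_compat_r; apply Rabs_triang|]. rewrite Rabs_Ropp.
  assert (G1 := Rmult_le_pos _ _ (Rmult_le_pos _ _ P1 (Rlt_le _ _ HiL)) Hlam). assert (G2 := Rmult_le_pos _ _ (Rmult_le_pos _ _ PSH (Rlt_le _ _ HiL)) Hlam). assert (G3 := Rmult_le_pos _ _ P0 (Rlt_le _ _ HiL)).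
  unfold Rdiv. lra.
Qed.

(** In [osc_sum_tail] the upper end tends to infinity, while the constant depends on neither
    [mu / nu] nor [K]. The zeta terms of (i) are left to [resonant_bound]. *)
Lemma osc_rational_truncation g sigma tau B : 0 < g -> 1 <= B -> exists C H, 0 <= C /\ 0 <= H /\ forall mu nu K lam,
  (1 <= mu)%nat -> (1 <= nu)%nat -> Nat.gcd mu nu = 1%nat -> / B <= sqrt (INR mu / INR nu) <= B -> 0 <= lam -> (1 <= K)%nat ->
  Rabs (osc_rational g sigma tau mu nu lam - gamma_const g * osc_sum g sigma tau K (INR mu / INR nu) lam)
    <= C * (lam + 1) * Rpower (INR K) (- g) + H * (lam + 1) / sqrt (INR mu * INR nu).
Proof.
  intros Hg HB. destruct (osc_sum_tail g sigma tau (B * B) Hg ltac:(nra)) as [C [HC HT]].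
  destruct (resonant_bound g sigma tau B Hg HB) as [H [HH HR]].
  exists (Rabs (gamma_const g) * C), H. split; [apply Rmult_le_pos; [apply Rabs_pos|exact HC]|]. split; [exact HH|].
  intros mu nu K lam Hmu Hnu Hgcd Hb Hlam HK. set (beta := INR mu / INR nu) in *.
  assert (Hm : 0 < INR mu) by (apply lt_0_INR; lia). assert (Hn : 0 < INR nu) by (apply lt_0_INR; lia).
  assert (Hb0 : 0 < beta) by now apply Rdiv_lt_0_compat.
  assert (HiB : 0 < / B) by (apply Rinv_0_lt_compat; lra).
  assert (HbD : / (B * B) <= beta <= B * B).
  { rewrite <- (sqrt_sqrt beta) by lra. rewrite Rinv_mult. split; apply Rmult_le_compat; lra. }
  set (x := sqrt (INR mu * INR nu) * lam - INR mu * sigma - INR nu * tau).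
  set (Lim := Rpower beta (- g / 2) * osc_rational_series g x mu nu + Rpower beta (g / 2) * osc_rational_series g x nu mu).
  assert (HL : Rabs (Lim - osc_sum g sigma tau K beta lam) <= C * (lam + 1) * Rpower (INR K) (- g)).
  { assert (Q := osc_sum_lim g sigma tau mu nu lam Hg Hmu Hnu Hgcd). cbv zeta in Q. fold x beta Lim in Q.
    apply (is_lim_seq_incr_n _ K) in Q.
    assert (Q2 := is_lim_seq_abs _ _ (is_lim_seq_minus' _ _ _ _ Q (is_lim_seq_const (osc_sum g sigma tau K beta lam)))).
    assert (Q3 : Rbar_le (Rabs (Lim - osc_sum g sigma tau K beta lam)) (C * (lam + 1) * Rpower (INR K) (- g))); [|exact Q3].
    apply (is_lim_seq_le _ _ _ _ (fun n => HT beta lam K n HbD Hlam HK)); [|apply is_lim_seq_const].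
    eapply is_lim_seq_ext; [|exact Q2]. intros n. cbv beta. now rewrite (Nat.add_comm n K). }
  specialize (HR mu nu lam Hmu Hnu Hb Hlam). cbv zeta in HR. fold x in HR.
  replace (osc_rational g sigma tau mu nu lam) with
   ((zp g x / Rpower (INR mu * INR nu) ((1 + g) / 2) * lam - zp (1 + g) x / Rpower (INR mu * INR nu) (1 + g / 2)
    - ((1 + 2 * sigma) * INR mu + (1 + 2 * tau) * INR nu) / (2 * Rpower (INR mu * INR nu) (1 + g / 2)) * zp g x) + gamma_const g * Lim).
  2:{ assert (E1 : Rpower beta (- g / 2) = Rpower (INR nu) (g / 2) / Rpower (INR mu) (g / 2)).
      { replace (- g / 2) with (- (g / 2)) by field. rewrite Rpower_Ropp. unfold beta, Rdiv at 1. rewrite <- Rpower_mult_distr by (try apply Rinv_0_lt_compat; assumption).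
        replace (Rpower (/ INR nu) (g / 2)) with (/ Rpower (INR nu) (g / 2)).
        - field. split; apply Rgt_not_eq, Rpower_pos.
        - rewrite <- Rpower_Ropp. unfold Rpower. f_equal. rewrite ln_Rinv by exact Hn. ring. }
      assert (E2 : Rpower beta (g / 2) = Rpower (INR mu) (g / 2) / Rpower (INR nu) (g / 2)).
      { replace (Rpower beta (g / 2)) with (/ Rpower beta (- g / 2)) by (rewrite <- Rpower_Ropp; f_equal; field). rewrite E1. field. split; apply Rgt_not_eq, Rpower_pos. }
      unfold Lim. rewrite E1, E2. unfold osc_rational. fold x. unfold zp, gamma_const. replace (- (1 + g)) with (- 1 - g) by ring.
      assert (N1 := Rpower_pos (INR mu) (g / 2)). assert (N2 := Rpower_pos (INR nu) (g / 2)). assert (N3 := Rpower_pos (2 * PI) (1 + g)).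
      assert (N4 := Rpower_pos (INR mu * INR nu) (1 + g / 2)). assert (N5 := Rpower_pos (INR mu * INR nu) ((1 + g) / 2)).
      field. repeat split; lra. }
  match goal with |- Rabs (?r + _ - _) <= _ => set (res := r) in * end.
  replace (res + gamma_const g * Lim - gamma_const g * osc_sum g sigma tau K beta lam) with (gamma_const g * (Lim - osc_sum g sigma tau K beta lam) + res) by ring.
  eapply Rle_trans; [apply Rabs_triang|]. apply Rplus_le_compat; [|exact HR].
  rewrite Rabs_mult. rewrite !Rmult_assoc. apply Rmult_le_compat_l; [apply Rabs_pos|]. rewrite <- Rmult_assoc. exact HL.
Qed.

(** * Approximation by rational numbers *)

Lemma odd_coprime_pow2 p j : Nat.gcd (2 * p + 1) (2 ^ j) = 1%nat.
Proof.
  induction j as [|j IH]; [rewrite Nat.gcd_comm; reflexivity|].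
  set (d := Nat.gcd (2 * p + 1) (2 ^ S j)).
  assert (D1 : Nat.divide d (2 * p + 1)) by apply Nat.gcd_divide_l.
  assert (D2 : Nat.divide d (2 * 2 ^ j)) by apply Nat.gcd_divide_r.
  assert (G : Nat.gcd d 2 = 1%nat).
  { assert (E1 : Nat.divide (Nat.gcd d 2) (2 * p + 1)) by (eapply Nat.divide_trans; [apply Nat.gcd_divide_l|exact D1]).
    assert (E2 : Nat.divide (Nat.gcd d 2) 2) by apply Nat.gcd_divide_r.
    apply Nat.divide_1_r. apply (Nat.divide_add_cancel_r _ (2 * p) 1); [|exact E1]. now apply Nat.divide_mul_l. }
  apply Nat.divide_1_r. rewrite <- IH. apply Nat.gcd_greatest; [exact D1|]. now apply (Nat.gauss d 2).
Qed.

(** An odd numerator keeps the fraction with denominator [2^j] reduced, so that the reduced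
    denominators of the approximations do tend to infinity. *)
Definition dyadic_num (beta : R) (j : nat) : nat := (2 * nat_floor (INR (2 ^ j) * beta / 2) + 1)%nat.

Lemma pow2_pos j : 0 < INR (2 ^ j).
Proof. apply lt_0_INR. apply Nat.neq_0_lt_0. apply Nat.pow_nonzero. lia. Qed.

Lemma dyadic_lim beta : 0 < beta -> is_lim_seq (fun j => INR (dyadic_num beta j) / INR (2 ^ j)) beta.
Proof.
  intros Hb. assert (HD : forall j, Rabs (INR (dyadic_num beta j) / INR (2 ^ j) - beta) <= (/ 2) ^ j).
  { intros j. assert (P := pow2_pos j). assert (F := nat_floor_spec (INR (2 ^ j) * beta / 2) ltac:(apply Rmult_le_pos; [apply Rmult_le_pos|]; lra)).
    unfold dyadic_num. set (n := nat_floor _) in *. rewrite plus_INR, mult_INR. change (INR 2) with (1 + 1). change (INR 1) with 1.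
    replace ((/ 2) ^ j) with (1 * / INR (2 ^ j)) by (rewrite pow_INR, pow_inv; change (INR 2) with (1 + 1); replace (1 + 1) with 2 by ring; ring).
    replace (((1 + 1) * INR n + 1) / INR (2 ^ j) - beta) with ((2 * INR n + 1 - INR (2 ^ j) * beta) * / INR (2 ^ j)) by (field; lra).
    assert (Hi : 0 < / INR (2 ^ j)) by now apply Rinv_0_lt_compat.
    rewrite Rabs_mult, (Rabs_pos_eq (/ _)) by lra. apply Rmult_le_compat_r; [lra|]. apply Rabs_le. lra. }
  assert (L0 : is_lim_seq (fun j => (/ 2) ^ j) 0) by (apply is_lim_seq_geom; rewrite Rabs_pos_eq; lra).
  apply (is_lim_seq_le_le (fun j => beta - (/ 2) ^ j) _ (fun j => beta + (/ 2) ^ j)).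
  - intros j. specialize (HD j). apply Rabs_le_between in HD. lra.
  - assert (L := is_lim_seq_minus' _ _ _ _ (is_lim_seq_const beta) L0). now rewrite Rminus_0_r in L.
  - assert (L := is_lim_seq_plus' _ _ _ _ (is_lim_seq_const beta) L0). now rewrite Rplus_0_r in L.
Qed.

Lemma sqrt_range_locally B beta : 1 <= B -> / B <= sqrt beta <= B -> locally beta (fun b => 0 < b /\ / (2 * B) <= sqrt b <= 2 * B).
Proof.
  intros HB H. destruct (sqrt_pos_B B beta HB H) as [Hs Hb].
  assert (E : / (2 * B) = / 2 * / B) by (field; lra). assert (HiB : 0 < / B) by (apply Rinv_0_lt_compat; lra).
  apply filter_and; [apply (locally_interval _ beta 0 p_infty); simpl; try exact I; try exact Hb; intros; assumption|].
  apply (sqrt_continuous beta Hb (fun y => / (2 * B) <= y <= 2 * B)). apply (locally_interval _ (sqrt beta) (/ (2 * B)) (2 * B)); simpl; try lra. intros y Hy1 Hy2. lra.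
Qed.

(** For all parameters near [beta] the same finite double sum represents the Riesz mean, since the
    steps are bounded below there. *)
Lemma riesz_mean_continuous g sigma tau lam beta : 0 < g -> 0 < beta -> continuous (fun b => riesz_mean g sigma tau b lam) beta.
Proof.
  intros Hg Hb. assert (Hs0 := sqrt_lt_R0 beta Hb).
  destruct (Reg_exists (sqrt beta) (/ sqrt beta) Hs0 (Rinv_0_lt_compat _ Hs0) (Rinv_r _ (Rgt_not_eq _ _ Hs0))) as [HB [HR _]].
  set (B := 1 + sqrt beta + / sqrt beta) in *.
  set (X := Rabs lam + (Rabs sigma + Rabs tau) * (2 * B)).
  destruct (steps_exist (/ (2 * B)) X) as [n Hn]; [apply Rinv_0_lt_compat; lra|].
  apply (continuous_ext_loc _ (fun b => rsum (fun k => rsum (fun l => pp g (lam - shift_c sigma tau b - INR (S k) * sqrt b - INR (S l) * / sqrt b)) n) n)).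
  - generalize (sqrt_range_locally B beta HB HR). apply filter_imp. intros b [Hb0 Hb1].
    rewrite riesz_mean_Rdbl by exact Hb0.
    replace (lam - sigma * sqrt b - tau / sqrt b) with (lam - shift_c sigma tau b) by (unfold shift_c; ring).
    assert (HB2 : 1 <= 2 * B) by lra. destruct (Reg_sqrt (2 * B) b HB2 Hb1) as [[R1 _] [[R2 _] _]].
    assert (Hsc := proj1 (Rabs_le_between _ _) (shift_c_bound sigma tau (2 * B) b HB2 Hb1)).
    assert (HwX : lam - shift_c sigma tau b <= X) by (assert (Q := Rle_abs lam); unfold X; lra).
    assert (Hs := sqrt_lt_R0 b Hb0). assert (Hn0 := pos_INR n).
    symmetry. apply Rdbl_double; [exact Hs|now apply Rinv_0_lt_compat| |].
    + apply Rle_trans with (INR n * / (2 * B)); [lra|]. now apply Rmult_le_compat_l.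
    + apply Rle_trans with (INR n * / (2 * B)); [lra|]. now apply Rmult_le_compat_l.
  - apply (cont_rsum (fun k b => rsum (fun l => pp g (lam - shift_c sigma tau b - INR (S k) * sqrt b - INR (S l) * / sqrt b)) n)). intros k _.
    apply (cont_rsum (fun l b => pp g (lam - shift_c sigma tau b - INR (S k) * sqrt b - INR (S l) * / sqrt b))). intros l _.
    apply (continuous_comp (fun b => lam - shift_c sigma tau b - INR (S k) * sqrt b - INR (S l) * / sqrt b) (pp g)); [|now apply pp_continuous].
    apply cont_minus; [apply cont_minus; [apply cont_minus; [apply cont_const|now apply shift_c_continuous]|apply cont_mult; [apply cont_const|now apply sqrt_continuous]]|].
    apply cont_mult; [apply cont_const|now apply inv_sqrt_continuous].
Qed.

Lemma irrational_mult beta n z : irrational beta -> (1 <= n)%nat -> beta * INR n <> IZR z.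
Proof.
  intros Hi Hn E. apply Hi. exists (QArith_base.Qmake z (Pos.of_nat n)). unfold Q2R. simpl.
  rewrite <- E. replace (IZR (Z.pos (Pos.of_nat n))) with (INR n).
  - field. apply Rgt_not_eq. apply lt_0_INR. lia.
  - rewrite INR_IZR_INZ. f_equal. lia.
Qed.

Lemma oscA_continuous g sigma tau lam k beta : 0 < beta -> irrational beta -> (1 <= k)%nat ->
  continuous (fun b => oscA g sigma tau b lam k) beta.
Proof.
  intros Hb Hi Hk. unfold oscA, Rdiv.
  assert (Hs : sin (PI * INR k * beta) <> 0).
  { intros E. apply sin_eq_0_0 in E. destruct E as [z Hz]. apply (irrational_mult beta k z Hi Hk). assert (HPI := PI_RGT_0).
    apply (Rmult_eq_reg_r PI); [|lra]. lra. }
  apply smooth_cont. assert (Hk0 := Rpower_pos (INR k) (1 + g)). auto_derive. repeat split; try exact Hb.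
  apply Rmult_integral_contrapositive_currified; [lra|exact Hs].
Qed.

Lemma oscB_continuous g sigma tau lam l beta : 0 < beta -> irrational beta -> (1 <= l)%nat ->
  continuous (fun b => oscB g sigma tau b lam l) beta.
Proof.
  intros Hb Hi Hl. unfold oscB, Rdiv. assert (Hl0 : 1 <= INR l) by (apply (le_INR 1); exact Hl).
  assert (Hs : sin (PI * INR l * / beta) <> 0).
  { intros E. apply sin_eq_0_0 in E. destruct E as [z Hz]. assert (HPI := PI_RGT_0).
    assert (E1 : INR l = IZR z * beta). { apply (Rmult_eq_reg_r (PI * / beta)); [|apply Rmult_integral_contrapositive_currified; [lra|apply Rinv_neq_0_compat; lra]].
      transitivity (PI * INR l * / beta); [ring|]. rewrite Hz. field. lra. }
    assert (Hz0 : (0 < z)%Z). { apply lt_IZR. apply (Rmult_lt_reg_r beta); [exact Hb|]. lra. }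
    apply (irrational_mult beta (Z.to_nat z) (Z.of_nat l) Hi); [lia|]. rewrite <- INR_IZR_INZ, E1, INR_IZR_INZ, Z2Nat.id by lia. ring. }
  apply smooth_cont. assert (Hk0 := Rpower_pos (INR l) (1 + g)). auto_derive. assert (Hsb := sqrt_lt_R0 beta Hb). repeat split; try exact Hb; try lra.
  apply Rmult_integral_contrapositive_currified; [lra|exact Hs].
Qed.

(** Irrationality enters twice: no denominator vanishes, and [(K + 1/2) beta] is not an integer, so
    that the number of terms of the second sum is locally constant. *)
Lemma osc_sum_continuous g sigma tau lam K beta : 0 < beta -> irrational beta ->
  continuous (fun b => osc_sum g sigma tau K b lam) beta.
Proof.
  intros Hb Hi. assert (HK := pos_INR K). set (n := nat_floor ((INR K + / 2) * beta)).
  assert (F := nat_floor_spec ((INR K + / 2) * beta) ltac:(apply Rmult_le_pos; lra)). fold n in F.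
  assert (F' : INR n < (INR K + / 2) * beta).
  { destruct F as [[F|F] _]; [exact F|]. exfalso. apply (irrational_mult beta (2 * K + 1) (Z.of_nat (2 * n)) Hi); [lia|].
    rewrite <- INR_IZR_INZ, plus_INR, !mult_INR. change (INR 2) with (1 + 1). change (INR 1) with 1. rewrite F. field. }
  apply (continuous_ext_loc _ (fun b => rsum (fun j => Rpower b (- g / 2) * oscA g sigma tau b lam (S j)) K + rsum (fun i => Rpower b (g / 2) * oscB g sigma tau b lam (S i)) n)).
  - assert (CL : continuous (fun b => (INR K + / 2) * b) beta) by (apply cont_mult; [apply cont_const|apply continuous_id]).
    assert (L : locally beta (fun b => INR n < (INR K + / 2) * b < INR n + 1)).
    { apply (CL (fun y => INR n < y < INR n + 1)). apply (locally_interval _ ((INR K + / 2) * beta) (INR n) (INR n + 1)); simpl; try lra. intros y Y1 Y2. lra. }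
    generalize L. apply filter_imp. intros b Hb1. unfold osc_sum. rewrite (nat_floor_unique _ n); [reflexivity|lra].
  - apply cont_plus.
    + apply (cont_rsum (fun j b => Rpower b (- g / 2) * oscA g sigma tau b lam (S j))). intros j _.
      apply cont_mult; [now apply Rpower_continuous|apply oscA_continuous; [exact Hb|exact Hi|lia]].
    + apply (cont_rsum (fun j b => Rpower b (g / 2) * oscB g sigma tau b lam (S j))). intros j _.
      apply cont_mult; [now apply Rpower_continuous|apply oscB_continuous; [exact Hb|exact Hi|lia]].
Qed.

(* The two sums make sense at every rational number, and their difference to [Osc] is controlled
   there uniformly; a generic [beta] is reached through odd multiples of powers of 1/2. *)
Lemma Osc_truncation g sigma tau B M : 0 < g -> 1 <= B -> exists C W, 0 <= C /\ 1 <= W /\ forall beta lam K,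
  irrational beta -> / B <= sqrt beta <= B -> W <= lam -> (1 <= K)%nat ->
  Rabs (Osc g sigma tau beta lam - gamma_const g * osc_sum g sigma tau K beta lam)
    <= C * (Rpower lam (g - INR M) + (lam + 1) * Rpower (INR K) (- g)).
Proof.
  intros Hg HB. destruct (remainder_bound g sigma tau (2 * B) M Hg ltac:(lra)) as [C1 [W [HC1 [HW H1]]]].
  destruct (osc_rational_truncation g sigma tau (2 * B) Hg ltac:(lra)) as [C2 [H [HC2 [HH H2]]]].
  exists (2 * C1 + C2), W. split; [lra|]. split; [exact HW|]. intros beta lam K Hi Hb Hlam HK.
  destruct (sqrt_pos_B B beta HB Hb) as [Hs Hb0].
  (* In place of [Osc], the Riesz mean minus the expansion is used, which is continuous at [beta].
     The price is the remainder, once along the sequence and once at [beta], whence [2 * C1]. *)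
  set (G := fun b => riesz_mean g sigma tau b lam - sum_n (fun k => alpha g sigma tau k b * Rpower lam (2 - INR k + g)) (M + 1) - gamma_const g * osc_sum g sigma tau K b lam).
  assert (CG : continuous G beta).
  { unfold G. apply cont_minus; [apply cont_minus; [now apply riesz_mean_continuous|]|apply cont_mult; [apply cont_const|now apply osc_sum_continuous]].
    apply (continuous_ext (fun b => rsum (fun k => alpha g sigma tau k b * Rpower lam (2 - INR k + g)) (S (M + 1)))); [intros b; symmetry; apply sum_n_rsum|].
    apply (cont_rsum (fun k b => alpha g sigma tau k b * Rpower lam (2 - INR k + g))). intros k _. apply cont_mult; [now apply alpha_continuous|apply cont_const]. }
  set (X := C1 * Rpower lam (g - INR M) + C2 * (lam + 1) * Rpower (INR K) (- g)).
  set (u := fun j => INR (dyadic_num beta j) / INR (2 ^ j)).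
  assert (Lu : is_lim_seq u beta) by exact (dyadic_lim beta Hb0).
  assert (LG : is_lim_seq (fun j => Rabs (G (u j))) (Rabs (G beta))).
  { apply (is_lim_seq_abs (fun j => G (u j)) (G beta)). exact (filterlim_comp _ _ _ u G eventually (locally beta) (locally (G beta)) Lu CG). }
  (* The last term bounds the resonant part: [sqrt (mu nu) = 2^j sqrt (u j)] is at least
     [2^j / (2 B)]. *)
  assert (LX : is_lim_seq (fun j => X + H * (lam + 1) * (2 * B) * (/ 2) ^ j) X).
  { replace (Finite X) with (Finite (X + H * (lam + 1) * (2 * B) * 0)) by (f_equal; ring). apply is_lim_seq_plus'; [apply is_lim_seq_const|].
    apply (is_lim_seq_scal_l _ (H * (lam + 1) * (2 * B)) 0). apply is_lim_seq_geom. rewrite Rabs_pos_eq; lra. }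
  assert (HG : Rabs (G beta) <= X).
  { assert (Q : Rbar_le (Rabs (G beta)) X); [|exact Q]. eapply is_lim_seq_le_loc; [|exact LG|exact LX].
    assert (EV : eventually (fun j => 0 < u j /\ / (2 * B) <= sqrt (u j) <= 2 * B)) by exact (Lu _ (sqrt_range_locally B beta HB Hb)).
    destruct EV as [J HJ]. exists J. intros j Hj. destruct (HJ j Hj) as [Hu0 Hu].
    assert (HB2 : 1 <= 2 * B) by lra. assert (Hmu : (1 <= dyadic_num beta j)%nat) by (unfold dyadic_num; lia).
    assert (P := pow2_pos j). assert (Hnu : (1 <= 2 ^ j)%nat) by (assert (E := INR_lt 0 _ P); lia).
    assert (Hgcd : Nat.gcd (dyadic_num beta j) (2 ^ j) = 1%nat) by apply odd_coprime_pow2.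
    specialize (H1 (u j) lam Hu Hlam). specialize (H2 _ _ K lam Hmu Hnu Hgcd Hu ltac:(lra) HK).
    unfold u in H1 at 3. rewrite Osc_rational_eq in H1 by assumption.
    replace (G (u j)) with ((riesz_mean g sigma tau (u j) lam - sum_n (fun k => alpha g sigma tau k (u j) * Rpower lam (2 - INR k + g)) (M + 1) - osc_rational g sigma tau (dyadic_num beta j) (2 ^ j) lam)
      + (osc_rational g sigma tau (dyadic_num beta j) (2 ^ j) lam - gamma_const g * osc_sum g sigma tau K (u j) lam)) by (unfold G; ring).
    eapply Rle_trans; [apply Rabs_triang|]. unfold X. rewrite Rplus_assoc. apply Rplus_le_compat; [exact H1|].
    eapply Rle_trans; [exact H2|]. apply Rplus_le_compat_l.
    destruct (sqrt_ratio _ _ Hmu Hnu) as [_ [HL [EL _]]]. rewrite <- EL. fold (u j).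
    unfold Rdiv. rewrite Rmult_assoc. rewrite !Rmult_assoc. apply Rmult_le_compat_l; [exact HH|]. apply Rmult_le_compat_l; [lra|].
    rewrite Rinv_mult, pow_inv, pow_INR. change (INR 2) with (1 + 1). replace (1 + 1) with 2 by ring.
    rewrite <- Rmult_assoc, (Rmult_comm (2 * B)). apply Rmult_le_compat_l; [left; apply Rinv_0_lt_compat; apply pow_lt; lra|].
    rewrite <- (Rinv_inv (2 * B)). apply Rinv_le_contravar; [apply Rinv_0_lt_compat; lra|apply Hu]. }
  assert (HR : / (2 * B) <= sqrt beta <= 2 * B) by (exact (proj2 (locally_singleton _ _ (sqrt_range_locally B beta HB Hb)))).
  specialize (H1 beta lam HR Hlam).
  match type of H1 with Rabs ?r <= _ => set (rem := r) in * end.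
  replace (Osc g sigma tau beta lam - gamma_const g * osc_sum g sigma tau K beta lam) with (G beta + - rem) by (unfold G, rem; ring).
  eapply Rle_trans; [apply Rabs_triang|]. rewrite Rabs_Ropp.
  assert (P1 := Rpower_pos lam (g - INR M)). assert (P2 := Rpower_pos (INR K) (- g)).
  assert (Q1 : 0 <= 2 * C1 * ((lam + 1) * Rpower (INR K) (- g))) by (apply Rmult_le_pos; [lra|]; apply Rmult_le_pos; lra).
  assert (Q2 : 0 <= C2 * Rpower lam (g - INR M)) by (apply Rmult_le_pos; lra).
  unfold X in HG. lra.
Qed.

(** * Compact sets, choice of the cutoff, and conclusion *)

Lemma compact_sqrt_range K : compact_in_pos K -> exists B, 1 <= B /\ forall b, K b -> / B <= sqrt b <= B.
Proof.
  intros [HK Hpos]. destruct (compact_P1 K HK) as [m [M HM]].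
  (* A compact set is closed; as 0 is outside [K], so is a disc of some radius [d] about 0, and [d]
     is a lower bound for [K]. *)
  assert (Hc := compact_P2 K HK 0).
  assert (Hn : complementary K 0) by (intros H0; specialize (Hpos 0 H0); lra).
  destruct (Hc Hn) as [d Hd].
  set (B := 1 + Rabs M + / d). assert (Hd0 := cond_pos d). assert (Hid : 0 < / d) by now apply Rinv_0_lt_compat. assert (HM0 := Rabs_pos M). assert (HMM := Rle_abs M).
  exists B. assert (HB : 1 <= B) by (unfold B; lra). split; [exact HB|]. intros b Hb. assert (Hb0 := Hpos b Hb).
  assert (B1 : b <= B) by (specialize (HM b Hb); unfold B; lra).
  assert (B2 : d <= b).
  { apply Rnot_lt_le. intros H. apply (Hd b); [|exact Hb]. unfold disc. rewrite Rminus_0_r, Rabs_pos_eq; lra. }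
  assert (B3 : / B <= b).
  { apply Rle_trans with d; [|exact B2]. rewrite <- (Rinv_inv d). apply Rinv_le_contravar; unfold B; lra. }
  assert (HiB : 0 < / B) by (apply Rinv_0_lt_compat; lra). assert (HiB1 : / B <= 1) by (rewrite <- Rinv_1; apply Rinv_le_contravar; lra).
  split.
  - rewrite <- (sqrt_square (/ B)) by lra. apply sqrt_le_1; nra.
  - rewrite <- (sqrt_square B) by lra. apply sqrt_le_1; nra.
Qed.

(** The room [d] in the exponent absorbs any constant; with [d = delta] it turns the bounds of type
    [O] into the required [o]. *)
Lemma Rpower_gain eps c p d : 0 < eps -> 0 < d -> exists W, 1 <= W /\ forall lam, W <= lam -> c * Rpower lam p <= eps * Rpower lam (p + d).
Proof.
  intros He Hd. destruct (tends0_power c (- d) ltac:(lra) eps He) as [W HW]. exists (Rmax 1 W). split; [apply Rmax_l|].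
  intros lam Hl. assert (Hl1 : W <= lam) by (eapply Rle_trans; [apply Rmax_r|exact Hl]).
  replace p with (- d + (p + d)) at 1 by ring. rewrite Rpower_plus, <- Rmult_assoc. apply Rmult_le_compat_r; [left; apply Rpower_pos|].
  eapply Rle_trans; [apply Rle_abs|]. now apply HW.
Qed.

Lemma little_o_intro r C W p d : 0 < d -> (forall lam, W <= lam -> Rabs (r lam) <= C * Rpower lam p) -> little_o_pow r (p + d).
Proof.
  intros Hd H eps. destruct (Rpower_gain eps C p d (cond_pos eps) Hd) as [W' [_ HW']].
  exists (Rmax W W'). intros lam Hl. assert (L1 := Rmax_l W W'). assert (L2 := Rmax_r W W').
  change (Rabs (r lam) <= eps * Rabs (Rpower lam (p + d))). rewrite (Rabs_pos_eq (Rpower _ _)) by (left; apply Rpower_pos).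
  eapply Rle_trans; [apply H; lra|]. apply HW'. lra.
Qed.

Lemma osc_truncated_sum g sigma tau K beta lam : 0 < beta ->
  osc_truncated g sigma tau beta ((INR K + / 2) * sqrt beta) lam = gamma_const g * osc_sum g sigma tau K beta lam.
Proof.
  intros Hb. assert (Hs := sqrt_lt_R0 beta Hb).
  assert (E : forall X f, sum_upto X f = rsum (fun i => f (S i)) (nat_floor X)).
  { intros X f. unfold sum_upto. fold (nat_floor X). destruct (nat_floor X) as [|n]; [rewrite sum_n_m_zero by lia; reflexivity|].
    rewrite <- sum_n_m_S. change (sum_n_m (fun i => f (S i)) 0 n) with (sum_n (fun i => f (S i)) n). apply sum_n_rsum. }
  unfold osc_truncated. rewrite !E.
  replace ((INR K + / 2) * sqrt beta / sqrt beta) with (INR K + / 2) by (field; lra).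
  replace ((INR K + / 2) * sqrt beta * sqrt beta) with ((INR K + / 2) * beta) by (rewrite Rmult_assoc, sqrt_sqrt by lra; reflexivity).
  rewrite (nat_floor_unique (INR K + / 2) K) by lra.
  unfold osc_sum. rewrite !rsum_scal. unfold gamma_const, oscA, oscB, Rdiv. ring.
Qed.

Lemma osc_truncated_0 g sigma tau beta lam : osc_truncated g sigma tau beta 0 lam = 0.
Proof.
  unfold osc_truncated, sum_upto. unfold Rdiv at 3. rewrite !Rmult_0_l.
  assert (E : forall y, 0 / y = 0) by (intros y; unfold Rdiv; ring). rewrite ?E.
  replace (Z.to_nat (Int_part 0)) with 0%nat by (rewrite (Int_part_unique 0 0) by lra; reflexivity).
  rewrite !sum_n_m_zero by lia. change (@zero R_AbelianMonoid) with 0. ring.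
Qed.

(** The least admissible constant. It depends on [beta] alone, and any [C] that works for all [beta]
    in a compact set bounds it there. *)
Definition osc_slope (g sigma tau beta : R) : R :=
  real (Lub_Rbar (fun y => exists lam, 0 <= lam /\ y = Rabs (Osc g sigma tau beta lam) / (lam + 1))).

Lemma osc_slope_spec g sigma tau beta C : (forall lam, 0 <= lam -> Rabs (Osc g sigma tau beta lam) <= C * (lam + 1)) ->
  osc_slope g sigma tau beta <= C /\ forall lam, 0 <= lam -> Rabs (Osc g sigma tau beta lam) <= osc_slope g sigma tau beta * (lam + 1).
Proof.
  intros H. unfold osc_slope. set (E := fun y => _). destruct (Lub_Rbar_correct E) as [H1 H2].
  assert (HC : Rbar_le (Lub_Rbar E) C).
  { apply H2. intros y [lam [Hl ->]]. apply (Rmult_le_reg_r (lam + 1)); [lra|]. unfold Rdiv. rewrite Rmult_assoc, Rinv_l by lra. rewrite Rmult_1_r. now apply H. }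
  assert (H0 := H1 _ (ex_intro _ 0 (conj (Rle_refl 0) eq_refl))).
  assert (HQ : forall lam, 0 <= lam -> Rbar_le (Rabs (Osc g sigma tau beta lam) / (lam + 1)) (Lub_Rbar E)) by (intros lam Hl; apply H1; now exists lam).
  destruct (Lub_Rbar E) as [r| |]; simpl in *; try contradiction. split; [exact HC|]. intros lam Hl. specialize (HQ lam Hl).
  apply (Rmult_le_compat_r (lam + 1)) in HQ; [|lra]. unfold Rdiv in HQ. rewrite Rmult_assoc, Rinv_l in HQ by lra. lra.
Qed.

Lemma sqrt_range_single beta : 0 < beta -> exists B, 1 <= B /\ / B <= sqrt beta <= B.
Proof.
  intros Hb. assert (Hs0 := sqrt_lt_R0 beta Hb).
  destruct (Reg_exists (sqrt beta) (/ sqrt beta) Hs0 (Rinv_0_lt_compat _ Hs0) (Rinv_r _ (Rgt_not_eq _ _ Hs0))) as [HB [HR _]].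
  eauto.
Qed.

(** [K] is the integer part of [lam^e], which makes the truncation error [(lam + 1) K^(- g)] of
    order [lam^(g - M - 1)]; the factor [sqrt beta] in [Lambda] adapts [osc_truncated] to the cutoff
    of [osc_sum]. *)
Lemma irrational_cutoff g sigma tau beta M : 0 < g -> 0 < beta -> irrational beta ->
  exists Lambda, big_O_pow Lambda ((INR M + 2 - g) / g) /\
   exists C W, forall lam, W <= lam -> Rabs (Osc g sigma tau beta lam - osc_truncated g sigma tau beta (Lambda lam) lam) <= C * Rpower lam (g - INR M).
Proof.
  intros Hg Hb Hi. destruct (sqrt_range_single beta Hb) as [B [HB HR]]. set (e := (INR M + 2 - g) / g).
  destruct (Rle_dec 0 e) as [He|He].
  - destruct (Osc_truncation g sigma tau B M Hg HB) as [C [W [HC [HW H]]]].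
    exists (fun lam => (INR (nat_floor (Rpower lam e)) + / 2) * sqrt beta). split.
    + exists (2 * sqrt beta), 1. intros lam Hlam. assert (Hp : 1 <= Rpower lam e) by (rewrite <- (Rpower_O lam) by lra; apply Rpower_le_exp; lra).
      assert (F := nat_floor_spec (Rpower lam e) ltac:(lra)). assert (F0 := pos_INR (nat_floor (Rpower lam e))). assert (Hs := sqrt_pos beta).
      rewrite Rabs_pos_eq by (apply Rmult_le_pos; lra). rewrite (Rmult_comm 2), Rmult_assoc, Rmult_comm. apply Rmult_le_compat_l; lra.
    + exists (C * (1 + 2 * Rpower 2 g)), W. intros lam Hlam. set (K := nat_floor (Rpower lam e)).
      assert (Hp : 1 <= Rpower lam e) by (rewrite <- (Rpower_O lam) by lra; apply Rpower_le_exp; lra).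
      assert (F := nat_floor_spec (Rpower lam e) ltac:(lra)). fold K in F.
      assert (HK : (1 <= K)%nat) by (apply Nat.lt_succ_r, INR_lt; rewrite (S_INR K); change (INR 1) with 1; lra).
      assert (HK1 : 1 <= INR K) by (apply (le_INR 1); exact HK).
      rewrite osc_truncated_sum by exact Hb. eapply Rle_trans; [apply (H beta lam K Hi HR Hlam HK)|].
      rewrite Rmult_assoc. apply Rmult_le_compat_l; [exact HC|]. rewrite (Rmult_plus_distr_r 1), Rmult_1_l. apply Rplus_le_compat_l.
      assert (EK : Rpower (INR K) (- g) <= Rpower 2 g * Rpower lam (- (INR M + 2 - g))).
      { apply Rle_trans with (Rpower (Rpower lam e / 2) (- g)).
        - rewrite !Rpower_Ropp. apply Rinv_le_contravar; [apply Rpower_pos|]. apply Rle_Rpower_l; lra.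
        - rewrite Rpower_half by lra. rewrite Rpower_mult. right. f_equal. f_equal. unfold e. field. lra. }
      apply Rle_trans with ((2 * lam) * (Rpower 2 g * Rpower lam (- (INR M + 2 - g)))).
      * apply Rmult_le_compat; [lra|left; apply Rpower_pos|lra|exact EK].
      * assert (E2 : lam * Rpower lam (- (INR M + 2 - g)) = Rpower lam (g - INR M - 1)).
        { rewrite <- (Rpower_1 lam) at 1 by lra. rewrite <- Rpower_plus. f_equal. ring. }
        replace (2 * lam * (Rpower 2 g * Rpower lam (- (INR M + 2 - g)))) with (2 * Rpower 2 g * (lam * Rpower lam (- (INR M + 2 - g)))) by ring.
        rewrite E2. assert (P2 := Rpower_pos 2 g). apply Rmult_le_compat_l; [lra|]. apply Rpower_le_exp; lra.
  (* If [e < 0], the prescribed bound forces [Lambda] to 0. But then [g > M + 2], and the linear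
     bound puts [Osc] itself below the order [lam^(g - M)], so that empty sums will do. *)
  - apply Rnot_le_lt in He. destruct (Osc_linear_bound g sigma tau B Hg HB) as [C [HC H]].
    assert (Hge : INR M + 2 < g).
    { assert (Q : e * g < 0) by nra. unfold e in Q. replace ((INR M + 2 - g) / g * g) with (INR M + 2 - g) in Q by (field; lra). lra. }
    exists (fun _ => 0). split.
    + exists 0, 0. intros lam _. rewrite Rabs_R0. lra.
    + exists (2 * C), 1. intros lam Hlam. rewrite osc_truncated_0, Rminus_0_r. eapply Rle_trans; [apply (H beta lam HR); lra|].
      assert (Hp : lam <= Rpower lam (g - INR M)) by (rewrite <- (Rpower_1 lam) at 1 by lra; apply Rpower_le_exp; lra).
      replace (2 * C * Rpower lam (g - INR M)) with (C * (2 * Rpower lam (g - INR M))) by ring. apply Rmult_le_compat_l; lra.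
Qed.

Theorem theorem1p6 :
  forall gamma sigma tau : R, 0 < gamma -> -1 < sigma -> -1 < tau ->
  exists (alpha : nat -> R -> R) (Osc : R -> R -> R) (Cst : R -> R),
    let remainder (M : nat) (beta lam : R) :=
      riesz_mean gamma sigma tau beta lam
      - sum_n (fun k => alpha k beta * Rpower lam (2 - INR k + gamma)) (M + 1)
      - Osc beta lam in
    (forall (M : nat) (delta beta : R), (1 <= M)%nat -> 0 < delta -> 0 < beta ->
       little_o_pow (remainder M beta) (- INR M + gamma + delta)) /\
    (forall (k : nat) (beta : R), 0 < beta -> continuous (alpha k) beta) /\
    (forall beta lam : R, 0 < beta -> 0 <= lam ->
       Rabs (Osc beta lam) <= Cst beta * (lam + 1)) /\
    (forall K : R -> Prop, compact_in_pos K ->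
       (exists B : R, forall beta, K beta -> Cst beta <= B) /\
       (forall (M : nat) (delta : R), (1 <= M)%nat -> 0 < delta ->
          little_o_pow_unif K (remainder M) (- INR M + gamma + delta))) /\
    (forall mu nu : nat, (1 <= mu)%nat -> (1 <= nu)%nat -> Nat.gcd mu nu = 1%nat ->
       forall lam : R, 0 <= lam ->
         Osc (INR mu / INR nu) lam = osc_rational gamma sigma tau mu nu lam) /\
    (forall (M : nat) (delta beta : R), (1 <= M)%nat -> 0 < delta ->
       0 < beta -> irrational beta ->
       exists Lambda : R -> R,
         big_O_pow Lambda ((INR M + 2 - gamma) / gamma) /\
         little_o_pow
           (fun lam => Osc beta lam
                       - osc_truncated gamma sigma tau beta (Lambda lam) lam)
           (- INR M + gamma + delta)).
Proof.
  intros g sigma tau Hg Hsigma Htau.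
  exists (alpha g sigma tau), (Osc g sigma tau), (osc_slope g sigma tau). cbv zeta.
  split; [|split; [|split; [|split; [|split]]]].
  - intros M delta beta _ Hd Hb. destruct (sqrt_range_single beta Hb) as [B [HB HR]].
    destruct (remainder_bound g sigma tau B M Hg HB) as [C [W [_ [_ H]]]].
    replace (- INR M + g + delta) with (g - INR M + delta) by ring.
    apply (little_o_intro _ C W); [exact Hd|]. intros lam Hlam. now apply H.
  - intros k beta Hb. now apply alpha_continuous.
  - intros beta lam Hb Hlam. destruct (sqrt_range_single beta Hb) as [B [HB HR]].
    destruct (Osc_linear_bound g sigma tau B Hg HB) as [C [_ H]].
    apply (osc_slope_spec g sigma tau beta C); [|exact Hlam]. intros l Hl. now apply H.
  - intros K HK. destruct (compact_sqrt_range K HK) as [B [HB HR]]. split.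
    + destruct (Osc_linear_bound g sigma tau B Hg HB) as [C [_ H]]. exists C. intros beta Hb.
      apply (osc_slope_spec g sigma tau beta C). intros l Hl. apply H; [now apply HR|exact Hl].
    + intros M delta _ Hd eps. destruct (remainder_bound g sigma tau B M Hg HB) as [C [W [_ [_ H]]]].
      destruct (Rpower_gain eps C (g - INR M) delta (cond_pos eps) Hd) as [W' [_ HW']].
      exists (Rmax W W'). intros lam Hlam beta Hb. assert (L1 := Rmax_l W W'). assert (L2 := Rmax_r W W').
      replace (- INR M + g + delta) with (g - INR M + delta) by ring.
      eapply Rle_trans; [apply H; [now apply HR|lra]|]. apply HW'. lra.
  - intros mu nu Hmu Hnu Hgcd lam _. now apply Osc_rational_eq.
  - intros M delta beta _ Hd Hb Hi. destruct (irrational_cutoff g sigma tau beta M Hg Hb Hi) as [Lambda [HL [C [W H]]]].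
    exists Lambda. split; [exact HL|]. replace (- INR M + g + delta) with (g - INR M + delta) by ring.
    now apply (little_o_intro _ C W).
Qed.
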